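(* Let $Z$ be a critical Galton–Watson process of index $1+\alpha$ as described in the context, started from $Z_0=1$. Assume that integers $j_m\geq1$ satisfy $j_m/m\to\eta\in[0,1]$ as $m\uparrow\infty$. (a) If $\eta=0$, then $\mathbf{E}M_m(j_m)\sim j_m\log(m/j_m)$ as $m\uparrow\infty$. (b) If $0<\eta\leq1$, then $\mathbf{E}M_m(j_m)\sim j_m\varphi(\eta)$ as $m\uparrow\infty$, where $$\varphi(\eta):=\frac{\alpha}{2\alpha+1}+\mathbf{E}V^{\ast}(1/\eta).$$ In particular, $\varphi(\eta)\sim\log(1/\eta)$ as $\eta\downarrow0$.
   Context: Let $Z=\{Z_n:n\geq0\}$ be a Galton–Watson process with offspring variable $\xi$ whose generating function satisfies $\mathbf{E}\xi=1$ and $f(s):=\mathbf{E}s^{\xi}=s+(1-s)^{1+\alpha}L(1-s)$ for $0\leq s\leq1$, for some $\alpha\in(0,1]$ and some function $L$ slowly varying at $0$. For $k\geq0$ and $1\leq j\leq m<\infty$ put $S_k(j):=\sum_{l=k}^{k+j-1}Z_l$ and $M_m(j):=\max_{0\leq k\leq m-j}S_k(j)$. When an expression indexed by an integer is evaluated at a non-integer, its integer part is meant. Let $X$ be the continuous-state branching process of index $1+\alpha$: a $[0,\infty)$-valued time-homogeneous Markov process with càdlàg paths and $\mathbf{E}\{e^{-\lambda X(t)}\mid X(0)=x\}=\exp[-x(t+\lambda^{-\alpha})^{-1/\alpha}]$ for $\lambda,t,x\geq0$. Let $\chi\geq0$ be a random variable with $\mathbf{E}e^{-\lambda\chi}=1-(1+\lambda^{-\alpha})^{-1/\alpha}$,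 $\lambda\geq0$. Let $\{X^+(t):0\leq t\leq1\}$ be the Markov process with càdlàg paths, $X^+(0)=0$, obtained by conditioning $X$ (started at $0$) to be positive at time $1$ in the sense of Durrett: for $y>0$, $0<t\leq1$, $\mathbf{P}(X^+(t)\in dy)=t^{-1/\alpha}\mathbf{P}(t^{1/\alpha}\chi\in dy)\,\mathbf{P}\{X(1-t)>0\mid X(0)=y\}$, and for $x>0$, $0<s<t\leq1$, $\mathbf{P}\{X^+(t)\in dy\mid X^+(s)=x\}=\mathbf{P}\{X(t-s)\in dy\mid X(0)=x\}\,\mathbf{P}\{X(1-t)>0\mid X(0)=y\}/\mathbf{P}\{X(1-s)>0\mid X(0)=x\}$. Define $X^{\ast}(t):=X^+(t)$ for $0\leq t\leq1$ and $X^{\ast}(t):=X^{X^+(1)}(t-1)$ for $t\geq1$, where $\{X^x:x>0\}$ is a family of copies of $X$ with $X^x(0)=x$, independent of $X^+$. Finally $V^{\ast}(T):=\sup_{0\leq s\leq T-1}\int_s^{s+1}X^{\ast}(u)\,du$ for $T\geq1$. *)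

(* Defs.v *)
From mathcomp Require Import all_boot all_order all_algebra.
From mathcomp Require Import all_classical all_reals all_analysis.
Set Implicit Arguments. Unset Strict Implicit. Unset Printing Implicit Defensive.
Import Order.TTheory GRing.Theory Num.Theory numFieldNormedType.Exports.
Local Open Scope ring_scope.
Local Open Scope classical_set_scope.

Section Defs.
Variable R : realType.

Definition conv (p q : nat -> R) : nat -> R :=
  fun k => \sum_(i < k.+1) p i * q (k - i)%N.

Fixpoint convpow (p : nat -> R) (n : nat) : nat -> R :=
  match n with
  | 0%N => fun k => (k == 0%N)%:R
  | n'.+1 => conv p (convpow p n')
  end.

Definition gen_fun (p : nat -> R) (s : R) : \bar R :=
  (\sum_(k <oo) (p k * s ^+ k)%:E)%E.

Definition slowly_varying_at0 (L : R -> R) : Prop :=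
  (exists2 e : R, 0 < e & forall x, 0 < x < e -> 0 < L x) /\
  (forall lam : R, 0 < lam -> (fun x : R => L (lam * x) / L x) @ (0:R)^'+ --> (1 : R)).

Definition offspring_hyp (alpha : R) (p : nat -> R) (L : R -> R) : Prop :=
  [/\ (forall k, 0 <= p k),
      (\sum_(k <oo) (p k)%:E = 1)%E,
      (\sum_(k <oo) (k%:R * p k)%:E = 1)%E,
      slowly_varying_at0 L &
      (forall s, 0 <= s <= 1 ->
         gen_fun p s = (s + (1 - s) `^ (1 + alpha) * L (1 - s))%:E)].

(* Z is a Galton-Watson process with offspring law p started from Z_0 = 1:
   the law of (Z_0,...,Z_m) is given by the branching transition
   probabilities P(Z_{k+1} = b | Z_k = a) = p^{*a}(b). *)
Definition is_GW d (T : measurableType d) (P : probability T R)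
    (Z : nat -> T -> nat) (p : nat -> R) : Prop :=
  (forall n k, measurable [set w | Z n w = k]) /\
  (forall (m : nat) (z : nat -> nat),
     P [set w | forall k, (k <= m)%N -> Z k w = z k] =
     (((z 0%N == 1%N)%:R) * \prod_(k < m) convpow p (z k) (z k.+1))%:E).

Definition Sblock (T : Type) (Z : nat -> T -> nat) (j k : nat) (w : T) : nat :=
  (\sum_(k <= l < k + j) Z l w)%N.

Definition Mmax (T : Type) (Z : nat -> T -> nat) (m j : nat) (w : T) : nat :=
  (\max_(0 <= k < (m - j).+1) Sblock Z j k w)%N.

Definition EMmax d (T : measurableType d) (P : probability T R)
    (Z : nat -> T -> nat) (m j : nat) : \bar R :=
  (\int[P]_w ((Mmax Z m j w)%:R)%:E)%E.

(* Q t x = P{X(t) in . | X(0) = x}, the transition law of the CSBP of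
   index 1+alpha, characterized by its support in [0,oo) and its Laplace
   transform E{e^{-lam X(t)} | X(0)=x} = exp[-x (t + lam^{-alpha})^{-1/alpha}]
   (for lam > 0; lam = 0 is total mass 1). *)
Definition csbp_kernel (alpha : R) (Q : R -> R -> probability R R) : Prop :=
  forall t x, 0 <= t -> 0 <= x ->
    Q t x `]-oo, 0[ = 0%E /\
    (forall lam : R, 0 < lam ->
       (\int[Q t x]_y (expR (- lam * y))%:E)%E =
       (expR (- x * (t + lam `^ (- alpha)) `^ (- alpha^-1)))%:E).

Definition chi_law (alpha : R) (chi : probability R R) : Prop :=
  chi `]-oo, 0[ = 0%E /\
  (forall lam : R, 0 < lam ->
     (\int[chi]_y (expR (- lam * y))%:E)%E =
     (1 - (1 + lam `^ (- alpha)) `^ (- alpha^-1))%:E).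

Definition surv (Q : R -> R -> probability R R) (u y : R) : R :=
  fine (Q u y `]0, +oo[).

(* Finite-dimensional distributions of X^* (the Markov process equal to the
   Durrett-conditioned X^+ on [0,1] and evolving as X after time 1).
   [tailfdd Q s x l] = P{X^*(t_i) in A_i for all (t_i,A_i) in l | X^*(s) = x},
   for s < t_1 < t_2 < ... . Transition kernels:
   - for s < t <= 1 : Q (t-s) x (dy) surv(1-t,y) / surv(1-s,x)
   - for 1 <= s < t : Q (t-s) x (dy)
   - for s < 1 < t  : composition of the two through time 1. *)
Fixpoint tailfdd (Q : R -> R -> probability R R) (s x : R)
    (l : seq (R * set R)) : \bar R :=
  match l with
  | [::] => 1%E
  | (t, A) :: l' =>
    if t <= 1 then
      (\int[Q (t - s)%R x]_y
         ((\1_A y * surv Q (1 - t) y / surv Q (1 - s) x)%R%:E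
          * tailfdd Q t y l'))%E
    else if 1 <= s then
      (\int[Q (t - s)%R x]_y ((\1_A y)%R%:E * tailfdd Q t y l'))%E
    else
      (\int[Q (1 - s)%R x]_z
         ((surv Q 0 z / surv Q (1 - s) x)%R%:E *
          \int[Q (t - 1)%R z]_y ((\1_A y)%R%:E * tailfdd Q t y l')))%E
  end.

(* P{X^*(t_i) in A_i for all i}, 0 < t_1 < t_2 < ..., with X^*(0) = 0 and
   P(X^+(t) in dy) = t^{-1/alpha} P(t^{1/alpha} chi in dy) surv(1-t, y). *)
Definition fdd (alpha : R) (Q : R -> R -> probability R R)
    (chi : probability R R) (l : seq (R * set R)) : \bar R :=
  match l with
  | [::] => 1%E
  | (t, A) :: l' =>
    if t <= 1 then
      (\int[chi]_c
         ((t `^ (- alpha^-1) * \1_A (t `^ (alpha^-1) * c)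
           * surv Q (1 - t) (t `^ (alpha^-1) * c))%R%:E
          * tailfdd Q t (t `^ (alpha^-1) * c)%R l'))%E
    else
      (\int[chi]_c
         ((surv Q 0 c)%:E *
          \int[Q (t - 1)%R c]_y ((\1_A y)%R%:E * tailfdd Q t y l')))%E
  end.

Fixpoint holds_all (T : Type) (X : R -> T -> R) (w : T)
    (l : seq (R * set R)) : Prop :=
  match l with
  | [::] => True
  | (t, A) :: l' => A (X t w) /\ holds_all X w l'
  end.

Fixpoint measurable_list (l : seq (R * set R)) : Prop :=
  match l with
  | [::] => True
  | (t, A) :: l' => measurable A /\ measurable_list l'
  end.

Definition cadlag_paths (T : Type) (X : R -> T -> R) : Prop :=
  forall w,
    (forall t, 0 <= t -> (fun u => X u w) @ t^'+ --> X t w) /\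
    (forall t, 0 < t -> cvg ((fun u => X u w) @ t^'-)).

Definition is_Xstar (alpha : R) (Q : R -> R -> probability R R)
    (chi : probability R R) d (T : measurableType d) (Pr : probability T R)
    (X : R -> T -> R) : Prop :=
  [/\ (forall w, X 0 w = 0),
      (forall t, 0 <= t -> measurable_fun setT (X t)),
      cadlag_paths X &
      (forall l : seq (R * set R),
         sorted <%R (map fst l) -> all (fun t => 0 < t) (map fst l) ->
         measurable_list l ->
         Pr [set w | holds_all X w l] = fdd alpha Q chi l)].

Definition Vstar (T : Type) (X : R -> T -> R) (Tm : R) (w : T) : \bar R :=
  ereal_sup [set (\int[lebesgue_measure]_(u in `[s, (s + 1)%R]) (X u w)%:E)%E
            | s in `[0, (Tm - 1)%R]].

Definition EVstar d (T : measurableType d) (Pr : probability T R)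
    (X : R -> T -> R) (Tm : R) : \bar R :=
  (\int[Pr]_w Vstar X Tm w)%E.

Definition phiV (alpha : R) d (T : measurableType d) (Pr : probability T R)
    (X : R -> T -> R) (eta : R) : \bar R :=
  ((alpha / (2 * alpha + 1))%:E + EVstar Pr X eta^-1)%E.

End Defs.

(* Main.v *)
Require Import Defs.
From mathcomp Require Import all_boot all_order all_algebra.
From mathcomp Require Import all_classical all_reals all_analysis.
From mathcomp Require Import measurable_realfun.
From mathcomp Require Import ring lra zify.
Set Implicit Arguments. Unset Strict Implicit. Unset Printing Implicit Defensive.
Import Order.TTheory GRing.Theory Num.Theory numFieldNormedType.Exports.
Import HBSimple HBNNSimple.
Local Open Scope ring_scope.
Local Open Scope classical_set_scope.

(* Let d(x) = f(1-x) - (1-x), u(x) = d(x)/x and q_n = P(Z_n > 0), the n-th iterate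
   of x - d(x) at 1. Convexity of d and regular variation give n u(q_n) -> 1/alpha
   and q_k/q_j -> t^(-1/alpha) as k/j -> t. Stopping H(Z), where
   H(w) = sum_i c_i (1 - s^(i w)) has coefficients built from a polynomial bump, at the
   first passage above y shows that y P(max_(k<m) Z_k >= y) is alpha (1 + o(1)), up to
   a multiple of y q_m. Since Z barely moves during j generations when y is large,
   summing over levels gives E M_m(j) = (1 + o(1)) j ln(m/j) + O(j), hence (a) and the
   last claim. For (b), M_m(j) = S_0(j) on Z_j = 0, so that
   E M_m(j) = j + E[M_m(j); Z_j > 0] - E[S_0(j); Z_j > 0]; given Z_j > 0 the rescaled
   process converges to X^* by Laplace transforms, and block sums are averages over a
   fixed grid up to a small L1 error, so the last two terms divided by j tend to
   E V^*(1/eta) and E V^*(1) = 1 - alpha/(2 alpha + 1). *)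

(** Only regular variation of the loss is given, so chord slopes of a convex function replace
    derivatives and monotonicity replaces uniformity in the limits. The kernel z^alpha - (z -
    w)_+^alpha is, up to a constant, the Green function of the spectrally positive stable process of
    index 1 + alpha killed at 0. Integrating a bump near z = 1 against it gives a function of w that
    is constant beyond the bump and has slope about alpha times that constant at w = 0: this is the
    origin of the constant alpha in the tail of the maximum. The bump is a polynomial in exp(-z)
    because one generation acts exactly, through f, on finite combinations of powers s^w. Summing
    alpha/y over levels from 1/q_j to 1/q_m gives alpha ln(q_j/q_m), about ln(m/j), so alpha leaves
    (a). For (b) no limit theorem in path space is used: transforms settle finitely many grid times,
    Bernstein polynomials pass from them to Lipschitz functionals, and L1 bounds uniform in m
    justify truncation and sampling. The constant alpha/(2 alpha + 1) is the integral over [0,1] of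
    (1 - t)^(1 + 1/alpha), which is 1 - E X^*(t). *)

Local Notation mfunT := (measurable_fun setT).

(** * Real powers and limits along sequences *)

Section Powers.
Variable R : realType.

Lemma cvg_powR (T : Type) (F : set_system T) (FF : Filter F) (f : T -> R)
    (l b : R) : 0 < l -> f @ F --> l -> (fun x => f x `^ b) @ F --> l `^ b.
Proof.
move=> l0 fl.
apply: (@cvg_comp _ _ _ f (fun x => x `^ b) F (nbhs l) _ fl).
have dl : derivable (fun x : R => x `^ b) l 1 by apply: derivable_powR; rewrite in_itv/= andbT.
by move/derivable1_diffP: dl; exact: differentiable_continuous.
Qed.

Lemma near_cvg (T : Type) {F : set_system T} {FF : Filter F} (f g : T -> R)
    (l : R) : (\forall x \near F, f x = g x) -> f @ F --> l -> g @ F --> l.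
Proof. by move=> fg; apply: cvg_trans; exact: near_eq_cvg. Qed.

Lemma cvg_infty_comp (T : Type) (G : set_system T) (f : nat -> T) (j : nat -> nat) :
  (forall J, \forall n \near \oo, (J <= j n)%N) -> f n @[n --> \oo] --> G ->
  f (j n) @[n --> \oo] --> G.
Proof.
move=> jo fG; apply: cvg_comp fG => A [J _ HJ].
by have := jo J; apply: filterS => n Jn; exact: HJ.
Qed.

Lemma cvg_inv_natr : (n%:R^-1 : R) @[n --> \oo] --> 0.
Proof. rewrite -(cvg_shiftS (fun n => (n%:R^-1 : R))); exact: cvg_harmonic. Qed.

Lemma powR_lt1 (x b : R) : 0 <= x -> x < 1 -> 0 < b -> x `^ b < 1.
Proof.
move=> x0 x1 b0; have := @gt0_ltr_powR R b b0 x 1.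
by rewrite powR1 !nnegrE x0 ler01; apply.
Qed.

Lemma powR_slope (b e : R) : 0 < e -> exists2 r : R, 0 < r &
  forall h, h != 0 -> `|h| < r -> `| ((1 + h) `^ b - 1) / h - b| < e.
Proof.
move=> e0.
have [dv dE] := @is_derive1_powR R b 1 ltr01.
move: dE; rewrite powR1 mulr1 => dE.
have := dv; rewrite /derivable => /cvg_ex [l Hl].
have El : l = b by rewrite -dE /derive; apply/esym/cvg_lim.
move: Hl; rewrite El => /cvgrPdist_lt/(_ e e0).
rewrite near_withinE => /nbhs_ballP[r /= r0 H].
exists r => // h h0 hr.
have := H h; rewrite /ball/= sub0r normrN hr => /(_ isT h0).
by rewrite distrC powR1 scaler1 (addrC h 1) /GRing.scale/= (mulrC h^-1).
Qed.

End Powers.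

(** * Iteration of the survival map and asymptotics of the survival probability *)

Section Decrement.
Variable R : realType.
Implicit Types (al x y e lam : R) (d : R -> R).

(* For an offspring generating function f, the map d x = f(1-x) - (1-x) is the
   one-step loss of the survival probability: 1 - f(1-x) = x - d x. *)
Record decrement al d : Prop := Decrement {
  dec_alpha : 0 < al <= 1;
  dec_0 : d 0 = 0;
  dec_bounds : forall x, 0 < x <= 1 -> 0 < d x < x;
  dec_chord : forall a b c e, 0 <= a -> a <= c -> b <= e -> a < b -> c < e ->
    e <= 1 -> (d b - d a) * (e - c) <= (d e - d c) * (b - a);
  dec_next_le : forall x y, 0 <= x -> x <= y -> y <= 1 -> x - d x <= y - d y;
  dec_rv : forall lam, 0 < lam ->
    d (lam * x) / d x @[x --> 0^'+] --> lam `^ (1 + al) }.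

Definition rate d x := d x / x.
Definition surv_next d x := x - d x.
Definition survp d n := iter n (surv_next d) 1.

Variables (al : R) (d : R -> R).
Hypothesis dd : decrement al d.
Local Notation u := (rate d).
Local Notation phi := (surv_next d).
Local Notation q := (survp d).

Let alpha0 : 0 < al. Proof. by case/andP: (dec_alpha dd). Qed.

Lemma rate_gt0 x : 0 < x <= 1 -> 0 < u x.
Proof.
move=> xx; have /andP[d0 _] := dec_bounds dd xx.
by rewrite divr_gt0//; case/andP: xx.
Qed.

Lemma rate_lt1 x : 0 < x <= 1 -> u x < 1.
Proof.
move=> xx; have /andP[_ d0] := dec_bounds dd xx.
by rewrite /rate ltr_pdivrMr ?mul1r//; case/andP: xx.
Qed.

Lemma decE x : 0 < x -> d x = x * u x.
Proof. by move=> x0; rewrite /rate mulrC divfK ?gt_eqF. Qed.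

(** The rate is the slope of the chord from the origin, and convexity makes such slopes increase. *)
Lemma rate_le x y : 0 < x -> x <= y -> y <= 1 -> u x <= u y.
Proof.
move=> x0 xy y1; have y0 : 0 < y by apply: lt_le_trans xy.
rewrite /rate ler_pdivrMr// mulrAC ler_pdivlMr//.
have := dec_chord dd (lexx 0) (lexx 0) xy x0 y0 y1.
by rewrite (dec_0 dd) !subr0.
Qed.

Lemma rate_rv lam : 0 < lam -> u (lam * x) / u x @[x --> 0^'+] --> lam `^ al.
Proof.
move=> l0.
have E : lam `^ al = lam `^ (1 + al) / lam.
  rewrite powRD; last by rewrite gt_eqF ?addr_gt0.
  by rewrite powRr1 ?ltW// mulrAC divff ?mul1r// gt_eqF.
rewrite E; apply: cvg_trans; last first.
  exact: (cvgM (dec_rv dd l0) (cvg_cst lam^-1)).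
apply: near_eq_cvg; near=> x.
have x0 : 0 < x by near: x; exact: nbhs_right_gt.
have x1 : x < 1 by near: x; exact: nbhs_right_lt.
have d0 : d x != 0 by rewrite gt_eqF//; have /andP[] := @dec_bounds _ _ dd x (introT andP (conj x0 (ltW x1))).
by rewrite /rate/=; field; rewrite d0 !gt_eqF.
Unshelve. all: end_near. Qed.

(** Regular variation with positive index [al] makes the rate shrink by a fixed factor at each
    halving of the argument; monotonicity fills in between the dyadic points. *)
Lemma rate_cvg0 : u x @[x --> 0^'+] --> 0.
Proof.
have c1 : (2^-1 : R) `^ al < 1 by rewrite powR_lt1//; lra.
have [r [r0 r1 [x0 x00 Hx]]] : exists r : R, [/\ 0 < r, r < 1 &
    exists2 x0 : R, 0 < x0 & forall x, 0 < x < x0 -> u (2^-1 * x) <= r * u x].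
  (* Any ratio strictly between 2^(-al) and 1 would do. *)
  pose r := ((2^-1 : R) `^ al + 1) / 2.
  exists r; split.
  - by rewrite /r; have := powR_ge0 (2^-1 : R) al; lra.
  - by rewrite /r; lra.
  have rl : (2^-1 : R) `^ al < r by rewrite /r; lra.
  have h2 : 0 < (2^-1 : R) by rewrite invr_gt0.
  have := rate_rv h2 => /cvgr_le /(_ _ rl).
  rewrite /nbhs/= /within/= /= => -[e /= e0 He].
  exists (Num.min e 1); first by rewrite lt_min e0 ltr01.
  move=> x /andP[x0]; rewrite lt_min => /andP[xe x1].
  rewrite -ler_pdivrMr ?rate_gt0 ?x0 ?(ltW x1)//.
  by apply: He => //=; rewrite sub0r normrN gtr0_norm.
apply/cvgrPdist_le => e e0.
pose y := Num.min x0 1 / 2.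
have y0 : 0 < y by rewrite divr_gt0// lt_min x00 ltr01.
have yx : y < x0 by apply: (@lt_le_trans _ _ (Num.min x0 1)); [rewrite /y ltr_pdivrMr// ltr_pMr ?lt_min ?x00 ?ltr01// ltr1n|rewrite ge_min lexx].
have y1 : y <= 1 by rewrite /y ler_pdivrMr// mul1r ge_min; apply/orP; right; rewrite ler1n.
have it n : u (2^-1 ^+ n * y) <= r ^+ n.
  elim: n => [|n IH]; first by rewrite !expr0 mul1r ltW ?rate_lt1 ?y0.
  rewrite !exprS -mulrA (le_trans (Hx _ _)) ?ler_wpM2l ?(ltW r0)//.
  rewrite mulr_gt0 ?exprn_gt0//= (le_lt_trans _ yx)// ler_piMl ?(ltW y0)//.
  by rewrite exprn_ile1//; lra.
have := @cvg_expr R r; rewrite gtr0_norm// => /(_ r1) /cvgrPdist_le/(_ e e0) [n _ Hn].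
near=> x.
have x0' : 0 < x by near: x; exact: nbhs_right_gt.
have xy : x <= 2^-1 ^+ n * y by near: x; apply: nbhs_right_le; rewrite mulr_gt0// exprn_gt0.
have y1n : 2^-1 ^+ n * y <= 1 by rewrite mulr_ile1 ?(ltW y0) ?exprn_ge0// exprn_ile1//; lra.
rewrite sub0r normrN gtr0_norm ?rate_gt0 ?x0' ?(le_trans xy)//.
rewrite (le_trans (rate_le _ xy _))// (le_trans (it n))//.
by have := Hn n (leqnn n); rewrite sub0r normrN ger0_norm ?exprn_ge0// ltW.
Unshelve. all: end_near. Qed.

Lemma next_gt0 x : 0 < x <= 1 -> 0 < phi x <= 1.
Proof.
move=> xx; have /andP[d0 d1] := dec_bounds dd xx; case/andP: xx => x0 x1.
by rewrite /surv_next subr_gt0 d1/= (le_trans _ x1)// lerBlDr lerDl ltW.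
Qed.

Lemma next_lt x : 0 < x <= 1 -> phi x < x.
Proof. by move=> xx; have /andP[d0 _] := dec_bounds dd xx; rewrite /surv_next gtrBl. Qed.

Lemma next_loss x : x - phi x = d x.
Proof. by rewrite /surv_next opprB addrC subrK. Qed.

Lemma right_near (P : R -> Prop) (e : R) : 0 < e ->
  (forall x, 0 < x < e -> P x) -> \forall x \near 0^'+, P x.
Proof.
move=> e0 H; near=> x; apply: H; apply/andP; split.
- by near: x; exact: nbhs_right_gt.
- by near: x; exact: nbhs_right_lt.
Unshelve. all: end_near. Qed.

(** The chord slope of [d] over [phi x, x], an interval of length [d x], divided by [d x / x]: a
    derivative-free substitute for x d'(x)/d(x), whose limit should be 1 + al. *)
Let w x := (d x - d (phi x)) * x / d x ^+ 2.

(** Convexity bounds the slope over [phi x, x] by the slope over [x, lam x]. *)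
Let w_le lam x : 1 < lam -> 0 < x -> lam * x <= 1 ->
  w x <= (d (lam * x) / d x - 1) / (lam - 1).
Proof.
move=> l1 x0 lx1.
have xl : x < lam * x by rewrite ltr_pMl.
have x1 : x <= 1 by apply: le_trans lx1; exact: ltW.
have xx : 0 < x <= 1 by rewrite x0.
have /andP[d0 dx] := dec_bounds dd xx.
have /andP[p0 _] := next_gt0 xx.
have := @dec_chord _ _ dd (phi x) x x (lam * x) (ltW p0) (ltW (next_lt xx)) (ltW xl) (next_lt xx) xl lx1.
rewrite next_loss => H.
rewrite /w ler_pdivrMr ?exprn_gt0// mulrAC ler_pdivlMr ?subr_gt0//.
rewrite [leRHS](_ : _ = (d (lam * x) - d x) * d x); last first.
  by field; rewrite gt_eqF.
apply: le_trans H.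
by rewrite -mulrA mulrBr mulr1 (mulrC x lam).
Qed.
(** The chord over [mu^2 x, mu x] lies to the left of [phi x, x] as soon as the relative loss [u x]
    is at most 1 - mu. *)
Let w_ge (mu x : R) : 0 < mu < 1 -> 0 < x <= 1 -> u x <= 1 - mu ->
  (d (mu * x) / d x - d (mu * (mu * x)) / d x) / (mu * (1 - mu)) <= w x.
Proof.
move=> /andP[m0 m1] xx ux; have /andP[x0 x1] := xx.
have /andP[d0 dx] := dec_bounds dd xx.
have mx : mu * x <= phi x by rewrite /surv_next decE//; nra.
have mm : mu * (mu * x) < mu * x by rewrite gtr_pMl// mulr_gt0.
have := @dec_chord _ _ dd (mu * (mu * x)) (mu * x) (phi x) x (ltW (mulr_gt0 m0 (mulr_gt0 m0 x0)))
  (le_trans (ltW mm) mx) (le_trans mx (ltW (next_lt xx))) mm (next_lt xx) x1.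
rewrite next_loss => H.
rewrite /w ler_pdivlMr ?exprn_gt0// mulrAC ler_pdivrMr ?mulr_gt0 ?subr_gt0//.
rewrite [leLHS](_ : _ = (d (mu * x) - d (mu * (mu * x))) * d x); last first.
  by field; rewrite gt_eqF.
by nra.
Qed.
(** By regular variation both bounding slopes converge to difference quotients of z^(1 + al) near 1.
    A fixed small [h] brings these quotients within [e] of 1 + al, and only then does x tend to
    0. *)
Let w_cvg : w x @[x --> 0^'+] --> 1 + al.
Proof.
apply/cvgrPdist_le => e e0.
have e20 : 0 < e / 4 by rewrite divr_gt0.
have [r r0 Hr] := powR_slope (1 + al) e20.
have e30 : 0 < Num.min (e / 8) 1 by rewrite lt_min ltr01 andbT divr_gt0.
have [r' r'0 Hr'] := powR_slope al e30.
(* One [h] serves both quotients: it lies below the two radii of [powR_slope], and the last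
   condition pays for the extra factor mu^al in the lower quotient, which is at least 1 - h (al +
   1). *)
have [h [h0 hr hr' h1 hs]] : exists h : R, [/\ 0 < h, h < r, h < r', h < 1/2 & h * (al + 1) * 4 < e / 4].
  exists (Num.min (Num.min r r') (Num.min (1/2) (e / (32 * (al + 1)))) / 2).
  set M := Num.min _ _.
  have a0 := alpha0.
  have e'0 : 0 < e / (32 * (al + 1)) by rewrite divr_gt0// mulr_gt0// addr_gt0.
  have M0 : 0 < M by rewrite !lt_min r0 r'0 e'0 andbT; lra.
  have [M1 M2 M3 M4] : [/\ M <= r, M <= r', M <= 1/2 & M <= e / (32 * (al + 1))] by rewrite /M; split; rewrite !ge_min lexx ?orbT.
  split; try by lra.
  move: M4; rewrite ler_pdivlMr ?mulr_gt0// ?addr_gt0// => M4.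
  by nra.
have hn0 : h != 0 by rewrite gt_eqF.
pose lam := 1 + h; pose mu := 1 - h.
have l0 : 0 < lam by rewrite /lam; lra.
have m0 : 0 < mu by rewrite /mu; lra.
have := Hr h hn0; rewrite gtr0_norm// => /(_ hr) slam.
have mhn0 : - h != 0 by rewrite oppr_eq0.
have := Hr (- h) mhn0; rewrite normrN gtr0_norm// => /(_ hr) smu.
have := Hr' (- h) mhn0; rewrite normrN gtr0_norm// => /(_ hr') smu'.
have cl : (d (lam * x) / d x - 1) / (lam - 1) @[x --> 0^'+] --> (lam `^ (1 + al) - 1) / (lam - 1).
  by apply: cvgM (cvg_cst _); apply: cvgB (cvg_cst _); exact: dec_rv.
have cm : (d (mu * x) / d x - d (mu * (mu * x)) / d x) / (mu * (1 - mu)) @[x --> 0^'+] -->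
    (mu `^ (1 + al) - (mu * mu) `^ (1 + al)) / (mu * (1 - mu)).
  apply: cvgM (cvg_cst _); apply: cvgB; first exact: (dec_rv dd).
  under eq_fun do rewrite mulrA.
  by apply: (dec_rv dd); exact: mulr_gt0.
have limu : (lam `^ (1 + al) - 1) / (lam - 1) < 1 + al + e.
  move: slam; rewrite /lam addrAC subrr add0r ltr_norml => /andP[_].
  by lra.
have lime : 1 + al - e < (mu `^ (1 + al) - (mu * mu) `^ (1 + al)) / (mu * (1 - mu)).
  rewrite powRM ?(ltW m0)//.
  have E : mu `^ (1 + al) = mu * mu `^ al by rewrite powRD ?powRr1 ?(ltW m0)// (gt_eqF m0) implybT.
  have -> : (mu `^ (1 + al) - mu `^ (1 + al) * mu `^ (1 + al)) / (mu * (1 - mu)) =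
     mu `^ al * ((mu `^ (1 + al) - 1) / (mu - 1)).
    rewrite {1 2}E; field.
    by apply/and3P; split; [rewrite lt_eqF// /mu; lra|rewrite gt_eqF// /mu; lra|rewrite gt_eqF].
  move: smu smu'; rewrite (_ : 1 - h = mu)//.
  rewrite (_ : mu - 1 = - h); last by rewrite /mu; lra.
  set A := (_ / - h); set B := mu `^ al; rewrite !ltr_norml => /andP[A1 _] /andP[_ B1].
  have Bl : 1 - h * (al + 1) < B.
    have m1 : Num.min (e / 8) 1 <= 1 by rewrite ge_min lexx orbT.
    have : (B - 1) / - h < 1 + al by move: B1; lra.
    by rewrite invrN mulrN -mulNr ltr_pdivrMr//; lra.
  have B1' : B <= 1 by rewrite /B ltW// powR_lt1// ?(ltW m0)//; rewrite /mu; lra.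
  have a0 := alpha0.
  have /andP[_ a1] := dec_alpha dd.
  have B0 : 0 <= B by exact: powR_ge0.
  pose a := 1 + al - e / 4.
  have p1 : B * a <= B * A by rewrite ler_wpM2l// /a; lra.
  have [an|ap] := leP a 0.
    have : (1 - B) * a <= 0 by rewrite mulr_ge0_le0// subr_ge0.
    by rewrite /a in p1 *; lra.
  have : (1 - h * (al + 1)) * a <= B * a by rewrite ler_wpM2r// ltW.
  have : h * (al + 1) * a <= h * (al + 1) * 2 by rewrite ler_wpM2l// ?mulr_ge0 ?addr_ge0 ?(ltW h0) ?(ltW a0)// /a; lra.
  by rewrite mulrBl mul1r /a in p1 *; lra.
have r1 := cvgr_lt _ cl _ limu.
have r2 := cvgr_gt _ cm _ lime.
have r3 : \forall x \near 0^'+, u x <= 1 - mu by apply: (cvgr_le _ rate_cvg0); rewrite /mu; lra.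
near=> x.
have x0 : 0 < x by near: x; exact: nbhs_right_gt.
have xl : x <= lam^-1 by near: x; apply: nbhs_right_le; rewrite invr_gt0.
have lx1 : lam * x <= 1 by rewrite mulrC -ler_pdivlMr// mul1r.
have x1 : x <= 1 by rewrite (le_trans xl)// invf_le1// /lam; lra.
have W1 : w x <= 1 + al + e.
  apply: (le_trans (w_le _ x0 lx1)); first by rewrite /lam; lra.
  by apply: ltW; near: x; exact: r1.
have W2 : 1 + al - e <= w x.
  apply: (le_trans _ (@w_ge mu x _ _ _)); first by apply: ltW; near: x; exact: r2.
  - by rewrite m0/= /mu; lra.
  - by rewrite x0.
  - by near: x; exact: r3.
by rewrite ler_norml; lra.
Unshelve. all: end_near. Qed.

(** Since x - phi x = d x, one has u(phi x)/u(x) = (1 - w u)/(1 - u) with u = u(x), so the increment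
    of 1/u equals (w - 1)/(1 - w u). *)
Lemma inv_rate_step : (u (phi x))^-1 - (u x)^-1 @[x --> 0^'+] --> al.
Proof.
have c2 : (1 - w x * u x)^-1 * (w x - 1) @[x --> 0^'+] --> al.
  rewrite -[X in _ --> X](_ : (1 - (1 + al) * 0)^-1 * (1 + al - 1) = al); last first.
    by rewrite mulr0 subr0 invr1 mul1r addrAC subrr add0r.
  apply: cvgM; last by apply: cvgB (cvg_cst _); exact: w_cvg.
  apply: cvgV; first by rewrite mulr0 subr0 oner_neq0.
  by apply: cvgB (cvg_cst _) _; apply: cvgM rate_cvg0; exact: w_cvg.
apply: cvg_trans c2; apply: near_eq_cvg; near=> x.
have x0 : 0 < x by near: x; exact: nbhs_right_gt.
have xx : 0 < x <= 1 by rewrite x0 ltW.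
have /andP[d0 dx] := dec_bounds dd xx.
have px := next_gt0 xx.
have /andP[d'0 d'x] := dec_bounds dd px.
rewrite /w /rate.
have -> : 1 - (d x - d (phi x)) * x / d x ^+ 2 * (d x / x) = d (phi x) / d x by field; rewrite !gt_eqF.
have /andP[p0 _] := px; move: p0 d'0; move: (d (phi x)) => D.
by rewrite /surv_next => p0 D0; field; rewrite !gt_eqF.
Unshelve. all: end_near. Qed.

Lemma survpS n : q n.+1 = phi (q n). Proof. by []. Qed.

Lemma survp_gt0 n : 0 < q n <= 1.
Proof.
elim: n => [|n IH]; first by rewrite /survp/= ltr01 lexx.
by rewrite survpS; exact: next_gt0.
Qed.

Lemma survp_decr : {homo q : m n / (m <= n)%N >-> n <= m}.
Proof.
apply: homo_leq => [//|x y z xy yz|n]; first exact: le_trans yz xy.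
by rewrite survpS ltW// next_lt// survp_gt0.
Qed.

(** If all iterates stayed above some [l], each step would lose at least l u(l), which cannot go on
    forever. *)
Lemma survp_cvg0 : q n @[n --> \oo] --> 0.
Proof.
apply/cvgrPdist_le => e e0.
pose l := Num.min e 1.
have l0 : 0 < l by rewrite lt_min e0 ltr01.
have l1 : l <= 1 by rewrite ge_min lexx orbT.
have ll : 0 < l <= 1 by rewrite l0.
have dl : 0 < l * u l by rewrite mulr_gt0// rate_gt0.
have [n Hn] : exists n, q n <= l.
  apply: contrapT => /forallNP H.
  have {}H n : l < q n by rewrite ltNge; apply/negP/H.
  have B n : q n <= 1 - n%:R * (l * u l).
    elim: n => [|n IH]; first by rewrite mul0r subr0.
    have /andP[q0 q1] := survp_gt0 n.
    have -> : q n.+1 = q n - q n * u (q n) by rewrite survpS /surv_next -decE.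
    have : l * u l <= q n * u (q n) by apply: ler_pM; rewrite ?(ltW l0) ?(ltW (rate_gt0 ll)) ?(ltW (H n)) ?rate_le ?(ltW (H n)).
    by rewrite -natr1 mulrDl mul1r; lra.
  have := H (Num.bound (l * u l)^-1).
  have := B (Num.bound (l * u l)^-1).
  have := archi_boundP (ltW (_ : 0 < (l * u l)^-1)).
  rewrite invr_gt0 => /(_ dl).
  rewrite -(ltr_pM2r dl) mulVf ?gt_eqF// => b1 b2 b3; lra.
near=> k.
have /andP[q0 q1] := survp_gt0 k.
rewrite sub0r normrN gtr0_norm// (le_trans (survp_decr (_ : n <= k)%N))//.
  by near: k; exact: nbhs_infty_ge.
by rewrite (le_trans Hn)// ge_min lexx.
Unshelve. all: end_near. Qed.

Lemma cvg_at_right_pos (T : Type) (F : set_system T) (FF : Filter F)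
  (x : T -> R) : (forall n, 0 < x n) -> x n @[n --> F] --> 0 -> x n @[n --> F] --> 0^'+.
Proof.
move=> x0 xc P; rewrite /nbhs/= /within/= => NP.
have := xc _ NP; rewrite /nbhs/= /fmap/=; apply: filterS => n; apply; exact: x0.
Qed.

Lemma survp_at_right : q n @[n --> \oo] --> 0^'+.
Proof.
apply: cvg_at_right_pos; last exact: survp_cvg0.
by move=> n; have /andP[] := survp_gt0 n.
Qed.

(** Averaging the increments of 1/u along the orbit (Cesaro) gives 1/u(q_n) ~ al n. *)
Lemma rate_survp : n%:R * u (q n) @[n --> \oo] --> al^-1.
Proof.
have c1 : (u (q n.+1))^-1 - (u (q n))^-1 @[n --> \oo] --> al.
  exact: (cvg_comp _ _ survp_at_right inv_rate_step).
have c2 := cesaro c1.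
have c3 : n%:R * u (q n) @[n --> \oo] --> al^-1.
  rewrite -[X in X --> _]/(_ @ \oo) -cvg_shiftS.
  have c4 : n.+1%:R^-1 * (u (q n.+1))^-1 @[n --> \oo] --> al.
    have -> : al = al + 0 * (u (q 0))^-1 by rewrite mul0r addr0.
    have : arithmetic_mean (fun n => (u (q n.+1))^-1 - (u (q n))^-1) n + n.+1%:R^-1 * (u (q 0))^-1
       @[n --> \oo] --> al + 0 * (u (q 0))^-1.
      by apply: cvgD c2 _; apply: cvgM (cvg_cst _); exact: cvg_harmonic.
    apply: cvg_trans; apply: near_eq_cvg; near=> n.
    rewrite /arithmetic_mean/= /series/= telescope_sumr//.
    by rewrite mulrBr subrK.
  have : (n.+1%:R^-1 * (u (q n.+1))^-1)^-1 @[n --> \oo] --> al^-1 by apply: cvgV c4; rewrite gt_eqF.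
  by under eq_fun do rewrite invfM !invrK.
exact: c3.
Unshelve. all: end_near. Qed.

Lemma ln_succ_bounds n : (0 < n)%N ->
  (n.+1%:R^-1 : R) <= ln (n.+1%:R : R) - ln (n%:R : R) <= n%:R^-1.
Proof.
move=> n0; have n0' : 0 < n%:R :> R by rewrite ltr0n.
have E : n.+1%:R = n%:R * (1 + n%:R^-1) :> R by rewrite mulrDr mulr1 divff ?gt_eqF// natr1.
have i0 : 0 < n%:R^-1 :> R by rewrite invr_gt0.
have L : ln n.+1%:R - ln n%:R = ln (1 + n%:R^-1) :> R by rewrite E lnM ?posrE// ?addr_gt0// addrAC subrr add0r.
apply/andP; split; last by rewrite L le_ln1Dx//; lra.
have -> : ln n.+1%:R - ln n%:R = - ln (1 + - n.+1%:R^-1) :> R.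
  rewrite -[LHS]opprK opprB -ln_div ?posrE//; congr (- ln _).
  by rewrite -natr1; field; rewrite natr1 pnatr_eq0.
by rewrite lerNr le_ln1Dx// ltrN2 invf_lt1// ltr1n ltnS.
Qed.
(** The logarithmic decrement of q is -ln(1 - u(q_n)), hence about u(q_n), hence about 1/(al n). The
    error is stated relative to ln(n+1) - ln n so that it telescopes. *)
Let survp_ln_step (e : R) : 0 < e -> exists J, (0 < J)%N /\ forall n, (J <= n)%N ->
  `|al * (ln (q n) - ln (q n.+1)) - (ln (n.+1%:R : R) - ln (n%:R : R))| <=
  e * (ln (n.+1%:R : R) - ln (n%:R : R)).
Proof.
move=> e0; have a0 := alpha0.
have U0 : u (q n) @[n --> \oo] --> 0 by exact: cvg_comp survp_at_right rate_cvg0.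
have c1 : al * (n%:R * u (q n)) @[n --> \oo] --> (1 : R).
  rewrite -[X in _ --> X](divff (lt0r_neq0 a0)).
  by apply: cvgM (cvg_cst _) _; exact: rate_survp.
have c2 : al * (n%:R * u (q n)) * (1 - u (q n))^-1 @[n --> \oo] --> (1 : R).
  rewrite -[X in _ --> X](_ : 1 * (1 - 0)^-1 = 1); last by rewrite subr0 invr1 mulr1.
  apply: cvgM c1 _; apply: cvgV; first by rewrite subr0 oner_neq0.
  by apply: cvgB (cvg_cst _) _.
have e4 : 0 < e / 4 by rewrite divr_gt0.
have i4 : 1 < 1 + e / 4 by rewrite ltrDl.
have i4' : 1 - e / 4 < 1 by rewrite ltrBlDr ltrDl.
have r1 : \forall n \near \oo, 1 - e / 4 < al * (n%:R * u (q n)) by exact: cvgr_gt c1 _ i4'.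
have r2 : \forall n \near \oo, al * (n%:R * u (q n)) * (1 - u (q n))^-1 < 1 + e / 4.
  exact: cvgr_lt c2 _ i4.
have r3 : \forall n \near \oo, (n.+1%:R^-1 : R) < e / 4 by apply: cvgr_lt e4; exact: cvg_harmonic.
have : \forall n \near \oo, [/\ 1 - e / 4 < al * (n%:R * u (q n)),
   al * (n%:R * u (q n)) * (1 - u (q n))^-1 < 1 + e / 4 & (n.+1%:R^-1 : R) < e / 4].
  by near=> n; split; near: n.
move=> [J _ HJ]; exists J.+1; split=> // n Jn.
have [h1 h2 h3] := HJ n (ltnW Jn).
have n0 : (0 < n)%N by apply: leq_trans Jn.
have n0' : 0 < n%:R :> R by rewrite ltr0n.
have /andP[l1 l2] := ln_succ_bounds n0.
have qq := survp_gt0 n; have /andP[q0 q1] := qq.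
have ug := rate_gt0 qq; have ul := rate_lt1 qq.
set U := u (q n) in h1 h2 ug ul.
have E : ln (q n) - ln (q n.+1) = - ln (1 + - U).
  rewrite survpS /surv_next decE// -{2}[q n]mulr1 -mulrBr lnM ?posrE ?subr_gt0//.
  by rewrite opprD addrA subrr add0r.
clearbody U.
have b1 : U <= - ln (1 + - U) by rewrite lerNr le_ln1Dx// ltrN2.
have b2 : - ln (1 + - U) <= U * (1 - U)^-1.
  rewrite -lnV ?posrE ?subr_gt0//.
  have -> : (1 - U)^-1 = 1 + U * (1 - U)^-1 by field; rewrite gt_eqF// subr_gt0.
  rewrite (le_trans (le_ln1Dx _))//.
    by rewrite (@lt_le_trans _ _ 0)// mulr_ge0 ?(ltW ug)// invr_ge0 subr_ge0 ltW.
  rewrite [X in _ <= U * X](_ : _ = (1 - U)^-1)//.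
  by field; rewrite gt_eqF// subr_gt0.
rewrite E.
set A := - ln (1 + - U) in b1 b2 *; set l := ln _ - ln _ in l1 l2 *.
have nA1 : 1 - e / 4 < al * (n%:R * A) by apply: lt_le_trans h1 _; rewrite ler_wpM2l ?(ltW a0)// ler_wpM2l.
have nA2 : al * (n%:R * A) < 1 + e / 4 by apply: le_lt_trans _ h2; rewrite -[leRHS]mulrA ler_wpM2l ?(ltW a0)// -[leRHS]mulrA ler_wpM2l.
have nl1 : 1 - e / 4 < n%:R * l.
  apply: lt_le_trans (_ : n%:R * n.+1%:R^-1 <= _); last by rewrite ler_wpM2l.
  have -> : n%:R * n.+1%:R^-1 = 1 - n.+1%:R^-1 :> R by rewrite -natr1; field; rewrite natr1 pnatr_eq0.
  by rewrite ltrD2l ltrN2.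
have nl2 : n%:R * l <= 1 by rewrite (le_trans (ler_wpM2l _ l2))// divff// gt_eqF.
have nl3 : 2^-1 <= n%:R * l.
  apply: (le_trans _ (ler_wpM2l _ l1)) => //.
  by rewrite ler_pdivlMr// ler_pdivrMl// -natrM ler_nat; move: n0; clear; lia.
rewrite -(ler_pM2l n0') -{1}(gtr0_norm n0') -normrM.
rewrite mulrBr ler_norml; apply/andP; split; nra.
Unshelve. all: end_near. Qed.

(** Potter bounds in logarithmic form, by telescoping: q varies regularly with index -1/al. *)
Lemma survp_ln (e : R) : 0 < e -> exists J, (0 < J)%N /\ forall j k, (J <= j)%N ->
  (j <= k)%N -> `|al * (ln (q j) - ln (q k)) - (ln (k%:R : R) - ln (j%:R : R))| <=
  e * (ln (k%:R : R) - ln (j%:R : R)).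
Proof.
move=> e0; have [J [J0 HJ]] := survp_ln_step e0; exists J; split=> // j k Jj.
elim: k => [|k IH]; first by rewrite leqn0 => /eqP ->; rewrite !subrr mulr0 subrr normr0 mulr0.
rewrite leq_eqVlt => /predU1P[->|]; first by rewrite !subrr mulr0 subrr normr0 mulr0.
rewrite ltnS => jk.
have := HJ k (leq_trans Jj jk); have := IH jk.
set a := ln (q j); set b := ln (q k); set c := ln (q k.+1).
set x := ln j%:R; set y := ln k%:R; set z := ln k.+1%:R => h1 h2.
have -> : al * (a - c) - (z - x) = (al * (a - b) - (y - x)) + (al * (b - c) - (z - y)) by ring.
have -> : e * (z - x) = e * (y - x) + e * (z - y) by ring.
by apply: (le_trans (ler_normD _ _)); exact: lerD.
Qed.

Lemma survp_ln_sym (e : R) : 0 < e -> exists J, (0 < J)%N /\ forall j k, (J <= j)%N ->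
  (J <= k)%N -> `|al * (ln (q j) - ln (q k)) - (ln (k%:R : R) - ln (j%:R : R))| <=
  e * `|ln (k%:R : R) - ln (j%:R : R)|.
Proof.
move=> e0; have [J [J0 HJ]] := survp_ln e0; exists J; split=> // j k Jj Jk.
have l0 m n : (J <= m)%N -> (m <= n)%N -> 0 <= ln (n%:R : R) - ln (m%:R : R).
  move=> Jm mn; have m0 : (0 < m)%N by exact: leq_trans Jm.
  by rewrite subr_ge0 ler_ln ?posrE ?ltr0n ?ler_nat// (leq_trans m0).
have [jk|/ltnW kj] := leqP j k.
  by rewrite (ger0_norm (l0 _ _ Jj jk)); exact: HJ.
rewrite -normrN opprB [X in `|X|](_ : _ = al * (ln (q k) - ln (q j)) - (ln j%:R - ln k%:R)); last by ring.
by rewrite (distrC (ln (k%:R : R)) (ln (j%:R : R))) (ger0_norm (l0 _ _ Jk kj)); exact: HJ.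
Qed.

(** The constant absorbs the finitely many indices below [J]. Validity for every j >= 1 is what
    makes the later bounds on expected maxima uniform in m and j. *)
Lemma survp_ln_bound (e : R) : 0 < e -> exists C : R, 0 <= C /\ forall j k, (0 < j)%N ->
  (j <= k)%N -> `|al * (ln (q j) - ln (q k)) - (ln (k%:R : R) - ln (j%:R : R))| <=
  e * (ln (k%:R : R) - ln (j%:R : R)) + C.
Proof.
move=> e0; have [J [J0 HJ]] := survp_ln e0.
have lq i k : (i <= k)%N -> ln (q k) <= ln (q i).
  move=> ik; have /andP[qi _] := survp_gt0 i; have /andP[qk _] := survp_gt0 k.
  by rewrite ler_ln ?posrE//; exact: survp_decr.
have ll i k : (0 < i)%N -> (i <= k)%N -> ln (i%:R : R) <= ln (k%:R : R) by move=> i0 ik; rewrite ler_ln ?posrE ?ltr0n ?ler_nat// (leq_trans i0).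
have a0 := alpha0.
have lJ1 : ln (1%:R : R) = 0 by rewrite ln1.
pose C := - al * ln (q J) + ln (J%:R : R).
have small i k : (0 < i)%N -> (i <= k)%N -> (k <= J)%N ->
    `|al * (ln (q i) - ln (q k)) - (ln (k%:R : R) - ln (i%:R : R))| <= C.
  move=> i0 ik kJ.
  have h1 := lq 0%N i isT; have h2 := lq _ _ ik; have h3 := lq _ _ kJ.
  have h4 := ll 1%N i isT i0; have h5 := ll _ _ i0 ik.
  have h6 := ll _ _ (leq_trans i0 ik) kJ.
  have A1 : 0 <= al * (ln (q i) - ln (q k)) by rewrite mulr_ge0 ?(ltW a0)// subr_ge0.
  have A2 : al * (ln (q i) - ln (q k)) <= al * - ln (q J) by rewrite ler_wpM2l ?(ltW a0)//; lra.
  by rewrite ler_norml /C; lra.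
have C0 : 0 <= C by apply: le_trans (small 1%N 1%N isT isT J0).
exists C; split => // j k j0 jk.
have lkj := ll _ _ j0 jk.
have [Jj|jJ] := leqP J j.
  by apply: le_trans (HJ _ _ Jj jk) _; rewrite lerDl.
have [kJ|/ltnW Jk] := leqP k J.
  apply: le_trans (small _ _ j0 jk kJ) _; rewrite lerDr mulr_ge0 ?(ltW e0)//.
  by rewrite subr_ge0.
have s1 := small _ _ j0 (ltnW jJ) (leqnn J).
have s2 := HJ _ _ (leqnn J) Jk.
rewrite [X in `|X|](_ : _ = al * (ln (q j) - ln (q J)) - (ln (J%:R : R) - ln (j%:R : R)) +
   (al * (ln (q J) - ln (q k)) - (ln (k%:R : R) - ln (J%:R : R)))); last by ring.
apply: (le_trans (ler_normD _ _)); rewrite addrC; apply: lerD => //.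
apply: (le_trans s2); rewrite ler_wpM2l ?(ltW e0)//.
by have := ll _ _ j0 (ltnW jJ); lra.
Qed.
Let cvg_close_l (a b : nat -> R) (l : R) :
  (forall e, 0 < e -> \forall n \near \oo, `|a n - b n| <= e * `|b n|) ->
  b n @[n --> \oo] --> l -> a n @[n --> \oo] --> l.
Proof.
move=> H bl.
suff ab : a n - b n @[n --> \oo] --> 0.
  rewrite -[l]add0r; apply: (near_cvg _ (cvgD ab bl)).
  by near=> n; rewrite /= subrK.
apply/cvgrPdist_le => e e0.
have l1 : 0 < `|l| + 1 by rewrite ltr_wpDl.
have bl' : `|b n| @[n --> \oo] --> `|l| by exact: cvg_norm.
have l1' : `|l| < `|l| + 1 by rewrite ltrDl.
have r1 : \forall n \near \oo, `|b n| < `|l| + 1 by exact: cvgr_lt bl' _ l1'.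
have r2 := H (e / (`|l| + 1)) (divr_gt0 e0 l1).
near=> n.
rewrite sub0r normrN (le_trans (_ : _ <= e / (`|l| + 1) * `|b n|))//.
  by near: n.
rewrite mulrAC ler_pdivrMr// ler_wpM2l ?(ltW e0)//.
by apply: ltW; near: n.
Unshelve. all: end_near. Qed.
Let cvg_close_r (a b : nat -> R) (l : R) :
  (forall e, 0 < e -> \forall n \near \oo, `|a n - b n| <= e * `|b n|) ->
  a n @[n --> \oo] --> l -> b n @[n --> \oo] --> l.
Proof.
move=> H; apply: cvg_close_l => e e0.
have h0 : 0 < Num.min (e / 2) (1/2) by rewrite lt_min divr_gt0//=; lra.
apply: filterS (H _ h0) => n Hn.
have m1 : Num.min (e / 2) (1/2) <= e / 2 by rewrite ge_min lexx.
have m2 : Num.min (e / 2) (1/2) <= 1 / 2 by rewrite ge_min lexx orbT.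
have H1 : `|a n - b n| <= e / 2 * `|b n| by apply: le_trans Hn _; rewrite ler_wpM2r.
have H2 : `|a n - b n| <= 1 / 2 * `|b n| by apply: le_trans Hn _; rewrite ler_wpM2r.
have T : `|b n| <= `|a n| + `|a n - b n| by rewrite -{1}[b n](subKr (a n)); exact: ler_normB.
rewrite distrC; apply: le_trans H1 _.
have : `|b n| <= 2 * `|a n| by lra.
move=> bb; apply: le_trans (_ : e / 2 * (2 * `|a n|) <= _).
  by rewrite ler_wpM2l// ltW// divr_gt0.
by rewrite mulrA divfK.
Qed.
Let infty_near (j : nat -> nat) : (forall J, \forall n \near \oo, (J <= j n)%N) ->
  \forall n \near \oo, (0 < j n)%N.
Proof. by move=> /(_ 1%N). Qed.

Lemma ratio_infty (k j : nat -> nat) (t : R) : 0 < t ->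
  (forall J, \forall n \near \oo, (J <= j n)%N) ->
  (k n)%:R / (j n)%:R @[n --> \oo] --> t -> forall J, \forall n \near \oo, (J <= k n)%N.
Proof.
move=> t0 jo kj J.
have t2 : t / 2 < t by rewrite ltr_pdivrMr// ltr_pMr// ltr1n.
have r1 : \forall n \near \oo, t / 2 < (k n)%:R / (j n)%:R by exact: cvgr_gt kj _ t2.
have [M HM] : exists M : nat, J%:R / (t / 2) < M%:R :> R.
  exists (Num.bound (J%:R / (t / 2))); rewrite archi_boundP// divr_ge0//.
  by rewrite divr_ge0// ltW.
near=> n.
have : (maxn M 1 <= j n)%N by near: n.
rewrite geq_max => /andP[Mj j0].
have : t / 2 < (k n)%:R / (j n)%:R by near: n.
rewrite ltr_pdivlMr ?ltr0n// => h.
rewrite -(ler_nat R); apply: ltW; apply: le_lt_trans h.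
rewrite -ler_pdivrMl ?divr_gt0// mulrC (le_trans (ltW HM))// ler_nat//.
Unshelve. all: end_near. Qed.

Lemma survp_ratio (k j : nat -> nat) (t : R) : 0 < t ->
  (forall J, \forall n \near \oo, (J <= j n)%N) ->
  (k n)%:R / (j n)%:R @[n --> \oo] --> t ->
  q (k n) / q (j n) @[n --> \oo] --> t `^ (- al^-1).
Proof.
move=> t0 jo kj; have ko := ratio_infty t0 jo kj; have a0 := alpha0.
have c1 : ln (k n)%:R - ln (j n)%:R @[n --> \oo] --> ln t.
  have : ln ((k n)%:R / (j n)%:R) @[n --> \oo] --> ln t by apply: (cvg_comp _ _ kj); exact: continuous_ln.
  apply: near_cvg.
  have r1 := infty_near jo; have r2 := infty_near ko.
  near=> n; rewrite ln_div ?posrE ?ltr0n//; by near: n.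
have c2 : al * (ln (q (j n)) - ln (q (k n))) @[n --> \oo] --> ln t.
  apply: cvg_close_l c1 => e e0.
  have [J [_ HJ]] := survp_ln_sym e0.
  have r1 := jo J; have r2 := ko J.
  by near=> n; apply: HJ; near: n.
have c3 : expR (- al^-1 * (al * (ln (q (j n)) - ln (q (k n))))) @[n --> \oo] --> expR (- al^-1 * ln t).
  apply: (cvg_comp _ _ (_ : - al^-1 * (al * (ln (q (j n)) - ln (q (k n)))) @[n --> \oo] --> - al^-1 * ln t) (@continuous_expR _ _)).
  by apply: cvgM c2; exact: cvg_cst.
rewrite /powR gt_eqF//.
apply: (near_cvg _ c3); near=> n.
have /andP[qj _] := survp_gt0 (j n); have /andP[qk _] := survp_gt0 (k n).
rewrite mulrA mulNr mulVf ?gt_eqF// mulN1r opprB -ln_div ?posrE//.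
by rewrite lnK// posrE divr_gt0.
Unshelve. all: end_near. Qed.

(** The ratio of survival probabilities determines the ratio of generations. The relative error in
    [survp_ln_sym] is now measured against the unknown logarithm, hence the use of [cvg_close_r]. *)
Lemma survp_ratio_inv (i j : nat -> nat) (lam : R) : 0 < lam ->
  (forall J, \forall n \near \oo, (J <= j n)%N) ->
  (forall J, \forall n \near \oo, (J <= i n)%N) ->
  q (i n) / q (j n) @[n --> \oo] --> lam ->
  (i n)%:R / (j n)%:R @[n --> \oo] --> lam `^ (- al).
Proof.
move=> l0 jo io qq; have a0 := alpha0.
have c1 : al * (ln (q (j n)) - ln (q (i n))) @[n --> \oo] --> - al * ln lam.
  have c0 : ln (q (i n) / q (j n)) @[n --> \oo] --> ln lam by apply: (cvg_comp _ _ qq); exact: continuous_ln.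
  have : - al * ln (q (i n) / q (j n)) @[n --> \oo] --> - al * ln lam by apply: cvgM c0; exact: cvg_cst.
  apply: near_cvg; near=> n.
  have /andP[qj _] := survp_gt0 (j n); have /andP[qk _] := survp_gt0 (i n).
  by rewrite ln_div ?posrE//; ring.
have c2 : ln (i n)%:R - ln (j n)%:R @[n --> \oo] --> - al * ln lam.
  apply: cvg_close_r c1 => e e0.
  have [J [_ HJ]] := survp_ln_sym e0.
  have r1 := jo J; have r2 := io J.
  by near=> n; apply: HJ; near: n.
rewrite /powR gt_eqF//.
have c3 : expR (ln (i n)%:R - ln (j n)%:R) @[n --> \oo] --> expR (- al * ln lam).
  exact: (cvg_comp _ _ c2 (@continuous_expR _ _)).
apply: (near_cvg _ c3).
have r1 := infty_near jo; have r2 := infty_near io.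
near=> n.
have j0 : (0 < j n)%N by near: n.
have i0 : (0 < i n)%N by near: n.
by rewrite -ln_div ?posrE ?ltr0n// lnK// posrE divr_gt0// ltr0n.
Unshelve. all: end_near. Qed.

Lemma next_le x y : 0 <= x -> x <= y -> y <= 1 -> phi x <= phi y.
Proof. exact: (dec_next_le dd). Qed.

Lemma iter_next_bounds n x : 0 < x <= 1 -> 0 < iter n phi x <= x.
Proof.
move=> /andP[x0 x1]; elim: n => [|n /andP[i0 i1]]; first by rewrite /= x0 lexx.
have ii : 0 < iter n phi x <= 1 by rewrite i0 (le_trans i1).
have /andP[p0 _] := next_gt0 ii.
by rewrite iterS p0 (le_trans (ltW (next_lt ii))).
Qed.

Lemma iter_next_le n x y : 0 < x -> x <= y -> y <= 1 -> iter n phi x <= iter n phi y.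
Proof.
move=> x0 xy y1; elim: n => [//|n IH]; rewrite !iterS next_le//.
  by have /andP[/ltW] := @iter_next_bounds n x (introT andP (conj x0 (le_trans xy y1))).
have /andP[_ h] := @iter_next_bounds n y (introT andP (conj (lt_le_trans x0 xy) y1)).
exact: le_trans h y1.
Qed.

(** Every step loses at most x u(x), because the iterates stay below x and the rate increases. *)
Lemma iter_next_ge n x : 0 < x <= 1 -> x * (1 - n%:R * u x) <= iter n phi x.
Proof.
move=> xx; have /andP[x0 x1] := xx.
elim: n => [|n IH]; first by rewrite mul0r subr0 mulr1.
have /andP[i0 i1] := iter_next_bounds n xx.
rewrite iterS /surv_next decE//.
have := rate_le i0 i1 x1; have := rate_gt0 xx.
set U := u x in IH *; set y := iter n phi x in IH i0 i1 * => U0 yU.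
have : y * u y <= x * U.
  apply: ler_pM => //; rewrite ?(ltW i0)// ltW// rate_gt0// i0.
  by rewrite (le_trans i1).
by rewrite -natr1; nra.
Qed.

Lemma survp_add m n : q (m + n) = iter m phi (q n).
Proof. by rewrite /survp iterD. Qed.

(** Locates x on the orbit of 1, so that iterating from x amounts, up to one step, to continuing
    that orbit. *)
Lemma survp_lt x : 0 < x <= 1 -> exists m, [/\ (0 < m)%N, q m < x & x <= q m.-1].
Proof.
move=> /andP[x0 x1].
have ex : exists m, q m < x.
  have : \forall n \near \oo, q n < x by exact: cvgr_lt survp_cvg0 _ x0.
  by move=> [m _ Hm]; exists m; exact: (Hm m (leqnn m)).
have [m qm Hm] := ex_minnP ex; exists m.
have m0 : (0 < m)%N by rewrite lt0n; apply/eqP => m0; move: qm; rewrite m0 /survp/= ltNge x1.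
split => //; rewrite leNgt; apply/negP => /Hm.
by rewrite -ltnS prednK// ltnn.
Qed.

(** The Laplace exponent in [csbp_kernel], seen as a flow in [t]; it is the scaling limit of the
    iterates of [surv_next]. *)
Definition csbp_exponent a (t lam : R) := (t + lam `^ (- a)) `^ (- a^-1).

(** Squeezing x_n between q_m and q_(m-1) turns k iterations into q_(k+m) and q_(k+m-1). Here m/j
    tends to lam^(-al), so the ratio of generations tends to t + lam^(-al), and regular variation of
    q yields the exponent. This is where the exponent of the limit process arises from the tree. *)
Lemma iter_next_scaling (x : nat -> R) (k j : nat -> nat) (t lam : R) :
  0 < lam -> 0 <= t -> (forall J, \forall n \near \oo, (J <= j n)%N) ->
  (forall n, 0 < x n <= 1) -> x n / q (j n) @[n --> \oo] --> lam ->
  (k n)%:R / (j n)%:R @[n --> \oo] --> t ->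
  iter (k n) phi (x n) / q (j n) @[n --> \oo] --> csbp_exponent al t lam.
Proof.
move=> l0 t0 jo xx xl kt; have a0 := alpha0.
pose m n := projT1 (cid (survp_lt (xx n))).
have Hm n : [/\ (0 < m n)%N, q (m n) < x n & x n <= q (m n).-1] := projT2 (cid (survp_lt (xx n))).
have qp n : 0 < q n by have /andP[] := survp_gt0 n.
have qjo : q (j n) @[n --> \oo] --> 0.
  apply: (cvg_comp _ _ _ survp_cvg0) => A [J _ HJ].
  by have := jo J; apply: filterS => n Jn; exact: HJ.
have xo : x n @[n --> \oo] --> 0.
  rewrite -(mulr0 lam).
  apply: (near_cvg _ (cvgM xl qjo)); near=> n.
  by rewrite /= divfK// gt_eqF.
have mo J : \forall n \near \oo, (J <= m n)%N.
  have : \forall n \near \oo, x n < q J by exact: cvgr_lt xo _ (qp J).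
  apply: filterS => n xq; rewrite leqNgt; apply/negP => mJ.
  have [_ qm _] := Hm n.
  by have := survp_decr (ltnW mJ); rewrite leNgt (lt_trans qm xq).
have m1o J : \forall n \near \oo, (J <= (m n).-1)%N by have := mo J.+1; apply: filterS => n; case: (m n).
have um : u (q (m n).-1) @[n --> \oo] --> 0.
  apply: (cvg_comp _ _ _ (cvg_comp _ _ survp_at_right rate_cvg0)) => A [J _ HJ].
  by have := m1o J; apply: filterS => n Jn; exact: HJ.
have qmE n : q (m n) = q (m n).-1 * (1 - u (q (m n).-1)).
  have [m0 _ _] := Hm n.
  by rewrite -{1}(prednK m0) survpS /surv_next decE ?qp// mulrBr mulr1.
have ql : q (m n) / q (j n) @[n --> \oo] --> lam.
  apply: (@squeeze_cvgr _ _ _ _ (fun n => x n / q (j n) * (1 - u (q (m n).-1))) (fun n => x n / q (j n))) => //.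
    near=> n; have [m0 h1 h2] := Hm n; apply/andP; split.
      rewrite mulrAC ler_pM2r ?invr_gt0// qmE ler_wpM2r// subr_ge0 ltW// rate_lt1//.
      exact: survp_gt0.
    by rewrite ler_pM2r ?invr_gt0// ltW.
  rewrite -[X in _ --> X]mulr1 -[X in _ * X]subr0.
  by apply: cvgM xl _; apply: cvgB um; exact: cvg_cst.
have ml := survp_ratio_inv l0 jo mo ql.
have jV : (j n)%:R^-1 @[n --> \oo] --> (0 : R).
  exact: (@cvg_infty_comp _ _ (fun n => n%:R^-1 : R) _ jo (@cvg_inv_natr R)).
have lp : 0 < t + lam `^ (- al) by rewrite ltr_wpDl// powR_gt0.
have kml : (k n + m n)%:R / (j n)%:R @[n --> \oo] --> t + lam `^ (- al).
  apply: (near_cvg _ (cvgD kt ml)); near=> n.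
  by rewrite /= natrD mulrDl.
have kml1 : (k n + (m n).-1)%:R / (j n)%:R @[n --> \oo] --> t + lam `^ (- al).
  rewrite -[X in _ --> X]subr0.
  apply: (near_cvg _ (cvgB kml jV)); near=> n.
  have [m0 _ _] := Hm n.
  rewrite -[LHS]/((k n + m n)%:R / (j n)%:R - (j n)%:R^-1).
  by rewrite -{1}(prednK m0) addnS -natr1 mulrDl mul1r addrK.
apply: (@squeeze_cvgr _ _ _ _ (fun n => q (k n + m n) / q (j n)) (fun n => q (k n + (m n).-1) / q (j n))).
- near=> n; have [m0 h1 h2] := Hm n; have /andP[_ x1] := xx n.
  rewrite !ler_pM2r ?invr_gt0//; apply/andP; split.
    by rewrite survp_add; apply: iter_next_le => //; exact: ltW.
  rewrite survp_add; apply: iter_next_le => //; first by have /andP[] := xx n.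
  by have /andP[] := survp_gt0 (m n).-1.
- exact: survp_ratio lp jo kml.
- exact: survp_ratio lp jo kml1.
Unshelve. all: end_near. Qed.

Lemma rate_survp_scaled (kap : R) : 0 < kap -> kap <= 1 ->
  n%:R * u (kap * q n) @[n --> \oo] --> kap `^ al / al.
Proof.
move=> k0 k1.
have c1 : n%:R * u (q n) * (u (kap * q n) / u (q n)) @[n --> \oo] --> al^-1 * kap `^ al.
  apply: cvgM rate_survp _.
  exact: (cvg_comp _ _ survp_at_right (rate_rv k0)).
rewrite mulrC; apply: (near_cvg _ c1); near=> n.
by field; rewrite gt_eqF// rate_gt0// survp_gt0.
Unshelve. all: end_near. Qed.

(** Uniformity in [n] is the point. Large [n] follow from the limit kap^al / al, which is small with
    kap; the finitely many others follow from the rate tending to 0. *)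
Lemma rate_survp_small (e : R) : 0 < e -> exists kap : R, 0 < kap <= 1 /\
  forall n, n%:R * u (kap * q n) <= e.
Proof.
move=> e0; have a0 := alpha0.
have [k1 [k10 k11 Hk1]] : exists k1 : R, [/\ 0 < k1, k1 <= 1 & k1 `^ al / al < e].
  have : kap `^ al / al @[kap --> 0^'+] --> 0.
    rewrite -[X in _ --> X](mul0r al^-1); apply: cvgM; last exact: cvg_cst.
    exact: powR_cvg0.
  move=> /cvgr_lt/(_ _ e0) H.
  have [k1 [H1 H2 H3]] : exists k, [/\ 0 < k, k <= 1 & k `^ al / al < e].
    near (0:R)^'+ => k; exists k; split; near: k => //.
    - exact: nbhs_right_gt.
    - exact: nbhs_right_le.
  by exists k1.
have : \forall n \near \oo, n%:R * u (k1 * q n) < e.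
  exact: cvgr_lt (rate_survp_scaled k10 k11) _ Hk1.
move=> [J _ HJ].
have [k2 [k20 k21 Hk2]] : exists k2 : R, [/\ 0 < k2, k2 <= 1 & J%:R * u k2 < e].
  have : J%:R * u x @[x --> 0^'+] --> 0 by rewrite -[X in _ --> X](mulr0 J%:R); apply: cvgM rate_cvg0; exact: cvg_cst.
  move=> /cvgr_lt/(_ _ e0) H.
  near (0:R)^'+ => k; exists k; split; near: k => //.
  - exact: nbhs_right_gt.
  - exact: nbhs_right_le.
pose k := Num.min k1 k2.
have k0 : 0 < k by rewrite lt_min k10.
have kk1 : k <= k1 by rewrite ge_min lexx.
have kk2 : k <= k2 by rewrite ge_min lexx orbT.
exists k; rewrite k0 (le_trans kk1)//; split=> // n.
have /andP[q0 q1] := survp_gt0 n.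
have [Jn|nJ] := leqP J n.
  apply: le_trans (ltW (HJ n Jn)); rewrite ler_wpM2l// rate_le ?mulr_gt0//.
    by rewrite ler_wpM2r// ltW.
  by rewrite mulr_ile1// ltW.
apply: le_trans (ltW Hk2); apply: ler_pM => //.
- by rewrite ltW// rate_gt0// mulr_gt0//= mulr_ile1// ?(ltW k0) ?(ltW q0)// (le_trans kk1).
- by rewrite ler_nat ltnW.
- rewrite rate_le ?mulr_gt0//.
  by rewrite (le_trans _ kk2)// ler_piMr// ltW.
Unshelve. all: end_near. Qed.

End Decrement.

(** * Generating functions of the offspring law *)

Section Offspring.
Variable R : realType.
Implicit Types (p q : nat -> R) (h : nat -> R) (s : R).

Lemma nneseries_conv p q h : (forall k, 0 <= p k) -> (forall k, 0 <= q k) ->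
  (forall k, 0 <= h k) ->
  (\sum_(k <oo) (h k * Defs.conv p q k)%:E =
   \sum_(i <oo) \sum_(j <oo) (p i * q j * h (i + j)%N)%:E)%E.
Proof.
move=> p0 q0 h0.
pose a i k : \bar R := if (i <= k)%N then (p i * q (k - i)%N * h k)%:E else 0%E.
have a0 i k : (0 <= a i k)%E by rewrite /a; case: ifP => // _; rewrite lee_fin !mulr_ge0.
transitivity (\sum_(k <oo) \sum_(i <oo) a i k)%E.
  apply: eq_eseriesr => k _.
  rewrite (nneseries_split 0 k.+1)// add0n [X in (_ + X)%E]eseries0 ?adde0; last first.
    by move=> i ki _; rewrite /a leqNgt ki.
  rewrite big_mkord /Defs.conv mulr_sumr -sumEFin; apply: eq_bigr => i _.
  by rewrite /a -ltnS ltn_ord mulrC.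
rewrite nneseries_interchange//; apply: eq_eseriesr => i _.
rewrite (nneseries_split 0 i)// add0n big1_seq ?add0e; last first.
  by move=> k; rewrite mem_index_iota /a => /andP[_ /andP[_ ki]]; rewrite leqNgt ki.
rewrite -nneseries_addn//; apply: eq_eseriesr => k _.
by rewrite /a leq_addl addnK addnC.
Qed.

Variable p : nat -> R.
Hypothesis p_ge0 : forall k, 0 <= p k.
Hypothesis p_sum : (\sum_(k <oo) (p k)%:E = 1)%E.
Hypothesis p_mean : (\sum_(k <oo) (k%:R * p k)%:E = 1)%E.

Definition pgf p s : R := fine (gen_fun p s).

Lemma convpow_ge0 n k : 0 <= convpow p n k.
Proof.
elim: n k => [|n IH] k /=; first by [].
by rewrite /Defs.conv; apply: sumr_ge0 => i _; rewrite mulr_ge0.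
Qed.

Lemma gen_funE s : 0 <= s <= 1 -> gen_fun p s = (pgf p s)%:E.
Proof.
move=> /andP[s0 s1]; rewrite /pgf fineK// ge0_fin_numE; last first.
  by apply: nneseries_ge0 => k _ _; rewrite lee_fin mulr_ge0// exprn_ge0.
apply: (@le_lt_trans _ _ 1%E); last exact: ltry.
rewrite -p_sum; apply: lee_nneseries => k _; first by rewrite lee_fin mulr_ge0// exprn_ge0.
by rewrite lee_fin ler_piMr// exprn_ile1.
Qed.

Lemma pgf1 : pgf p 1 = 1.
Proof.
rewrite /pgf /gen_fun (_ : (\sum_(k <oo) _)%E = 1%E)//.
by rewrite -p_sum; apply: eq_eseriesr => k _; rewrite expr1n mulr1.
Qed.

(** An inequality between combinations of powers, valid for every exponent k, passes to the
    generating function because the weights p_k are nonnegative. Two terms on each side suffice for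
    monotonicity, chord bounds and convexity. *)
Lemma pgf_le (c1 c2 c3 c4 s1 s2 s3 s4 : R) :
  0 <= c1 -> 0 <= c2 -> 0 <= c3 -> 0 <= c4 ->
  0 <= s1 <= 1 -> 0 <= s2 <= 1 -> 0 <= s3 <= 1 -> 0 <= s4 <= 1 ->
  (forall k, c1 * s1 ^+ k + c2 * s2 ^+ k <= c3 * s3 ^+ k + c4 * s4 ^+ k) ->
  c1 * pgf p s1 + c2 * pgf p s2 <= c3 * pgf p s3 + c4 * pgf p s4.
Proof.
move=> c10 c20 c30 c40 h1 h2 h3 h4 H.
have E c s : 0 <= c -> 0 <= s <= 1 -> ((c * pgf p s)%:E = \sum_(k <oo) (c * (p k * s ^+ k))%:E)%E.
  move=> c0 s01; have /andP[s0 _] := s01.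
  rewrite EFinM -gen_funE// /gen_fun -nneseriesZl//.
  by move=> k _; rewrite lee_fin mulr_ge0// exprn_ge0.
have N c s k : 0 <= c -> 0 <= s <= 1 -> (0 <= (c * (p k * s ^+ k))%:E)%E by move=> c0 /andP[s0 _]; rewrite lee_fin !mulr_ge0// exprn_ge0.
rewrite -lee_fin !EFinD !E// -!nneseriesD//; try by move=> *; exact: N.
apply: lee_nneseries => [k _|k _]; first by rewrite adde_ge0// N.
rewrite -!EFinD lee_fin !(mulrCA _ (p k)) -!mulrDr.
by rewrite ler_wpM2l.
Qed.

Lemma pgf_homo s t : 0 <= s -> s <= t -> t <= 1 -> pgf p s <= pgf p t.
Proof.
move=> s0 st t1; have := @pgf_le 1 0 1 0 s s t s ler01 (lexx 0) ler01 (lexx 0).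
rewrite !mul0r !mul1r !addr0; apply => //; rewrite ?s0 ?(le_trans st t1) ?(le_trans s0 st)//.
by move=> k; rewrite !mul0r !mul1r !addr0 lerXn2r// nnegrE// (le_trans s0).
Qed.

Lemma pgf_ge0 s : 0 <= s -> 0 <= pgf p s.
Proof.
move=> s0; apply: fine_ge0; apply: nneseries_ge0 => k _ _.
by rewrite lee_fin mulr_ge0// exprn_ge0.
Qed.

Lemma pgf_le1 s : 0 <= s <= 1 -> pgf p s <= 1.
Proof. by move=> /andP[s0 s1]; rewrite -pgf1 pgf_homo. Qed.

Lemma pgf_itv s : 0 <= s <= 1 -> 0 <= pgf p s <= 1.
Proof. by move=> s01; rewrite pgf_le1// pgf_ge0//; case/andP: s01. Qed.

(** Otherwise all the mass sits at 0 and the mean would be 0 instead of 1. *)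
Lemma pgf0_lt1 : pgf p 0 < 1.
Proof.
have E : pgf p 0 = p 0%N.
  rewrite /pgf /gen_fun nneseries_recl//; last by move=> k _; rewrite lee_fin mulr_ge0// exprn_ge0.
  rewrite eseries0 ?adde0 ?expr0 ?mulr1// => i i1 _.
  by rewrite expr0n; case: i i1 => // i _; rewrite mulr0.
rewrite lt_neqAle pgf_le1 ?lexx ?ler01// andbT E; apply/eqP => p01.
have pk k : (0 < k)%N -> p k = 0.
  move=> k0; apply/eqP; rewrite eq_le p_ge0 andbT.
  have := @nneseries_lim_ge _ (fun k => (p k)%:E) xpredT 0%N k.+1.
  rewrite p_sum sumEFin lee_fin => /(_ (fun i _ _ => p_ge0 i)).
  case: k k0 => // k _; rewrite big_nat_recr//= big_nat_recl//= p01.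
  have : 0 <= \sum_(0 <= i < k) p i.+1 by apply: sumr_ge0.
  by lra.
have := p_mean; rewrite eseries0; first by move=> /eqP; rewrite eq_sym onee_eq0.
by move=> [|i] _ _; rewrite ?mul0r// pk// mulr0.
Qed.

(** From s^k <= (1 - s) 0^k + s for every k, hence f(s) <= (1 - s) f(0) + s. *)
Lemma pgf_lt1 s : 0 <= s -> s < 1 -> pgf p s < 1.
Proof.
move=> s0 s1; have := @pgf_le 1 0 (1 - s) s s s 0 1 ler01 (lexx 0) _ s0.
rewrite subr_ge0 (ltW s1) mul1r mul0r addr0 pgf1 mulr1 s0 !lexx !ler01/= => H.
apply: le_lt_trans (H isT isT isT isT isT _) _.
  move=> k; rewrite mul1r mul0r addr0 expr1n mulr1 expr0n.
  case: k => [|k]/=; first by rewrite expr0 mulr1 subrK.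
  by rewrite mulr0 add0r exprS ler_piMr// exprn_ile1// ltW.
have : (1 - s) * pgf p 0 < (1 - s) * 1 by rewrite ltr_pM2l ?subr_gt0// pgf0_lt1.
by lra.
Qed.

(** A difference of k-th powers factors into the difference times a sum of products of the bases;
    the bases 1 - c and 1 - e are at most 1 - a and 1 - b, so the comparison is termwise. *)
Lemma pgf_chord a b c e : 0 <= a -> a <= c -> b <= e -> a < b -> c < e -> e <= 1 ->
  (pgf p (1 - c) - pgf p (1 - e)) * (b - a) <= (pgf p (1 - a) - pgf p (1 - b)) * (e - c).
Proof.
move=> a0 ac be ab ce e1.
suff : (b - a) * pgf p (1 - c) + (e - c) * pgf p (1 - b) <=
       (e - c) * pgf p (1 - a) + (b - a) * pgf p (1 - e) by lra.
have [ba0 ec0] : 0 <= b - a /\ 0 <= e - c by lra.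
apply: pgf_le => //; try (lra).
move=> k; suff : ((1 - c) ^+ k - (1 - e) ^+ k) * (b - a) <= ((1 - a) ^+ k - (1 - b) ^+ k) * (e - c) by lra.
rewrite !subrXX.
have -> : 1 - c - (1 - e) = e - c by ring.
have -> : 1 - a - (1 - b) = b - a by ring.
rewrite [leLHS]mulrAC [leRHS]mulrAC (mulrC (b - a)) -!mulrA.
rewrite ler_wpM2l// ler_wpM2l//.
apply: ler_sum => i _; apply: ler_pM; rewrite ?exprn_ge0//; try lra.
- by rewrite lerXn2r ?nnegrE; lra.
- by rewrite lerXn2r ?nnegrE; lra.
Qed.

Definition loss p x := pgf p (1 - x) - (1 - x).

Lemma next_loss_pgf x : surv_next (loss p) x = 1 - pgf p (1 - x).
Proof. by rewrite /surv_next /loss; ring. Qed.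

Lemma iter_next_pgf n x : iter n (surv_next (loss p)) x = 1 - iter n (pgf p) (1 - x).
Proof.
elim: n => [|n IH]; first by rewrite /= subKr.
by rewrite !iterS IH next_loss_pgf subKr.
Qed.

Lemma iter_pgf_itv n s : 0 <= s <= 1 -> 0 <= iter n (pgf p) s <= 1.
Proof. by move=> s01; elim: n => // n IH; rewrite iterS pgf_itv. Qed.

Lemma convpow_gen n s : 0 <= s <= 1 ->
  (\sum_(k <oo) (s ^+ k * convpow p n k)%:E = (pgf p s ^+ n)%:E)%E.
Proof.
move=> s01; have /andP[s0 s1] := s01; elim: n => [|n IH].
  rewrite nneseries_recl//=; last by move=> k _; rewrite lee_fin mulr_ge0// exprn_ge0.
  rewrite eseries0 ?adde0 ?expr0 ?mulr1// => i i1 _.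
  by case: i i1 => // i _; rewrite mulr0.
rewrite /= nneseries_conv//; [|exact: convpow_ge0|by move=> k; rewrite exprn_ge0].
have -> : (\sum_(i <oo) \sum_(j <oo) (p i * convpow p n j * s ^+ (i + j))%:E =
          \sum_(i <oo) (pgf p s ^+ n)%:E * (p i * s ^+ i)%:E)%E.
  apply: eq_eseriesr => i _; rewrite -IH muleC -nneseriesZl.
    by apply: eq_eseriesr => j _; rewrite -EFinM exprD; congr (_%:E); ring.
  by move=> j _; rewrite lee_fin mulr_ge0// ?exprn_ge0// convpow_ge0.
rewrite nneseriesZl; last by move=> j _; rewrite lee_fin mulr_ge0// exprn_ge0.
by rewrite -/(gen_fun p s) gen_funE// -EFinM exprSr.
Qed.

Lemma convpow_sum n : (\sum_(k <oo) (convpow p n k)%:E = 1)%E.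
Proof.
have := @convpow_gen n 1; rewrite ler01 lexx pgf1 expr1n => /(_ isT) <-.
by apply: eq_eseriesr => k _; rewrite expr1n mul1r.
Qed.

Lemma convpow_mean n : (\sum_(k <oo) (k%:R * convpow p n k)%:E = n%:R%:E)%E.
Proof.
elim: n => [|n IH]; first by rewrite eseries0// => -[|i] _ _; rewrite ?mul0r//= mulr0.
rewrite /= nneseries_conv//; last exact: convpow_ge0.
have -> : (\sum_(i <oo) \sum_(j <oo) (p i * convpow p n j * (i + j)%:R)%:E =
          \sum_(i <oo) ((i%:R * p i)%:E + n%:R%:E * (p i)%:E))%E.
  apply: eq_eseriesr => i _.
  rewrite [X in (_ + X)%E]muleC -IH -nneseriesZl; last first.
    by move=> j _; rewrite lee_fin mulr_ge0// convpow_ge0.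
  rewrite -[X in (X + _)%E]mule1 -(convpow_sum n) -nneseriesZl; last first.
    by move=> j _; rewrite lee_fin convpow_ge0.
  rewrite -nneseriesD.
  - by apply: eq_eseriesr => j _; rewrite -!EFinM -EFinD natrD; congr (_%:E); ring.
  - by move=> j _ _; rewrite -EFinM lee_fin !mulr_ge0// convpow_ge0.
  - by move=> j _ _; rewrite -EFinM lee_fin !mulr_ge0// convpow_ge0.
rewrite nneseriesD; [|by move=> i _ _; rewrite lee_fin mulr_ge0|by move=> i _ _; rewrite -EFinM lee_fin mulr_ge0].
rewrite nneseriesZl; last by move=> i _; rewrite lee_fin.
by rewrite p_mean p_sum mule1 -EFinD -natr1 addrC.
Qed.

End Offspring.

(** Positivity of the loss is known only near 0, where L > 0; convexity together with value 0 at 0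
    carries it to all of (0,1]. The bound by x itself says f(1 - x) < 1... in the form f(1 - x) - (1
    - x) < x. *)
Lemma decrement_loss (R : realType) (al : R) (p : nat -> R) (L : R -> R) :
  0 < al <= 1 -> offspring_hyp al p L -> decrement al (loss p).
Proof.
move=> aa [p0 p1 pm [[e e0 Le] Lv] pL].
have dE x : 0 <= x <= 1 -> loss p x = x `^ (1 + al) * L x.
  move=> /andP[x0 x1]; rewrite /loss.
  have s01 : 0 <= 1 - x <= 1 by lra.
  have := pL _ s01; rewrite gen_funE// => -[->].
  by rewrite subKr; ring.
have chord a b c h : 0 <= a -> a <= c -> b <= h -> a < b -> c < h -> h <= 1 ->
    (loss p b - loss p a) * (h - c) <= (loss p h - loss p c) * (b - a).
  move=> a0' ac be ab ce e1.
  by have := pgf_chord p0 p1 a0' ac be ab ce e1; rewrite /loss; lra.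
have l0 : loss p 0 = 0 by rewrite /loss subr0 pgf1// subrr.
split => //.
- move=> x /andP[x0 x1].
  apply/andP; split; last first.
    have : pgf p (1 - x) < 1 by apply: pgf_lt1 => //; lra.
    by rewrite /loss; lra.
  (* A point below x at which L is known to be positive. *)
  pose y := Num.min (e / 2) (x / 2).
  have y0 : 0 < y by rewrite lt_min !divr_gt0.
  have ye : y < e by apply: le_lt_trans (_ : e / 2 < e); [rewrite /y ge_min lexx|rewrite ltr_pdivrMr// ltr_pMr// ltr1n].
  have yx : y < x by apply: le_lt_trans (_ : x / 2 < x); [rewrite /y ge_min lexx orbT|rewrite ltr_pdivrMr// ltr_pMr// ltr1n].
  have dy : 0 < loss p y.
    rewrite dE; last by rewrite (ltW y0)/= (le_trans (ltW yx)).
    by rewrite mulr_gt0 ?powR_gt0// Le// y0.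
  have := chord 0 y 0 x (lexx 0) (lexx 0) (ltW yx) y0 x0 x1.
  rewrite l0 !subr0 => h.
  have : 0 < loss p x * y by apply: lt_le_trans h; rewrite mulr_gt0.
  by rewrite pmulr_lgt0.
- move=> x y x0 xy y1; rewrite -!/(surv_next (loss p) _) !next_loss_pgf lerD2l lerN2.
  by apply: pgf_homo => //; lra.
- move=> lam lam0.
  have -> : lam `^ (1 + al) = lam `^ (1 + al) * 1 by rewrite mulr1.
  have c1 : lam `^ (1 + al) * (L (lam * x) / L x) @[x --> 0^'+] --> lam `^ (1 + al) * 1 by apply: cvgM (Lv _ lam0); exact: cvg_cst.
  apply: (near_cvg _ c1); near=> x.
  have x0 : 0 < x by near: x; exact: nbhs_right_gt.
  have x1 : x <= 1 by near: x; exact: nbhs_right_le.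
  have xe : x < e by near: x; exact: nbhs_right_lt.
  have xl : x <= lam^-1 by near: x; apply: nbhs_right_le; rewrite invr_gt0.
  have lx1 : lam * x <= 1 by rewrite mulrC -ler_pdivlMr// mul1r.
  rewrite !dE ?(ltW x0) ?mulr_ge0 ?(ltW x0) ?(ltW lam0)// powRM ?(ltW x0) ?(ltW lam0)//.
  have Lx : L x != 0 by rewrite gt_eqF// Le// x0.
  by field; rewrite Lx gt_eqF// powR_gt0.
Unshelve. all: end_near. Qed.

(** Takes the place of a filtration: the states are integers, so any function of finitely many
    generations is measurable. *)
Definition adapt (n : nat) (U : Type) (g : (nat -> nat) -> U) :=
  forall z z', (forall k, (k <= n)%N -> z k = z' k) -> g z = g z'.

(** * Positive parts and elementary inequalities *)

Section Bernoulli.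
Variable R : realType.

Definition pos (x : R) : R := Num.max x 0.

Lemma pos_ge0 x : 0 <= pos x. Proof. by rewrite /pos le_max lexx orbT. Qed.

Lemma pos_ge x : x <= pos x. Proof. by rewrite /pos le_max lexx. Qed.

Lemma pos_le x y : x <= y -> 0 <= y -> pos x <= y.
Proof. by move=> xy y0; rewrite /pos ge_max xy. Qed.

Lemma bernoulli_le (x : R) n : 0 <= x <= 1 -> 1 - n%:R * x <= (1 - x) ^+ n.
Proof.
move=> /andP[x0 x1]; elim: n => [|n IH]; first by rewrite mul0r subr0 expr0.
have := IH; rewrite exprS -natr1; set a := n%:R; set b := (1 - x) ^+ n => h.
have : (1 - x) * (1 - a * x) <= (1 - x) * b by rewrite ler_wpM2l// subr_ge0.
have : 0 <= a * x * x by rewrite !mulr_ge0.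
by lra.
Qed.

(** From mu t <= exp(mu t) with t = 1 - w: an exponential majorant whose mean a generating function
    can evaluate. *)
Lemma pos_le_exp (mu w : R) : 0 < mu -> pos (1 - w) <= expR (mu * (1 - w)) / mu.
Proof.
move=> m0; apply: pos_le; last by rewrite divr_ge0 ?expR_ge0// ltW.
rewrite ler_pdivlMr// mulrC; apply: le_trans (expR_ge1Dx _).
by rewrite lerDr.
Qed.

End Bernoulli.

(** * Bernstein approximation in one and several variables *)

Section Bernstein.
Variable R : realType.
Implicit Types (v : R) (phi : nat -> R).

(* The binomial(N, v) mean of phi, by conditioning on the first trial. *)
Fixpoint bern v N phi : R := match N with
  | 0%N => phi 0%N
  | N'.+1 => (1 - v) * bern v N' phi + v * bern v N' (fun r => phi r.+1)
  end.

Lemma bern_le v N phi psi : 0 <= v <= 1 -> (forall r, (r <= N)%N -> phi r <= psi r) ->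
  bern v N phi <= bern v N psi.
Proof.
move=> /andP[v0 v1]; elim: N phi psi => [|N IH] phi psi pp /=; first exact: pp.
apply: lerD; apply: ler_wpM2l; rewrite ?subr_ge0//; apply: IH => r rN; apply: pp => //.
exact: leqW.
Qed.

Lemma bern_lin v N a b phi psi :
  bern v N (fun r => a * phi r + b * psi r) = a * bern v N phi + b * bern v N psi.
Proof. by elim: N phi psi => [|N IH] phi psi //=; rewrite !IH; ring. Qed.

Lemma bern_cst v N c : bern v N (fun=> c) = c.
Proof. by elim: N => [|N IH] //=; rewrite IH; ring. Qed.

(** The shift [a] makes the induction close: conditioning on the first trial replaces it by a - v or
    by a + 1 - v. *)
Lemma bern_var v N a :
  bern v N (fun r => (a + r%:R - N%:R * v) ^+ 2) = a ^+ 2 + N%:R * (v * (1 - v)).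
Proof.
elim: N a => [|N IH] a /=; first by rewrite !mul0r !addr0 subr0.
have := IH (a - v); have := IH (a + 1 - v).
rewrite (_ : (fun r => _) = (fun r : nat => (a + r.+1%:R - N.+1%:R * v) ^+ 2)); last first.
  by apply/funext => r; congr (_ ^+ 2); rewrite -!natr1; ring.
move=> ->.
rewrite (_ : (fun r => _) = (fun r : nat => (a + r%:R - N.+1%:R * v) ^+ 2)); last first.
  by apply/funext => r; congr (_ ^+ 2); rewrite -!natr1; ring.
by move=> ->; rewrite -!natr1; ring.
Qed.

(** [N] depends on the Lipschitz constant and on the error only, so one [N] serves a whole family of
    functions in [weierstrass_cube]. Chebyshev's argument enters through |t| <= de + t^2/de and the
    variance. *)
Lemma bern_approx (Lip e : R) : 0 <= Lip -> 0 < e -> exists N, (0 < N)%N /\ forall f : R -> R,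
  (forall x y, 0 <= x <= 1 -> 0 <= y <= 1 -> `|f x - f y| <= Lip * `|x - y|) ->
  forall v, 0 <= v <= 1 -> `|bern v N (fun r => f (r%:R / N%:R)) - f v| <= e.
Proof.
move=> L0 e0.
pose de := e / (2 * (Lip + 1)).
have L1 : 0 < Lip + 1 by lra.
have de0 : 0 < de by rewrite divr_gt0// mulr_gt0.
pose N := (Num.bound (de ^- 2)).+1.
have NB : de ^- 2 < N%:R.
  apply: (@lt_le_trans _ _ (Num.bound (de ^- 2))%:R); last by rewrite ler_nat.
  by rewrite archi_boundP// invr_ge0 exprn_ge0// ltW.
exists N; split=> // f fL v v01; have /andP[v0 v1] := v01.
have B2 : bern v N (fun r => (r%:R / N%:R - v) ^+ 2) <= de ^+ 2.
  have -> : (fun r : nat => (r%:R / N%:R - v) ^+ 2) =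
      (fun r : nat => (N%:R ^- 2) * (0 + r%:R - N%:R * v) ^+ 2 + 0 * 0) :> (nat -> R).
    by apply/funext => r; field; rewrite gt_eqF.
  rewrite (bern_lin v N (N%:R ^- 2) 0 _ (fun=> 0)) bern_var expr0n add0r mul0r addr0.
  have -> : N%:R ^- 2 * (N%:R * (v * (1 - v))) = v * (1 - v) / N%:R :> R by field; rewrite gt_eqF.
  rewrite ler_pdivrMr//.
  have : 1 <= de ^+ 2 * N%:R by rewrite -ler_pdivrMl ?exprn_gt0// mulr1 ltW.
  by nra.
have key r : (r <= N)%N -> `|f (r%:R / N%:R) - f v| <= Lip * de + Lip / de * (r%:R / N%:R - v) ^+ 2.
  move=> rN; apply: le_trans (fL _ _ _ v01) _.
    by rewrite divr_ge0//= ler_pdivrMr// mul1r ler_nat.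
  set t := r%:R / N%:R - v; rewrite -mulrA -mulrDr ler_wpM2l//.
  have E : de * (de + de^-1 * t ^+ 2) = de ^+ 2 + t ^+ 2 by field; rewrite gt_eqF.
  rewrite -(ler_pM2l de0) E.
  by rewrite -(real_normK (num_real t)); have := sqr_ge0 (de - `|t|); have := normr_ge0 t; nra.
have bd : Lip * de + Lip / de * de ^+ 2 <= e.
  have -> : Lip * de + Lip / de * de ^+ 2 = 2 * Lip * de by field; rewrite gt_eqF.
  by rewrite /de mulrA ler_pdivrMr ?mulr_gt0//; nra.
have up : bern v N (fun r => Lip * de + Lip / de * (r%:R / N%:R - v) ^+ 2) <= e.
  rewrite (bern_lin v N Lip (Lip / de) (fun=> de)) bern_cst; apply: le_trans bd.
  by rewrite lerD2l ler_wpM2l// divr_ge0// ltW.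
have split_fv (s : R) : bern v N (fun r => s * f (r%:R / N%:R) + (- s) * f v) =
    s * (bern v N (fun r => f (r%:R / N%:R)) - f v).
  by rewrite (bern_lin v N s (- s) _ (fun=> f v)) bern_cst; ring.
rewrite ler_norml; apply/andP; split.
- rewrite lerNl -mulN1r -split_fv; apply: le_trans up; apply: bern_le => // r rN.
  by apply: le_trans (key _ rN); rewrite -[leLHS]opprK -normrN; apply: le_trans (ler_norm _); lra.
- rewrite -[leLHS]mul1r -split_fv; apply: le_trans up; apply: bern_le => // r rN.
  by apply: le_trans (key _ rN); apply: le_trans (ler_norm _); lra.
Qed.

Fixpoint bernp N phi : {poly R} := match N with
  | 0%N => (phi 0%N)%:P
  | N'.+1 => (1 - 'X) * bernp N' phi + 'X * bernp N' (fun r => phi r.+1)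
  end.

Lemma horner_bernp N phi v : (bernp N phi).[v] = bern v N phi.
Proof. by elim: N phi => [|N IH] phi; rewrite /= ?hornerC// !hornerE !IH. Qed.

Lemma weierstrass (f : R -> R) (Lip e : R) : 0 <= Lip -> 0 < e ->
  (forall x y, 0 <= x <= 1 -> 0 <= y <= 1 -> `|f x - f y| <= Lip * `|x - y|) ->
  exists B : {poly R}, forall v, 0 <= v <= 1 -> `|B.[v] - f v| <= e.
Proof.
move=> L0 e0 fL; have [N [_ HN]] := bern_approx L0 e0.
by exists (bernp N (fun r => f (r%:R / N%:R))) => v v01; rewrite horner_bernp HN.
Qed.

Definition upd (x : nat -> R) k c : nat -> R := fun i => if i == k then c else x i.

Definition in_cube (x : nat -> R) := forall i, 0 <= x i <= 1.

(** Coordinates are eliminated one at a time: the last one is replaced by a Bernstein polynomial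
    whose coefficients depend on one coordinate less. The class is abstract because it will be the
    class of functionals along which convergence in law holds. *)
Lemma weierstrass_cube (C : ((nat -> R) -> R) -> Prop) :
  (forall n (a : nat -> nat), C (fun x => \prod_(i < n) x i ^+ a i)) ->
  (forall c f g, C f -> C g -> C (fun x => c * f x + g x)) ->
  (forall f, (forall e, 0 < e -> exists2 g, C g & forall x, in_cube x -> `|f x - g x| <= e) -> C f) ->
  forall n (Lip : R) f, 0 <= Lip ->
  (forall x y, (forall i, (i < n)%N -> x i = y i) -> f x = f y) ->
  (forall x k c, in_cube x -> 0 <= c <= 1 -> `|f (upd x k c) - f x| <= Lip * `|c - x k|) ->
  C f.
Proof.
move=> Cmon Clin Clim n Lip.
(* The monomial factor is carried through the induction because expanding a Bernstein polynomial in
   the last coordinate multiplies by powers of that coordinate. *)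
suff H (a : nat -> nat) m f : 0 <= Lip ->
    (forall x y, (forall i, (i < n)%N -> x i = y i) -> f x = f y) ->
    (forall x k c, in_cube x -> 0 <= c <= 1 -> `|f (upd x k c) - f x| <= Lip * `|c - x k|) ->
    C (fun x => f x * \prod_(i < m) x i ^+ a i).
  move=> f L0 fn fL; have := H (fun=> 0%N) 0%N f L0 fn fL.
  by under eq_fun do rewrite big_ord0 mulr1.
elim: n a m f => [|n IH] a m f L0 fn fL.
  have -> : (fun x => f x * \prod_(i < m) x i ^+ a i) =
     (fun x => f (fun=> 0) * (\prod_(i < m) x i ^+ a i) + 0 * (\prod_(i < m) x i ^+ a i) ).
    by apply/funext => x; rewrite mul0r addr0; congr (_ * _); apply: fn.
  apply: (Clin _ _ (fun x => 0 * (\prod_(i < m) x i ^+ a i))) => //.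
  have := Clin (-1) _ _ (Cmon m a) (Cmon m a).
  by congr C; apply/funext => x; rewrite mul0r mulN1r addNr.
apply: Clim => e e0; have [N [N0 HN]] := bern_approx L0 e0.
have N0' : 0 < N%:R :> R by rewrite ltr0n.
exists (fun x => bern (x n) N (fun r => f (upd x n (r%:R / N%:R))) * \prod_(i < m) x i ^+ a i).
  have K M (psi : nat -> (nat -> R) -> R) b : (forall r b, (r <= M)%N -> C (fun x => psi r x * x n ^+ b)) ->
      C (fun x => bern (x n) M (fun r => psi r x) * x n ^+ b).
    elim: M psi b => [|M IHM] psi b HC; first exact: HC.
    have c1 := IHM psi b (fun r b rM => HC r b (leqW rM)).
    have c2 := IHM psi b.+1 (fun r b rM => HC r b (leqW rM)).
    have c3 := IHM (fun r => psi r.+1) b.+1 (fun r b rM => HC r.+1 b rM).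
    have := Clin 1 _ _ c1 (Clin (-1) _ _ c2 c3).
    by congr C; apply/funext => x /=; rewrite exprS; ring.
  have := K N (fun r x => f (upd x n (r%:R / N%:R)) * \prod_(i < m) x i ^+ a i) 0%N.
  have E : (fun x => bern (x n) N (fun r => f (upd x n (r%:R / N%:R)) * \prod_(i < m) x i ^+ a i) * x n ^+ 0) =
      (fun x => bern (x n) N (fun r => f (upd x n (r%:R / N%:R))) * \prod_(i < m) x i ^+ a i).
    apply/funext => x; rewrite expr0 mulr1 mulrC.
    have := bern_lin (x n) N (\prod_(i < m) x i ^+ a i) 0 (fun r => f (upd x n (r%:R / N%:R))) (fun=> 0).
    rewrite bern_cst mulr0 addr0 => <-; congr bern; apply/funext => r.
    by rewrite ?mul0r ?mulr0 ?addr0 mulrC.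
  rewrite E; apply => r b rN.
  pose m' := maxn m n.+1.
  pose a' i := ((if (i < m)%N then a i else 0) + (if i == n then b else 0))%N.
  have := IH a' m' (fun x => f (upd x n (r%:R / N%:R))) L0.
  have -> : (fun x => f (upd x n (r%:R / N%:R)) * \prod_(i < m') x i ^+ a' i) =
    (fun x => f (upd x n (r%:R / N%:R)) * \prod_(i < m) x i ^+ a i * x n ^+ b).
    apply/funext => x; rewrite -mulrA; congr (_ * _).
    rewrite -(big_mkord xpredT (fun i => x i ^+ a i)) -(big_mkord xpredT (fun i => x i ^+ a' i)) /a'.
    under eq_bigr do rewrite exprD.
    rewrite big_split/=; congr (_ * _).
      rewrite (@big_cat_nat _ _ _ m)//= ?leq_maxl// [X in _ * X]big1_seq ?mulr1.
        by rewrite big_nat [RHS]big_nat; apply: eq_bigr => i /andP[_ ->].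
      by move=> i; rewrite mem_index_iota => /andP[_ /andP[mi _]]; rewrite ltnNge mi expr0.
    rewrite (bigD1_seq n)/= ?eqxx ?iota_uniq ?mem_index_iota ?leq_maxr//.
    by rewrite big1 ?mulr1// => i /negbTE ->; rewrite expr0.
  apply.
    move=> x y xy; apply: fn => i; rewrite ltnS leq_eqVlt /upd => /predU1P[->|iN].
      by rewrite eqxx.
    by rewrite ltn_eqF//; exact: xy.
  move=> x k c xc c01.
  have rN' : (0 : R) <= (r%:R / N%:R : R) <= 1 by apply/andP; split; [rewrite divr_ge0|rewrite ler_pdivrMr// mul1r ler_nat].
  have [->|kn] := eqVneq k n.
    rewrite (_ : f _ = f (upd x n (r%:R / N%:R))) ?subrr ?normr0 ?mulr_ge0//.
    by congr f; apply/funext => i; rewrite /upd; case: eqP.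
  have -> : upd (upd x k c) n (r%:R / N%:R) = upd (upd x n (r%:R / N%:R)) k c.
    apply/funext => i; rewrite /upd; case: eqP => [->|//]; case: eqP => // E'.
    by rewrite E' eqxx in kn.
  apply: le_trans (fL _ _ _ _ c01) _.
    by move=> i; rewrite /upd; case: eqP.
  by rewrite /upd (negbTE kn).
move=> x xc; rewrite -mulrBl normrM -[leRHS]mulr1; apply: ler_pM => //.
- have := HN (fun t => f (upd x n t)) _ (x n) (xc n).
  rewrite distrC (_ : upd x n (x n) = x); last first.
    by apply/funext => i; rewrite /upd; case: eqP => // ->.
  apply=> t t' t01 t'01.
  have := fL (upd x n t') n t _ t01.
  have -> : upd (upd x n t') n t = upd x n t by apply/funext => i; rewrite /upd; case: eqP.
  rewrite (_ : upd x n t' n = t'); last by rewrite /upd eqxx.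
  apply.
  by move=> i; rewrite /upd; case: eqP.
- rewrite normr_prod; apply: (@le_trans _ _ (\prod_(i < m) (1 : R))); last by rewrite big1.
  apply: ler_prod => i _; rewrite normr_ge0/=.
  have /andP[x0 x1] := xc i.
  by rewrite ger0_norm ?exprn_ge0// exprn_ile1.
Qed.

End Bernstein.

Lemma cvg_expR (R : realType) (T : Type) {F : set_system T} {FF : Filter F} (f : T -> R)
  (l : R) : f @ F --> l -> expR (f x) @[x --> F] --> expR l.
Proof. by move=> h; exact: (cvg_comp _ _ h (@continuous_expR R l)). Qed.

Lemma cvg_sumr (R : realType) (T I : Type) {F : set_system T} {FF : Filter F} (r : seq I)
    (f : I -> T -> R) (l : I -> R) : (forall i, f i x @[x --> F] --> l i) ->
  \sum_(i <- r) f i x @[x --> F] --> \sum_(i <- r) l i.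
Proof.
move=> h; elim: r => [|i r IH].
  by rewrite big_nil; under eq_fun do rewrite big_nil; exact: cvg_cst.
by rewrite big_cons; under eq_fun do rewrite big_cons; exact: cvgD.
Qed.

(** * Gamma integrals and the Green potential of a polynomial weight *)

Section Kernel.
Variables (R : realType) (a : R).
Hypothesis a01 : 0 < a <= 1.
Let a0 : 0 < a. Proof. by case/andP: a01. Qed.
Let a1 : a <= 1. Proof. by case/andP: a01. Qed.

(** With y = exp t, the tangent bounds for exp at (1 - a) t and at -a t are averaged with weights a
    and 1 - a. *)
Lemma powR_bernoulli (y : R) : 0 < y -> y `^ a <= 1 + a * (y - 1).
Proof.
move=> y0; rewrite /powR gt_eqF//; set t := ln y.
have -> : y = expR t by rewrite /t lnK// posrE.
have h1 : expR (a * t) * (1 + (1 - a) * t) <= expR t.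
  rewrite -[X in _ <= expR X](_ : a * t + (1 - a) * t = t); last by ring.
  by rewrite expRD ler_wpM2l ?expR_ge0// expR_ge1Dx.
have h2 : expR (a * t) * (1 + - (a * t)) <= 1.
  rewrite -[leRHS](expRxMexpNx_1 (a * t)).
  by rewrite ler_wpM2l ?expR_ge0// expR_ge1Dx.
have h1' : a * (expR (a * t) * (1 + (1 - a) * t)) <= a * expR t by rewrite ler_wpM2l// ltW.
have h2' : (1 - a) * (expR (a * t) * (1 + - (a * t))) <= (1 - a) * 1 by rewrite ler_wpM2l// subr_ge0.
by lra.
Qed.

Local Notation mu := (@lebesgue_measure R).
Local Notation D := (`[0%R, +oo[%classic : set R).

Let mD : measurable D. Proof. exact: measurable_itv. Qed.
Let gf (z : R) : R := z `^ a * expR (- z).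

Let gf_ge0 z : 0 <= gf z. Proof. by rewrite mulr_ge0 ?powR_ge0 ?expR_ge0. Qed.

(** The value Gamma(1 + a). *)
Definition gamI : R := fine (\int[mu]_(z in D) (z `^ a * expR (- z))%:E).

Lemma measurable_powR_ (r : R) : mfunT (fun z : R => z `^ r).
Proof. exact: measurable_powR. Qed.

Lemma measurable_gf : mfunT gf.
Proof.
apply: measurable_funM; first exact: measurable_powR_.
by apply: measurableT_comp => //; exact: measurable_funN.
Qed.

Lemma gamIE : (\int[mu]_(z in D) (gf z)%:E = gamI%:E)%E.
Proof.
rewrite /gamI fineK// ge0_fin_numE; last by apply: integral_ge0 => z _; rewrite lee_fin gf_ge0.
(* An integrable majorant: z^a <= 1 + z <= 2 exp(z/2), and 2 exp(-z/2) is four times the exponential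
   density of rate 1/2. *)
apply: (@le_lt_trans _ _ (\int[mu]_(z in D) (4%:E * (exponential_pdf 2^-1 z)%:E))%E).
  apply: ge0_le_integral => //.
  - by move=> z _; rewrite lee_fin gf_ge0.
  - by apply/measurable_EFinP; apply: measurable_funTS; exact: measurable_gf.
  - apply: measurable_funeM; apply/measurable_EFinP; apply: measurable_funTS.
    exact: measurable_exponential_pdf.
  - move=> z; rewrite /= in_itv/= andbT => z0; rewrite -EFinM lee_fin /gf exponential_pdfE//.
    have -> : expR (- z) = expR (- (z / 2)) * expR (- (z / 2)) by rewrite -expRD; congr expR; lra.
    have -> : 4 * (2^-1 * expR (- 2^-1 * z)) = 2 * expR (- (z / 2)) by rewrite mulNr (mulrC z) mulrA; congr (_ * _); lra.
    rewrite mulrA ler_wpM2r ?expR_ge0// expRN ler_pdivrMr ?expR_gt0//.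
    have : z `^ a <= 1 + z.
      have [->|zn0] := eqVneq z 0; first by rewrite powR0 ?gt_eqF// addr0 ler01.
      have z0' : 0 < z by rewrite lt_neqAle eq_sym zn0.
      have := powR_bernoulli z0'.
      have : a * z <= 1 * z by rewrite ler_wpM2r.
      by have := a0; lra.
    have := expR_ge1Dx (z / 2); lra.
rewrite ge0_integralZl//.
- apply: (@le_lt_trans _ _ (4%:E * \int[mu]_z (exponential_pdf 2^-1 z)%:E)%E).
    apply: lee_wpmul2l; first by rewrite lee_fin.
    apply: ge0_subset_integral => //.
      by apply/measurable_EFinP; apply: measurable_exponential_pdf.
    by move=> z _; rewrite lee_fin exponential_pdf_ge0// ltW.
  by rewrite integral_exponential_pdf// mule1 ltry.
- by apply/measurable_EFinP; apply: measurable_funTS; apply: measurable_exponential_pdf.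
- by move=> z _; rewrite lee_fin exponential_pdf_ge0// ltW.
Qed.

Lemma gamI_gt0 : 0 < gamI.
Proof.
rewrite -lte_fin -gamIE.
apply: (@lt_le_trans _ _ (\int[mu]_(z in `[1%R, 2%R]) (expR (- 2))%:E)%E).
  rewrite integral_cst//= lebesgue_measure_itv/= lte_fin ltr1n -EFinD -EFinM lte_fin.
  by rewrite mulr_gt0 ?expR_gt0//; lra.
apply: (@le_trans _ _ (\int[mu]_(z in `[1%R, 2%R]) (gf z)%:E)%E).
  apply: ge0_le_integral => //.
  - by apply/measurable_EFinP; apply: measurable_funTS; exact: measurable_gf.
  - move=> z; rewrite /= in_itv/= => /andP[z1 z2]; rewrite lee_fin /gf.
    rewrite -[leLHS]mul1r; apply: ler_pM; rewrite ?expR_ge0 ?ler_expR ?lerN2//.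
    by rewrite -[leLHS](powRr0 z) ler_powR// ltW.
apply: ge0_subset_integral => //.
- by apply/measurable_EFinP; apply: measurable_funTS; exact: measurable_gf.
- by move=> z _; rewrite lee_fin gf_ge0.
- by move=> z; rewrite /= !in_itv/= andbT => /andP[z1 _]; lra.
Qed.

Lemma gamI_scale (c w : R) : 0 < c -> 0 <= w ->
  (\int[mu]_(z in `[w, +oo[) ((z - w) `^ a * expR (- (c * z)))%:E =
   (gamI * (c `^ (- (1 + a)) * expR (- (c * w))))%:E)%E.
Proof.
move=> c0 w0.
pose F t := c^-1 * t + w.
have c'0 : 0 < c^-1 by rewrite invr_gt0.
have F0 : F 0 = w by rewrite /F mulr0 add0r.
have dF (x : R) : is_derive x 1 F c^-1.
  have h := @is_deriveZ _ _ _ (id : R -> R) c^-1 x 1 _ (is_derive_id _ _).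
  have h' := is_deriveD h (is_derive_cst w x 1).
  by move: h'; rewrite /GRing.scale/= mulr1 addr0.
have F'E : F^`() = fun=> c^-1 by apply/funext => x; rewrite derive1E; apply: derive_val.
have cF : continuous F by move=> x; apply: differentiable_continuous; apply/derivable1_diffP; apply: ex_derive.
have Ept (z : R) : 0 <= z -> ((F z - F 0) `^ a * expR (- (c * F z))) * derive1 F z =
    c `^ (- (1 + a)) * expR (- (c * w)) * gf z.
  move=> z0; rewrite F'E F0 /F addrK powRM ?(ltW c'0)//.
  have -> : c^-1 `^ a = c `^ (- a) by rewrite -powR_inv1 ?(ltW c0)// -powRrM mulN1r.
  have -> : - (c * (c^-1 * z + w)) = - z + - (c * w) by field; rewrite gt_eqF.
  have -> : c `^ (- (1 + a)) = c^-1 * c `^ (- a) by rewrite opprD powRD ?(gt_eqF c0) ?implybT// powR_inv1// ltW.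
  by rewrite /gf expRD; ring.
rewrite -[in LHS]F0 (@increasing_ge0_integration_by_substitutiony _ F _ 0).
- transitivity (\int[mu]_(z in D) ((c `^ (- (1 + a)) * expR (- (c * w)))%:E * (gf z)%:E))%E.
    apply: eq_integral => z; rewrite inE/= in_itv/= andbT => z0; rewrite -EFinM; congr (_%:E).
    exact: Ept.
  rewrite ge0_integralZl//.
  + by rewrite gamIE -EFinM mulrC.
  + by apply/measurable_EFinP; apply: measurable_funTS; exact: measurable_gf.
  + by move=> z _; rewrite lee_fin gf_ge0.
  + by rewrite lee_fin mulr_ge0 ?powR_ge0 ?expR_ge0.
- by move=> x y _ _ xy; rewrite /F ltrD2r ltr_pM2l.
- by rewrite F'E => x _; exact: cvg_cst.
- by rewrite F'E; exact: is_cvg_cst.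
- by rewrite F'E; exact: is_cvg_cst.
- split; first by move=> x _; apply: ex_derive.
  by apply: cvg_at_right_filter; exact: cF.
- apply/cvgryPge => A; near=> x.
  have h : (A - w) * c <= x by near: x; apply: nbhs_pinfty_ge; rewrite num_real.
  by rewrite /F -lerBlDr mulrC ler_pdivlMr.
- apply/continuous_within_itvcyP; rewrite F0; split.
    move=> x; rewrite in_itv/= andbT => wx.
    apply: cvgM.
      by apply: cvg_powR; [rewrite subr_gt0|apply: cvgB (cvg_cst _); exact: cvg_id].
    apply: cvg_expR; apply: cvgN; apply: cvgM; [exact: cvg_cst|exact: cvg_id].
  apply: cvgM.
    rewrite subrr powR0 ?gt_eqF//.
    have h : (x - w : R) @[x --> w^'+] --> (0 : R)^'+.
      move=> Q [e /= e0 He]; exists e => //= x xe wx; apply: He; last by rewrite subr_gt0.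
      by rewrite /= sub0r normrN -normrN opprB; exact: xe.
    exact: (cvg_comp _ _ h (@powR_cvg0 _ a a0)).
  by apply: cvg_expR; apply: cvgN; apply: cvgM; [exact: cvg_cst|exact: cvg_at_right_filter].
- by move=> x _; rewrite mulr_ge0 ?powR_ge0 ?expR_ge0.
Unshelve. all: end_near. Qed.
Let posm (w : R) : mfunT (fun z : R => pos (z - w) `^ a).
Proof.
apply: (measurableT_comp (measurable_powR_ a)).
apply: measurable_maxr => //; exact: measurable_funB.
Qed.
Let expm (c : R) : mfunT (fun z : R => expR (- (c * z))).
Proof.
apply: measurableT_comp => //; apply: measurable_funN.
exact: measurable_funM.
Qed.
Let diffm (w : R) : mfunT (fun z : R => z `^ a - pos (z - w) `^ a).
Proof. by apply: measurable_funB; [exact: measurable_powR_|exact: posm]. Qed.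

Lemma pos_powR_le (w z : R) : 0 <= w -> 0 <= z -> pos (z - w) `^ a <= z `^ a.
Proof.
move=> w0 z0; apply: ge0_ler_powR; rewrite ?nnegrE ?pos_ge0 ?(ltW a0)//.
by rewrite /pos ge_max z0 andbT; lra.
Qed.

(** The Laplace transform in z of the Green kernel. The function (1 - exp(-c w))/c^(1 + a) that
    appears is mapped by the generator of the branching process to a multiple of -w exp(-c w). *)
Lemma integral_kernel (c w : R) : 0 < c -> 0 <= w ->
  (\int[mu]_(z in D) (expR (- (c * z)) * (z `^ a - pos (z - w) `^ a))%:E =
   (gamI * (c `^ (- (1 + a)) * (1 - expR (- (c * w)))))%:E)%E.
Proof.
move=> c0 w0.
have mm f : mfunT f -> measurable_fun D (fun z : R => (expR (- (c * z)) * f z)%:E).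
  by move=> mf; apply/measurable_EFinP; apply: measurable_funTS; exact: measurable_funM.
have iA : (\int[mu]_(z in D) (expR (- (c * z)) * z `^ a)%:E = (gamI * c `^ (- (1 + a)))%:E)%E.
  have := gamI_scale c0 (lexx 0); rewrite mulr0 oppr0 expR0 mulr1 => <-.
  by apply: eq_integral => z _; rewrite ?subr0 ?addr0 mulrC.
have iB : (\int[mu]_(z in D) (expR (- (c * z)) * pos (z - w) `^ a)%:E =
    (gamI * (c `^ (- (1 + a)) * expR (- (c * w))))%:E)%E.
  have DE : D = `[0%R, w[%classic `|` `[w, +oo[%classic.
    apply/seteqP; split => z /=; rewrite !in_itv/= ?andbT.
      by move=> z0; have [zw|wz] := ltP z w; [left; rewrite z0|right].
    by move=> [/andP[]//|wz]; exact: le_trans wz.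
  rewrite DE ge0_integral_setU//=; last 3 first.
  - by rewrite -DE; apply: mm; exact: posm.
  - by move=> z _; rewrite lee_fin mulr_ge0 ?expR_ge0 ?powR_ge0.
  - apply/disj_setPS => z [/=]; rewrite !in_itv/= => /andP[_ zw]; rewrite andbT => wz.
    by move: zw; rewrite ltNge wz.
  rewrite integral0_eq ?add0e; last first.
    move=> z; rewrite /= in_itv/= => /andP[z0 zw].
    rewrite (_ : pos (z - w) = 0) ?powR0 ?mulr0// ?gt_eqF//.
    by rewrite /pos max_r// subr_le0 ltW.
  rewrite -gamI_scale//; apply: eq_integral => z; rewrite inE/= in_itv/= andbT => wz.
  by rewrite /pos max_l ?subr_ge0// mulrC.
have : (\int[mu]_(z in D) (expR (- (c * z)) * z `^ a)%:E =
    \int[mu]_(z in D) (expR (- (c * z)) * (z `^ a - pos (z - w) `^ a))%:E +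
    \int[mu]_(z in D) (expR (- (c * z)) * pos (z - w) `^ a)%:E)%E.
  rewrite -ge0_integralD//.
  - by apply: eq_integral => z _; rewrite -EFinD -mulrDr subrK.
  - move=> z; rewrite /= in_itv/= andbT => z0.
    by rewrite lee_fin mulr_ge0 ?expR_ge0// subr_ge0 pos_powR_le.
  - by apply: mm; exact: diffm.
  - by move=> z _; rewrite lee_fin mulr_ge0 ?expR_ge0 ?powR_ge0.
  - by apply: mm; exact: posm.
rewrite iA iB => E.
have := congr1 (fun x => x - (gamI * (c `^ (- (1 + a)) * expR (- (c * w))))%:E)%E E.
rewrite addeK// -EFinB => <-; congr (_%:E); ring.
Qed.

(** In the variable v = exp(-w), this is the Green potential of the weight B(exp(-z)) exp(-z),
    divided by [gamI]; the factor (i+1)^(-(1+a)) inverts the branching mechanism on each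
    exponential. *)
Definition potl (B : {poly R}) (v : R) : R :=
  \sum_(i < size B) B`_i * (i.+1%:R `^ (- (1 + a)) * (1 - v ^+ i.+1)).

Definition potl_slope (B : {poly R}) : R :=
  \sum_(i < size B) B`_i * i.+1%:R `^ (- a).

Lemma integral_potl (B : {poly R}) (w : R) : 0 <= w ->
  (\int[mu]_(z in D) (B.[expR (- z)] * (expR (- z) * (z `^ a - pos (z - w) `^ a)))%:E =
   (gamI * potl B (expR (- w)))%:E)%E.
Proof.
move=> w0.
pose f (i : nat) (z : R) : \bar R := (expR (- (i.+1%:R * z)) * (z `^ a - pos (z - w) `^ a))%:E.
have fi i : mu.-integrable D (f i).
  apply/integrableP; split.
    by apply/measurable_EFinP; apply: measurable_funTS; apply: measurable_funM; [exact: expm|exact: diffm].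
  rewrite (_ : (\int[mu]_(x in D) `|f i x| = \int[mu]_(x in D) f i x)%E).
    by rewrite integral_kernel// ltry.
  apply: eq_integral => z; rewrite inE/= in_itv/= andbT => z0.
  by rewrite /f ger0_norm// mulr_ge0 ?expR_ge0// subr_ge0 pos_powR_le.
transitivity (\int[mu]_(z in D) (\sum_(i < size B) (B`_i)%:E * f i z))%E.
  apply: eq_integral => z _; rewrite /f; under [RHS]eq_bigr do rewrite -EFinM.
  rewrite sumEFin horner_coef mulr_suml; congr (_%:E).
  apply: eq_bigr => i _; rewrite -mulrA; congr (_ * _); rewrite mulrA; congr (_ * _).
  by rewrite -mulrN expRM_natl exprSr.
rewrite integral_sum//; last by move=> i; exact: integrableZl.
rewrite /potl mulr_sumr -sumEFin; apply: eq_bigr => i _.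
rewrite integralZl// integral_kernel// -EFinM; congr (_%:E).
by rewrite -mulrN expRM_natl; ring.
Qed.

Lemma potl_slopeP (B : {poly R}) :
  potl B (expR (- w)) / w @[w --> 0^'+] --> potl_slope B.
Proof.
rewrite /potl /potl_slope.
have -> : (fun w : R => (\sum_(i < size B) B`_i * (i.+1%:R `^ (- (1 + a)) * (1 - expR (- w) ^+ i.+1))) / w) =
   (fun w : R => \sum_(i < size B) B`_i * (i.+1%:R `^ (- (1 + a)) * ((1 - expR (- w) ^+ i.+1) / w))).
  by apply/funext => w; rewrite mulr_suml; apply: eq_bigr => i _; rewrite !mulrA.
apply: cvg_sumr => i; apply: cvgM; first exact: cvg_cst.
have -> : i.+1%:R `^ (- a) = i.+1%:R `^ (- (1 + a)) * i.+1%:R :> R.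
  by rewrite opprD powRD ?pnatr_eq0 ?implybT// powR_inv1// mulrAC mulVf ?mul1r// pnatr_eq0.
apply: cvgM; first exact: cvg_cst.
apply: (@squeeze_cvgr _ _ _ _ (fun w => i.+1%:R * (1 - i.+1%:R * w)) (fun w => i.+1%:R)).
- near=> w; have w0 : 0 < w by near: w; exact: nbhs_right_gt.
  rewrite -expRM_natl mulrN; set n := i.+1%:R.
  apply/andP; split.
    rewrite ler_pdivlMr// lerBrDr -lerBrDl.
    have e1 : 0 < 1 + n * w by rewrite addr_gt0// mulr_gt0// ltr0n.
    have h : expR (- (n * w)) * (1 + n * w) <= 1 by rewrite expRN ler_pdivrMl ?expR_gt0// mulr1 expR_ge1Dx.
    have nw : 0 <= n * w by rewrite mulr_ge0 ?(ltW w0)// ler0n.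
    rewrite -(ler_pM2r e1); apply: le_trans h _.
    have : 0 <= (n * w) ^+ 3 by rewrite exprn_ge0.
    have -> : (1 - n * (1 - n * w) * w) * (1 + n * w) = 1 + (n * w) ^+ 3 by ring.
    by lra.
  rewrite ler_pdivrMr//; have := expR_ge1Dx (- (n * w)); lra.
- rewrite -[X in _ --> X]mulr1 -[X in _ * X]subr0 -[X in _ - X](mulr0 i.+1%:R).
  apply: cvgM; first exact: cvg_cst.
  apply: cvgB; first exact: cvg_cst.
  by apply: cvgM; [exact: cvg_cst|exact: cvg_at_right_filter].
- exact: cvg_cst.
Unshelve. all: end_near. Qed.

(** A mean value estimate without derivative: [powR_bernoulli] at (z - w)/z gives the lower bound
    and at z/(z - w) the upper one. *)
Lemma powR_increment (w z l b : R) : 0 < w < l -> l <= z <= b ->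
  a * w / b * z `^ a <= z `^ a - (z - w) `^ a <= a * w / (l - w) * z `^ a.
Proof.
move=> /andP[w0 wl] /andP[lz zb]; have z0 : 0 < z by lra.
have zw : 0 < z - w by lra.
have b0 : 0 < b by lra.
have za : 0 < z `^ a by rewrite powR_gt0.
have zwa : 0 < (z - w) `^ a by rewrite powR_gt0.
have t0 : 0 < (z - w) / z by rewrite divr_gt0.
have s0 : 0 < z / (z - w) by rewrite divr_gt0.
have := powR_bernoulli t0; have := powR_bernoulli s0.
have P1' : (z / (z - w)) `^ a = z `^ a / (z - w) `^ a by rewrite powRM ?(ltW z0) ?invr_ge0 ?(ltW zw)// -powR_inv1 ?(ltW zw)// -powRrM mulN1r powRN.
have P2' : ((z - w) / z) `^ a = (z - w) `^ a / z `^ a by rewrite powRM ?(ltW zw) ?invr_ge0 ?(ltW z0)// -powR_inv1 ?(ltW z0)// -powRrM mulN1r powRN.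
rewrite P1' P2' => h1 h2; apply/andP; split.
  have h2' : (z - w) `^ a <= z `^ a * (1 - a * (w / z)).
    rewrite mulrC -ler_pdivrMr//; apply: le_trans h2 _.
    by rewrite (_ : (z - w) / z - 1 = - (w / z)) ?mulrN//; field; rewrite gt_eqF.
  have h3 : a * w / b <= a * (w / z) by rewrite -mulrA ler_wpM2l ?(ltW a0)// ler_wpM2l ?(ltW w0)// lef_pV2 ?posrE.
  have : a * w / b * z `^ a <= a * (w / z) * z `^ a by rewrite ler_wpM2r// ltW.
  by lra.
have h1' : z `^ a <= (z - w) `^ a * (1 + a * (w / (z - w))).
  rewrite mulrC -ler_pdivrMr//; apply: le_trans h1 _.
  by rewrite (_ : z / (z - w) - 1 = w / (z - w))//; field; rewrite gt_eqF.
have h3 : a * (w / (z - w)) <= a * w / (l - w).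
  rewrite -mulrA ler_wpM2l ?(ltW a0)// ler_wpM2l ?(ltW w0)// lef_pV2 ?posrE//; lra.
have h4 : (z - w) `^ a <= z `^ a by apply: ge0_ler_powR; rewrite ?nnegrE ?(ltW a0) ?(ltW zw) ?(ltW z0)//; lra.
have h5 : (z - w) `^ a * (a * (w / (z - w))) <= z `^ a * (a * w / (l - w)).
  apply: ler_pM => //; rewrite ?(ltW zwa)// mulr_ge0 ?(ltW a0)// divr_ge0 ?(ltW w0)//; exact: ltW.
by lra.
Qed.

(** * A polynomial bump with controlled potential *)

Section Bump.
Variables (l b : R).
Hypothesis lb : 0 < l < b.
Let l0 : 0 < l. Proof. by case/andP: lb. Qed.
Let lb' : l < b. Proof. by case/andP: lb. Qed.
Let v0 := (expR (- b) + expR (- l)) / 2.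
Let r := (expR (- l) - expR (- b)) / 2.
Let r0 : 0 < r. Proof. by rewrite /r divr_gt0// subr_gt0 ltr_expR ltrN2. Qed.
(** A tent on [exp(-b), exp(-l)]; in the variable z = -ln v it is supported on [l, b]. *)
Let bt v := pos (1 - `|v - v0| / r).

Let bt0 v : 0 <= bt v. Proof. exact: pos_ge0. Qed.
Let bt1 v : bt v <= 1.
Proof. by apply: pos_le => //; rewrite gerBl divr_ge0// ltW. Qed.
Let bt_supp v : bt v != 0 -> expR (- b) <= v <= expR (- l).
Proof.
rewrite /bt /pos; case: (leP (1 - `|v - v0| / r) 0) => [_|]; first by rewrite eqxx.
rewrite subr_gt0 ltr_pdivrMr// mul1r ltr_norml => /andP[h1 h2] _.
by rewrite /r /v0 in h1 h2; lra.
Qed.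
Let k0 (z : R) := bt (expR (- z)).

Let k00 z : 0 <= k0 z. Proof. exact: bt0. Qed.
Let k01 z : k0 z <= 1. Proof. exact: bt1. Qed.
Let powR_l (z : R) : l <= z -> l `^ a <= z `^ a.
Proof. by move=> lz; apply: ge0_ler_powR; rewrite ?nnegrE ?(ltW a0) ?(ltW l0)//; move: l0; lra. Qed.
Let k0_supp z : k0 z != 0 -> l <= z <= b.
Proof. by move=> /bt_supp; rewrite !ler_expR !lerN2 andbC. Qed.
Let k0m : mfunT k0.
Proof.
apply: measurable_maxr => //; apply: measurable_funB => //.
apply: measurable_funM => //; apply: measurableT_comp => //.
apply: measurable_funB => //; apply: measurableT_comp => //; exact: measurable_funN.
Qed.
Let M := (\int[mu]_(z in D) (k0 z * gf z)%:E)%E.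

Let Mfin : M \is a fin_num.
Proof.
rewrite ge0_fin_numE; last by apply: integral_ge0 => z _; rewrite lee_fin mulr_ge0 ?gf_ge0.
apply: (@le_lt_trans _ _ (gamI%:E)); last exact: ltry.
rewrite -gamIE; apply: ge0_le_integral => //.
- by move=> z _; rewrite lee_fin mulr_ge0 ?gf_ge0.
- by apply/measurable_EFinP; apply: measurable_funTS; apply: measurable_funM => //; exact: measurable_gf.
- by apply/measurable_EFinP; apply: measurable_funTS; exact: measurable_gf.
- by move=> z _; rewrite lee_fin ler_piMl ?gf_ge0.
Qed.
Let Mgt0 : 0 < fine M.
Proof.
rewrite -lte_fin fineK//.
have e1 : expR (- b) < v0 - r / 2 by rewrite /v0 /r; move: r0; rewrite /r; lra.
have e0 : 0 < v0 - r / 2 by apply: lt_trans e1; exact: expR_gt0.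
have e2 : v0 + r / 2 < expR (- l) by rewrite /v0 /r; move: r0; rewrite /r; lra.
have e3 : v0 - r / 2 < v0 + r / 2 by move: r0; lra.
have e4 : 0 < v0 + r / 2 by lra.
pose z1 := - ln (v0 + r / 2); pose z2 := - ln (v0 - r / 2).
have z12 : z1 < z2 by rewrite /z1 /z2 ltrN2 ltr_ln ?posrE.
have lz1 : l <= z1 by rewrite /z1 lerNr -(expRK (- l)) ler_ln ?posrE ?expR_gt0// ltW.
pose c := 2^-1 * (l `^ a * expR (- z2)).
have c0 : 0 < c by rewrite !mulr_gt0 ?invr_gt0 ?powR_gt0 ?expR_gt0.
apply: (@lt_le_trans _ _ (\int[mu]_(z in `[z1, z2]) c%:E)%E).
  rewrite integral_cst//= lebesgue_measure_itv/= lte_fin z12 -EFinD -EFinM lte_fin.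
  by rewrite mulr_gt0// subr_gt0.
have mk : mfunT (fun z => k0 z * gf z) by apply: measurable_funM => //; exact: measurable_gf.
apply: (@le_trans _ _ (\int[mu]_(z in `[z1, z2]) (k0 z * gf z)%:E)%E).
  apply: ge0_le_integral => //.
  - by move=> z _; rewrite lee_fin ltW.
  - by apply/measurable_EFinP; exact: measurable_funTS.
  - move=> z; rewrite /= in_itv/= => /andP[zz1 zz2]; rewrite lee_fin /c.
    have zl : l <= z by lra.
    apply: ler_pM; rewrite ?invr_ge0 ?mulr_ge0 ?powR_ge0 ?expR_ge0//; last first.
      apply: ler_pM; rewrite ?powR_ge0 ?expR_ge0 ?ler_expR ?lerN2//.
      exact: powR_l.
    apply: le_trans (pos_ge _).
    have k1 : expR (- z) <= v0 + r / 2 by rewrite -(@lnK _ (v0 + r / 2)) ?posrE// ler_expR; move: zz1; rewrite /z1; lra.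
    have k2 : v0 - r / 2 <= expR (- z) by rewrite -(@lnK _ (v0 - r / 2)) ?posrE// ler_expR; move: zz2; rewrite /z2; lra.
    have : `|expR (- z) - v0| / r <= 2^-1 by rewrite ler_pdivrMr// ler_norml; lra.
    by lra.
apply: ge0_subset_integral => //.
- by apply/measurable_EFinP; exact: measurable_funTS.
- by move=> z _; rewrite lee_fin mulr_ge0 ?gf_ge0.
- by move=> z; rewrite /= !in_itv/= andbT => /andP[h _]; move: l0; lra.
Qed.
(** The potential of the tent at w: it equals [M] once w has passed the support, and its slope at w
    = 0 lies between a M / b and a M / l. *)
Let I w := (\int[mu]_(z in D) (k0 z * (expR (- z) * (z `^ a - pos (z - w) `^ a)))%:E)%E.

Let mW w : mfunT (fun z : R => expR (- z) * (z `^ a - pos (z - w) `^ a)).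
Proof.
apply: measurable_funM; last exact: diffm.
by apply: measurableT_comp => //; exact: measurable_funN.
Qed.
Let W0 w z : 0 <= w -> 0 <= z -> 0 <= expR (- z) * (z `^ a - pos (z - w) `^ a).
Proof. by move=> w0 z0; rewrite mulr_ge0 ?expR_ge0// subr_ge0 pos_powR_le. Qed.
Let mI w : measurable_fun D (fun z => (k0 z * (expR (- z) * (z `^ a - pos (z - w) `^ a)))%:E).
Proof. by apply/measurable_EFinP; apply: measurable_funTS; apply: measurable_funM => //; exact: mW. Qed.
Let mM : measurable_fun D (fun z => (k0 z * gf z)%:E).
Proof.
by apply/measurable_EFinP; apply: measurable_funTS; apply: measurable_funM => //; exact: measurable_gf.
Qed.
Let I_le w : 0 <= w -> (I w <= M)%E.
Proof.
move=> w0; apply: ge0_le_integral => //.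
- by move=> z; rewrite /= in_itv/= andbT => z0; rewrite lee_fin mulr_ge0// W0.
- exact: mI.
- move=> z _; rewrite lee_fin ler_wpM2l// /gf mulrC ler_wpM2r ?expR_ge0//.
  by rewrite gerBl powR_ge0.
Qed.
Let I_ge w : b <= w -> (M <= I w)%E.
Proof.
move=> bw; apply: ge0_le_integral => //.
- by move=> z _; rewrite lee_fin mulr_ge0 ?gf_ge0.
- exact: mI.
- move=> z _; rewrite lee_fin; have [->|/k0_supp/andP[lz zb]] := eqVneq (k0 z) 0; first by rewrite !mul0r.
  rewrite ler_wpM2l// /gf (_ : pos (z - w) = 0); last by rewrite /pos max_r//; lra.
  by rewrite powR0 ?gt_eqF// subr0 mulrC.
Qed.
Let incr_k0 (w z : R) : 0 < w < l ->
  a * w / b * (k0 z * gf z) <= k0 z * (expR (- z) * (z `^ a - pos (z - w) `^ a)) <=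
  a * w / (l - w) * (k0 z * gf z).
Proof.
move=> wl; have [->|/k0_supp lzb] := eqVneq (k0 z) 0; first by rewrite !mul0r !mulr0 lexx.
have /andP[lz zb] := lzb; have /andP[w0 wl'] := wl.
have /andP[h1 h2] := powR_increment wl lzb.
rewrite /gf (_ : pos (z - w) = z - w); last by rewrite /pos max_l//; lra.
have E c : c * (k0 z * (z `^ a * expR (- z))) = k0 z * (expR (- z) * (c * z `^ a)) by ring.
by rewrite !E !ler_wpM2l ?expR_ge0.
Qed.
Let I_bounds w : 0 < w < l -> ((a * w / b)%:E * M <= I w /\ I w <= (a * w / (l - w))%:E * M)%E.
Proof.
move=> wl; have /andP[w0 wl'] := wl.
have b0 : 0 < b by move: l0 lb'; lra.
have c1 : 0 <= a * w / b by rewrite divr_ge0 ?mulr_ge0 ?(ltW a0) ?(ltW w0) ?(ltW b0).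
have c2 : 0 <= a * w / (l - w) by rewrite divr_ge0 ?mulr_ge0 ?(ltW a0) ?(ltW w0)// subr_ge0 ltW.
have nn z : D z -> (0 <= (k0 z * gf z)%:E)%E by move=> _; rewrite lee_fin mulr_ge0 ?gf_ge0.
rewrite /M -!ge0_integralZl//; split; apply: ge0_le_integral => //.
- by move=> z _; rewrite -EFinM lee_fin mulr_ge0// mulr_ge0 ?gf_ge0.
- exact: measurable_funeM.
- exact: mI.
- by move=> z _; rewrite -EFinM lee_fin; have /andP[] := incr_k0 z wl.
- by move=> z; rewrite /= in_itv/= andbT => z0; rewrite lee_fin mulr_ge0// W0// ltW.
- exact: mI.
- exact: measurable_funeM.
- by move=> z _; rewrite -EFinM lee_fin; have /andP[] := incr_k0 z wl.
Qed.

(** The tent raised by 2 eta is approximated within eta, so the polynomial is at least eta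
    everywhere and at most 3 eta where the tent vanishes. For l and b close to 1 the slope at 0 is
    about a times the saturation value [m]; this ratio becomes the constant of the tail of the
    maximum. [m] is chosen before eta, so eta can be taken small against it. *)
Lemma poly_bump : exists m : R, 0 < m /\ forall eta : R, 0 < eta -> exists B : {poly R},
  [/\ (forall v, 0 <= v <= 1 -> eta <= B.[v]),
      (forall v, expR (- l) <= v <= 1 -> B.[v] <= 3 * eta),
      (forall v, 0 < v <= expR (- b) -> m <= potl B v),
      (forall v, 0 < v <= 1 -> 0 <= potl B v <= m + 3 * eta) &
      a * m / b <= potl_slope B <= a * m / l + 3 * eta].
Proof.
have g0 := gamI_gt0.
exists (fine M / gamI); split; first by rewrite divr_gt0.
move=> eta eta0.
have Lr : 0 <= r^-1 by rewrite invr_ge0 ltW.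
have lip (x y : R) : 0 <= x <= 1 -> 0 <= y <= 1 ->
    `|(bt x + 2 * eta) - (bt y + 2 * eta)| <= r^-1 * `|x - y|.
  move=> x01 y01; rewrite opprD addrACA subrr addr0 /bt.
  have pl (s t : R) : `|pos s - pos t| <= `|s - t|.
    rewrite /pos; case: (leP s 0) => s0; case: (leP t 0) => t0; rewrite ?subrr ?normr0// ?subr0 ?sub0r ?normrN.
    - by rewrite ger0_norm ?(ltW t0)// distrC ger0_norm//; lra.
    - by rewrite ger0_norm ?(ltW s0)// ger0_norm//; lra.
  apply: le_trans (pl _ _) _.
  rewrite opprB addrC addrA subrK -mulrBl normrM (ger0_norm Lr) mulrC ler_wpM2l//.
  by rewrite distrC (le_trans (ler_dist_dist _ _))// opprB addrA subrK.
have [B HB] := weierstrass Lr eta0 lip.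
have HB1 v : 0 <= v <= 1 -> bt v + eta <= B.[v] by move=> /HB; rewrite ler_norml => /andP[h _]; lra.
have HB2 v : 0 <= v <= 1 -> B.[v] <= bt v + 3 * eta by move=> /HB; rewrite ler_norml => /andP[_ h]; lra.
have ez (z : R) : 0 <= z -> 0 <= expR (- z) <= 1 by move=> z0; rewrite expR_ge0 expR_le1 oppr_le0.
have mB : mfunT (fun z : R => B.[expR (- z)]).
  apply: (@measurableT_comp _ _ _ _ _ _ (fun x : R => B.[x])).
    by apply: continuous_measurable_fun => x; exact: continuous_horner.
  by apply: measurableT_comp => //; exact: measurable_funN.
have mBW w : measurable_fun D (fun z => (B.[expR (- z)] * (expR (- z) * (z `^ a - pos (z - w) `^ a)))%:E).
  by apply/measurable_EFinP; apply: measurable_funTS; apply: measurable_funM => //; exact: mW.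
have low w : 0 <= w -> (I w <= (gamI * potl B (expR (- w)))%:E)%E.
  move=> w0; rewrite -integral_potl//; apply: ge0_le_integral => //.
  - by move=> z; rewrite /= in_itv/= andbT => z0; rewrite lee_fin mulr_ge0// W0.
  - exact: mI.
  - exact: mBW.
  - move=> z; rewrite /= in_itv/= andbT => z0; rewrite lee_fin ler_wpM2r ?W0//.
    by apply: le_trans (HB1 _ (ez _ z0)); rewrite lerDl ltW.
have upp w : 0 <= w -> ((gamI * potl B (expR (- w)))%:E <= I w + (3 * eta * (gamI * (1 - expR (- w))))%:E)%E.
  move=> w0; rewrite -integral_potl//.
  have := integral_kernel ltr01 w0; rewrite powR1 !mul1r => E.
  rewrite EFinM -E -ge0_integralZl//; last 3 first.
  - by apply/measurable_EFinP; apply: measurable_funTS; under eq_fun do rewrite mul1r; exact: mW.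
  - by move=> z; rewrite /= in_itv/= andbT => z0; rewrite mul1r lee_fin W0.
  - by rewrite lee_fin mulr_ge0// ltW.
  rewrite -ge0_integralD//; last 4 first.
  - by move=> z; rewrite /= in_itv/= andbT => z0; rewrite lee_fin mulr_ge0// W0.
  - exact: mI.
  - move=> z; rewrite /= in_itv/= andbT => z0; rewrite mul1r -EFinM lee_fin mulr_ge0 ?W0//.
    by rewrite mulr_ge0// ltW.
  - apply: measurable_funeM; apply/measurable_EFinP; apply: measurable_funTS.
    by under eq_fun do rewrite mul1r; exact: mW.
  apply: ge0_le_integral => //.
  - move=> z; rewrite /= in_itv/= andbT => z0; rewrite lee_fin mulr_ge0 ?W0//.
    by apply: le_trans (HB1 _ (ez _ z0)); rewrite addr_ge0// ltW.
  - exact: mBW.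
  - apply: emeasurable_funD; first exact: mI.
    apply: measurable_funeM; apply/measurable_EFinP; apply: measurable_funTS.
    by under eq_fun do rewrite mul1r; exact: mW.
  - move=> z; rewrite /= in_itv/= andbT => z0; rewrite mul1r -EFinM -EFinD lee_fin -mulrDl.
    by rewrite ler_wpM2r ?W0// HB2// ez.
have ME : M = (fine M)%:E by rewrite fineK.
have lnv (v : R) : 0 < v <= 1 -> exists2 w, 0 <= w & v = expR (- w).
  move=> /andP[vp v1]; exists (- ln v); first by rewrite oppr_ge0 ln_le0.
  by rewrite opprK lnK.
exists B; split.
- by move=> v v01; apply: le_trans (HB1 _ v01); rewrite lerDr.
- move=> v /andP[lv v1].
  have v01 : 0 <= v <= 1 by rewrite v1 (le_trans (expR_ge0 _) lv).
  have [btv|/bt_supp/andP[_ vl]] := eqVneq (bt v) 0; first by have := HB2 _ v01; rewrite btv add0r.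
  have vE : v = expR (- l) by apply/eqP; rewrite eq_le vl lv.
  have -> : 3 * eta = bt v + 3 * eta; last exact: HB2.
  rewrite /bt vE /v0 (_ : expR (- l) - _ = r); last by rewrite /r; lra.
  by rewrite gtr0_norm// divff ?gt_eqF// subrr /pos maxxx add0r.
- move=> v /andP[vp vb].
  have /lnv[w w0 vE] : 0 < v <= 1 by rewrite vp (le_trans vb)// expR_le1 oppr_le0; move: l0 lb'; lra.
  rewrite vE ler_pdivrMr// mulrC -lee_fin -ME.
  apply: le_trans (low _ w0); apply: I_ge.
  by move: vb; rewrite vE ler_expR lerN2.
- move=> v /lnv[w w0 vE].
  rewrite vE; apply/andP; split.
    rewrite -(pmulr_rge0 _ g0) -lee_fin; apply: le_trans (low _ w0).
    by apply: integral_ge0 => z; rewrite /= in_itv/= andbT => z0; rewrite lee_fin mulr_ge0// W0.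
  rewrite -(ler_pM2l g0) mulrDr mulrCA divff ?gt_eqF// mulr1 -lee_fin.
  apply: le_trans (upp _ w0) _; rewrite EFinD -ME; apply: leeD; first exact: I_le.
  rewrite lee_fin mulrCA ler_wpM2l ?(ltW g0)// ler_piMr ?mulr_ge0 ?(ltW eta0)//.
- have b0 : 0 < b by move: l0 lb'; lra.
  have key w : 0 < w < l -> a * (fine M / gamI) / b <= potl B (expR (- w)) / w <=
      a * (fine M / gamI) / (l - w) + 3 * eta.
    move=> wl; have /andP[w0 wl'] := wl; have [h1 h2] := I_bounds wl.
    have lw0 : 0 < l - w by rewrite subr_gt0.
    have k1 := le_trans h1 (low _ (ltW w0)).
    have k2 := le_trans (upp _ (ltW w0)) (leeD h2 (le_refl _)).
    rewrite ME -EFinM lee_fin in k1; rewrite ME -EFinM -EFinD lee_fin in k2.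
    apply/andP; split.
      rewrite ler_pdivlMr// -(ler_pM2l g0); apply: le_trans k1.
      by rewrite le_eqVlt; apply/orP; left; apply/eqP; field; rewrite !gt_eqF.
    rewrite ler_pdivrMr// -(ler_pM2l g0); apply: le_trans k2 _.
    have ew : 1 - expR (- w) <= w by have := expR_ge1Dx (- w); lra.
    have : 3 * eta * (gamI * (1 - expR (- w))) <= 3 * eta * (gamI * w) by rewrite ler_wpM2l ?mulr_ge0 ?(ltW eta0)// ler_wpM2l// ltW.
    have -> : gamI * ((a * (fine M / gamI) / (l - w) + 3 * eta) * w) =
        a * w / (l - w) * fine M + 3 * eta * (gamI * w) by field; rewrite !gt_eqF.
    by lra.
  have near_l : \forall w \near (0:R)^'+, 0 < w < l.
    near=> w; apply/andP; split; first by near: w; exact: nbhs_right_gt.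
    by near: w; exact: nbhs_right_lt.
  apply/andP; split.
    have S := @potl_slopeP B.
    have : \forall w \near (0:R)^'+, a * (fine M / gamI) / b <= potl B (expR (- w)) / w by apply: filterS near_l => w /key/andP[].
    exact: cvgr_to_ge S.
  have lim : a * (fine M / gamI) / (l - w) + 3 * eta @[w --> (0:R)^'+] -->
      a * (fine M / gamI) / (l - 0) + 3 * eta.
    apply: cvgD; last exact: cvg_cst.
    apply: cvgM; first exact: cvg_cst.
    apply: cvgV; first by rewrite subr_eq0 gt_eqF.
    by apply: cvgB; [exact: cvg_cst|exact: cvg_at_right_filter].
  rewrite -[X in _ / X](subr0 l).
  have S : a * (fine M / gamI) / (l - w) + 3 * eta - potl B (expR (- w)) / w @[w --> (0:R)^'+] -->
      a * (fine M / gamI) / (l - 0) + 3 * eta - potl_slope B.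
    by exact: cvgB lim (@potl_slopeP B).
  rewrite -subr_ge0.
  have : \forall w \near (0:R)^'+, 0 <= a * (fine M / gamI) / (l - w) + 3 * eta - potl B (expR (- w)) / w.
    by apply: filterS near_l => w /key/andP[_]; rewrite subr_ge0.
  exact: cvgr_to_ge S.
Unshelve. all: end_near. Qed.

End Bump.
End Kernel.

(** * Differences of powers, uniformly in the exponent *)

Section PowerGaps.
Variable R : realType.
Implicit Types s t f : R.

Lemma exprn_sub_ge t f w : 0 <= t -> t <= f -> (f - t) * (w.+1%:R * t ^+ w) <= f ^+ w.+1 - t ^+ w.+1.
Proof.
move=> t0 tf; have f0 : 0 <= f by lra.
rewrite subrXX ler_wpM2l ?subr_ge0// mulr_natl -[in leLHS](card_ord w.+1) -sumr_const.
apply: ler_sum => i _; rewrite /= -[in leLHS](subnK (leq_ord i)) exprD.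
by rewrite ler_wpM2r ?exprn_ge0// lerXn2r// nnegrE.
Qed.

Lemma exprn_sub_le t f w : 0 <= t -> t <= f -> f ^+ w.+1 - t ^+ w.+1 <= (f - t) * (w.+1%:R * f ^+ w).
Proof.
move=> t0 tf; have f0 : 0 <= f by lra.
rewrite subrXX ler_wpM2l ?subr_ge0// mulr_natl -[in leRHS](card_ord w.+1) -sumr_const.
apply: ler_sum => i _; rewrite /= -[in leRHS](subnK (leq_ord i)) exprD.
by rewrite ler_wpM2l ?exprn_ge0// lerXn2r// nnegrE.
Qed.

(** The factor w in the mean value bound is absorbed by the room between f and s, where the same
    factor appears; the estimate is therefore uniform in w. *)
Lemma exprn_gap s t f w : 0 <= t -> t <= f -> f < s ->
  f ^+ w - t ^+ w <= s ^+ w * ((f - t) / (s - f)).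
Proof.
move=> t0 tf fs; have f0 : 0 <= f by lra.
have sf : 0 < s - f by lra.
case: w => [|w]; first by rewrite !expr0 subrr mul1r divr_ge0 ?(ltW sf)// subr_ge0.
apply: le_trans (exprn_sub_le _ t0 tf) _.
rewrite [leRHS]mulrCA ler_wpM2l ?subr_ge0// ler_pdivlMr// mulrC.
apply: le_trans (exprn_sub_ge w f0 (ltW fs)) _.
by rewrite gerBl exprn_ge0.
Qed.

Lemma squeeze_l (A A2 X X2 e : R) : - (e / 2) <= A - A2 -> - (e / 2) <= A2 - X2 -> X <= X2 -> - e <= A - X.
Proof. lra. Qed.

Lemma squeeze_r (A A1 X X1 e : R) : A - A1 <= e / 2 -> A1 - X1 <= e / 2 -> X1 <= X -> A - X <= e.
Proof. lra. Qed.

End PowerGaps.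

(** * The test function on the tree and its one-step gain *)

Section Test.
Variables (R : realType) (p : nat -> R) (a : R).
Hypothesis p_ge0 : forall k, 0 <= p k.
Hypothesis p_sum : (\sum_(k <oo) (p k)%:E = 1)%E.
Hypothesis p_mean : (\sum_(k <oo) (k%:R * p k)%:E = 1)%E.
Hypothesis dd : decrement a (loss p).

Local Notation u := (rate (loss p)).
Local Notation f := (pgf p).
Let a01 : 0 < a <= 1 := dec_alpha dd.

Lemma cvg_at_right_near (T : Type) (F : set_system T) (FF : Filter F) (x : T -> R) :
  (\forall t \near F, 0 < x t) -> x t @[t --> F] --> 0 -> x t @[t --> F] --> 0^'+.
Proof.
move=> x0 /cvgrPdist_lt xc Q [e /= e0 He]; have h := xc e e0.
by apply: filterS2 h x0 => t h1 h2; apply: He.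
Qed.

(** Regular variation, given at fixed ratios, extends to converging ratios because the rate is
    monotone. *)
Lemma rate_rv_gen (T : Type) (F : set_system T) (FF : Filter F) (x y : T -> R) (lam : R) :
  0 < lam -> y t @[t --> F] --> 0^'+ ->
  x t / y t @[t --> F] --> lam -> u (x t) / u (y t) @[t --> F] --> lam `^ a.
Proof.
move=> lam0 yr xc.
have pc : (l `^ a : R) @[l --> lam] --> lam `^ a by apply: cvg_powR => //; exact: cvg_id.
apply/cvgrPdist_le => e e0.
have e2 : 0 < e / 2 by rewrite divr_gt0.
have := (cvgrPdist_le _ _).1 pc _ e2; rewrite near_map => -[r /= r0 Hr].
pose r' := Num.min (r / 2) (lam / 2).
have r'0 : 0 < r' by rewrite lt_min !divr_gt0.
have r'1 : r' <= lam / 2 by rewrite ge_min lexx orbT.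
have r'2 : r' < r by apply: le_lt_trans (_ : r / 2 < r); [rewrite ge_min lexx|lra].
have l1 : 0 < lam - r' by lra.
have l2 : 0 < lam + r' by lra.
have B1 : `|lam `^ a - (lam - r') `^ a| <= e / 2 by apply: Hr; rewrite /ball/= opprB addrC subrK gtr0_norm.
have B2 : `|lam `^ a - (lam + r') `^ a| <= e / 2 by apply: Hr; rewrite /ball/= opprD addrA subrr sub0r normrN gtr0_norm.
have C1 := cvg_comp _ _ yr (rate_rv dd l1); have C2 := cvg_comp _ _ yr (rate_rv dd l2).
have n1 : \forall t \near F, 0 < y t by exact: yr _ (nbhs_right_gt _).
have c0 : 0 < (lam + r')^-1 by rewrite invr_gt0.
have n2 : \forall t \near F, y t <= (lam + r')^-1 by exact: yr _ (nbhs_right_le c0).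
have n3 : \forall t \near F, y t <= 1 by exact: yr _ (nbhs_right_le ltr01).
near=> t.
have yt : 0 < y t by near: t.
have y1 : (lam + r') * y t <= 1 by rewrite -ler_pdivlMl// mulr1; near: t.
have y2 : y t <= 1 by near: t.
have u0 : 0 < u (y t) by apply: (rate_gt0 dd); rewrite yt.
have u0' : 0 < (u (y t))^-1 by rewrite invr_gt0.
have xt1 : (lam - r') * y t <= x t by rewrite -ler_pdivlMr//; near: t; apply: (cvgr_ge _ xc); lra.
have xt2 : x t <= (lam + r') * y t by rewrite -ler_pdivrMr//; near: t; apply: (cvgr_le _ xc); lra.
have x0 : 0 < (lam - r') * y t by rewrite mulr_gt0.
have x0' := lt_le_trans x0 xt1; have x1' := le_trans xt2 y1.
have D1 : `|(lam - r') `^ a - u ((lam - r') * y t) / u (y t)| <= e / 2 by near: t; exact: (cvgrPdist_le _ _).1 C1 _ e2.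
have D2 : `|(lam + r') `^ a - u ((lam + r') * y t) / u (y t)| <= e / 2 by near: t; exact: (cvgrPdist_le _ _).1 C2 _ e2.
have h1 : u ((lam - r') * y t) / u (y t) <= u (x t) / u (y t) by rewrite ler_pM2r//; exact: (rate_le dd).
have h2 : u (x t) / u (y t) <= u ((lam + r') * y t) / u (y t) by rewrite ler_pM2r//; exact: (rate_le dd).
have /andP[b1 b2] : - (e / 2) <= lam `^ a - (lam - r') `^ a <= e / 2 by rewrite -ler_norml.
have /andP[b3 b4] : - (e / 2) <= lam `^ a - (lam + r') `^ a <= e / 2 by rewrite -ler_norml.
move: D1 D2; rewrite !ler_norml => /andP[c1 c2] /andP[c3 c4].
by apply/andP; split; [apply: squeeze_l b3 c3 h2|apply: squeeze_r b2 c2 h1].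
Unshelve. all: end_near. Qed.

(** Here x is the inverse of the level: the w-th power of [node x i] is ((1 - x)^w)^(i+1), the
    discrete counterpart of exp(-(i+1) w x). *)
Definition node (x : R) i := (1 - x) ^+ i.+1.
(** The quotient of losses cancels f(node) - node, so that every power contributes a one-step gain
    on the common scale [loss p x]; by regular variation the quotient tends to (i+1)^(-(1+a)), the
    coefficient in [potl]. *)
Definition tcoef (B : {poly R}) x i := B`_i * (loss p x / loss p (1 - node x i)).
Definition tfun (B : {poly R}) x w :=
  \sum_(i < size B) tcoef B x i * (1 - node x i ^+ w).
(** The expected decrease of [tfun] over one generation, since a power s^Z has conditional mean
    f(s)^w from w individuals. *)
Definition tgain (B : {poly R}) x w :=
  \sum_(i < size B) tcoef B x i * (f (node x i) ^+ w - node x i ^+ w).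

Lemma node_itv x i : 0 < x < 1 -> 0 < node x i < 1.
Proof.
move=> /andP[x0 x1]; rewrite /node exprn_gt0 ?subr_gt0//= exprn_ilt1 ?subr_ge0 ?(ltW x1)//.
by rewrite gtrBl.
Qed.

Lemma node_loss x i : loss p (1 - node x i) = f (node x i) - node x i.
Proof. by rewrite /loss subKr. Qed.

Lemma node_loss_gt0 x i : 0 < x < 1 -> 0 < loss p (1 - node x i).
Proof.
move=> /(node_itv i) /andP[h0 h1].
by have /(_ (1 - node x i)) := dec_bounds dd; case/(_ _)/andP => //; lra.
Qed.

Lemma node_slope i : (1 - node x i) / x @[x --> (0:R)^'+] --> (i.+1%:R : R).
Proof.
have -> : (i.+1%:R : R) = \sum_(k < i.+1) (1 - 0) ^+ k by under eq_bigr do rewrite subr0 expr1n; rewrite sumr_const card_ord.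
apply: (@near_cvg R _ _ _ (fun x => \sum_(k < i.+1) (1 - x) ^+ k)); last first.
  apply: cvg_sumr => k.
  have h : (1 - x : R) @[x --> (0:R)^'+] --> (1 - 0 : R) by apply: cvgB; [exact: cvg_cst|exact: cvg_at_right_filter].
  exact: (cvg_comp _ _ h (@exprn_continuous R k _)).
near=> x; have x0 : 0 < x by near: x; exact: nbhs_right_gt.
rewrite /node -[X in _ = (X - _) / _](expr1n _ i.+1) subrXX subKr mulrC mulKf ?gt_eqF//.
by apply: eq_bigr => k _; rewrite expr1n mul1r.
Unshelve. all: end_near. Qed.

Lemma tcoef_cvg B i :
  tcoef B x i @[x --> (0:R)^'+] --> B`_i * i.+1%:R `^ (- (1 + a)).
Proof.
apply: cvgM; first exact: cvg_cst.
have i0 : 0 < i.+1%:R :> R by rewrite ltr0n.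
have -> : i.+1%:R `^ (- (1 + a)) = (i.+1%:R * i.+1%:R `^ a)^-1 :> R by rewrite powRN powRD ?pnatr_eq0 ?implybT// powRr1 ?ler0n.
have sl := @node_slope i.
have rv : u (1 - node x i) / u x @[x --> (0:R)^'+] --> i.+1%:R `^ a by exact: (@rate_rv_gen _ _ _ (fun x => 1 - node x i) id _ i0 (@cvg_id _ _) sl).
have H : ((1 - node x i) / x * (u (1 - node x i) / u x))^-1 @[x --> (0:R)^'+] -->
    (i.+1%:R * i.+1%:R `^ a : R)^-1.
  by apply: cvgV; [rewrite mulf_neq0// gt_eqF// powR_gt0|exact: cvgM].
apply: near_cvg H.
near=> x; have x0 : 0 < x by near: x; exact: nbhs_right_gt.
have x1 : x < 1 by near: x; exact: nbhs_right_lt.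
have x01 : 0 < x < 1 by rewrite x0.
have D0 := node_loss_gt0 i x01; have /andP[n0 n1] := node_itv i x01.
have x01' : 0 < x <= 1 by rewrite x0 ltW.
have /andP[d0 _] := dec_bounds dd x01'.
rewrite /= /rate; field.
by rewrite !gt_eqF// subr_gt0.
Unshelve. all: end_near. Qed.
Let beta (B : {poly R}) (i : nat) := B`_i * i.+1%:R `^ (- (1 + a)).

Lemma tcoef_near (B : {poly R}) (e : R) : 0 < e ->
  \forall x \near (0:R)^'+, \sum_(i < size B) `|tcoef B x i - beta B i| * i.+1%:R <= e.
Proof.
move=> e0; have : \sum_(i < size B) `|tcoef B x i - beta B i| * i.+1%:R @[x --> (0:R)^'+] -->
    \sum_(i < size B) (`|beta B i - beta B i| * i.+1%:R : R).
  apply: cvg_sumr => i; apply: cvgM; last exact: cvg_cst.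
  by apply: cvg_norm; apply: cvgB; [exact: tcoef_cvg|exact: cvg_cst].
rewrite big1 => [H|i _]; last by rewrite subrr normr0 mul0r.
by exact: cvgr_le H _ e0.
Qed.

(** The process starts from one individual, so the value at w = 1 is what enters the stopping
    argument; in the scaling it becomes the slope of the potential at 0. *)
Lemma tfun1_cvg B : tfun B x 1 / x @[x --> (0:R)^'+] --> potl_slope a B.
Proof.
have H : \sum_(i < size B) tcoef B x i * ((1 - node x i) / x) @[x --> (0:R)^'+] -->
    \sum_(i < size B) beta B i * i.+1%:R.
  by apply: cvg_sumr => i; apply: cvgM; [exact: tcoef_cvg|exact: node_slope].
have E : \sum_(i < size B) beta B i * i.+1%:R = potl_slope a B.
  apply: eq_bigr => i _; rewrite /beta -mulrA; congr (_ * _).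
  by rewrite opprD powRD ?pnatr_eq0 ?implybT// powR_inv1// mulrAC mulVf ?mul1r// pnatr_eq0.
rewrite -E; apply: near_cvg H; near=> x.
by rewrite /tfun mulr_suml; apply: eq_bigr => i _; rewrite expr1 mulrA.
Unshelve. all: end_near. Qed.
Let pow_itv (x : R) w : 0 < x < 1 -> 0 < (1 - x) ^+ w <= 1.
Proof.
by move=> /andP[x0 x1]; rewrite exprn_gt0 ?subr_gt0//= exprn_ile1 ?subr_ge0 ?(ltW x1)// gerBl ltW.
Qed.

Lemma node_expr x i w : node x i ^+ w = ((1 - x) ^+ w) ^+ i.+1.
Proof. by rewrite /node -!exprM mulnC. Qed.

(** Discrete function and potential are built on the same powers of (1 - x)^w and differ only in
    coefficients, so the comparison is uniform in w. *)
Lemma tfun_potl B x w : 0 < x < 1 ->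
  `|tfun B x w - potl a B ((1 - x) ^+ w)| <=
  \sum_(i < size B) `|tcoef B x i - beta B i| * i.+1%:R.
Proof.
move=> x01; have /andP[v0 v1] := pow_itv w x01.
rewrite /tfun /potl -sumrB; apply: le_trans (ler_norm_sum _ _ _) _; apply: ler_sum => i _.
rewrite node_expr mulrA -/(beta B i) -mulrBl normrM ler_wpM2l//.
have : 0 <= ((1 - x) ^+ w) ^+ i.+1 <= 1 by rewrite exprn_ge0 ?(ltW v0)//= exprn_ile1// ltW.
move=> /andP[h0 h1]; rewrite ger0_norm ?subr_ge0//.
by apply: (@le_trans _ _ 1); [lra|rewrite ler1n].
Qed.

(** The error is linear in w rather than constant: averaged over a generation, whose mean is 1, it
    costs only a small multiple of x, the order of the quantity to be estimated. *)
Lemma tfun_ge B x w : 0 < x < 1 -> (forall v, 0 < v <= 1 -> 0 <= potl a B v) ->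
  - (w%:R * x * \sum_(i < size B) `|tcoef B x i - beta B i| * i.+1%:R) <= tfun B x w.
Proof.
move=> x01 pot0; have /andP[x0 x1] := x01.
apply: le_trans (_ : _ <= tfun B x w - potl a B ((1 - x) ^+ w)) _; last first.
  by rewrite gerBl; apply: pot0; exact: pow_itv.
rewrite lerNl; apply: le_trans (ler_norm _) _; rewrite normrN.
rewrite /tfun /potl -sumrB; apply: le_trans (ler_norm_sum _ _ _) _.
rewrite mulr_sumr; apply: ler_sum => i _.
rewrite mulrA -/(beta B i) -node_expr -mulrBl normrM mulrC [leRHS]mulrCA [leRHS]mulrC ler_wpM2r//.
have nn : 0 <= 1 - node x i <= 1 by have /andP[] := node_itv i x01; lra.
have := bernoulli_le w nn; rewrite subKr => h1.
have xx : 0 <= x <= 1 by lra.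
have := bernoulli_le i.+1 xx; rewrite -/(node x i) => h2.
rewrite ger0_norm; last by rewrite subr_ge0 exprn_ile1//; have /andP[] := node_itv i x01; lra.
apply: (@le_trans _ _ (w%:R * (1 - node x i))); first by lra.
rewrite -mulrA ler_wpM2l//; lra.
Qed.

Lemma tfun0 B x : tfun B x 0 = 0.
Proof. by rewrite /tfun big1// => i _; rewrite expr0 subrr mulr0. Qed.
(** The divided difference of t -> t^w between node and f(node); it should be close to w times a
    power of (1 - x)^w. *)
Let nu x i w := (f (node x i) ^+ w - node x i ^+ w) / loss p (1 - node x i).

Lemma tgainE B x w : tgain B x w = loss p x * \sum_(i < size B) B`_i * nu x i w.
Proof.
rewrite /tgain mulr_sumr; apply: eq_bigr => i _.
by rewrite /tcoef /nu; ring.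
Qed.
Let nu_bounds x i w : 0 < x < 1 ->
  w.+1%:R * node x i ^+ w <= nu x i w.+1 <= w.+1%:R * f (node x i) ^+ w.
Proof.
move=> x01; have D0 := node_loss_gt0 i x01; have /andP[n0 _] := node_itv i x01.
have tf : node x i <= f (node x i) by rewrite -subr_ge0 -node_loss ltW.
rewrite /nu ler_pdivlMr// ler_pdivrMr// mulrC node_loss exprn_sub_ge ?(ltW n0)//=.
by rewrite mulrC exprn_sub_le ?(ltW n0).
Qed.
(** The relative cost, measured against (1 - x)^w, of passing from node to f(node). For i > 0 the
    node lies at a distance of order x below 1 - x while the loss is o(x), so the cost tends to
    0. *)
Let kap x i := loss p (1 - node x i) / (1 - x - f (node x i)).

Let kap_ok x := forall i, (0 < i)%N -> f (node x i) < 1 - x.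

Let nu_gap x i w : 0 < x < 1 -> f (node x i) < 1 - x ->
  nu x i w.+1 <= w.+1%:R * (((1 - x) ^+ w) ^+ i.+1 + (1 - x) ^+ w * kap x i).
Proof.
move=> x01 fx; have /andP[_ h] := nu_bounds i w x01.
apply: le_trans h _; rewrite ler_wpM2l// -node_expr.
have D0 := node_loss_gt0 i x01; have /andP[n0 _] := node_itv i x01.
have tf : node x i <= f (node x i) by rewrite -subr_ge0 -node_loss ltW.
by have := exprn_gap w (ltW n0) tf fx; rewrite /kap node_loss; lra.
Qed.
Let kap_near (B : {poly R}) (e : R) : 0 < e -> \forall x \near (0:R)^'+,
  (forall i : 'I_(size B), (0 < i)%N -> f (node x i) < 1 - x) /\
  \sum_(i < size B | (0 < i)%N) `|B`_i| * kap x i <= e.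
Proof.
move=> e0.
have key i : (0 < i)%N -> kap x i @[x --> (0:R)^'+] --> (0:R) /\
    \forall x \near (0:R)^'+, f (node x i) < 1 - x.
  move=> i0; pose X x := 1 - node x i.
  have Xc : X x @[x --> (0:R)^'+] --> (0:R).
    rewrite -[X in _ --> X](mulr0 i.+1%:R).
    apply: (@near_cvg R _ _ _ (fun x => (1 - node x i) / x * x)); last first.
      by apply: cvgM; [exact: node_slope|exact: cvg_at_right_filter].
    by near=> x; rewrite divfK// gt_eqF//; near: x; exact: nbhs_right_gt.
  have X0 : \forall x \near (0:R)^'+, 0 < X x.
    near=> x; have : 0 < x < 1 by apply/andP; split; near: x; [exact: nbhs_right_gt|exact: nbhs_right_lt].
    by move=> /(node_itv i) /andP[_ h]; rewrite subr_gt0.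
  have uc : u (X x) @[x --> (0:R)^'+] --> (0:R).
    exact: (cvg_comp _ _ (cvg_at_right_near _ X0 Xc) (rate_cvg0 dd)).
  have sc : x / X x @[x --> (0:R)^'+] --> (i.+1%:R^-1 : R).
    apply: (@near_cvg R _ _ _ (fun x => (X x / x)^-1)); last first.
      by apply: cvgV; [rewrite pnatr_eq0|exact: node_slope].
    by near=> x; rewrite invf_div.
  have dc : 1 - x / X x - u (X x) @[x --> (0:R)^'+] --> (1 - i.+1%:R^-1 - 0 : R) by apply: cvgB => //; apply: cvgB => //; exact: cvg_cst.
  have dpos : 0 < 1 - i.+1%:R^-1 - 0 :> R by rewrite subr0 subr_gt0 invf_lt1 ?ltr0n// ltr1n ltnS.
  split.
    have : u (X x) * (1 - x / X x - u (X x))^-1 @[x --> (0:R)^'+] --> 0 * (1 - i.+1%:R^-1 - 0 : R)^-1.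
      by apply: cvgM => //; apply: cvgV => //; rewrite gt_eqF.
    rewrite mul0r => h.
    apply: near_cvg h; near=> x.
    have hX : 0 < X x by near: x.
    have hd : 0 < 1 - x / X x - u (X x) by near: x; exact: cvgr_gt dc _ dpos.
    rewrite /= /kap.
    have -> : 1 - x - f (node x i) = X x * (1 - x / X x - u (X x)).
      rewrite !mulrBr mulr1 -(decE (loss p) hX) mulrCA divff ?gt_eqF// mulr1 node_loss /X; ring.
    rewrite -/(X x) (decE (loss p) hX); field; rewrite !gt_eqF//=.
    have : 0 < X x * (1 - x / X x - u (X x)) by exact: mulr_gt0.
    by rewrite (_ : X x * _ = X x - x + - u (X x) * X x)//; field; rewrite gt_eqF.
  near=> x.
  have hX : 0 < X x by near: x.
  have hd : 0 < 1 - x / X x - u (X x) by near: x; exact: cvgr_gt dc _ dpos.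
  rewrite -subr_gt0.
  have -> : 1 - x - f (node x i) = X x * (1 - x / X x - u (X x)).
    rewrite !mulrBr mulr1 -(decE (loss p) hX) mulrCA divff ?gt_eqF// mulr1 node_loss /X; ring.
  by rewrite mulr_gt0.
apply: filterI.
  have all_lt n : \forall x \near (0:R)^'+, forall i, (i < n)%N -> (0 < i)%N -> f (node x i) < 1 - x.
    elim: n => [|n IH]; first by near=> x.
    case: (posnP n) => [->|n0]; first by near=> x => i; rewrite ltnS leqn0 => /eqP->.
    have [_ h] := key _ n0; apply: filterS2 IH h => x h1 h2 i.
    by rewrite ltnS leq_eqVlt => /orP[/eqP->//|]; exact: h1.
  by apply: filterS (all_lt (size B)) => x h i; exact: h.
have H : \sum_(i < size B | (0 < i)%N) `|B`_i| * kap x i @[x --> (0:R)^'+] --> (0:R).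
  have -> : nbhs (0:R) = nbhs (\sum_(i < size B) (0:R)) by rewrite big1.
  under eq_fun do rewrite big_mkcond; apply: cvg_sumr => i.
  case: (boolP (0 < i)%N) => i0; last exact: cvg_cst.
  by rewrite -[X in _ --> X](mulr0 `|B`_i|); apply: cvgM; [exact: cvg_cst|have [] := key _ i0].
by exact: cvgr_le H _ e0.
Unshelve. all: end_near. Qed.
Let horner_sum (B : {poly R}) v : \sum_(i < size B) B`_i * v ^+ i.+1 = v * B.[v].
Proof. by rewrite horner_coef mulr_sumr; apply: eq_bigr => i _; rewrite exprS mulrCA. Qed.

(** The sign is needed for every w, also far beyond the level where all powers are tiny. Measured
    against (1 - x)^w the errors are uniform: terms with i > 0 err by [kap], the term i = 0 has a
    nonnegative coefficient and an exact lower bound, and the floor [e] of B absorbs the total. *)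
Lemma tgain_ge (B : {poly R}) (e : R) : 0 < e -> (forall v, 0 <= v <= 1 -> e <= B.[v]) ->
  \forall x \near (0:R)^'+, forall w, 0 <= tgain B x w.
Proof.
move=> e0 Be; have B0 : 0 <= B`_0 by rewrite -horner_coef0; apply: (le_trans (ltW e0)); apply: Be; rewrite lexx ler01.
near=> x => w; have x01 : 0 < x < 1 by apply/andP; split; near: x; [exact: nbhs_right_gt|exact: nbhs_right_lt].
have [k1 k2] : (forall i : 'I_(size B), (0 < i)%N -> f (node x i) < 1 - x) /\
  \sum_(i < size B | (0 < i)%N) `|B`_i| * kap x i <= e by near: x; exact: kap_near.
have /andP[x0 x1] := x01.
case: w => [|w]; first by rewrite /tgain big1// => i _; rewrite !expr0 subrr mulr0.
have x01' : 0 < x <= 1 by rewrite x0 ltW.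
have /andP[d0 _] := dec_bounds dd x01'.
rewrite tgainE pmulr_rge0//; set v := (1 - x) ^+ w.
have /andP[v0 v1] : 0 < v <= 1 by exact: pow_itv.
have : w.+1%:R * (v * B.[v] - v * \sum_(i < size B | (0 < i)%N) `|B`_i| * kap x i) <=
    \sum_(i < size B) B`_i * nu x i w.+1.
  rewrite -horner_sum [X in _ - _ * X]big_mkcond/= mulrBr !mulr_sumr -sumrB; apply: ler_sum => i _.
  have /andP[h1 _] := nu_bounds i w x01; rewrite node_expr -/v in h1.
  case: (posnP i) => [i0|i0].
    by rewrite !mulr0 subr0 mulrCA; apply: ler_wpM2l => //; rewrite i0.
  have h2 := nu_gap w x01 (k1 i i0); rewrite -/v in h2.
  have h3 : `|nu x i w.+1 - w.+1%:R * v ^+ i.+1| <= w.+1%:R * (v * kap x i) by rewrite ger0_norm ?subr_ge0//; lra.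
  have : `|B`_i * (nu x i w.+1 - w.+1%:R * v ^+ i.+1)| <= `|B`_i| * (w.+1%:R * (v * kap x i)) by rewrite normrM ler_wpM2l.
  rewrite ler_norml => /andP[h4 _].
  by move: h4; rewrite mulrBr; lra.
apply: le_trans; rewrite mulr_ge0// -mulrBr mulr_ge0 ?(ltW v0)// subr_ge0.
by apply: le_trans k2 _; apply: Be; rewrite v1 ltW.
Unshelve. all: end_near. Qed.

(** For states below the level, w x <= 1, the power (1 - x)^w stays above exp(-l), where B is at
    most [b]. The majorant f(1-x)^w - (1-x)^w is chosen because its expectations along the process
    telescope. *)
Lemma tgain_le (B : {poly R}) (e b l : R) : 0 < e -> 0 <= b -> 1 < l -> (forall v, expR (- l) <= v <= 1 -> B.[v] <= b) ->
  \forall x \near (0:R)^'+, forall w, w%:R * x <= 1 ->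
    tgain B x w <= (b + e) * (f (1 - x) ^+ w - (1 - x) ^+ w).
Proof.
move=> e0 b0 l1 Bb.
have e2 : 0 < e / 2 by rewrite divr_gt0.
have : `|B`_0| * (expR (u x / (1 - x)) - 1) @[x --> (0:R)^'+] --> `|B`_0| * (expR (0 / (1 - 0)) - 1).
  apply: cvgM; first exact: cvg_cst.
  apply: cvgB; last exact: cvg_cst.
  apply: cvg_expR; apply: cvgM; first exact: (rate_cvg0 dd).
  apply: cvgV; first by rewrite subr0 oner_neq0.
  by apply: cvgB; [exact: cvg_cst|exact: cvg_at_right_filter].
rewrite mul0r expR0 subrr mulr0 => k0c.
near=> x => w wx; have x01 : 0 < x < 1 by apply/andP; split; near: x; [exact: nbhs_right_gt|exact: nbhs_right_lt].
have [k1 k2] : (forall i : 'I_(size B), (0 < i)%N -> f (node x i) < 1 - x) /\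
  \sum_(i < size B | (0 < i)%N) `|B`_i| * kap x i <= e / 2 by near: x; exact: kap_near.
have /andP[x0 x1] := x01.
have k3 : `|B`_0| * (expR (u x / (1 - x)) - 1) <= e / 2 by near: x; exact: cvgr_le k0c _ e2.
have xl : x <= 1 - l^-1 by near: x; apply: nbhs_right_le; rewrite subr_gt0 invf_lt1//; lra.
case: w wx => [|w] wx.
  by rewrite !expr0 subrr mulr0 /tgain big1// => i _; rewrite !expr0 subrr mulr0.
have x1' : 0 < 1 - x by lra.
have x01' : 0 < x <= 1 by rewrite x0 ltW.
have /andP[d0 _] := dec_bounds dd x01'.
set v := (1 - x) ^+ w.
have /andP[v0 v1] : 0 < v <= 1 by exact: pow_itv.
have lv : expR (- l) <= v.
  have wl : w%:R * x <= 1 by apply: le_trans wx; rewrite ler_wpM2r ?(ltW x0)// ler_nat.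
  rewrite /v -(@lnK _ (1 - x)) ?posrE// -expRM_natl ler_expR.
  have : - (x / (1 - x)) <= ln (1 - x).
    have := @le_ln1Dx R (x / (1 - x)).
    have -> : 1 + x / (1 - x) = (1 - x)^-1 by field; rewrite gt_eqF.
    rewrite lnV ?posrE// => /(_ _); rewrite lerNl; apply.
    by apply: lt_le_trans (_ : 0 <= _); [rewrite ltrN10|rewrite divr_ge0// ltW].
  move=> h; apply: le_trans (_ : w%:R * - (x / (1 - x)) <= _); last by rewrite ler_wpM2l.
  rewrite mulrN lerN2 mulrA ler_pdivrMr//; apply: le_trans wl _.
  have l0 : 0 < l by lra.
  by rewrite mulrC -ler_pdivrMr// mul1r; lra.
(* For i = 0 there is no gap between the node and 1 - x; instead w x <= 1 bounds the w-th power of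
   f(1-x)/(1-x) by exp(u(x)/(1-x)). *)
have h0 : nu x 0 w.+1 <= w.+1%:R * (v + v * (expR (u x / (1 - x)) - 1)).
  have /andP[_ h] := nu_bounds 0 w x01; apply: le_trans h _; rewrite ler_wpM2l//.
  have -> : v + v * (expR (u x / (1 - x)) - 1) = v * expR (u x / (1 - x)) by ring.
  rewrite /node expr1.
  have -> : f (1 - x) = (1 - x) * (1 + loss p x / (1 - x)) by rewrite mulrDr mulr1 mulrCA divff ?gt_eqF// mulr1 /loss; ring.
  rewrite exprMn -/v ler_wpM2l ?(ltW v0)//.
  have q0 : 0 <= loss p x / (1 - x) by rewrite divr_ge0// ltW.
  apply: le_trans (_ : expR (loss p x / (1 - x)) ^+ w <= _).
    by apply: lerXn2r; rewrite ?nnegrE ?expR_ge0 ?addr_ge0// expR_ge1Dx.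
  rewrite -expRM_natl ler_expR mulrA ler_pM2r ?invr_gt0// (decE (loss p) x0) mulrA.
  rewrite -[leRHS]mul1r ler_wpM2r ?(ltW (rate_gt0 dd x01'))//.
  by apply: le_trans wx; rewrite ler_wpM2r ?(ltW x0)// ler_nat.
have up : \sum_(i < size B) B`_i * nu x i w.+1 <=
    w.+1%:R * (v * B.[v] + v * (\sum_(i < size B | (0 < i)%N) `|B`_i| * kap x i +
                              `|B`_0| * (expR (u x / (1 - x)) - 1))).
  have ee : 0 <= expR (u x / (1 - x)) - 1.
    have u0 : 0 < u x := rate_gt0 dd x01'.
    by rewrite subr_ge0 -[X in X <= _]expR0 ler_expR; apply: divr_ge0; apply: ltW.
  case: (posnP (size B)) => [sB|sB].
    have -> : B = 0 by apply/eqP; rewrite -size_poly_eq0 sB.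
    rewrite size_poly0 big_ord0 mulr_ge0// hornerC mulr0 add0r mulr_ge0 ?(ltW v0)// big_ord0 add0r.
    by rewrite mulr_ge0.
  have -> : `|B`_0| * (expR (u x / (1 - x)) - 1) =
     \sum_(i < size B | ~~ (0 < i)%N) `|B`_i| * (expR (u x / (1 - x)) - 1).
    rewrite (big_pred1 (Ordinal sB))//= => i; rewrite -leqNgt leqn0.
    by apply/idP/eqP => [/eqP h|->//]; exact: val_inj.
  rewrite -horner_sum [X in _ * (_ + _ * (X + _))]big_mkcond [X in _ * (_ + _ * (_ + X))]big_mkcond/=.
  rewrite -big_split/= mulr_sumr -big_split/= mulr_sumr; apply: ler_sum => i _.
  have /andP[h1 _] := nu_bounds i w x01; rewrite node_expr -/v in h1.
  pose K := if (0 < i)%N then kap x i else expR (u x / (1 - x)) - 1.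
  have h2 : nu x i w.+1 <= w.+1%:R * (v ^+ i.+1 + v * K).
    rewrite /K; case: (posnP i) => [->|i0]; first by rewrite expr1.
    exact: (nu_gap w x01 (k1 i i0)).
  have h3 : `|nu x i w.+1 - w.+1%:R * v ^+ i.+1| <= w.+1%:R * (v * K) by rewrite ger0_norm ?subr_ge0//; lra.
  have : `|B`_i * (nu x i w.+1 - w.+1%:R * v ^+ i.+1)| <= `|B`_i| * (w.+1%:R * (v * K)) by rewrite normrM ler_wpM2l.
  rewrite ler_norml => /andP[_ h4].
  rewrite (_ : (if (0 < i)%N then _ else _) + _ = `|B`_i| * K); last first.
    by rewrite /K; case: (posnP i) => i0; rewrite ?addr0 ?add0r.
  by move: h4; rewrite mulrBr; lra.
have s1 : 0 <= 1 - x by exact: ltW.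
have sf : 1 - x <= f (1 - x) by rewrite -subr_ge0 ltW.
have dw := exprn_sub_ge w s1 sf; rewrite -/v -[f (1 - x) - (1 - x)]/(loss p x) in dw.
rewrite tgainE; apply: le_trans (ler_wpM2l (ltW d0) up) _.
apply: le_trans (_ : (b + e) * (loss p x * (w.+1%:R * v)) <= _); last first.
  by rewrite ler_wpM2l// addr_ge0// ltW.
have Bv : B.[v] <= b by apply: Bb; rewrite lv v1.
have -> : (b + e) * (loss p x * (w.+1%:R * v)) = loss p x * (w.+1%:R * (v * (b + e))) by ring.
rewrite ler_wpM2l ?(ltW d0)// ler_wpM2l// -mulrDr ler_wpM2l ?(ltW v0)//.
by apply: lerD => //; apply: le_trans (lerD k2 k3) _; rewrite -splitr.
Unshelve. all: end_near. Qed.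

End Test.

(** * Harmonic sums and counting of levels *)

Section Harmonic.
Variable R : realType.

Lemma nat_above (x : R) : 0 <= x -> exists n : nat, [/\ (0 < n)%N, x <= n%:R & n%:R <= x + 1].
Proof.
move=> x0; have /andP[h1 h2] := truncn_itv x0.
by exists (Num.truncn x).+1; split => //; [exact: ltW|rewrite -natr1 lerD2r].
Qed.

Lemma harmonic_le A b : (0 < A <= b)%N ->
  \sum_(A <= i < b) (i.+1%:R^-1 : R) <= ln (b%:R : R) - ln (A%:R : R).
Proof.
move=> /andP[A0 Ab]; rewrite -(telescope_sumr (fun i => ln (i%:R : R)) Ab) big_nat [leRHS]big_nat.
apply: ler_sum => i /andP[Ai _]; have i0 : (0 < i)%N by apply: leq_trans Ai.
by have /andP[] := @ln_succ_bounds R i i0.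
Qed.

Lemma harmonic_ge A b : ln (b.+1%:R : R) - ln (A.+1%:R : R) <= \sum_(A <= i < b) (i.+1%:R^-1 : R).
Proof.
have [Ab|bA] := leqP A b; last first.
  by rewrite (big_geq (ltnW bA)) subr_le0 ler_ln ?posrE ?ltr0n// ler_nat ltnS (ltnW bA).
rewrite -(telescope_sumr (fun i => ln (i.+1%:R : R)) Ab); apply: ler_sum => i _.
by have /andP[] := @ln_succ_bounds R i.+1 isT.
Qed.

(** A layer-cake bound: each level c(i+1) below X accounts for a slice of height c. *)
Lemma count_levels (c X : R) b : 0 <= c -> 0 <= X ->
  \sum_(0 <= i < b) ((c * i.+1%:R <= X)%R%:R : R) * c <= X.
Proof.
move=> c0 X0.
suff h : \sum_(0 <= i < b) ((c * i.+1%:R <= X)%R%:R : R) * c <= Num.min (c * b%:R) X by apply: le_trans h _; rewrite ge_min lexx orbT.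
elim: b => [|b IH]; first by rewrite big_geq// le_min mulr0 lexx.
rewrite big_nat_recr//=; move: IH; rewrite !le_min => /andP[h1 h2].
have e : c * b.+1%:R = c * b%:R + c by rewrite -natr1 mulrDr mulr1.
case: (leP (c * b.+1%:R) X) => h; rewrite ?mul1r ?mul0r ?addr0.
  by rewrite e lerD2r h1/=; apply: le_trans h; rewrite e lerD2r.
by rewrite h2 andbT; apply: le_trans h1 _; rewrite e lerDl.
Qed.

End Harmonic.

(** * Block sums and maxima of an integer sequence *)

Section Blocks.
Implicit Types z : nat -> nat.

Definition peak m z := (\max_(k < m) z k)%N.
(** [block] and [top] are [Sblock] and [Mmax] read on a single path, free of the probability
    space. *)
Definition block j k z := (\sum_(k <= l < k + j) z l)%N.
Definition top m j z := (\max_(0 <= k < (m - j).+1) block j k z)%N.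

Lemma peak_ge m z k : (k < m)%N -> (z k <= peak m z)%N.
Proof. by move=> km; exact: (leq_bigmax (Ordinal km)). Qed.

Lemma block_shift j k z : block j k z = (\sum_(r < j) z (k + r))%N.
Proof. by rewrite /block -{1}[k]add0n big_addn addKn big_mkord; apply: eq_bigr => r _; rewrite addnC. Qed.

Lemma block_le_top m j k z : (k <= m - j)%N -> (block j k z <= top m j z)%N.
Proof.
move=> km; rewrite /top big_mkord; have km' : (k < (m - j).+1)%N by [].
exact: (leq_bigmax (F := fun k : 'I_(m - j).+1 => block j k z) (Ordinal km')).
Qed.

Lemma top_leP m j z x : (forall k, (k <= m - j)%N -> (block j k z <= x)%N) -> (top m j z <= x)%N.
Proof. by move=> h; rewrite /top big_mkord; apply/bigmax_leqP => k _; apply: h; rewrite -ltnS. Qed.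

Lemma top_adapt m j (U : Type) (h : nat -> U) : adapt (m + j) (fun z => h (top m j z)).
Proof.
move=> z z' e; congr h; rewrite /top !big_mkord; apply: eq_bigr => k _.
rewrite !block_shift; apply: eq_bigr => r _; apply: e.
by have := ltn_ord k; have := ltn_ord r; lia.
Qed.

Lemma top_le_sum m j z : (j <= m)%N -> (top m j z <= \sum_(l < m) z l)%N.
Proof.
move=> jm; apply: top_leP => k km; rewrite block_shift.
have e : (m = k + (j + (m - j - k)))%N by lia.
rewrite [in leqRHS]e big_split_ord/= -[leqLHS]add0n leq_add// big_split_ord/=.
by rewrite -[leqLHS]addn0 leq_add.
Qed.

Lemma top_le_peak m j z : (j <= m)%N -> (top m j z <= j * peak m z)%N.
Proof.
move=> jm; apply: top_leP => k km; rewrite block_shift.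
rewrite -[j in leqRHS]card_ord -sum_nat_const; apply: leq_sum => r _.
by apply: peak_ge; have := ltn_ord r; lia.
Qed.

Lemma half_nat m j : (0 < j)%N -> (2 * j <= m)%N ->
  [/\ (j <= m - j)%N, (0 < j <= m)%N, (0 < m)%N & (m <= (m - j).+1 * 2)%N].
Proof. by move=> j0 jm; split; lia. Qed.

End Blocks.

(** * Means of bounded measurable functions *)

Section Mean.
Variables (R : realType) (d : measure_display) (T : measurableType d).
Implicit Types (mu : probability T R) (h g : T -> R).

Definition bmf h := mfunT h /\ exists C, forall x, `|h x| <= C.
Definition mean mu h : R := fine (\int[mu]_x (h x)%:E)%E.

Lemma bmf_integrable mu h : bmf h -> mu.-integrable setT (fun x => (h x)%:E).
Proof.
move=> [mh [C hC]].
have iC : mu.-integrable setT (EFin \o cst C) by apply: finite_measure_integrable_cst.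
apply: le_integrable iC => //; first exact/measurable_EFinP.
by move=> x _; rewrite /= lee_fin; apply: le_trans (hC x) _; exact: ler_norm.
Qed.

Lemma meanE mu h : bmf h -> (\int[mu]_x (h x)%:E)%E = (mean mu h)%:E.
Proof. by move=> bh; rewrite /mean fineK// integrable_fin_num//; exact: bmf_integrable. Qed.

Lemma bmf_cst c : bmf (fun=> c).
Proof. by split => //; exists `|c|. Qed.

Lemma bmfD h g : bmf h -> bmf g -> bmf (fun x => h x + g x).
Proof.
move=> [mh [C hC]] [mg [E gE]]; split; first exact: measurable_funD.
by exists (C + E) => x; apply: le_trans (ler_normD _ _) _; exact: lerD.
Qed.

Lemma bmfM h g : bmf h -> bmf g -> bmf (fun x => h x * g x).
Proof.
move=> [mh [C hC]] [mg [E gE]]; split; first exact: measurable_funM.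
by exists (C * E) => x; rewrite normrM; exact: ler_pM.
Qed.

Lemma bmfZ c h : bmf h -> bmf (fun x => c * h x).
Proof. by move=> bh; apply: bmfM => //; exact: bmf_cst. Qed.

Lemma bmfB h g : bmf h -> bmf g -> bmf (fun x => h x - g x).
Proof.
move=> bh bg; have := bmfD bh (bmfZ (-1) bg).
by under [X in bmf X -> _]eq_fun do rewrite mulN1r.
Qed.

Lemma bmf_indic (A : set T) : measurable A -> bmf (\1_A : T -> R).
Proof.
move=> mA; split; first exact: measurable_indic.
by exists 1 => x; rewrite /indic; case: (_ \in _); rewrite ?normr1 ?normr0.
Qed.

Lemma mean_cst mu c : mean mu (fun=> c) = c.
Proof. by rewrite /mean integral_cst//= probability_setT mule1. Qed.

Lemma meanD mu h g : bmf h -> bmf g -> mean mu (fun x => h x + g x) = mean mu h + mean mu g.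
Proof.
move=> bh bg; apply: EFin_inj; rewrite -meanE; last exact: bmfD.
rewrite EFinD -!meanE// -integralD//; exact: bmf_integrable.
Qed.

Lemma meanZ mu c h : bmf h -> mean mu (fun x => c * h x) = c * mean mu h.
Proof.
move=> bh; apply: EFin_inj; rewrite -meanE; last exact: bmfZ.
by rewrite EFinM -!meanE// -integralZl//; exact: bmf_integrable.
Qed.

Lemma meanB mu h g : bmf h -> bmf g -> mean mu (fun x => h x - g x) = mean mu h - mean mu g.
Proof.
move=> bh bg; rewrite -[in RHS]mulN1r -meanZ// -meanD//; last exact: bmfZ.
by congr mean; apply/funext => x; rewrite mulN1r.
Qed.

Lemma mean_ge0 mu h : (forall x, 0 <= h x) -> 0 <= mean mu h.
Proof. by move=> h0; apply: fine_ge0; apply: integral_ge0 => x _; rewrite lee_fin. Qed.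

Lemma mean_le mu h g : bmf h -> bmf g -> (forall x, h x <= g x) -> mean mu h <= mean mu g.
Proof.
move=> bh bg hg; rewrite -subr_ge0 -meanB//; apply: mean_ge0 => x.
by rewrite subr_ge0.
Qed.

Lemma mean_norm mu h C : bmf h -> (forall x, `|h x| <= C) -> `|mean mu h| <= C.
Proof.
move=> bh hC; rewrite ler_norml; apply/andP; split.
  rewrite -[leLHS](mean_cst mu); apply: mean_le => //; first exact: bmf_cst.
  by move=> x; have := hC x; rewrite ler_norml => /andP[].
rewrite -[leRHS](mean_cst mu); apply: mean_le => //; first exact: bmf_cst.
by move=> x; have := hC x; rewrite ler_norml => /andP[].
Qed.

Lemma mean_close mu h g e : bmf h -> bmf g -> (forall x, `|h x - g x| <= e) ->
  `|mean mu h - mean mu g| <= e.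
Proof. by move=> bh bg hg; rewrite -meanB//; apply: mean_norm => //; exact: bmfB. Qed.

Lemma mean_ae mu h g (N : set T) : measurable N -> mu N = 0%E -> bmf h -> bmf g ->
  (forall x, ~ N x -> h x = g x) -> mean mu h = mean mu g.
Proof.
move=> mN N0 [mh _] [mg _] hg; rewrite /mean; congr fine; apply: ae_eq_integral => //.
- exact/measurable_EFinP.
- exact/measurable_EFinP.
- exists N; split => // x /= hx; apply: contrapT => Nx; apply: hx => _; by rewrite hg.
Qed.

Lemma mean_indic mu (A : set T) : measurable A -> mean mu \1_A = fine (mu A).
Proof. by move=> mA; rewrite /mean integral_indic// setIT. Qed.

Lemma mean_cvg mu (h : nat -> T -> R) g C : (forall n, mfunT (h n)) ->
  (forall n x, `|h n x| <= C) -> (forall x, h n x @[n --> \oo] --> g x) ->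
  mean mu (h n) @[n --> \oo] --> mean mu g.
Proof.
move=> mh hC hg.
have mg : mfunT g by apply: (measurable_fun_cvg (h := h)) => // x _; exact: hg.
have gC x : `|g x| <= C.
  apply: (cvgr_to_le (cvg_norm (hg x))); exact: nearW.
have bg : bmf g by split => //; exists C.
have iC : mu.-integrable setT (EFin \o cst C) by apply: finite_measure_integrable_cst.
have H : (\int[mu]_x (h n x)%:E)%E @[n --> \oo] --> (\int[mu]_x (g x)%:E)%E.
  apply: (@dominated_cvg _ _ _ mu setT measurableT (fun n x => (h n x)%:E) (fun x => (g x)%:E) (cst C%:E)) => //.
  - by move=> n; exact/measurable_EFinP.
  - by move=> x _; apply/fine_cvgP; split; [exact: nearW|exact: hg].
  - by move=> n x _; rewrite /= lee_fin.
by rewrite meanE// in H; move/fine_cvgP: H => [].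
Qed.

(** A function with values in [0,1] is uniformly within 1/n of 1/n times the sum of the indicators
    of its level sets {g >= i/n}; an affine change of scale covers the bounded case. *)
Lemma indicator_closure (C : (T -> R) -> Prop) :
  (forall A, measurable A -> C \1_A) ->
  (forall c f g, C f -> C g -> C (fun x => c * f x + g x)) ->
  (forall f, bmf f -> (forall e, 0 < e -> exists2 g, C g & forall x, `|f x - g x| <= e) -> C f) ->
  forall g, bmf g -> C g.
Proof.
move=> C1 CD Clim.
have C0 : C (fun=> 0) by have := C1 set0 measurable0; rewrite indic0.
have CC : C (fun=> 1) by have := C1 setT measurableT; rewrite indicT.
have CZ c f : C f -> C (fun x => c * f x) by move=> Cf; have := CD c f _ Cf C0; under [X in C X]eq_fun do rewrite addr0.
have Cs n (f : nat -> T -> R) : (forall i, C (f i)) -> C (fun x => \sum_(0 <= i < n) f i x).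
  move=> Cf; elim: n => [|n IH]; first by under eq_fun do rewrite big_geq//.
  under eq_fun do rewrite big_nat_recr//=.
  by have := CD 1 _ _ IH (Cf n); under [X in C X -> _]eq_fun do rewrite mul1r.
have C01 g : mfunT g -> (forall x, 0 <= g x <= 1) -> C g.
  move=> mg g01; apply: Clim.
    by split => //; exists 1 => x; have /andP[h1 h2] := g01 x; rewrite ger0_norm.
  move=> e e0.
  have e'0 : 0 <= e^-1 by rewrite invr_ge0 ltW.
  have [n [n0 n1 _]] := nat_above e'0.
  have n0' : 0 < n%:R :> R by rewrite ltr0n.
  pose c : R := n%:R^-1.
  have c0 : 0 <= c by rewrite invr_ge0.
  pose A i := [set x | c * i.+1%:R <= g x].
  have mA i : measurable (A i).
    rewrite (_ : A i = g @^-1` `[c * i.+1%:R, +oo[); first by rewrite -[X in measurable X]setTI; exact: mg.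
    by apply/seteqP; split => x /=; rewrite in_itv/= andbT.
  exists (fun x => \sum_(0 <= i < n) c * \1_(A i) x); first by apply: Cs => i; apply: CZ; exact: C1.
  move=> x; have /andP[g0 g1] := g01 x.
  have E : \sum_(0 <= i < n) c * \1_(A i) x = \sum_(0 <= i < n) ((c * i.+1%:R <= g x)%R%:R : R) * c.
    apply: eq_bigr => i _; rewrite mulrC; congr ((nat_of_bool _)%:R * _).
    by apply/idP/idP; rewrite inE.
  have up := count_levels n c0 g0.
  have low : Num.min (g x - c) (c * n%:R) <= \sum_(0 <= i < n) ((c * i.+1%:R <= g x)%R%:R : R) * c.
    elim: (n) => [|b IH]; first by rewrite big_geq// mulr0 ge_min lexx orbT.
    rewrite big_nat_recr//=; have eb : c * b.+1%:R = c * b%:R + c by rewrite -natr1 mulrDr mulr1.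
    case: (leP (c * b.+1%:R) (g x)) => hb; rewrite ?mul1r ?mul0r ?addr0.
      rewrite ge_min; apply/orP; right; rewrite eb lerD2r; apply: le_trans IH.
      by rewrite le_min lexx andbT; move: hb; rewrite eb; lra.
    rewrite ge_min; apply/orP; left; apply: le_trans IH.
    by rewrite le_min lexx/=; move: hb; rewrite eb; lra.
  have cn : c * n%:R = 1 by rewrite mulVf// gt_eqF.
  rewrite cn min_l in low; last by lra.
  rewrite E ger0_norm ?subr_ge0//.
  have ce : c <= e by rewrite -[leRHS]invrK lef_pV2 ?posrE// invr_gt0.
  by lra.
move=> g [mg [K gK]].
pose M := `|K| + 1; have M0 : 0 < M by rewrite ltr_wpDl.
have gM x : - M <= g x <= M by rewrite -ler_norml /M; apply: le_trans (gK x) _; apply: le_trans (ler_norm _) _; lra.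
have Ch : C (fun x => (g x + M) / (2 * M)).
  apply: C01.
    by apply: measurable_funM => //; exact: measurable_funD.
  move=> x; have /andP[h1 h2] := gM x.
  rewrite ler_pdivrMr ?mulr_gt0// mul1r divr_ge0 ?mulr_ge0 ?(ltW M0)//=; lra.
have := CD (2 * M) _ _ Ch (CZ (- M) _ CC).
rewrite (_ : (fun x => _) = g)//; apply/funext => x; field.
by rewrite gt_eqF.
Qed.

End Mean.

(** * Transition operators of the limit process *)

Section Kernel.
Variables (R : realType) (a : R) (Q : R -> R -> probability R R).
Hypothesis a01 : 0 < a <= 1.
Hypothesis hQ : csbp_kernel a Q.
Local Notation psi := (csbp_exponent a).
Let a0 : 0 < a. Proof. by case/andP: a01. Qed.

(** The starting point is cut at 0 because the kernel is described for nonnegative starting points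
    only; the operator is then defined on all of R. *)
Definition op t (h : R -> R) (y : R) : R := mean (Q t (pos y)) h.
Definition expf (c : R) : R -> R := fun y => expR (- (c * pos y)).

Lemma posE (x : R) : 0 <= x -> pos x = x.
Proof. by move=> x0; rewrite /pos max_l. Qed.

Lemma pos_le0 (x : R) : x <= 0 -> pos x = 0.
Proof. by move=> x0; rewrite /pos max_r. Qed.

Lemma measurable_pos : mfunT (@pos R).
Proof. by apply: measurable_maxr. Qed.

Lemma measurable_expf c : mfunT (expf c).
Proof.
apply: measurableT_comp => //; apply: measurable_funN; apply: measurable_funM => //.
exact: measurable_pos.
Qed.

Lemma expf_itv c y : 0 <= c -> 0 <= expf c y <= 1.
Proof. by move=> c0; rewrite expR_ge0 expR_le1 oppr_le0 mulr_ge0// pos_ge0. Qed.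

Lemma bmf_expf c : 0 <= c -> bmf (expf c).
Proof.
move=> c0; split; first exact: measurable_expf.
by exists 1 => y; have /andP[h1 h2] := expf_itv y c0; rewrite ger0_norm.
Qed.

Lemma psi_gt0 t c : 0 <= t -> 0 < c -> 0 < psi t c.
Proof. by move=> t0 c0; rewrite powR_gt0// ltr_wpDl// powR_gt0. Qed.

(** The quantity psi_t(c)^(-a) = t + c^(-a) is additive in time: Chapman-Kolmogorov at the level of
    exponents. *)
Lemma psi_add s t c : 0 <= s -> 0 <= t -> 0 < c -> psi s (psi t c) = psi (s + t) c.
Proof.
move=> s0 t0 c0; have h : 0 <= t + c `^ (- a) by rewrite addr_ge0// powR_ge0.
have E : psi t c `^ (- a) = t + c `^ (- a) by rewrite /csbp_exponent -powRrM mulrNN mulVf ?gt_eqF// powRr1.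
by rewrite {1}/csbp_exponent E addrA.
Qed.

Lemma psi0 c : 0 < c -> psi 0 c = c.
Proof. by move=> c0; rewrite /csbp_exponent add0r -powRrM mulrNN mulfV ?gt_eqF// powRr1// ltW. Qed.

Lemma mean_pos_ae (mu : probability R R) (h g : R -> R) : mu `]-oo, 0[ = 0%E -> bmf h -> bmf g ->
  (forall y, 0 <= y -> h y = g y) -> mean mu h = mean mu g.
Proof.
move=> m0 bh bg hg.
have mN : measurable (`]-oo, 0[%classic : set R) by exact: measurable_itv.
apply: (mean_ae mN m0 bh bg) => x; rewrite /= in_itv/= => /negP; rewrite -leNgt; exact: hg.
Qed.

Lemma op_expf t c y : 0 <= t -> 0 < c -> op t (expf c) y = expf (psi t c) y.
Proof.
move=> t0 c0; have [n0 /(_ c c0) E] := hQ t0 (pos_ge0 y).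
rewrite /op /mean.
have -> : (\int[Q t (pos y)]_x (expf c x)%:E = \int[Q t (pos y)]_x (expR (- c * x))%:E)%E.
  apply: ae_eq_integral => //.
  - by apply/measurable_EFinP; exact: measurable_expf.
  - by apply/measurable_EFinP; apply: measurableT_comp => //; exact: measurable_funM.
  - exists (`]-oo, 0[%classic : set R); split; [exact: measurable_itv|by []|].
    move=> x /= hx; rewrite in_itv/= ltNge; apply/negP => x0; apply: hx => _.
    by rewrite /expf posE// mulNr.
by rewrite E /= /expf mulNr mulrC.
Qed.

Lemma op_close t h g e y : bmf h -> bmf g -> (forall x, `|h x - g x| <= e) ->
  `|op t h y - op t g y| <= e.
Proof. exact: mean_close. Qed.

Lemma measurable_op_closure t f : bmf f ->
  (forall e, 0 < e -> exists2 g, bmf g /\ mfunT (op t g) & forall x, `|f x - g x| <= e) ->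
  mfunT (op t f).
Proof.
move=> bf H.
have H' n : exists g, [/\ bmf g, mfunT (op t g) & forall x, `|f x - g x| <= n.+1%:R^-1].
  have i0 : 0 < n.+1%:R^-1 :> R by rewrite invr_gt0.
  by have [g [h1 h2] h3] := H _ i0; exists g.
have [g Hg] := choice H'.
apply: (measurable_fun_cvg (h := fun n => op t (g n))); first by move=> n; have [] := Hg n.
move=> y _; apply/cvgrPdist_le => e e0.
have e'0 : 0 <= e^-1 by rewrite invr_ge0 ltW.
have [N [N0 N1 _]] := nat_above e'0.
near=> n; have [bg _ gn] := Hg n.
apply: le_trans (op_close _ _ bf bg gn) _.
rewrite -[leRHS]invrK lef_pV2 ?posrE ?invr_gt0//; apply: le_trans N1 _; rewrite ler_nat.
by apply: leqW; near: n; exact: nbhs_infty_ge.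
Unshelve. all: end_near. Qed.

Lemma measurable_op_poly t (B : {poly R}) : 0 <= t ->
  bmf (fun y => B.[expf 1 y]) /\ mfunT (op t (fun y => B.[expf 1 y])).
Proof.
move=> t0.
have E y : B.[expf 1 y] = \sum_(i < size B) B`_i * expf i%:R y.
  rewrite horner_coef; apply: eq_bigr => i _; congr (_ * _).
  by rewrite /expf mul1r -expRM_natl mulrN.
have bs n (c : nat -> R) : bmf (fun y => \sum_(i < n) c i * expf i%:R y) /\
    mfunT (op t (fun y => \sum_(i < n) c i * expf i%:R y)).
  elim: n => [|n [IH1 IH2]].
    under [X in bmf X]eq_fun do rewrite big_ord0; under [X in op t X]eq_fun do rewrite big_ord0.
    split; first exact: bmf_cst.
    by rewrite (_ : op t _ = fun=> 0)//; apply/funext => y; rewrite /op mean_cst.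
  under [X in bmf X]eq_fun do rewrite big_ord_recr/=; under [X in op t X]eq_fun do rewrite big_ord_recr/=.
  have bn : bmf (expf n%:R) by exact: bmf_expf.
  split; first by apply: bmfD => //; exact: bmfZ.
  rewrite (_ : op t _ = fun y => op t (fun y => \sum_(i < n) c i * expf i%:R y) y + c n * op t (expf n%:R) y); last first.
    by apply/funext => y; rewrite /op meanD// ?meanZ//; exact: bmfZ.
  apply: measurable_funD => //; apply: measurable_funM => //.
  case: n {IH1 IH2 bn} => [|n].
    rewrite (_ : op t _ = fun=> 1)//; apply/funext => y; rewrite /op -[RHS](mean_cst (Q t (pos y)) 1).
    by congr mean; apply/funext => x; rewrite /expf mul0r oppr0 expR0.
  rewrite (_ : op t _ = expf (psi t n.+1%:R)); first exact: measurable_expf.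
  by apply/funext => y; rewrite op_expf.
by under [X in bmf X]eq_fun do rewrite E; under [X in op t X]eq_fun do rewrite E; exact: bs.
Qed.

Lemma measurable_op_Lipschitz t (F : R -> R) (Lip : R) : 0 <= t -> 0 <= Lip ->
  (forall x y, 0 <= x <= 1 -> 0 <= y <= 1 -> `|F x - F y| <= Lip * `|x - y|) ->
  bmf (fun y => F (expf 1 y)) -> mfunT (op t (fun y => F (expf 1 y))).
Proof.
move=> t0 L0 FL bF; apply: measurable_op_closure => // e e0.
have [B HB] := weierstrass L0 e0 FL.
exists (fun y => B.[expf 1 y]); first exact: measurable_op_poly.
by move=> y; rewrite distrC; apply: HB; exact: expf_itv.
Qed.

(** Measurability of the kernel in its starting point is recovered from the Laplace transform:
    exponentials go to exponentials, hence polynomials in exp(-y), Lipschitz functions of exp(-y)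
    and, in the limit, indicators of rays have measurable images. *)
Lemma measurable_Q_ray t (c : R) : 0 <= t -> mfunT (fun y => Q t (pos y) `]c, +oo[).
Proof.
move=> t0; have mI : measurable (`]c, +oo[%classic : set R) by exact: measurable_itv.
have E y : Q t (pos y) `]c, +oo[ = (op t (\1_`]c, +oo[) y)%:E.
  rewrite /op mean_indic// fineK// ge0_fin_numE//.
  by apply: le_lt_trans (probability_le1 _ _) _ => //; exact: ltry.
under eq_fun do rewrite E; apply/measurable_EFinP.
have [c0|c0] := ltP c 0.
  rewrite (_ : op t _ = fun=> 1)//; apply/funext => y; rewrite -[RHS](mean_cst (Q t (pos y)) 1).
  have [n0 _] := hQ t0 (pos_ge0 y).
  apply: (mean_pos_ae n0); [exact: bmf_indic|exact: bmf_cst|].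
  by move=> x x0; rewrite indicE mem_set//= in_itv/= andbT; lra.
(* Lipschitz ramps in v = exp(-x) that increase to the indicator of v < exp(-c), that is of x >
   c. *)
pose F n v : R := Num.min 1 (n%:R * pos (expR (- c) - v)).
have F01 n v : 0 <= F n v <= 1 by rewrite /F le_min ler01 ge_min lexx mulr_ge0// pos_ge0.
have mF n : mfunT (fun y => F n (expf 1 y)).
  apply: measurable_minr => //; apply: measurable_funM => //.
  apply: (measurableT_comp measurable_pos); apply: measurable_funB => //; exact: measurable_expf.
have bF n : bmf (fun y => F n (expf 1 y)) by split => //; exists 1 => y; have /andP[h1 h2] := F01 n (expf 1 y); rewrite ger0_norm.
apply: (measurable_fun_cvg (h := fun n => op t (fun y => F n (expf 1 y)))).
  move=> n; apply: (@measurable_op_Lipschitz _ (F n) n%:R) => // x y _ _.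
  have ml (s u : R) : `|Num.min 1 s - Num.min 1 u| <= `|s - u|.
    case: (leP 1 s) => hs; case: (leP 1 u) => hu; rewrite ?subrr ?normr0//.
    - by rewrite !ger0_norm; lra.
    - by rewrite distrC !(distrC s) !ger0_norm; lra.
  have pl (s u : R) : `|pos s - pos u| <= `|s - u|.
    rewrite /pos; case: (leP s 0) => s0; case: (leP u 0) => u0; rewrite ?subrr ?normr0// ?subr0 ?sub0r ?normrN.
    - by rewrite ger0_norm ?(ltW u0)// distrC ger0_norm//; lra.
    - by rewrite ger0_norm ?(ltW s0)// ger0_norm//; lra.
  apply: le_trans (ml _ _) _; rewrite -mulrBr normrM ger0_norm// ler_wpM2l//.
  by apply: le_trans (pl _ _) _; rewrite opprB addrC addrA subrK distrC.
move=> y _; apply: (@mean_cvg _ _ _ _ _ _ 1) => //.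
  by move=> n x; have /andP[h1 h2] := F01 n (expf 1 x); rewrite ger0_norm.
move=> z; have [zc|zc] := ltP c z.
  rewrite indicE mem_set/=; last by rewrite in_itv/= zc.
  have g0 : 0 < expR (- c) - expf 1 z by rewrite subr_gt0 /expf mul1r ltr_expR ltrN2 posE//; lra.
  have ig0 : 0 <= (expR (- c) - expf 1 z)^-1 by rewrite invr_ge0 ltW.
  have [N [_ N1 _]] := nat_above ig0.
  apply: (@near_cvg R _ _ _ (fun=> 1)); last exact: cvg_cst.
  near=> n; rewrite /F min_l// posE ?(ltW g0)// -ler_pdivrMr// mul1r; apply: le_trans N1 _.
  by rewrite ler_nat; near: n; exact: nbhs_infty_ge.
rewrite indicE memNset/=; last by rewrite in_itv/= andbT; apply/negP; rewrite -leNgt.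
apply: (@near_cvg R _ _ _ (fun=> 0)); last exact: cvg_cst.
apply: nearW => n; rewrite /F pos_le0 ?mulr0 ?min_r//.
rewrite subr_le0 /expf mul1r ler_expR lerN2.
by apply: pos_le.
Unshelve. all: end_near. Qed.

(** Open rays are stable under intersection and generate the Borel sets, so Dynkin's argument
    applies. *)
Lemma measurable_Q t (U : set R) : 0 <= t -> measurable U ->
  mfunT (fun y => Q t (pos y) U).
Proof.
move=> t0 mU.
have E : @measurable _ (measurableTypeR R) = <<s @RGenOInfty.G R >> by exact: RGenOInfty.measurableE.
suff : forall S, <<s @RGenOInfty.G R >> S -> mfunT (fun y => Q t (pos y) S) by apply; rewrite -E.
apply: (@dynkin_induction _ (measurableTypeR R) (@RGenOInfty.G R) (fun S => mfunT (fun y => Q t (pos y) S))).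
- exact: RGenOInfty.measurableE.
- move=> _ _ [x ->] [y ->]; exists (Num.max x y).
  by apply/seteqP; split => z /=; rewrite !in_itv/= !andbT gt_max; [move=> [-> ->]|move=> /andP[]].
- by rewrite (_ : (fun y => _) = cst 1%E)//; apply/funext => y; exact: probability_setT.
- by move=> _ [x ->]; exact: measurable_Q_ray.
- move=> S mS HS; under eq_fun do rewrite probability_setC//.
  by apply: emeasurable_funB.
- move=> F mF tF HF.
  rewrite (_ : (fun y => _) = (fun y => \sum_(0 <= i <oo) Q t (pos y) (F i))%E); last first.
    by apply/funext => y; apply: measure_semi_bigcup => //; exact: bigcupT_measurable.
  apply: ge0_emeasurable_sum => //.
Qed.

Lemma op_linear t c f g y : bmf f -> bmf g ->
  op t (fun x => c * f x + g x) y = c * op t f y + op t g y.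
Proof. by move=> bf bg; rewrite /op meanD ?meanZ//; exact: bmfZ. Qed.

Lemma op_bmf t h : 0 <= t -> bmf h -> bmf (op t h).
Proof.
move=> t0 bh; split; last by have [_ [C hC]] := bh; exists C => y; exact: mean_norm.
suff [] : bmf h /\ mfunT (op t h) by [].
apply: (@indicator_closure R _ _ (fun h => bmf h /\ mfunT (op t h))) bh.
- move=> A mA; split; first exact: bmf_indic.
  rewrite (_ : op t _ = fun y => fine (Q t (pos y) A)).
    by apply: measurableT_comp => //; exact: measurable_Q.
  by apply/funext => y; rewrite /op mean_indic.
- move=> c f g [bf mf] [bg mg]; split; first by apply: bmfD => //; exact: bmfZ.
  rewrite (_ : op t _ = fun y => c * op t f y + op t g y); last by apply/funext => y; exact: op_linear.
  by apply: measurable_funD => //; exact: measurable_funM.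
- by move=> f bf H; split => //; exact: measurable_op_closure.
Qed.

Definition le0 (z : R) : R := (z <= 0)%R%:R.
Definition gt0 (z : R) : R := (0 < z)%R%:R.

Lemma gt0E z : gt0 z = 1 - le0 z.
Proof. by rewrite /gt0 /le0 ltNge; case: (z <= 0); rewrite ?subrr ?subr0. Qed.

Lemma bmf_gt0 : bmf gt0.
Proof.
rewrite (_ : gt0 = \1_`]0, +oo[); first by apply: bmf_indic; exact: measurable_itv.
by apply/funext => z; rewrite indicE /gt0; congr ((nat_of_bool _)%:R); apply/idP/idP; rewrite inE/= in_itv/= andbT.
Qed.

Lemma bmf_le0 : bmf le0.
Proof.
rewrite (_ : le0 = \1_`]-oo, 0]); first by apply: bmf_indic; exact: measurable_itv.
by apply/funext => z; rewrite indicE /le0; congr ((nat_of_bool _)%:R); apply/idP/idP; rewrite inE/= in_itv/=.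
Qed.

Lemma mean_le0_cvg (mu : probability R R) :
  mean mu (expf n%:R) @[n --> \oo] --> mean mu le0.
Proof.
apply: (@mean_cvg _ _ _ _ _ _ 1).
- by move=> n; exact: measurable_expf.
- by move=> n x; have /andP[h1 h2] := expf_itv x (ler0n R n); rewrite ger0_norm.
move=> x; rewrite /le0 /expf; have [x0|x0] := leP x 0.
  by under eq_fun do rewrite pos_le0// mulr0 oppr0 expR0; exact: cvg_cst.
rewrite posE ?(ltW x0)//.
have h : expR (- x) ^+ n @[n --> \oo] --> (0 : R) by apply: cvg_expr; rewrite ger0_norm ?expR_ge0// expR_lt1 oppr_lt0.
apply: near_cvg h; apply: nearW => n; by rewrite -expRM_natl mulrN.
Qed.

Lemma powR_inv_cvg0 : (n%:R `^ (- a) : R) @[n --> \oo] --> 0.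
Proof.
apply/cvgrPdist_le => e e0.
have e'0 : 0 <= e `^ (- a^-1) by exact: powR_ge0.
have [N [N0 N1 _]] := nat_above e'0.
near=> n; have nN : (N <= n)%N by near: n; exact: nbhs_infty_ge.
rewrite sub0r normrN ger0_norm ?powR_ge0//.
have -> : e = (e `^ (- a^-1)) `^ (- a) by rewrite -powRrM mulrNN mulVf ?gt_eqF// powRr1// ltW.
rewrite !(powRN _ a) lef_pV2 ?posrE ?powR_gt0 ?ltr0n//; last exact: leq_trans N0 nN.
apply: ge0_ler_powR; rewrite ?nnegrE ?(ltW a0)//; apply: le_trans N1 _; by rewrite ler_nat.
Unshelve. all: end_near. Qed.

(** The extinction probability, as the limit of the Laplace transform when its argument tends to
    infinity. *)
Lemma op_le0 u y : 0 < u -> op u le0 y = expf (u `^ (- a^-1)) y.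
Proof.
move=> u0; have H := @mean_le0_cvg (Q u (pos y)).
apply: (cvg_unique _ H) => //.
have C : expf ((u + n%:R `^ (- a)) `^ (- a^-1)) y @[n --> \oo] --> expf (u `^ (- a^-1)) y.
  apply: cvg_expR; apply: cvgN; apply: cvgM; last exact: cvg_cst.
  apply: cvg_powR => //; rewrite -[X in _ --> X]addr0; apply: cvgD; [exact: cvg_cst|exact: powR_inv_cvg0].
apply: near_cvg C; near=> n; rewrite -/(op u (expf n%:R) y) op_expf ?(ltW u0)// ltr0n.
by near: n; exact: nbhs_infty_gt.
Unshelve. all: end_near. Qed.

Lemma op0_le0 y : op 0 le0 y = le0 y.
Proof.
have H := @mean_le0_cvg (Q 0 (pos y)); apply: (cvg_unique _ H) => //.
have C : expf n%:R y @[n --> \oo] --> le0 y.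
  rewrite /le0 /expf; have [y0|y0] := leP y 0.
    by under eq_fun do rewrite pos_le0// mulr0 oppr0 expR0; exact: cvg_cst.
  rewrite posE ?(ltW y0)//.
  have h : expR (- y) ^+ n @[n --> \oo] --> (0 : R) by apply: cvg_expr; rewrite ger0_norm ?expR_ge0// expR_lt1 oppr_lt0.
  by apply: near_cvg h; apply: nearW => n; rewrite -expRM_natl mulrN.
apply: near_cvg C; near=> n; rewrite -/(op 0 (expf n%:R) y) op_expf// ?psi0// ltr0n.
all: by near: n; exact: nbhs_infty_gt.
Unshelve. all: end_near. Qed.

Lemma opB t f g y : bmf f -> bmf g -> op t (fun x => f x - g x) y = op t f y - op t g y.
Proof. by move=> bf bg; exact: meanB. Qed.

Lemma op_gt0 t y : op t gt0 y = 1 - op t le0 y.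
Proof.
rewrite (_ : gt0 = fun x => 1 - le0 x); last by apply/funext => x; exact: gt0E.
rewrite opB; [by rewrite /op mean_cst|exact: bmf_cst|exact: bmf_le0].
Qed.

Lemma survE u y : 0 <= y -> surv Q u y = op u gt0 y.
Proof.
move=> y0; rewrite /op posE// /surv (_ : gt0 = \1_`]0, +oo[).
  by rewrite mean_indic//; exact: measurable_itv.
by apply/funext => z; rewrite indicE /gt0; congr ((nat_of_bool _)%:R); apply/idP/idP; rewrite inE/= in_itv/= andbT.
Qed.

(** Started at 0, the extinction probability is 1, so the law is a point mass at 0. *)
Lemma op_zero t h y : bmf h -> 0 <= t -> y <= 0 -> op t h y = h 0.
Proof.
move=> bh t0 y0.
have l1 : op t le0 y = 1.
  have [->|tn0] := eqVneq t 0; first by rewrite op0_le0 /le0 y0.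
  rewrite op_le0; first by rewrite /expf pos_le0// mulr0 oppr0 expR0.
  by rewrite lt_neqAle eq_sym tn0.
have g1 : op t gt0 y = 0 by rewrite op_gt0 l1 subrr.
have [n0 _] := hQ t0 (pos_ge0 y).
have -> : op t h y = op t (fun x => h x * gt0 x + h 0 * le0 x) y.
  apply: (mean_pos_ae n0) => //.
    by apply: bmfD; [apply: bmfM => //; exact: bmf_gt0|apply: bmfZ; exact: bmf_le0].
  move=> x x0; rewrite gt0E /le0; have [xl|xg] := leP x 0; last by rewrite subr0 mulr1 mulr0 addr0.
  by rewrite subrr mulr0 add0r mulr1; congr h; apply/eqP; rewrite eq_le xl.
have bhg : bmf (fun x => h x * gt0 x) by apply: bmfM => //; exact: bmf_gt0.
rewrite /op meanD//; last by apply: bmfZ; exact: bmf_le0.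
rewrite meanZ; last exact: bmf_le0.
rewrite -[mean _ le0]/(op t le0 y) l1 mulr1 -[RHS]add0r; congr (_ + _).
have [_ [C hC]] := bh.
apply/eqP; rewrite -normr_le0.
have : `|mean (Q t (pos y)) (fun x => h x * gt0 x)| <= C * op t gt0 y.
  rewrite -meanZ; last exact: bmf_gt0.
  rewrite ler_norml -mulN1r -meanZ; last by apply: bmfZ; exact: bmf_gt0.
  have hb x : `|h x * gt0 x| <= C * gt0 x by rewrite normrM [X in _ * X]ger0_norm ?ler0n// ler_wpM2r ?ler0n.
  apply/andP; split; apply: mean_le => //.
  - by apply: bmfZ; apply: bmfZ; exact: bmf_gt0.
  - by move=> x; have := hb x; rewrite ler_norml mulN1r => /andP[].
  - by apply: bmfZ; exact: bmf_gt0.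
  - by move=> x; have := hb x; rewrite ler_norml => /andP[].
by rewrite g1 mulr0.
Qed.

(** * Finite-dimensional laws and Laplace transforms of [X^*] *)

Section Paths.

(** [F] is controlled on [0, oo) only and may fail to be measurable. The integral is the supremum
    over simple functions below [F], each of which is dominated almost everywhere by the measurable
    function [H]; conversely simple functions below [H] lie below [F]. *)
Lemma null_integral (mu : probability R R) (F : R -> \bar R) (h : R -> R) :
  mu `]-oo, 0[ = 0%E -> bmf h -> (forall y, (0 <= F y)%E) ->
  (forall y, 0 <= y -> F y = (h y)%:E) -> (\int[mu]_y F y = (mean mu h)%:E)%E.
Proof.
move=> m0 bh F0 Fh.
have h0 y : 0 <= y -> 0 <= h y by move=> y0; rewrite -lee_fin -Fh.
pose H y := h y * \1_(`[0, +oo[%classic : set R) y.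
have bH : bmf H by apply: bmfM => //; exact: bmf_indic.
have Hp y : 0 <= y -> H y = h y by move=> y0; rewrite /H indicE mem_set ?mulr1//= in_itv/= y0.
have Hn y : y < 0 -> H y = 0 by move=> y0; rewrite /H indicE memNset ?mulr0//= in_itv/= andbT; apply/negP; rewrite -ltNge.
have H0 y : 0 <= H y by have [y0|y0] := leP 0 y; [rewrite Hp// h0|rewrite Hn].
rewrite (mean_pos_ae m0 bh bH) => [|y y0]; last by rewrite Hp.
rewrite -meanE//; apply/eqP; rewrite eq_le; apply/andP; split.
  rewrite ge0_integralTE//; apply: ge_ereal_sup => _ [s /= sF <-]; rewrite -integralT_nnsfun.
  apply: ae_ge0_le_integral; first exact: measurableT.
  - by move=> x _; rewrite lee_fin.
  - exact/measurable_EFinP.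
  - by move=> x _; rewrite lee_fin.
  - by apply/measurable_EFinP; case: bH.
  - exists (`]-oo, 0[%classic : set R); split; [exact: measurable_itv|by []|].
    move=> x /= hx; rewrite in_itv/= ltNge; apply/negP => x0; apply: hx => _.
    by rewrite Hp// -Fh.
rewrite [leRHS]ge0_integralTE// ge0_integralTE; last by move=> x; rewrite lee_fin.
apply: le_ereal_sup => _ [s /= sH <-]; exists s => //= x; apply: le_trans (sH x) _.
have [x0|x0] := leP 0 x; first by rewrite Hp// Fh.
by rewrite Hn.
Qed.
Let sv u := op u gt0.

Let sv01 u y : 0 <= sv u y <= 1.
Proof.
rewrite /sv op_gt0; have : 0 <= op u le0 y by apply: mean_ge0 => x; rewrite /le0.
have : op u le0 y <= 1.
  rewrite -[leRHS](mean_cst (Q u (pos y))); apply: mean_le; [exact: bmf_le0|exact: bmf_cst|].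
  by move=> x; rewrite /le0; case: (x <= 0).
by lra.
Qed.
Let sv_bmf u : 0 <= u -> bmf (sv u).
Proof. by move=> u0; apply: op_bmf => //; exact: bmf_gt0. Qed.

(** A transition without normalisation: a step that crosses time 1 records survival there through
    [sv 0], all other steps are plain. *)
Definition step s t (h : R -> R) : R -> R :=
  if (1 <= s) || (t < 1) then op (t - s) h
  else op (1 - s) (fun y => sv 0 y * op (t - 1) h y).

(** Time 1 is left out because the grid times never meet it, which avoids the borderline case of the
    conditioning. *)
Definition ok (s t : R) := (s < t) && (t != 1).

Lemma step_bmf s t h : ok s t -> bmf h -> bmf (step s t h).
Proof.
move=> /andP[st t1] bh; rewrite /step; have [s1|s1] := leP 1 s => /=.
  by apply: op_bmf => //; lra.
have [t1'|t1'] := ltP t 1; first by apply: op_bmf => //; lra.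
apply: op_bmf; first by lra.
by apply: bmfM; [exact: sv_bmf|apply: op_bmf => //; lra].
Qed.

Lemma step_linear s t c f g y : ok s t -> bmf f -> bmf g ->
  step s t (fun x => c * f x + g x) y = c * step s t f y + step s t g y.
Proof.
move=> /andP[st t1] bf bg; rewrite /step; have [s1|s1] := leP 1 s => /=; first by rewrite op_linear.
have [t1'|t1'] := ltP t 1; first by rewrite op_linear.
have t10 : 0 <= t - 1 by lra.
rewrite (_ : (fun y => _) = fun y => c * (sv 0 y * op (t - 1) f y) + sv 0 y * op (t - 1) g y); last first.
  by apply/funext => z; rewrite op_linear//; ring.
by rewrite op_linear//; apply: bmfM; [exact: sv_bmf|exact: op_bmf|exact: sv_bmf|exact: op_bmf].
Qed.

Lemma step_bound s t h C y : ok s t -> bmf h -> (forall x, `|h x| <= C) -> `|step s t h y| <= C.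
Proof.
move=> /andP[st t1] bh hC; rewrite /step; have [s1|s1] := leP 1 s => /=; first exact: mean_norm.
have [t1'|t1'] := ltP t 1; first exact: mean_norm.
have t10 : 0 <= t - 1 by lra.
apply: mean_norm; first by apply: bmfM; [exact: sv_bmf|exact: op_bmf].
move=> x; rewrite normrM; have /andP[h1 h2] := sv01 0 x; rewrite (ger0_norm h1).
rewrite -[leRHS]mul1r; apply: ler_pM => //; exact: mean_norm.
Qed.

(** This is [tailfdd] multiplied by the survival probability of the current state. The quotients of
    the h-transform then telescope, and a single weight remains, at time 1 or at the last time
    before it. *)
Fixpoint tailR s (l : seq (R * (R -> R))) : R -> R :=
  match l with
  | [::] => if s < 1 then sv (1 - s) else fun=> 1
  | (t, g) :: l' => step s t (fun y => g y * tailR t l' y)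
  end.

Fixpoint timed (U : Type) s (l : seq (R * U)) : Prop :=
  match l with [::] => True | (t, _) :: l' => ok s t /\ timed t l' end.

Fixpoint all_bmf (l : seq (R * (R -> R))) : Prop :=
  match l with [::] => True | (_, g) :: l' => bmf g /\ all_bmf l' end.

Lemma tailR_bmf s l : timed s l -> all_bmf l -> bmf (tailR s l).
Proof.
elim: l s => [|[t g] l IH] s /=.
  by move=> _ _; case: ltP => s1; [apply: sv_bmf; lra|exact: bmf_cst].
by move=> [ts tl] [bg bl]; apply: step_bmf => //; apply: bmfM => //; exact: IH.
Qed.

Lemma timed_map (U V : Type) (F : U -> V) s (l : seq (R * U)) :
  timed s (map (fun x => (x.1, F x.2)) l) <-> timed s l.
Proof.
elim: l s => [|[t g] l IH] s //=; split => -[h1 h2]; split => //; exact/IH.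
Qed.

Definition ind (x : R * set R) : R * (R -> R) := (x.1, \1_(x.2)).

Lemma all_bmf_ind l : measurable_list l -> all_bmf (map ind l).
Proof. by elim: l => [|[t A] l IH] //= [mA ml]; split; [exact: bmf_indic|exact: IH]. Qed.

Lemma all_bmf_cat l1 l2 : all_bmf (l1 ++ l2) <-> all_bmf l1 /\ all_bmf l2.
Proof.
elim: l1 => [|[t g] l IH] /=; first by split => // -[].
by split => [[bg /IH[h1 h2]]|[[bg h1] h2]]; do ?split => //; apply/IH.
Qed.

Let surv_ge0 u y : 0 <= surv Q u y.
Proof. by apply: fine_ge0; exact: measure_ge0. Qed.

Lemma tailfdd_ge0 s x l : (0 <= tailfdd Q s x l)%E.
Proof.
elim: l s x => [|[t A] l IH] s x //=.
case: ifP => _.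
  by apply: integral_ge0 => y _; apply: mule_ge0 => //; rewrite lee_fin divr_ge0// mulr_ge0.
case: ifP => _; first by apply: integral_ge0 => y _; apply: mule_ge0 => //; rewrite lee_fin.
apply: integral_ge0 => z _; apply: mule_ge0; first by rewrite lee_fin divr_ge0.
by apply: integral_ge0 => y _; apply: mule_ge0 => //; rewrite lee_fin.
Qed.

Lemma tailR_zero s l : s < 1 -> timed s l -> all_bmf l -> 0 <= s -> tailR s l 0 = 0.
Proof.
elim: l s => [|[t g] l IH] s s1 /=.
  move=> _ _ s0; rewrite s1 /sv op_zero//; [by rewrite /gt0 ltxx|exact: bmf_gt0|lra].
move=> [/andP[st t1] tl] [bg bl] s0; have bt := tailR_bmf tl bl.
rewrite /step leNgt s1/=; have [t1'|t1'] := ltP t 1.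
  rewrite op_zero ?lexx//; last by lra.
    by rewrite IH ?mulr0//; lra.
  exact: bmfM.
rewrite op_zero ?lexx//; last by lra.
  by rewrite /sv op_zero//; [rewrite /gt0 ltxx mul0r|exact: bmf_gt0].
by apply: bmfM; [exact: sv_bmf|apply: op_bmf; [lra|exact: bmfM]].
Qed.

Lemma surv_gt0 u x : 0 <= u -> 0 < x -> 0 < surv Q u x.
Proof.
move=> u0 x0; rewrite survE ?(ltW x0)// op_gt0 subr_gt0.
have [->|un0] := eqVneq u 0; first by rewrite op0_le0 /le0 leNgt x0.
have u0' : 0 < u by rewrite lt_neqAle eq_sym un0.
by rewrite op_le0// /expf expR_lt1 oppr_lt0 mulr_gt0 ?powR_gt0// posE// ltW.
Qed.
Let sv_surv u y : 0 <= y -> surv Q u y = sv u y.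
Proof. exact: survE. Qed.
Let Qneg t y : 0 <= t -> 0 <= y -> Q t y `]-oo, 0[ = 0%E.
Proof. by move=> t0 y0; have [] := hQ t0 y0. Qed.

(** Multiplying by [surv] cancels the denominator of each transition. At x = 0 that denominator
    vanishes and the quotients degenerate; there the right-hand sides vanish too, by absorption at 0
    and by [tailR_zero]. *)
Lemma tailfddE s l : 0 <= s -> s != 1 -> timed s l -> measurable_list l -> forall x, 0 <= x ->
  if s < 1 then ((surv Q (1 - s) x)%:E * tailfdd Q s x l = (tailR s (map ind l) x)%:E)%E
  else (tailfdd Q s x l = (tailR s (map ind l) x)%:E)%E.
Proof.
elim: l s => [|[t A] l IH] s s0 s1 /=.
  by move=> _ _ x x0; case: ltP => s1' //; rewrite mule1 sv_surv.
move=> [/andP[st t1] tl] [mA ml] x x0.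
have t0 : 0 <= t by lra.
have bA := @bmf_indic R _ _ _ mA.
have bt : bmf (tailR t (map ind l)) by apply: tailR_bmf; [exact/(timed_map (fun A => \1_A))|exact: all_bmf_ind].
have bAt : bmf (fun y => \1_A y * tailR t (map ind l) y) by exact: bmfM.
have iA (y : R) : 0 <= \1_A y :> R by rewrite indicE.
have IHt y : 0 <= y -> _ := IH t t0 t1 tl ml y.
have [t1'|t1'] := leP t 1; last first.
  have tn1 : t < 1 = false by apply/negbTE; rewrite -leNgt ltW.
  rewrite tn1 in IHt.
  have inner z : 0 <= z -> (\int[Q (t - 1)%R z]_y ((\1_A y)%R%:E * tailfdd Q t y l))%E =
      (op (t - 1) (fun y => \1_A y * tailR t (map ind l) y) z)%:E.
    move=> z0; rewrite (@null_integral _ _ (fun y => \1_A y * tailR t (map ind l) y)) ?Qneg//; last 3 first.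
    - by lra.
    - by move=> y; apply: mule_ge0; rewrite ?lee_fin ?iA//; exact: tailfdd_ge0.
    - by move=> y y0; rewrite IHt// EFinM.
    by rewrite /op posE.
  have [s1'|s1'] := ltP s 1; last first.
    rewrite /step s1'/=.
    rewrite (@null_integral _ _ (fun y => \1_A y * tailR t (map ind l) y)) ?Qneg//; last 3 first.
    - by lra.
    - by move=> y; apply: mule_ge0; rewrite ?lee_fin ?iA//; exact: tailfdd_ge0.
    - by move=> y y0; rewrite IHt// EFinM.
    by rewrite /op posE.
  rewrite /step leNgt s1'/= tn1.
  pose h z := sv 0 z * op (t - 1) (fun y => \1_A y * tailR t (map ind l) y) z.
  have bh : bmf h by apply: bmfM; [exact: sv_bmf|apply: op_bmf => //; lra].
  rewrite (@null_integral _ _ (fun z => (surv Q (1 - s) x)^-1 * h z)) ?Qneg//; last 4 first.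
  - by lra.
  - exact: bmfZ.
  - move=> z; apply: mule_ge0; first by rewrite lee_fin divr_ge0.
    by apply: integral_ge0 => y _; apply: mule_ge0; rewrite ?lee_fin ?iA//; exact: tailfdd_ge0.
  - by move=> z z0; rewrite inner// -EFinM sv_surv//; congr (_%:E); rewrite /h; ring.
  rewrite meanZ// -EFinM; congr (_%:E).
  have [x0'|xn] := eqVneq x 0; last first.
    have : 0 < surv Q (1 - s) x by apply: surv_gt0; [lra|rewrite lt_neqAle eq_sym xn].
    by move=> sp; rewrite mulrA mulfV ?gt_eqF// mul1r /op posE.
  rewrite x0' -/h op_zero ?lexx//; last by lra.
  rewrite sv_surv// /sv op_zero ?lexx//; [|exact: bmf_gt0|lra].
  rewrite /gt0 ltxx mul0r /h /sv op_zero ?lexx//; last exact: bmf_gt0.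
  by rewrite /gt0 ltxx mul0r.
have t1'' : t < 1 by rewrite lt_neqAle t1.
have s1' : s < 1 by lra.
rewrite t1'' in IHt; rewrite s1' /step leNgt s1'/= t1''.
pose h y := \1_A y * tailR t (map ind l) y.
rewrite (@null_integral _ _ (fun y => (surv Q (1 - s) x)^-1 * h y)) ?Qneg//; last 4 first.
- by lra.
- exact: bmfZ.
- move=> y; apply: mule_ge0; last exact: tailfdd_ge0.
  by rewrite lee_fin divr_ge0// mulr_ge0.
- move=> y y0; have := IHt y y0 => E.
  rewrite (_ : (\1_A y * surv Q (1 - t) y / surv Q (1 - s) x)%:E =
     (((surv Q (1 - s) x)^-1 * \1_A y)%:E * (surv Q (1 - t) y)%:E)%E); last first.
    by rewrite -EFinM; congr (_%:E); ring.
  by rewrite -muleA E -EFinM; congr (_%:E); rewrite /h; ring.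
rewrite meanZ// -EFinM; congr (_%:E).
have [x0'|xn] := eqVneq x 0; last first.
  have : 0 < surv Q (1 - s) x by apply: surv_gt0; [lra|rewrite lt_neqAle eq_sym xn].
  by move=> sp; rewrite mulrA mulfV ?gt_eqF// mul1r /op posE.
rewrite x0' -/h op_zero ?lexx//; last by lra.
rewrite sv_surv// /sv op_zero ?lexx//; [|exact: bmf_gt0|lra].
rewrite /gt0 ltxx mul0r /h tailR_zero ?mulr0//.
- exact/(timed_map (fun A => \1_A)).
- exact: all_bmf_ind.
Qed.

Variable chi : probability R R.
Hypothesis hchi : chi_law a chi.

(** The law of t^(1/a) chi with total mass t^(-1/a) is the entrance law at time t of the
    unconditioned process from 0; for later times it is used at time 1. *)
Definition step0 t (h : R -> R) : R :=
  if t < 1 then t `^ (- a^-1) * mean chi (fun c => h (t `^ a^-1 * c))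
  else mean chi (fun c => sv 0 c * op (t - 1) h c).

Definition fddR (l : seq (R * (R -> R))) : R :=
  match l with
  | [::] => 1
  | (t, g) :: l' => step0 t (fun y => g y * tailR t l' y)
  end.

Let scale_bmf (c : R) (h : R -> R) : bmf h -> bmf (fun x : R => h (c * x)).
Proof.
move=> [mh [C hC]]; split; last by exists C.
by apply: (measurableT_comp mh); exact: measurable_funM.
Qed.

Lemma step0_linear t c f g : ok 0 t -> bmf f -> bmf g ->
  step0 t (fun x => c * f x + g x) = c * step0 t f + step0 t g.
Proof.
move=> /andP[t0 t1] bf bg; rewrite /step0; have [t1'|t1'] := ltP t 1.
  rewrite meanD; [|by apply: bmfZ; exact: scale_bmf|exact: scale_bmf].
  by rewrite meanZ; [ring|exact: scale_bmf].
have t10 : 0 <= t - 1 by lra.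
rewrite (_ : (fun y => sv 0 y * op (t - 1) (fun x => c * f x + g x) y) =
    fun y => c * (sv 0 y * op (t - 1) f y) + sv 0 y * op (t - 1) g y); last first.
  by apply/funext => z; rewrite op_linear//; ring.
have bs h : bmf h -> bmf (fun y => sv 0 y * op (t - 1) h y) by move=> bh; apply: bmfM; [exact: sv_bmf|exact: op_bmf].
by rewrite meanD; [rewrite meanZ//; exact: bs|apply: bmfZ; exact: bs|exact: bs].
Qed.

Lemma step0_bound t h C : ok 0 t -> bmf h -> (forall x, `|h x| <= C) -> `|step0 t h| <= (t `^ (- a^-1) + 1) * C.
Proof.
move=> /andP[t0 t1] bh hC; have C0 : 0 <= C by apply: le_trans (hC 0).
have p0 := powR_ge0 t (- a^-1).
have key : `|step0 t h| <= (if t < 1 then t `^ (- a^-1) else 1) * C.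
  rewrite /step0; have [t1'|t1'] := ltP t 1.
    by rewrite normrM ger0_norm// ler_wpM2l//; apply: mean_norm => //; exact: scale_bmf.
  have t10 : 0 <= t - 1 by lra.
  rewrite mul1r; apply: mean_norm; first by apply: bmfM; [exact: sv_bmf|exact: op_bmf].
  move=> x; rewrite normrM; have /andP[h1 h2] := sv01 0 x; rewrite (ger0_norm h1).
  rewrite -[leRHS]mul1r; apply: ler_pM => //; exact: mean_norm.
apply: le_trans key _; rewrite ler_wpM2r//; case: ifP => _; lra.
Qed.

Lemma fddE l : timed 0 l -> measurable_list l -> fdd a Q chi l = (fddR (map ind l))%:E.
Proof.
case: l => [|[t A] l] //= [/andP[t0 t1] tl] [mA ml].
have [c0 _] := hchi.
have bA := @bmf_indic R _ _ _ mA.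
have bt : bmf (tailR t (map ind l)) by apply: tailR_bmf; [exact/(timed_map (fun A => \1_A))|exact: all_bmf_ind].
have bAt : bmf (fun y => \1_A y * tailR t (map ind l) y) by exact: bmfM.
have iA (y : R) : 0 <= \1_A y :> R by rewrite indicE.
have IHt y : 0 <= y -> _ := @tailfddE t l (ltW t0) t1 tl ml y.
rewrite /step0; have [t1'|t1'] := leP t 1; last first.
  have tn1 : t < 1 = false by apply/negbTE; rewrite -leNgt ltW.
  rewrite tn1 in IHt *.
  pose h z := sv 0 z * op (t - 1) (fun y => \1_A y * tailR t (map ind l) y) z.
  rewrite (@null_integral _ _ h)//.
  - by apply: bmfM; [exact: sv_bmf|apply: op_bmf => //; lra].
  - move=> z; apply: mule_ge0; first by rewrite lee_fin.
    by apply: integral_ge0 => y _; apply: mule_ge0; rewrite ?lee_fin ?iA//; exact: tailfdd_ge0.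
  - move=> z z0; rewrite (@null_integral _ _ (fun y => \1_A y * tailR t (map ind l) y)) ?Qneg//; last 3 first.
    - by lra.
    - by move=> y; apply: mule_ge0; rewrite ?lee_fin ?iA//; exact: tailfdd_ge0.
    - by move=> y y0; rewrite IHt// EFinM.
    by rewrite sv_surv// -EFinM /h /op posE.
have t1'' : t < 1 by rewrite lt_neqAle t1.
rewrite t1'' in IHt *; set k := t `^ a^-1; set k' := t `^ (- a^-1).
have k0 : 0 <= k by exact: powR_ge0.
have k'0 : 0 <= k' by exact: powR_ge0.
pose h y := \1_A y * tailR t (map ind l) y.
rewrite (@null_integral _ _ (fun c => k' * h (k * c)))//.
- by rewrite meanZ//; exact: scale_bmf.
- by apply: bmfZ; exact: scale_bmf.
- move=> y; apply: mule_ge0; last exact: tailfdd_ge0.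
  by rewrite lee_fin !mulr_ge0.
- move=> c cp; have kc : 0 <= k * c by exact: mulr_ge0.
  have E := IHt _ kc.
  rewrite EFinM -muleA E -EFinM; congr (_%:E); rewrite /h; ring.
Qed.

Variables (d' : measure_display) (Om : measurableType d') (Pr : probability Om R) (X : R -> Om -> R).
Hypothesis hX : is_Xstar a Q chi Pr X.

Fixpoint prodX (l : seq (R * (R -> R))) (w : Om) : R :=
  match l with [::] => 1 | (t, g) :: l' => g (X t w) * prodX l' w end.

Let timed_pos (U : Type) s (l : seq (R * U)) : 0 <= s -> timed s l -> all (fun t => 0 < t) (map fst l).
Proof.
by elim: l s => [|[t g] l IH] s s0 //= [/andP[st _] tl]; rewrite (le_lt_trans s0 st) (IH t)// (le_trans s0)// ltW.
Qed.
Let timed_sorted (U : Type) s (l : seq (R * U)) : timed s l -> path <%R s (map fst l).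
Proof. by elim: l s => [|[t g] l IH] s //= [/andP[st _] tl]; rewrite st IH. Qed.

Lemma prodX_bmf s l : 0 <= s -> timed s l -> all_bmf l -> bmf (prodX l).
Proof.
have [_ mX _ _] := hX.
elim: l s => [|[t g] l IH] s s0 /=; first by move=> _ _; exact: bmf_cst.
move=> [/andP[st _] tl] [[mg [C gC]] bl]; have t0 : 0 <= t by lra.
apply: bmfM; last exact: IH tl bl.
by split; [apply: (measurableT_comp mg); exact: mX|exists C].
Qed.

Lemma measurable_holds s l : 0 <= s -> timed s l -> measurable_list l ->
  measurable [set w | holds_all X w l].
Proof.
have [_ mX _ _] := hX.
elim: l s => [|[t A] l IH] s s0 /=; first by move=> _ _; exact: measurableT.
move=> [/andP[st _] tl] [mA ml]; have t0 : 0 <= t by lra.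
apply: measurableI; last exact: IH tl ml.
by rewrite -[X in measurable X]setTI; exact: mX.
Qed.

Lemma fdd_sets l : timed 0 l -> measurable_list l -> mean Pr (prodX (map ind l)) = fddR (map ind l).
Proof.
move=> tl ml; have [_ mX _ hf] := hX; apply: EFin_inj; rewrite -fddE//.
have /hf : sorted <%R (map fst l) by exact: (path_sorted (timed_sorted tl)).
move=> /(_ (timed_pos (lexx 0) tl) ml) <-.
have Eind w : prodX (map ind l) w = \1_[set w | holds_all X w l] w.
  rewrite indicE; elim: l {tl ml} => [|[t A] l IH] /=; first by rewrite mem_set.
  rewrite IH indicE; case: (boolP (X t w \in A)) => xA.
    rewrite mul1r; congr ((nat_of_bool _)%:R); apply/idP/idP; rewrite !inE/= => h.
      by split => //; rewrite -inE.
    by case: h.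
  rewrite mul0r memNset//= => -[h _]; by move: xA; rewrite mem_set.
have mS := measurable_holds (lexx 0) tl ml.
rewrite (_ : prodX _ = \1_[set w | holds_all X w l]); last by apply/funext.
by rewrite mean_indic// fineK// ge0_fin_numE// (le_lt_trans (probability_le1 _ _))// ltry.
Qed.

Lemma timed_coord (U : Type) s (l1 l2 : seq (R * U)) t f g :
  timed s (l1 ++ (t, f) :: l2) -> timed s (l1 ++ (t, g) :: l2).
Proof. by elim: l1 s => [|[t1 g1] l1 IH] s //= [h1 h2]; split => //; exact: IH. Qed.

Lemma all_bmf_coord l1 l2 t g : all_bmf l1 -> all_bmf l2 -> bmf g -> all_bmf (l1 ++ (t, g) :: l2).
Proof. by move=> b1 b2 bg; apply/all_bmf_cat. Qed.

Lemma prodX_linear l1 l2 t c f g w :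
  prodX (l1 ++ (t, fun x => c * f x + g x) :: l2) w =
  c * prodX (l1 ++ (t, f) :: l2) w + prodX (l1 ++ (t, g) :: l2) w.
Proof. by elim: l1 => [|[t1 g1] l1 IH] /=; [|rewrite IH]; ring. Qed.

Lemma prodX_bound l1 l2 t : all_bmf l1 -> all_bmf l2 -> exists2 K, 0 <= K &
  forall h e, (forall x, `|h x| <= e) -> forall w, `|prodX (l1 ++ (t, h) :: l2) w| <= K * e.
Proof.
have prod_bound l : all_bmf l -> exists2 K, 0 <= K & forall w, `|prodX l w| <= K.
  elim: l => [|[t1 g1] l IH] /=; first by move=> _; exists 1 => // w; rewrite normr1.
  move=> [[_ [C gC]] /IH[K K0 HK]]; have C0 : 0 <= C by apply: le_trans (gC 0).
  exists (C * K); first exact: mulr_ge0.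
  by move=> w; rewrite normrM; exact: ler_pM.
move=> b1 b2; elim: l1 b1 => [|[t1 g1] l1 IH] /=.
  move=> _; have [K K0 HK] := prod_bound _ b2; exists K => // h e he w.
  by rewrite normrM mulrC; exact: ler_pM.
move=> [[_ [C gC]] /IH[K K0 HK]]; have C0 : 0 <= C by apply: le_trans (gC 0).
exists (C * K); first exact: mulr_ge0.
by move=> h e he w; rewrite normrM -mulrA; apply: ler_pM => //; exact: HK.
Qed.

Lemma tailR_linear s l1 l2 t c f g y : timed s (l1 ++ (t, f) :: l2) -> all_bmf l1 -> all_bmf l2 ->
  bmf f -> bmf g ->
  tailR s (l1 ++ (t, fun x => c * f x + g x) :: l2) y =
  c * tailR s (l1 ++ (t, f) :: l2) y + tailR s (l1 ++ (t, g) :: l2) y.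
Proof.
move=> tl b1 b2 bf bg; elim: l1 s y b1 tl => [|[t1 g1] l1 IH] s y /=.
  move=> _ [ts tl]; have bt := tailR_bmf tl b2.
  rewrite (_ : (fun y => _) = fun y => c * (f y * tailR t l2 y) + g y * tailR t l2 y); last first.
    by apply/funext => z; ring.
  by rewrite step_linear//; exact: bmfM.
move=> [bg1 b1] [ts tl].
rewrite (_ : (fun y => _) = fun y => c * (g1 y * tailR t1 (l1 ++ (t, f) :: l2) y) +
    g1 y * tailR t1 (l1 ++ (t, g) :: l2) y); last by apply/funext => z; rewrite IH//; ring.
rewrite step_linear//; apply: bmfM => //; apply: tailR_bmf.
- exact: tl.
- exact: all_bmf_coord.
- exact: timed_coord tl.
- exact: all_bmf_coord.
Qed.

Lemma tailR_bound s l1 l2 t f : timed s (l1 ++ (t, f) :: l2) -> all_bmf l1 -> all_bmf l2 -> exists2 K, 0 <= K &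
  forall h e, bmf h -> (forall x, `|h x| <= e) -> forall y, `|tailR s (l1 ++ (t, h) :: l2) y| <= K * e.
Proof.
move=> tl b1 b2; elim: l1 s b1 tl => [|[t1 g1] l1 IH] s /=.
  move=> _ [ts tl]; have bt := tailR_bmf tl b2; have [_ [K HK]] := bt.
  have K0 : 0 <= K by apply: le_trans (HK 0).
  exists K => // h e bh he y; apply: step_bound => //; first exact: bmfM.
  by move=> x; rewrite normrM mulrC; exact: ler_pM.
move=> [bg1 b1] [ts tl]; have [K K0 HK] := IH _ b1 tl.
have [_ [C gC]] := bg1; have C0 : 0 <= C by apply: le_trans (gC 0).
exists (C * K); first exact: mulr_ge0.
move=> h e bh he y; apply: step_bound => //.
  by apply: bmfM => //; apply: tailR_bmf; [exact: timed_coord tl|exact: all_bmf_coord].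
by move=> x; rewrite normrM -mulrA; apply: ler_pM => //; exact: HK.
Qed.

Lemma fddR_linear l1 l2 t c f g : timed 0 (l1 ++ (t, f) :: l2) -> all_bmf l1 -> all_bmf l2 ->
  bmf f -> bmf g ->
  fddR (l1 ++ (t, fun x => c * f x + g x) :: l2) =
  c * fddR (l1 ++ (t, f) :: l2) + fddR (l1 ++ (t, g) :: l2).
Proof.
move=> tl b1 b2 bf bg; case: l1 b1 tl => [|[t1 g1] l1] /=.
  move=> _ [ts tl]; have bt := tailR_bmf tl b2.
  rewrite (_ : (fun y => _) = fun y => c * (f y * tailR t l2 y) + g y * tailR t l2 y); last first.
    by apply/funext => z; ring.
  by rewrite step0_linear//; exact: bmfM.
move=> [bg1 b1] [ts tl].
rewrite (_ : (fun y => _) = fun y => c * (g1 y * tailR t1 (l1 ++ (t, f) :: l2) y) +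
    g1 y * tailR t1 (l1 ++ (t, g) :: l2) y); last by apply/funext => z; rewrite tailR_linear//; ring.
rewrite step0_linear//; apply: bmfM => //; apply: tailR_bmf.
- exact: tl.
- exact: all_bmf_coord.
- exact: timed_coord tl.
- exact: all_bmf_coord.
Qed.

Lemma fddR_bound l1 l2 t f : timed 0 (l1 ++ (t, f) :: l2) -> all_bmf l1 -> all_bmf l2 -> exists2 K, 0 <= K &
  forall h e, bmf h -> (forall x, `|h x| <= e) -> `|fddR (l1 ++ (t, h) :: l2)| <= K * e.
Proof.
move=> tl b1 b2; case: l1 b1 tl => [|[t1 g1] l1] /=.
  move=> _ [ts tl]; have bt := tailR_bmf tl b2; have [_ [K HK]] := bt.
  have K0 : 0 <= K by apply: le_trans (HK 0).
  exists ((t `^ (- a^-1) + 1) * K); first by rewrite mulr_ge0// addr_ge0// powR_ge0.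
  move=> h e bh he; rewrite -mulrA; apply: step0_bound => //; first exact: bmfM.
  by move=> x; rewrite normrM mulrC; exact: ler_pM.
move=> [bg1 b1] [ts tl]; have [K K0 HK] := tailR_bound tl b1 b2.
have [_ [C gC]] := bg1; have C0 : 0 <= C by apply: le_trans (gC 0).
exists ((t1 `^ (- a^-1) + 1) * (C * K)); first by rewrite !mulr_ge0// addr_ge0// powR_ge0.
move=> h e bh he; rewrite -mulrA; apply: step0_bound => //.
  by apply: bmfM => //; apply: tailR_bmf; [exact: timed_coord tl|exact: all_bmf_coord].
by move=> x; rewrite normrM -mulrA; apply: ler_pM => //; exact: HK.
Qed.

Lemma eq_close (x y K : R) : 0 <= K -> (forall e, 0 < e -> `|x - y| <= K * e) -> x = y.
Proof.
move=> K0 H; apply/eqP; rewrite -subr_eq0 -normr_le0 leNgt; apply/negP => n0.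
have K1 : 0 < K + 1 by lra.
have e0 : 0 < `|x - y| / 2 / (K + 1) by rewrite !divr_gt0.
have := H _ e0; have : K * (`|x - y| / 2 / (K + 1)) <= `|x - y| / 2 by rewrite mulrCA ler_piMr ?divr_ge0// ler_pdivrMr// mul1r; lra.
by lra.
Qed.

(** The finite-dimensional laws are given on sets. Coordinates are upgraded to bounded functions one
    at a time: [l1] holds the functions, [l2] those still indicators, and the induction peels the
    last function off [l1]. *)
Lemma mean_prodX_mixed l1 l2 : timed 0 (l1 ++ map ind l2) -> all_bmf l1 -> measurable_list l2 ->
  mean Pr (prodX (l1 ++ map ind l2)) = fddR (l1 ++ map ind l2).
Proof.
elim/last_ind: l1 l2 => [|l1 [t g] IH] l2.
  by move=> tl _ ml; apply: fdd_sets => //; exact: (@timed_map _ _ (fun A : set R => \1_A : R -> R) 0 l2).1 tl.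
rewrite cat_rcons => tl; rewrite -cats1 => /all_bmf_cat[b1 [bg _]] ml.
have b2 := all_bmf_ind ml.
pose L h := l1 ++ (t, h) :: map ind l2.
have tL h : timed 0 (L h) by exact: timed_coord tl.
have bL h : bmf h -> bmf (prodX (L h)) by move=> bh; apply: (prodX_bmf (lexx 0) (tL h)); exact: all_bmf_coord.
pose C h := bmf h /\ mean Pr (prodX (L h)) = fddR (L h).
suff [] : C g by [].
apply: (@indicator_closure R _ _ C) => //.
- move=> A mA; split; first exact: bmf_indic.
  apply: (IH ((t, A) :: l2)) => //=; exact: tL.
- move=> c f h [bf Ef] [bh Eh]; split; first by apply: bmfD => //; exact: bmfZ.
  have -> : fddR (L (fun x => c * f x + h x)) = c * fddR (L f) + fddR (L h) by apply: fddR_linear => //; exact: tL.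
  rewrite -Ef -Eh -meanZ; last exact: bL.
  rewrite -meanD; [|by apply: bmfZ; exact: bL|exact: bL].
  by congr mean; apply/funext => w; exact: prodX_linear.
- move=> f bf Hf; split => //.
  have [K1 K10 H1] := prodX_bound t b1 b2; have [K2 K20 H2] := fddR_bound tl b1 b2.
  apply: (@eq_close _ _ (K1 + K2)); first exact: addr_ge0.
  move=> e e0; have [h [bh Eh] fh] := Hf e e0.
  pose k x := -1 * h x + f x.
  have bk : bmf k by apply: bmfD => //; exact: bmfZ.
  have ke x : `|k x| <= e by rewrite /k mulN1r addrC; exact: fh.
  have c1 : `|mean Pr (prodX (L f)) - mean Pr (prodX (L h))| <= K1 * e.
    apply: mean_close; [exact: bL|exact: bL|move=> w].
    have -> : prodX (L f) w - prodX (L h) w = prodX (L k) w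
      by have -> : prodX (L k) w = -1 * prodX (L h) w + prodX (L f) w; [exact: prodX_linear|rewrite mulN1r addrC].
    exact: H1.
  have c2 : `|fddR (L f) - fddR (L h)| <= K2 * e.
    have -> : fddR (L f) - fddR (L h) = fddR (L k)
      by have -> : fddR (L k) = -1 * fddR (L h) + fddR (L f); [apply: fddR_linear => //; exact: tL|rewrite mulN1r addrC].
    exact: H2.
  rewrite -Eh in c2; move: c1 c2; rewrite mulrDl !ler_norml => /andP[c1 c2] /andP[c3 c4].
  by lra.
Qed.

Lemma mean_prodX l : timed 0 l -> all_bmf l -> mean Pr (prodX l) = fddR l.
Proof. by move=> tl bl; have := @mean_prodX_mixed l [::]; rewrite /= cats0; apply. Qed.

(** Exponent of the joint Laplace transform of the unconditioned process, computed backwards in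
    time. *)
Fixpoint Psi s (l : seq (R * R)) : R :=
  match l with [::] => 0 | (t, c) :: l' => psi (t - s) (c + Psi t l') end.

(** The same exponent on the event of extinction by time 1: the recursion starts from (1-s)^(-1/a),
    the limit of psi_(1-s)(c) as c grows, and times after 1 drop out because the process is then
    0. *)
Fixpoint PsiK s (l : seq (R * R)) : R :=
  match l with
  | [::] => (1 - s) `^ (- a^-1)
  | (t, c) :: l' => if t < 1 then psi (t - s) (c + PsiK t l') else (1 - s) `^ (- a^-1)
  end.

Definition lap (l : seq (R * R)) : seq (R * (R -> R)) := map (fun x => (x.1, expf x.2)) l.

Lemma Psi_ge0 s l : timed s l -> all (fun x => 0 < x.2) l -> 0 <= Psi s l.
Proof.
elim: l s => [|[t c] l IH] s //= [/andP[st _] tl] /andP[c0 cl].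
by apply: ltW; apply: psi_gt0; [lra|rewrite ltr_wpDr// IH].
Qed.

Lemma PsiK_gt0 s l : s < 1 -> timed s l -> all (fun x => 0 < x.2) l -> 0 < PsiK s l.
Proof.
elim: l s => [|[t c] l IH] s s1 /=; first by move=> _ _; rewrite powR_gt0// subr_gt0.
move=> [/andP[st _] tl] /andP[c0 cl]; case: (ltP t 1) => t1; last by rewrite powR_gt0// subr_gt0.
by apply: psi_gt0; [lra|rewrite addr_gt0// IH].
Qed.

Lemma lap_bmf l : all (fun x => 0 < x.2) l -> all_bmf (lap l).
Proof. by elim: l => [|[t c] l IH] //= /andP[c0 cl]; split; [apply: bmf_expf; exact: ltW|exact: IH]. Qed.
Let expfD c k y : expf c y * expf k y = expf (c + k) y :> R.
Proof. by rewrite /expf -expRD; congr expR; ring. Qed.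
Let sv0E y : sv 0 y = gt0 y.
Proof. by rewrite /sv op_gt0 op0_le0 gt0E. Qed.
Let sv0_expf k y : sv 0 y * expf k y = expf k y - le0 y.
Proof.
rewrite sv0E gt0E /le0; have [y0|y0] := leP y 0; last by rewrite !subr0 mul1r.
by rewrite subrr mul0r /expf pos_le0// mulr0 oppr0 expR0 subrr.
Qed.

(** Survival at time 1 is the complement of extinction, whence a difference of two exponentials in
    the starting point. *)
Lemma tailR_lap s l y : 0 <= s -> s != 1 -> timed s l -> all (fun x => 0 < x.2) l ->
  tailR s (lap l) y = if s < 1 then expf (Psi s l) y - expf (PsiK s l) y else expf (Psi s l) y.
Proof.
elim: l s y => [|[t c] l IH] s y s0 sn1 /=.
  move=> _ _; have e0 : expf 0 y = 1 by rewrite /expf mul0r oppr0 expR0.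
  case: ltP => s1; rewrite e0//.
  by rewrite /sv op_gt0 op_le0// subr_gt0.
move=> [/andP[st tn1] tl] /andP[c0 cl].
have t0 : 0 <= t by lra.
have P0 := Psi_ge0 tl cl.
have cP : 0 < c + Psi t l by lra.
rewrite /step; have [t1|t1] := ltP t 1.
  have s1 : s < 1 by lra.
  have K0 := PsiK_gt0 t1 tl cl.
  have cK : 0 < c + PsiK t l by lra.
  rewrite s1 orbT (_ : (fun y => _) = fun y => expf (c + Psi t l) y - expf (c + PsiK t l) y); last first.
    by apply/funext => z; rewrite IH// t1 mulrBr !expfD.
  rewrite opB; [|by apply: bmf_expf; exact: ltW|by apply: bmf_expf; exact: ltW].
  by rewrite !op_expf//; lra.
have hE : (fun y => expf c y * tailR t (lap l) y) = expf (c + Psi t l) by apply/funext => z; rewrite IH// ltNge t1 expfD.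
rewrite hE orbF; have [s1|s1] := leP 1 s; first by rewrite op_expf//; lra.
have t10 : 0 <= t - 1 by lra.
have kk := psi_gt0 t10 cP.
rewrite (_ : (fun y => _) = fun y => expf (psi (t - 1) (c + Psi t l)) y - le0 y); last first.
  by apply/funext => z; rewrite op_expf// sv0_expf.
rewrite opB; [|by apply: bmf_expf; exact: ltW|exact: bmf_le0].
have s10 : 0 < 1 - s by lra.
have E1 : op (1 - s) (expf (psi (t - 1) (c + Psi t l))) y = expf (psi (t - s) (c + Psi t l)) y.
  have E2 := psi_add (ltW s10) t10 cP; have E3 := op_expf y (ltW s10) kk.
  have e : 1 - s + (t - 1) = t - s by ring.
  exact: (etrans E3 (congr1 (fun k => expf k y) (etrans E2 (congr1 (fun u => psi u (c + Psi t l)) e)))).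
by rewrite E1 op_le0.
Qed.
Let chi_expf m : 0 < m -> mean chi (expf m) = 1 - psi 1 m.
Proof.
move=> m0; have [n0 /(_ m m0) E] := hchi; rewrite /mean.
have -> : (\int[chi]_x (expf m x)%:E = \int[chi]_x (expR (- m * x))%:E)%E.
  apply: ae_eq_integral => //.
  - by apply/measurable_EFinP; exact: measurable_expf.
  - by apply/measurable_EFinP; apply: measurableT_comp => //; exact: measurable_funM.
  - exists (`]-oo, 0[%classic : set R); split; [exact: measurable_itv|by []|].
    move=> x /= hx; rewrite in_itv/= ltNge; apply/negP => x0; apply: hx => _.
    by rewrite /expf posE// mulNr.
by rewrite E.
Qed.
Let chi_le0 : mean chi le0 = 0.
Proof.
have H := @mean_le0_cvg chi; apply: (cvg_unique _ H) => //.
have C : 1 - (1 + n%:R `^ (- a)) `^ (- a^-1) @[n --> \oo] --> (1 - (1 + 0) `^ (- a^-1) : R).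
  apply: cvgB; first exact: cvg_cst.
  apply: cvg_powR; first by rewrite addr0.
  by apply: cvgD; [exact: cvg_cst|exact: powR_inv_cvg0].
rewrite addr0 powR1 subrr in C; apply: near_cvg C; near=> n; rewrite chi_expf// ltr0n.
by near: n; exact: nbhs_infty_gt.
Unshelve. all: end_near. Qed.
Let psi_scale t m : 0 < t -> 0 < m -> t `^ (- a^-1) * psi 1 (t `^ a^-1 * m) = psi t m.
Proof.
move=> t0 m0; have h : (t `^ a^-1 * m) `^ (- a) = t^-1 * m `^ (- a).
  rewrite powRM ?powR_ge0 ?(ltW m0)//; congr (_ * _).
  by rewrite -powRrM mulrN mulVf ?gt_eqF// -powR_inv1// ltW.
rewrite /csbp_exponent h -powRM ?(ltW t0)//.
  by rewrite mulrDr mulr1 mulrA mulfV ?gt_eqF// mul1r.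
by rewrite addr_ge0// mulr_ge0 ?powR_ge0// invr_ge0 ltW.
Qed.

(** The transform of chi is 1 - psi_1, so a difference of transforms becomes a difference of
    exponents; [psi_scale] removes the factor t^(-1/a). *)
Lemma fddR_lap t c l : timed 0 ((t, c) :: l) -> all (fun x => 0 < x.2) ((t, c) :: l) ->
  fddR (lap ((t, c) :: l)) = PsiK 0 ((t, c) :: l) - Psi 0 ((t, c) :: l).
Proof.
move=> /= [/andP[t0 tn1] tl] /andP[c0 cl]; rewrite !subr0.
have P0 := Psi_ge0 tl cl.
have cP : 0 < c + Psi t l by lra.
rewrite /step0; have [t1|t1] := ltP t 1.
  have K0 := PsiK_gt0 t1 tl cl.
  have cK : 0 < c + PsiK t l by lra.
  set k := t `^ a^-1; have k0 : 0 < k by rewrite powR_gt0.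
  have ek m x : expf m (k * x) = expf (k * m) x.
    rewrite /expf; congr expR; congr (- _); rewrite /pos; case: (leP x 0) => x0.
      by rewrite max_r ?mulr0// pmulr_rle0.
    by rewrite max_l; [ring|rewrite pmulr_rge0// ltW].
  rewrite (_ : (fun c0 => _) = fun x => expf (k * (c + Psi t l)) x - expf (k * (c + PsiK t l)) x); last first.
    by apply/funext => z; rewrite tailR_lap ?(ltW t0)// t1 mulrBr !expfD !ek.
  rewrite meanB; [|by apply: bmf_expf; rewrite mulr_ge0// ltW|by apply: bmf_expf; rewrite mulr_ge0// ltW].
  rewrite !chi_expf ?mulr_gt0//.
  have e1 := psi_scale t0 cK; have e2 := psi_scale t0 cP; rewrite -/k in e1 e2.
  by rewrite -e1 -e2 -mulrBr; congr (_ * _); rewrite opprB addrC addrA subrK addrC.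
have t10 : 0 <= t - 1 by lra.
have kk := psi_gt0 t10 cP.
have hE : (fun y => expf c y * tailR t (lap l) y) = expf (c + Psi t l) by apply/funext => z; rewrite tailR_lap ?(ltW t0)// ltNge t1 expfD.
rewrite hE (_ : (fun c0 => _) = fun y => expf (psi (t - 1) (c + Psi t l)) y - le0 y); last first.
  by apply/funext => z; rewrite op_expf// sv0_expf.
rewrite meanB; [|by apply: bmf_expf; exact: ltW|exact: bmf_le0].
rewrite chi_expf// chi_le0 subr0 powR1.
have E2 := psi_add ler01 t10 cP; rewrite E2; congr (_ - psi _ _); ring.
Qed.

Theorem laplace_Xstar t c l : timed 0 ((t, c) :: l) -> all (fun x => 0 < x.2) ((t, c) :: l) ->
  mean Pr (prodX (lap ((t, c) :: l))) = PsiK 0 ((t, c) :: l) - Psi 0 ((t, c) :: l).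
Proof.
move=> tl cl; rewrite mean_prodX ?fddR_lap//; last exact: lap_bmf.
by have [_ h] := @timed_map _ _ expf 0 ((t, c) :: l); exact: h tl.
Qed.

Lemma Xstar_ge0 t : 0 < t -> Pr [set w | X t w < 0] = 0%E.
Proof.
move=> t0; have [_ _ _ hf] := hX.
have mA : measurable (`]-oo, 0[%classic : set R) by exact: measurable_itv.
have := hf [:: (t, `]-oo, 0[%classic)] isT; rewrite /= t0 => /(_ isT (conj mA I)).
rewrite (_ : [set w | _] = [set w | X t w < 0]); last first.
  by apply/seteqP; split => w /=; rewrite in_itv/=; [case|].
have [c0 _] := hchi.
move=> ->; case: ifP => t1.
  have i0 c : 0 <= c -> \1_(`]-oo, 0[%classic : set R) c = 0 :> R by move=> cp; rewrite indicE memNset//= in_itv/=; apply/negP; rewrite -leNgt.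
  rewrite (@null_integral _ _ (fun=> 0)) ?mean_cst//; first exact: bmf_cst.
    by move=> y; rewrite mule1 lee_fin !mulr_ge0 ?powR_ge0// ?indicE//.
  by move=> y y0; rewrite i0 ?mulr0 ?mul0r ?mule1// mulr_ge0// powR_ge0.
rewrite (@null_integral _ _ (fun=> 0)) ?mean_cst//; first exact: bmf_cst.
  move=> y; apply: mule_ge0; first by rewrite lee_fin.
  by apply: integral_ge0 => z _; rewrite mule1 lee_fin indicE.
move=> y y0; rewrite (@null_integral _ _ (fun=> 0)) ?mean_cst ?mule0//.
- by apply: Qneg => //; move: t1 => /negbT; rewrite -ltNge; lra.
- exact: bmf_cst.
- by move=> z z0; rewrite mule1 indicE memNset//= in_itv/=; apply/negP; rewrite -leNgt.
Qed.

End Paths.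
End Kernel.

(** * Maxima of sliding sums *)

Section Window.
Variable R : realType.
Implicit Types (x y : nat -> R).

Fixpoint window N I x : R :=
  match I with
  | 0%N => \sum_(r < N) x r
  | I'.+1 => Num.max (window N I' x) (\sum_(r < N) x (I + r)%N)
  end.

Lemma window_ge N I i x : (i <= I)%N -> \sum_(r < N) x (i + r)%N <= window N I x.
Proof.
elim: I => [|I IH] /=; first by rewrite leqn0 => /eqP->.
rewrite leq_eqVlt ltnS => /orP[/eqP->|/IH h]; first by rewrite le_max lexx orbT.
by rewrite le_max h.
Qed.

Lemma window_le N I x b : (forall i, (i <= I)%N -> \sum_(r < N) x (i + r)%N <= b) -> window N I x <= b.
Proof.
elim: I => [|I IH] h /=; first exact: (h 0%N).
by rewrite ge_max IH ?(h I.+1)// => i iI; apply: h; exact: leqW.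
Qed.

Lemma window_ge0 N I x : (forall i, 0 <= x i) -> 0 <= window N I x.
Proof. by move=> x0; apply: le_trans (window_ge N x (leq0n I)); exact: sumr_ge0. Qed.

Lemma windowZ N I c x : 0 <= c -> window N I (fun i => c * x i) = c * window N I x.
Proof.
move=> c0; elim: I => [|I IH] /=; first by rewrite mulr_sumr.
by rewrite IH -mulr_sumr maxr_pMr.
Qed.

Lemma sum_shift_le (f : nat -> R) N I i : (forall r, 0 <= f r) -> (i <= I)%N ->
  \sum_(r < N) f (i + r)%N <= \sum_(r < I + N) f r.
Proof.
move=> f0 iI; have e : (I + N = i + (N + (I - i)))%N by lia.
rewrite e big_split_ord/= ler_wpDl ?sumr_ge0// big_split_ord/= ler_wpDr ?sumr_ge0//.
Qed.

Lemma window_le_sum N I x : (forall i, 0 <= x i) -> window N I x <= \sum_(r < I + N) x r.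
Proof. by move=> x0; apply: window_le => i; exact: sum_shift_le. Qed.

Lemma window_le_max N I x b : 0 <= b -> (forall r, (r < I + N)%N -> x r <= b) -> window N I x <= N%:R * b.
Proof.
move=> b0 xb; apply: window_le => i iI.
apply: le_trans (_ : \sum_(r < N) b <= _); last by rewrite sumr_const card_ord mulr_natl.
by apply: ler_sum => r _; apply: xb; have := ltn_ord r; lia.
Qed.

Lemma window_ext N I x y : (forall r, (r < I + N)%N -> x r = y r) -> window N I x = window N I y.
Proof.
elim: I => [|I IH] h /=; first by apply: eq_bigr => r _; apply: h; rewrite add0n ltn_ord.
congr Num.max; first by apply: IH => r rI; apply: h; lia.
by apply: eq_bigr => r _; apply: h; have := ltn_ord r; lia.
Qed.

End Window.

(** * Covering blocks by grid cells *)

Section Blocks.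

Lemma block_cat a b k z : block (a + b) k z = (block a k z + block b (k + a) z)%N.
Proof.
rewrite !block_shift big_split_ord/=; congr (_ + _)%N.
by apply: eq_bigr => r _; rewrite addnA.
Qed.

Lemma block_sub j k j0 k0 z : (k0 <= k)%N -> (k + j <= k0 + j0)%N -> (block j k z <= block j0 k0 z)%N.
Proof.
move=> h1 h2; set r := (k0 + j0 - k - j)%N.
have e1 : block (j + r) k z = block (j + r) (k0 + (k - k0)) z by rewrite subnKC.
have e2 : (j0 = (k - k0) + (j + r))%N by rewrite /r; lia.
have -> : block j0 k0 z = (block (k - k0) k0 z + (block j k z + block r (k + j) z))%N by rewrite -block_cat e1 -block_cat -e2.
by rewrite -[leqLHS]add0n leq_add// -[leqLHS]addn0 leq_add.
Qed.

Lemma block_grid N s i z : block (N * s) (i * s) z = (\sum_(r < N) \sum_(l < s) z ((i + r) * s + l))%N.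
Proof.
elim: N => [|N IH]; first by rewrite mul0n big_ord0 block_shift big_ord0.
by rewrite mulSnr block_cat IH big_ord_recr/= -mulnDl [in X in (_ + X)%N]block_shift.
Qed.

Lemma top_attained m j z : exists2 k, (k <= m - j)%N & top m j z = block j k z.
Proof.
rewrite /top big_mkord.
have h : (0 < #|'I_(m - j).+1|)%N by rewrite card_ord.
have [k ->] := bigop.eq_bigmax (fun k : 'I_(m - j).+1 => block j k z) h.
by exists k => //; rewrite -ltnS ltn_ord.
Qed.

Lemma four_cells n s : (0 < s)%N -> (0 < 4 * s <= (n + 8) * s)%N.
Proof. by move=> s0; rewrite muln_gt0 s0/= leq_mul2r; apply/orP; right; lia. Qed.

(** The middle of a cell: the corresponding rescaled times (2r+1)/(2N) never equal 1. *)
Definition mid s r := (r * s + s./2)%N.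

(** The start of the block exceeds that of a grid window by at most 3 cells, also when the window
    index is capped at [I], and the remainder of j by N is less than one cell because N <= s. A
    short block of 4 cells therefore covers the discrepancy. *)
Lemma upper_cover m j s N I z k : (j %/ N)%N = s -> (0 < N)%N -> (N <= s)%N -> (m - j <= (I + 2) * s)%N -> (k <= m - j)%N ->
  exists2 i, (i <= I)%N & (block j k z <= block (N * s) (i * s) z + top ((I + N + 8) * s) (4 * s) z)%N.
Proof.
move=> js N0 Ns h1 km; have s0 : (0 < s)%N by exact: leq_trans Ns.
have jE := divn_eq j N; rewrite js in jE; have rN := ltn_pmod j N0.
have kE := divn_eq k s; have ks := ltn_pmod k s0.
exists (minn (k %/ s) I); first exact: geq_minr.
set i := minn _ _.
have i1 : (i * s <= k)%N by rewrite [leqRHS]kE; apply: leq_trans (leq_addr _ _); rewrite leq_mul2r geq_minl orbT.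
have i2 : (k <= (i + 3) * s)%N.
  rewrite /i; case: (leqP (k %/ s) I) => c; first by rewrite [leqLHS]kE; nia.
  by nia.
apply: leq_trans (_ : block (N * s) (i * s) z + block (4 * s) ((i + N) * s) z <= _)%N.
  rewrite mulnDl -block_cat; apply: block_sub => //; nia.
rewrite leq_add2l; apply: block_le_top.
by rewrite -mulnBl leq_mul2r; apply/orP; right; lia.
Qed.

(** A grid window may begin beyond the last admissible start m - j; moving it back shifts it by at
    most one cell. *)
Lemma lower_cover m j s N I z i : (j <= m)%N -> (j %/ N)%N = s -> (0 < N)%N -> (N <= s)%N ->
  (m - j <= (I + 2) * s)%N -> (I * s <= (m - j) + s)%N -> (i <= I)%N ->
  (block (N * s) (i * s) z <= top m j z + top ((I + N + 8) * s) (4 * s) z)%N.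
Proof.
move=> jm js N0 Ns h1 h2 iI; have s0 : (0 < s)%N by exact: leq_trans Ns.
have jE := divn_eq j N; rewrite js in jE; have rN := ltn_pmod j N0.
pose k := minn (i * s) (m - j).
have k2 : (k <= m - j)%N by exact: geq_minr.
have k3 : (i * s <= k + s)%N by rewrite /k; case: (leqP (i * s) (m - j)) => c; [lia|nia].
apply: leq_trans (_ : block j k z + block (4 * s) (k + j) z <= _)%N.
  by rewrite -block_cat; apply: block_sub => //; nia.
by apply: leq_add; [exact: block_le_top|apply: block_le_top; nia].
Qed.

End Blocks.

(** * Sampling error and rescaled grid times *)

Section Spread.
Variable R : realType.

(** One sum that dominates the sampling error of all grid windows simultaneously. *)
Definition spread s n (z : nat -> nat) : R :=
  \sum_(r < n) \sum_(l < s) `|(z (r * s + l)%N)%:R - (z (mid s r))%:R|.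

Lemma block_sample N s I i z : (i <= I)%N ->
  `|(block (N * s) (i * s) z)%:R - s%:R * \sum_(r < N) (z (mid s (i + r)%N))%:R| <= spread s (I + N) z.
Proof.
move=> iI; rewrite block_grid natr_sum mulr_sumr -sumrB.
apply: le_trans (ler_norm_sum _ _ _) _.
apply: le_trans (sum_shift_le N (f := fun r => \sum_(l < s) `|(z (r * s + l)%N)%:R - (z (mid s r))%:R| : R) _ iI); last first.
  by move=> r; exact: sumr_ge0.
apply: ler_sum => r _; rewrite natr_sum.
have -> : s%:R * (z (mid s (i + r)%N))%:R = \sum_(l < s) (z (mid s (i + r)%N))%:R :> R by rewrite sumr_const card_ord mulr_natl.
by rewrite -sumrB; exact: ler_norm_sum.
Qed.

Lemma window_close m j s N I z : (j <= m)%N -> (j %/ N)%N = s -> (0 < N)%N -> (N <= s)%N ->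
  (m - j <= (I + 2) * s)%N -> (I * s <= (m - j) + s)%N ->
  `|(top m j z)%:R - s%:R * window N I (fun r => (z (mid s r))%:R)| <=
  (top ((I + N + 8) * s) (4 * s) z)%:R + spread s (I + N) z.
Proof.
move=> jm js N0 Ns h1 h2; set t' := top (_ * s) _ _.
have s0 : 0 < s%:R :> R by rewrite ltr0n; exact: leq_trans Ns.
rewrite ler_norml; apply/andP; split.
  rewrite lerBrDr addrC -lerBrDr opprK -ler_pdivlMl//.
  apply: window_le => i iI; rewrite ler_pdivlMl//.
  have := block_sample N s z iI; rewrite ler_norml => /andP[b1 b2].
  have : (block (N * s) (i * s) z)%:R <= (top m j z + t')%:R :> R by rewrite ler_nat; exact: lower_cover.
  by rewrite natrD; lra.
have [k km ->] := top_attained m j z.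
have [i iI] := upper_cover z js N0 Ns h1 km.
rewrite -(ler_nat R) natrD.
have := block_sample N s z iI; rewrite ler_norml => /andP[b1 b2].
have : s%:R * \sum_(r < N) (z (mid s (i + r)%N))%:R <= s%:R * window N I (fun r => (z (mid s r))%:R) :> R.
  by rewrite ler_pM2l//; exact: (@window_ge _ N I i (fun r => (z (mid s r))%:R)).
by rewrite -/t'; lra.
Qed.

Lemma near_infty_comp (Q : nat -> Prop) (j : nat -> nat) :
  (forall J, \forall n \near \oo, (J <= j n)%N) -> (\forall n \near \oo, Q n) -> \forall m \near \oo, Q (j m).
Proof. by move=> hj [J _ HJ]; near=> m; apply: HJ; rewrite /=; near: m; exact: hj.
Unshelve. all: end_near. Qed.

Variable j : nat -> nat.
Hypothesis jinf : forall J, \forall m \near \oo, (J <= j m)%N.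

Lemma cell_infty N : (0 < N)%N -> forall J, \forall m \near \oo, (J <= j m %/ N)%N.
Proof.
by move=> N0 J; near=> m; rewrite leq_divRL//; near: m; exact: jinf.
Unshelve. all: end_near. Qed.

Lemma cvg_inv_j (c : R) : c / (j m)%:R @[m --> \oo] --> (0 : R).
Proof.
rewrite -[X in _ --> X](mulr0 c); apply: cvgM; first exact: cvg_cst.
exact: (cvg_infty_comp jinf (@cvg_inv_natr R)).
Qed.

Lemma cell_ratio N : (0 < N)%N -> (j m %/ N)%N%:R / (j m)%:R @[m --> \oo] --> (N%:R^-1 : R).
Proof.
move=> N0; have N0' : 0 < N%:R :> R by rewrite ltr0n.
have c1 : N%:R^-1 - 1 / (j m)%:R @[m --> \oo] --> (N%:R^-1 : R) by rewrite -[X in _ --> X]subr0; apply: cvgB; [exact: cvg_cst|exact: cvg_inv_j].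
apply: (@squeeze_cvgr _ _ _ _ (fun m => N%:R^-1 - 1 / (j m)%:R) (fun=> N%:R^-1)) => //; last exact: cvg_cst.
near=> m.
have j0 : 0 < (j m)%:R :> R by rewrite ltr0n; near: m; exact: jinf.
have e := divn_eq (j m) N; have r := ltn_pmod (j m) N0.
have e1 : (j m %/ N)%N%:R * N%:R <= (j m)%:R :> R by rewrite -natrM ler_nat [leqRHS]e leq_addr.
have e2 : (j m)%:R <= ((j m %/ N)%N%:R + 1) * N%:R :> R by rewrite natr1 -natrM ler_nat [leqLHS]e mulSn addnC leq_add2r ltnW.
apply/andP; split.
  rewrite ler_pdivlMr// mulrBl divfK ?gt_eqF// lerBlDr ler_pdivrMl//; lra.
by rewrite ler_pdivrMr// ler_pdivlMl//; lra.
Unshelve. all: end_near. Qed.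

Lemma mid_ratio N r : (0 < N)%N ->
  (mid (j m %/ N) r)%:R / (j m)%:R @[m --> \oo] --> ((2 * r%:R + 1) / (2 * N%:R) : R).
Proof.
move=> N0; have N0' : 0 < N%:R :> R by rewrite ltr0n.
have C := cell_ratio N0.
have U : (2 * r%:R + 1) / 2 * ((j m %/ N)%N%:R / (j m)%:R) @[m --> \oo] --> ((2 * r%:R + 1) / (2 * N%:R) : R).
  rewrite invfM mulrA; apply: cvgM => //; exact: cvg_cst.
have Lo : (2 * r%:R + 1) / 2 * ((j m %/ N)%N%:R / (j m)%:R) - 1 / (j m)%:R @[m --> \oo] --> ((2 * r%:R + 1) / (2 * N%:R) : R).
  by rewrite -[X in _ --> X]subr0; apply: cvgB => //; exact: cvg_inv_j.
apply: (squeeze_cvgr _ Lo U); near=> m.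
have j0 : 0 < (j m)%:R :> R by rewrite ltr0n; near: m; exact: jinf.
rewrite /mid; set s := (j m %/ N)%N.
have h1 : (s./2)%:R <= s%:R / 2 :> R by rewrite ler_pdivlMr// -natrM ler_nat muln2 -[leqRHS](odd_double_half s) leq_addl.
have h2 : s%:R / 2 <= (s./2)%:R + 1 :> R.
  rewrite ler_pdivrMr// natr1 -natrM ler_nat muln2 -[leqLHS](odd_double_half s) doubleS.
  by case: (odd s); rewrite ?add1n ?add0n; lia.
rewrite natrD natrM; apply/andP; split.
  rewrite mulrA -mulrBl ler_pM2r ?invr_gt0//; lra.
by rewrite mulrA ler_pM2r ?invr_gt0//; lra.
Unshelve. all: end_near. Qed.

Lemma cvg_of_approx (A : nat -> R) (l : R) :
  (forall e, 0 < e -> exists B : nat -> R, exists l' : R, [/\ B m @[m --> \oo] --> l',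
     \forall m \near \oo, `|A m - B m| <= e & `|l - l'| <= e]) -> A m @[m --> \oo] --> l.
Proof.
move=> H; apply/cvgrPdist_le => e e0; have e3 : 0 < e / 3 by rewrite divr_gt0.
have [B [l' [Bl' AB ll']]] := H _ e3; move/cvgrPdist_le: Bl' => /(_ _ e3) Bn.
near=> m.
have h1 : `|A m - B m| <= e / 3 by near: m.
have h2 : `|l' - B m| <= e / 3 by near: m.
move: h1 h2 ll'; rewrite !ler_norml => /andP[? ?] /andP[? ?] /andP[? ?].
by lra.
Unshelve. all: end_near. Qed.

Lemma expR_decay_cvg (c : R) (x : nat -> R) : (forall m, 0 < x m) -> x m @[m --> \oo] --> 0 -> 0 <= c ->
  (1 - expR (- (c * x m))) / x m @[m --> \oo] --> c.
Proof.
move=> x0 xc c0.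
have Lo : c - c * c * x m @[m --> \oo] --> c.
  rewrite -[X in _ --> X]subr0 -[X in _ --> _ - X](mulr0 (c * c)); apply: cvgB; first exact: cvg_cst.
  by apply: cvgM => //; exact: cvg_cst.
have Up : (fun _ : nat => c) @ \oo --> c by exact: cvg_cst.
apply: (squeeze_cvgr _ Lo Up); apply: nearW => m.
have xm := x0 m; have y0 : 0 <= c * x m by rewrite mulr_ge0// ltW.
have e1 := @expR_ge1Dx R (- (c * x m)); have e2 := @expR_ge1Dx R (c * x m).
have ep := expR_gt0 (- (c * x m)).
have e3 : expR (- (c * x m)) * expR (c * x m) = 1 by rewrite -expRD addNr expR0.
apply/andP; split; last by rewrite ler_pdivrMr//; lra.
set y := c * x m in y0 e1 e2 ep e3 *.
have e4 : expR (- y) * (1 + y) <= 1 by rewrite -[leRHS]e3 ler_pM2l.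
have e5 : (1 - y) * y <= expR (- y) * y by rewrite ler_wpM2r.
rewrite ler_pdivlMr//; have -> : (c - c * c * x m) * x m = y - y * y by rewrite /y; ring.
by move: e4 e5; rewrite mulrDr mulrBl mulr1 mul1r; lra.
Qed.

Definition gtime N (r : nat) : R := (2 * r%:R + 1) / (2 * N%:R).

Variable N : nat.
Hypothesis N0 : (0 < N)%N.
Let NR0 : 0 < 2 * N%:R :> R. Proof. by rewrite mulr_gt0// ltr0n. Qed.

Lemma gtime_gt0 r : 0 < gtime N r.
Proof. by rewrite divr_gt0// ltr_wpDl// mulr_ge0. Qed.

Lemma gtime_lt r r' : (r < r')%N -> gtime N r < gtime N r'.
Proof. by move=> h; rewrite ltr_pM2r ?invr_gt0// ltrD2r ltr_pM2l// ltr_nat. Qed.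

(** The numerator 2r + 1 is odd and the denominator 2N is even. *)
Lemma gtime_neq1 r : gtime N r != 1.
Proof.
apply/eqP => /(congr1 (fun x => x * (2 * N%:R))); rewrite divfK ?gt_eqF// mul1r => /eqP.
rewrite -natrM natr1 -natrM eqr_nat => /eqP h.
by have := congr1 odd h; rewrite /= !oddM.
Qed.

Lemma gtime_lt1 r : (gtime N r < 1) = (r < N)%N.
Proof.
rewrite ltr_pdivrMr// mul1r -natrM natr1 -natrM ltr_nat.
by rewrite -(ltn_pmul2l (isT : (0 < 2)%N)); apply/idP/idP; lia.
Qed.

End Spread.

(** * Riemann sums along a cadlag path *)

Section Path.
Variables (R : realType) (x : R -> R).
Hypothesis right_cont : forall t, 0 <= t -> x u @[u --> t^'+] --> x t.
Hypothesis left_lim : forall t, 0 < t -> cvg (x u @[u --> t^'-]).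

Local Notation mu := (@lebesgue_measure R).

(** Right continuity on one side and the left limit on the other bound the path near each point;
    compactness of [0, b] makes the bound global. *)
Lemma cadlag_bounded (b : R) : exists2 B : R, 0 < B & forall u, 0 <= u <= b -> `|x u| <= B.
Proof.
have loc (t : R) : 0 <= t -> exists C : R, \forall u \near t, 0 <= u -> `|x u| <= C.
  move=> t0.
  have rt : \forall u \near t^'+, `|x u| <= `|x t| + 1.
    near=> u; have : `|x t - x u| <= 1 by near: u; move/cvgrPdist_le : (right_cont t0); exact.
    by move=> h; rewrite -[x u](subKr (x t)); apply: le_trans (ler_normB _ _) _; rewrite lerD2l.
  have [C HC] : exists C : R, \forall u \near t^'-, 0 <= u -> `|x u| <= C.
    move: t0; rewrite le_eqVlt => /orP[/eqP t0|t0].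
      exists 0; near=> u => u0.
      have : u < t by near: u; exact: nbhs_left_lt.
      by rewrite -t0 ltNge u0.
    have /cvg_ex[l Hl] := left_lim t0.
    exists (`|l| + 1); near=> u => _; have : `|l - x u| <= 1 by near: u; move/cvgrPdist_le : Hl; exact.
    by move=> h; rewrite -[x u](subKr l); apply: le_trans (ler_normB _ _) _; rewrite lerD2l.
  exists (Num.max C (`|x t| + 1)).
  move: rt HC; rewrite /at_right /at_left => rt HC.
  have rt' : \forall u \near t, t < u -> `|x u| <= `|x t| + 1 by exact: rt.
  have HC' : \forall u \near t, u < t -> 0 <= u -> `|x u| <= C by exact: HC.
  near=> u => u0; rewrite le_max.
  have h1 : t < u -> `|x u| <= `|x t| + 1 by near: u.
  have h2 : u < t -> 0 <= u -> `|x u| <= C by near: u.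
  case: (ltgtP u t) => c; first by rewrite h2.
    by rewrite h1// orbT.
  by rewrite c; apply/orP; right; lra.
have K : compact (`[0, b]%classic : set R) by exact: segment_compact.
have := (compact_near_coveringP _).1 K nat \oo (fun n u => 0 <= u -> `|x u| <= n%:R).
have H : forall t, `[0, b]%classic t -> \forall t' \near t & i \near \oo, 0 <= t' -> `|x t'| <= i%:R.
  move=> t; rewrite /= in_itv/= => /andP[t0 _]; have [C HC] := loc t t0.
  have C0 : 0 <= Num.max C 0 by rewrite le_max lexx orbT.
  have [M [_ M1 _]] := nat_above C0.
  exists ([set u | 0 <= u -> `|x u| <= C], [set i | (M <= i)%N]).
    by split => //=; exact: nbhs_infty_ge.
  move=> [u i] /= [h1 h2] u0; apply: le_trans (h1 u0) _; apply: le_trans (_ : M%:R <= _); last by rewrite ler_nat.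
  by apply: le_trans M1; rewrite le_max lexx.
move=> /(_ _ H) [M _ HM]; exists M.+1%:R => // u u01; have /andP[u0 _] := u01.
by apply: (HM M.+1) => //=; rewrite in_itv.
Unshelve. all: end_near. Qed.

Variable T : R.
Hypothesis T1 : 1 <= T.

Let D := (`]0, T]%classic : set R).
Let mD : measurable D. Proof. exact: measurable_itv. Qed.
Let b : nat := Num.truncn T + 1.
Let Tb : T <= b%:R.
Proof. by rewrite /b addn1; have /andP[_ /ltW] := truncn_itv (le_trans ler01 T1). Qed.

Local Notation tm N r := (gtime R N.+1 r%N).
Local Notation jt f := (mu.-integrable D (EFin \o f)).

Let iN N : R := N.+1%:R^-1.
Let iN_gt0 N : 0 < iN N. Proof. by rewrite /iN invr_gt0. Qed.
Let iN_le1 N : iN N <= 1. Proof. by rewrite /iN invf_le1 ?ler1n. Qed.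
Let iN_mul N : N.+1%:R * iN N = 1. Proof. by rewrite /iN mulfV// pnatr_eq0. Qed.
Let gtimeS N r : tm N r.+1 = tm N r + iN N.
Proof.
rewrite /gtime /iN -(natr1 r); move: (N.+1%:R : R) (ltr0Sn R N) => M M0; field; by rewrite gt_eqF.
Qed.
Let gtimeE N r : tm N r = (r%:R + 2^-1) * iN N.
Proof.
rewrite /gtime /iN; move: (N.+1%:R : R) (ltr0Sn R N) => M M0; field; by rewrite gt_eqF.
Qed.
Let index_lt i N r : (i + N.+1 <= N.+1 * b)%N -> (r < N.+1)%N -> (i + r < (N.+1 * b).+1)%N.
Proof. by lia. Qed.
Let cell N r : set R := `](tm N r - iN N), (tm N r)]%classic.

(** On each cell the value is taken at the right endpoint, a grid time at or to the right of u, so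
    right continuity alone gives pointwise convergence. *)
Definition stepf N (u : R) : R := \sum_(r < (N.+1 * b).+1) x (tm N r) * \1_(cell N r) u.

Let in_cell N r (u : R) : cell N r u = (tm N r - iN N < u <= tm N r) :> Prop.
Proof. by rewrite /cell /= in_itv. Qed.
Let cell_uniq N r r' (u : R) : cell N r u -> cell N r' u -> r = r'.
Proof.
have half (k k' : nat) : cell N k u -> cell N k' u -> (k <= k')%N.
  rewrite !in_cell => /andP[h1 _] /andP[_ h2]; rewrite -ltnS -(ltr_nat R) -natr1.
  have h : tm N k < tm N k' + iN N by lra.
  move: h; rewrite -gtimeS !gtimeE ltr_pM2r// -(natr1 k'); lra.
by move=> h1 h2; apply/eqP; rewrite eqn_leq !half.
Qed.

Lemma stepfE N r (u : R) : (r < (N.+1 * b).+1)%N -> cell N r u -> stepf N u = x (tm N r).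
Proof.
move=> rM cu; rewrite /stepf (bigD1 (Ordinal rM))//= indicE mem_set// mulr1 big1 ?addr0// => i /negP ne.
rewrite indicE memNset ?mulr0// => ci; apply: ne; apply/eqP/val_inj; exact: cell_uniq ci cu.
Qed.

Lemma cell_exists N u : 0 < u <= T -> exists r, (r < (N.+1 * b).+1)%N /\ cell N r u.
Proof.
move=> /andP[u0 uT].
have ex : exists r, u <= tm N r.
  exists (N.+1 * b)%N; apply: le_trans uT _; apply: le_trans Tb _; rewrite gtimeE /iN ler_pdivlMr// natrM; lra.
have [r ur rmin] := ex_minnP ex; exists r; split.
  rewrite ltnS; apply: rmin; apply: le_trans uT _; apply: le_trans Tb _; rewrite gtimeE /iN ler_pdivlMr// natrM; lra.
rewrite in_cell ur andbT; case: r ur rmin => [|r] ur rmin.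
  rewrite gtimeE add0r; apply: le_lt_trans u0; rewrite -[X in _ - X]mul1r -mulrBl pmulr_lle0 ?iN_gt0//; lra.
by rewrite gtimeS addrK ltNge; apply/negP => /rmin; rewrite ltnn.
Qed.
Let measurable_stepf N : mfunT (stepf N).
Proof.
apply: measurable_sum => r; apply: measurable_funM => //; apply: measurable_indic; exact: measurable_itv.
Qed.
Let stepf_cvg (u : R) : D u -> stepf N u @[N --> \oo] --> x u.
Proof.
rewrite /D /= in_itv/= => uT; have /andP[u0 _] := uT.
apply/cvgrPdist_le => e e0.
have /cvgrPdist_le/(_ _ e0) := right_cont (ltW u0); rewrite /at_right => -[r /= r0 Hr].
have ir0 : 0 <= r^-1 by rewrite invr_ge0 ltW.
have [M [_ M1 _]] := nat_above ir0.
near=> N; have [k [kM ck]] := cell_exists N uT; rewrite (stepfE kM ck).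
move: ck; rewrite in_cell => /andP[h1 h2].
have [->|ne] := eqVneq (tm N k) u; first by rewrite subrr normr0 ltW.
apply: Hr; last by rewrite lt_neqAle eq_sym ne.
rewrite /ball_/= distrC ger0_norm ?subr_ge0//.
have Nr : iN N < r.
  rewrite /iN -[ltRHS]invrK ltf_pV2 ?posrE ?invr_gt0//; apply: le_lt_trans M1 _; rewrite ltr_nat ltnS.
  by near: N; exact: nbhs_infty_ge.
by lra.
Unshelve. all: end_near. Qed.
Let mx : measurable_fun D x.
Proof.
apply: (measurable_fun_cvg (h := stepf)) => [N|u uD]; last exact: stepf_cvg.
by apply: measurable_funTS; exact: measurable_stepf.
Qed.
Let B_ex : exists2 B : R, 0 < B & forall u, 0 <= u <= b%:R + 1 -> `|x u| <= B.
Proof. exact: cadlag_bounded. Qed.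
Let D_fin : (mu D < +oo)%E.
Proof. by rewrite /D lebesgue_measure_itv/=; case: ifP => _; rewrite ?ltry// -EFinB ltry. Qed.
Let bounded_integrable (f : R -> R) (C : R) : measurable_fun D f -> (forall u : R, D u -> `|f u| <= C) ->
  jt f.
Proof.
move=> mf fC; apply: measurable_bounded_integrable => //.
exists C; split; first exact: num_real.
by move=> M CM u uD; apply: le_trans (fC u uD) (ltW CM).
Qed.

Definition jint (f : R -> R) (s t : R) : R := \int[mu]_(u in `]s, t]) f u.

Let subD (s t : R) : 0 <= s -> t <= T -> `]s, t]%classic `<=` D.
Proof. by move=> s0 tT u; rewrite /D /= !in_itv/= => /andP[h1 h2]; lra. Qed.
Let int_sub (f : R -> R) (s t : R) : jt f -> 0 <= s -> t <= T -> mu.-integrable `]s, t] (EFin \o f).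
Proof. by move=> fi s0 tT; apply: (@integrableS _ _ _ mu D) fi => //; exact: subD. Qed.
Let jint_cat (f : R -> R) (s t v : R) : jt f -> 0 <= s -> s <= t -> t <= v -> v <= T ->
  jint f s v = jint f s t + jint f t v.
Proof.
move=> fi s0 st tv vT; have i1 := int_sub fi s0 vT.
have := @Rintegral_itvB R f (BRight s) (BRight v) t i1; rewrite !bnd_simp => /(_ st tv) h.
by rewrite /jint -h addrC subrK.
Qed.
Let jint_cst (c s t : R) : s <= t -> jint (fun=> c) s t = c * (t - s).
Proof.
move=> st; rewrite /jint Rintegral_cst; last exact: measurable_itv.
suff E : mu `]s, t]%classic = (t - s)%:E by transitivity (c * fine (t - s)%:E) => //; congr (c * fine _); exact: E.
apply: (etrans (lebesgue_measure_itv _)); rewrite /= lte_fin; case: ltP => h //=.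
by rewrite (_ : t = s) ?subrr//; apply/eqP; rewrite eq_le h st.
Qed.
Let cst_int (c : R) : jt (fun=> c).
Proof. by apply: (@bounded_integrable _ `|c|). Qed.
Let jint_norm (f g : R -> R) (s t : R) : jt f -> jt g -> 0 <= s -> t <= T ->
  (forall u : R, s < u <= t -> `|f u| <= g u) -> `|jint f s t| <= jint g s t.
Proof.
move=> fi gi s0 tT fg.
have mI : measurable (`]s, t]%classic : set R) by exact: measurable_itv.
have h := @le_normr_Rintegral _ _ _ mu _ f mI (int_sub fi s0 tT); apply: le_trans h _.
apply: le_Rintegral => //.
- exact: (integrable_norm (int_sub fi s0 tT)).
- exact: int_sub.
Qed.
Let jint_bound (f : R -> R) (C s t : R) : jt f -> 0 <= s -> s <= t -> t <= T ->
  (forall u : R, s < u <= t -> `|f u| <= C) -> `|jint f s t| <= C * (t - s).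
Proof. by move=> fi s0 st tT fC; rewrite -jint_cst//; apply: jint_norm. Qed.

Variable I : nat -> nat.
Local Notation win N := (window N.+1 (I N.+1) (fun r => x (tm N r))).
Hypothesis hI : forall N, (I N)%:R <= N%:R * (T - 1) < (I N)%:R + 1.

Definition Vpath : \bar R :=
  ereal_sup [set (\int[mu]_(u in `[s, (s + 1)%R]) (x u)%:E)%E | s in `[0, (T - 1)%R]].

(** A scaled window sum is, up to boundary cells, the integral of [stepf] over a unit interval, and
    the L1 distance from [stepf] to the path controls all windows at once; it tends to 0 by
    dominated convergence. Starting points off the grid cost O(1/N) because the path is bounded. *)
Theorem window_cvg : Vpath \is a fin_num /\
  win N / N.+1%:R @[N --> \oo] --> fine Vpath.
Proof.
have [B B0 HB] := B_ex.
have xB (u : R) : D u -> `|x u| <= B.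
  rewrite /D /= in_itv/= => /andP[h1 h2]; apply: HB; rewrite (ltW h1)/=.
  by apply: le_trans h2 _; apply: le_trans Tb _; rewrite lerDl.
have xi : jt x by exact: bounded_integrable mx xB.
have tmB N r : (r < (N.+1 * b).+1)%N -> `|x (tm N r)| <= B.
  move=> rM; apply: HB; rewrite ltW ?gtime_gt0//=; rewrite gtimeE /iN ler_pdivrMr//.
  have : r%:R <= N.+1%:R * b%:R :> R by rewrite -natrM ler_nat -ltnS.
  have : 1 <= N.+1%:R :> R by rewrite ler1n.
  by rewrite mulrDl mul1r [b%:R * _]mulrC; lra.
pose g N (u : R) := `|stepf N u - x u|.
have gB N (u : R) : D u -> `|g N u| <= 2 * B.
  move=> uD; rewrite /g normr_id; apply: le_trans (ler_normB _ _) _.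
  have := uD; rewrite /D /= in_itv/= => /(cell_exists N)[r [rM cr]].
  by rewrite (stepfE rM cr); have := tmB N r rM; have := xB u uD; lra.
have mg N : measurable_fun D (g N) by apply: measurableT_comp => //; apply: measurable_funB => //; apply: measurable_funTS.
have gi N : jt (g N) := bounded_integrable (mg N) (gB N).
pose e N := jint (g N) 0 T.
have ecvg : e N @[N --> \oo] --> 0.
  have H : (\int[mu]_(u in D) (g N u)%:E)%E @[N --> \oo] --> (\int[mu]_(u in D) (cst 0 u)%:E)%E.
    apply: (@dominated_cvg _ _ _ mu D mD (fun N u => (g N u)%:E) (fun u => (cst 0 u)%:E) (EFin \o (fun=> 2 * B))).
    - by move=> N; apply/measurable_EFinP; exact: mg.
    - move=> u uD; apply/fine_cvgP; split; first exact: nearW.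
      have C := stepf_cvg uD; have C2 : stepf N u - x u @[N --> \oo] --> x u - x u by apply: cvgB => //; exact: cvg_cst.
      rewrite subrr in C2; have C3 := cvg_norm C2; rewrite normr0 in C3; exact: C3.
    - by [].
    - exact: cst_int.
    - by move=> N u uD; rewrite /= lee_fin; exact: gB.
  by rewrite integral0_eq// in H; move/fine_cvgP: H => [].
have eN N (s t : R) : 0 <= s -> s <= t -> t <= T -> jint (g N) s t <= e N.
  move=> s0 st tT; have T0 : 0 <= T by lra.
  have pos_int c c' : 0 <= jint (g N) c c' by apply: Rintegral_ge0 => u _; exact: normr_ge0.
  have sT : s <= T by lra.
  rewrite /e (@jint_cat _ 0 s T)// (@jint_cat _ s t T)//.
  by have := pos_int 0 s; have := pos_int t T; lra.
have cells N i k : (i + k < (N.+1 * b).+1)%N -> tm N (i + k) <= T ->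
    `|\sum_(r < k) x (tm N (i + r.+1)) * iN N - jint x (tm N i) (tm N (i + k))| <= jint (g N) (tm N i) (tm N (i + k)).
  have i0 := iN_gt0 N.
  have t0 r : 0 <= tm N r by apply: ltW; exact: gtime_gt0.
  elim: k => [|k IH] kM kT.
    rewrite big_ord0 addn0 sub0r normrN.
    have := @jint_bound _ B (tm N i) (tm N i) xi (t0 i) (lexx _); rewrite addn0 in kT => /(_ kT).
    rewrite subrr mulr0 => h; apply: le_trans (h _) _; first by move=> u /andP[h1 h2]; lra.
    by apply: Rintegral_ge0 => u _; exact: normr_ge0.
  have tS : tm N (i + k.+1) = tm N (i + k) + iN N by rewrite addnS gtimeS.
  have ik : tm N i <= tm N (i + k) by rewrite !gtimeE ler_pM2r// lerD2r ler_nat leq_addr.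
  have tk : tm N (i + k) <= tm N (i + k.+1) by rewrite tS; lra.
  rewrite big_ord_recr/= (@jint_cat x _ (tm N (i + k)))// (@jint_cat (g N) _ (tm N (i + k)))//.
  have kM' : (i + k < (N.+1 * b).+1)%N by apply: leq_trans kM; rewrite addnS ltnS.
  have {}IH := IH kM' (le_trans tk kT).
  have -> : x (tm N (i + k.+1)) * iN N = jint (fun=> x (tm N (i + k.+1))) (tm N (i + k)) (tm N (i + k.+1)).
    by rewrite jint_cst// [X in _ * (X - _)]tS addrC addKr.
  have ci := cst_int (x (tm N (i + k.+1))).
  have one : `|jint (fun=> x (tm N (i + k.+1))) (tm N (i + k)) (tm N (i + k.+1)) - jint x (tm N (i + k)) (tm N (i + k.+1))|
      <= jint (g N) (tm N (i + k)) (tm N (i + k.+1)).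
    have mI : measurable (`](tm N (i + k)), (tm N (i + k.+1))]%classic : set R) by exact: measurable_itv.
    rewrite /jint -RintegralB; [|exact: mI|exact: int_sub ci (t0 _) kT|exact: int_sub xi (t0 _) kT].
    apply: (@jint_norm (fun u => x (tm N (i + k.+1)) - x u) (g N)) => //.
      by apply: (@integrableB _ _ _ mu D mD (EFin \o cst (x (tm N (i + k.+1)))) (EFin \o x)).
    move=> u hu; rewrite /g (@stepfE N (i + k.+1) u)//.
    by rewrite in_cell [X in X - _]tS addrK.
  move: IH one; rewrite !ler_norml => *; lra.
pose S s := jint x s (s + 1).
have SE s : 0 <= s <= T - 1 -> (\int[mu]_(u in `[s, (s + 1)%R]) (x u)%:E)%E = (S s)%:E.
  move=> /andP[s0 sT]; have sT1 : s + 1 <= T by lra.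
  have xis := int_sub xi s0 sT1.
  rewrite -integral_itv_obnd_cbnd; last exact: (measurable_int mu xis).
  by rewrite /S /jint /Rintegral fineK//; apply: integrable_fin_num => //; exact: measurable_itv.
(* Three units pay for the end cells of a window in [avg] and two for moving the start s to a grid
   point; one is to spare. *)
pose del N := 6 * (B * iN N) + e N.
have avg N i : (i <= I N.+1)%N -> [/\ i%:R * iN N <= T - 1, (forall r, (r < N.+1)%N -> `|x (tm N (i + r))| <= B) &
    `|(\sum_(r < N.+1) x (tm N (i + r))) * iN N - S (i%:R * iN N)| <= 3 * (B * iN N) + e N].
  move=> iI; have /andP[I1 I2] := hI N.+1.
  have NR0 : 0 < N.+1%:R :> R by [].
  have i0 := iN_gt0 N.
  have iI' : i%:R <= (I N.+1)%:R :> R by rewrite ler_nat.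
  have s1 : i%:R * iN N <= T - 1 by rewrite /iN ler_pdivrMr// mulrC; lra.
  have s0 : 0 <= i%:R * iN N by rewrite mulr_ge0// ltW.
  have iM : (i + N.+1 <= N.+1 * b)%N.
    rewrite -(ler_nat R) natrD natrM; have : N.+1%:R * T <= N.+1%:R * b%:R by rewrite ler_wpM2l.
    by move: I1; rewrite mulrBr mulr1; lra.
  have rB r : (r < N.+1)%N -> `|x (tm N (i + r))| <= B by move=> rN; apply: tmB; exact: index_lt.
  split => //.
  have tE r : tm N (i + r) = i%:R * iN N + (r%:R + 2^-1) * iN N by rewrite gtimeE natrD -addrA mulrDl.
  have ti : tm N i = i%:R * iN N + 2^-1 * iN N by rewrite -(addn0 i) tE addn0 add0r.
  have tN : tm N (i + N) = i%:R * iN N + 1 - 2^-1 * iN N.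
    have eN1 : N%:R = N.+1%:R - 1 :> R by rewrite -natr1 addrK.
    rewrite tE eN1.
    have -> : (N.+1%:R - 1 + 2^-1) * iN N = N.+1%:R * iN N - 2^-1 * iN N by field.
    by rewrite iN_mul addrA.
  have titN : tm N i <= tm N (i + N) by rewrite !gtimeE ler_pM2r// lerD2r ler_nat leq_addr.
  have tNT : tm N (i + N) <= T by rewrite tN; lra.
  have cN := @cells N i N (index_lt iM (ltnSn N)) tNT.
  have tge0 r : 0 <= tm N r by apply: ltW; exact: gtime_gt0.
  have eNi := eN N (tm N i) (tm N (i + N)) (tge0 i) titN tNT.
  set sN := i%:R * iN N in s0 s1 ti tN *.
  have o1 : sN <= tm N i by rewrite ti; lra.
  have o2 : tm N (i + N) <= sN + 1 by rewrite tN; lra.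
  have o3 : sN + 1 <= T by lra.
  have SS : S sN = jint x sN (tm N i) + (jint x (tm N i) (tm N (i + N)) + jint x (tm N (i + N)) (sN + 1)).
    by rewrite /S -jint_cat// -jint_cat//; apply: le_trans titN _.
  have T1' : tm N i <= T by lra.
  have b1 : `|jint x sN (tm N i)| <= B * (tm N i - sN).
    apply: jint_bound => //.
    by move=> u /andP[h1 h2]; apply: xB; rewrite /D /= in_itv/=; lra.
  have b2 : `|jint x (tm N (i + N)) (sN + 1)| <= B * (sN + 1 - tm N (i + N)).
    apply: jint_bound => //.
    move=> u /andP[h1 h2]; apply: xB; rewrite /D /= in_itv/=; apply/andP; split; last by lra.
    by apply: le_lt_trans h1.
  have b0 : `|x (tm N (i + 0)) * iN N| <= B * iN N by rewrite normrM (gtr0_norm i0) ler_wpM2r ?(ltW i0)//; exact: rB.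
  have w1 : B * (tm N i - sN) = B * iN N / 2 by rewrite ti addrAC subrr add0r; ring.
  have w2 : B * (sN + 1 - tm N (i + N)) = B * iN N / 2 by rewrite tN; ring.
  have Bp : 0 < B * iN N by rewrite mulr_gt0.
  rewrite mulr_suml big_ord_recl/= SS; rewrite w1 in b1; rewrite w2 in b2.
  have {}cN := le_trans cN eNi.
  have -> : \sum_(i0 < N) x (tm N (i + bump 0 i0)) * iN N = \sum_(r < N) x (tm N (i + r.+1)) * iN N by apply: eq_bigr.
  move: cN b0 b1 b2; rewrite !ler_norml => /andP[? ?] /andP[? ?] /andP[? ?] /andP[? ?].
  by lra.
have low N : ((win N * iN N - del N)%:E <= Vpath)%E.
  have NR0 : 0 < N.+1%:R :> R by [].
  have Bp : 0 < B * iN N by rewrite mulr_gt0.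
  have [i iI ->] : exists2 i, (i <= I N.+1)%N & win N = \sum_(r < N.+1) x (tm N (i + r)).
    elim: (I N.+1) => [|k [i ik IH]] /=; first by exists 0%N.
    case: (leP (window N.+1 k (fun r => x (tm N r))) (\sum_(r < N.+1) x (tm N (k.+1 + r)))) => h.
      by exists k.+1.
    by exists i => //; exact: leqW.
  have [s1 _ h] := avg N i iI.
  have s0 : 0 <= i%:R * iN N by rewrite mulr_ge0// ltW.
  apply: le_trans (_ : (S (i%:R * iN N))%:E <= _)%E.
    by rewrite lee_fin /del; move: h; rewrite ler_norml => *; lra.
  apply: ereal_sup_ubound; exists (i%:R * iN N) => //; first by rewrite /= in_itv/= s0.
  by rewrite SE// s0.
have up N : (Vpath <= (win N * iN N + del N)%:E)%E.
  have NR0 : 0 < N.+1%:R :> R by [].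
  have iN0 := iN_gt0 N.
  apply: ge_ereal_sup => _ [s /= + <-]; rewrite in_itv/= => s01; have /andP[s0 s1] := s01.
  rewrite SE// lee_fin.
  pose i := Num.truncn (s * N.+1%:R).
  have sN0 : 0 <= s * N.+1%:R by rewrite mulr_ge0.
  have /andP[i1 i2] := truncn_itv sN0; rewrite -/i in i1 i2.
  have iI : (i <= I N.+1)%N.
    have /andP[_ I2] := hI N.+1; rewrite -ltnS -(ltr_nat R) -natr1; apply: le_lt_trans i1 _.
    by apply: le_lt_trans I2; rewrite mulrC ler_pM2l.
  have [t1 _ h] := avg N i iI.
  have t0 : 0 <= i%:R * iN N by rewrite mulr_ge0// ltW.
  have ts : i%:R * iN N <= s by rewrite /iN ler_pdivrMr.
  have st : s - i%:R * iN N <= iN N.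
    rewrite lerBlDl -[X in _ + X]mul1r -mulrDl /iN ler_pdivlMr// natr1; exact: ltW.
  set t := i%:R * iN N in t0 t1 ts st h.
  have sw : `|S s - S t| <= 2 * (B * iN N).
    have sT1 : s + 1 <= T by lra.
    have tT1 : t + 1 <= T by lra.
    have ts1 : t + 1 <= s + 1 by lra.
    have iN1 := iN_le1 N.
    have st1 : s <= t + 1 by lra.
    have tT : t <= T by lra.
    have e1 : S t = jint x t s + jint x s (t + 1) by rewrite /S -jint_cat.
    have e2 : S s = jint x s (t + 1) + jint x (t + 1) (s + 1) by rewrite /S -jint_cat.
    have t10 : 0 <= t + 1 by lra.
    have sT : s <= T by lra.
    have b1 : `|jint x t s| <= B * (s - t) by apply: jint_bound => // u /andP[h1 h2]; apply: xB; rewrite /D /= in_itv/=; lra.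
    have b2 : `|jint x (t + 1) (s + 1)| <= B * (s + 1 - (t + 1)).
      by apply: jint_bound => // u /andP[h1 h2]; apply: xB; rewrite /D /= in_itv/=; lra.
    have b3 : B * (s - t) <= B * iN N by rewrite ler_pM2l.
    have b4 : s + 1 - (t + 1) = s - t by ring.
    rewrite b4 in b2.
    have -> : S s - S t = jint x (t + 1) (s + 1) - jint x t s by rewrite e1 e2; ring.
    apply: le_trans (ler_normB _ _) _; rewrite (_ : 2 * (B * iN N) = B * iN N + B * iN N); last by ring.
    by apply: lerD; [exact: le_trans b2 b3|exact: le_trans b1 b3].
  have W : \sum_(r < N.+1) x (tm N (i + r)) <= win N.
    exact: (@window_ge _ N.+1 (I N.+1) i (fun r => x (tm N r)) iI).
  have W' := ler_wpM2r (ltW iN0) W.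
  have Bp : 0 < B * iN N by rewrite mulr_gt0.
  rewrite /del; move: h sw; rewrite !ler_norml => *; lra.
have fin : Vpath \is a fin_num.
  rewrite fin_numElt; apply/andP; split.
    by apply: lt_le_trans (low 0%N); exact: ltNyr.
  by apply: le_lt_trans (up 0%N) _; exact: ltry.
split; first exact: fin.
have dcvg : del N @[N --> \oo] --> 0.
  rewrite -[X in _ --> X]addr0; apply: cvgD => //.
  have ic : iN N @[N --> \oo] --> 0.
    have hs J : \forall n \near \oo, (J <= n.+1)%N by near=> n; apply: leqW; near: n; exact: nbhs_infty_ge.
    exact: (cvg_infty_comp hs (@cvg_inv_natr R)).
  have C : (6 * B) * iN N @[N --> \oo] --> (6 * B) * 0 by apply: cvgM => //; exact: cvg_cst.
  by rewrite mulr0 in C; apply: near_cvg C; apply: nearW => N; rewrite mulrA.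
suff C : win N * iN N @[N --> \oo] --> fine Vpath by exact: C.
apply/cvgrPdist_le => ep ep0; near=> N.
have dN : `|0 - del N| <= ep by near: N; move/cvgrPdist_le : dcvg; exact.
have l1 := low N; have u1 := up N; rewrite -(fineK fin) lee_fin in l1; rewrite -(fineK fin) lee_fin in u1.
rewrite sub0r normrN in dN; have dN' := le_trans (ler_norm _) dN.
by rewrite ler_norml; lra.
Unshelve. all: end_near. Qed.

End Path.

(** * Riemann sums of a power *)

Section RiemannPower.
Variable R : realType.

Lemma powR_bernoulli_ge (g y : R) : 1 <= g -> 0 <= y -> 1 + g * (y - 1) <= y `^ g.
Proof.
move=> g1; have g0 : 0 < g by lra.
rewrite le_eqVlt => /orP[/eqP<-|y0]; first by rewrite powR0 ?gt_eqF//; lra.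
have ig : 0 < g^-1 <= 1 by rewrite invr_gt0 g0 invf_le1.
have := powR_bernoulli ig (powR_gt0 g y0); rewrite -powRrM mulfV ?gt_eqF// powRr1 ?(ltW y0)//.
move=> h; have : g * y <= g * (1 + g^-1 * (y `^ g - 1)) by rewrite ler_pM2l.
by rewrite mulrDr mulrA mulfV ?gt_eqF// mul1r; lra.
Qed.

Variable b : R.
Hypothesis b0 : 0 < b.

Let split_pow (x : R) : 0 < x -> x `^ (b + 1) = x * x `^ b.
Proof. move=> x0; rewrite powRD; last by rewrite (gt_eqF x0) implybT.
by rewrite powRr1 ?(ltW x0)// mulrC. Qed.
Let incr_lo (x : R) : 0 <= x -> (b + 1) * x `^ b <= (x + 1) `^ (b + 1) - x `^ (b + 1).
Proof.
have g1 : 1 <= b + 1 by rewrite lerDr ltW.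
rewrite le_eqVlt => /orP[/eqP<-|x0].
  by rewrite !powR0 ?gt_eqF ?mulr0 ?subr0 ?powR_ge0//; lra.
have y0 : 0 <= (x + 1) / x by rewrite divr_ge0 ?(ltW x0)//; lra.
have xg := powR_gt0 (b + 1) x0.
have := powR_bernoulli_ge g1 y0; rewrite -(ler_pM2l xg) -powRM ?(ltW x0)// mulrCA mulfV ?gt_eqF// mulr1.
have -> : (x + 1) / x - 1 = x^-1 by field; rewrite gt_eqF.
rewrite mulrDr mulr1 {2}split_pow//.
have -> : x * x `^ b * ((b + 1) / x) = (b + 1) * x `^ b by field; rewrite gt_eqF.
by lra.
Qed.
Let incr_up (x : R) : 0 <= x -> (x + 1) `^ (b + 1) - x `^ (b + 1) <= (b + 1) * (x + 1) `^ b.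
Proof.
move=> x0; have g1 : 1 <= b + 1 by rewrite lerDr ltW.
have s0 : 0 < x + 1 by lra.
have y0 : 0 <= x / (x + 1) by rewrite divr_ge0// ltW.
have sg := powR_gt0 (b + 1) s0.
have := powR_bernoulli_ge g1 y0; rewrite -(ler_pM2l sg) -powRM ?(ltW s0)// mulrCA mulfV ?gt_eqF// mulr1.
have -> : x / (x + 1) - 1 = - (x + 1)^-1 by field; rewrite gt_eqF.
rewrite mulrDr mulr1 {2}split_pow//.
have -> : (x + 1) * (x + 1) `^ b * ((b + 1) * - (x + 1)^-1) = - ((b + 1) * (x + 1) `^ b) by field; rewrite gt_eqF.
by lra.
Qed.

(** The midpoint sum lies between the sums at left and at right endpoints; these enclose the
    integral and differ by N^b only. *)
Lemma sum_pow_half N : `|\sum_(r < N) (r%:R + 2^-1) `^ b - N%:R `^ (b + 1) / (b + 1)| <= N%:R `^ b.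
Proof.
have g0 : 0 < b + 1 by rewrite addr_gt0.
have mono (x y : R) : 0 <= x -> x <= y -> x `^ b <= y `^ b.
  by move=> x0 xy; apply: ge0_ler_powR => //; rewrite ?nnegrE ?(ltW b0)//; exact: le_trans xy.
have lo : \sum_(r < N) (r%:R : R) `^ b <= N%:R `^ (b + 1) / (b + 1).
  elim: N => [|N IH]; first by rewrite big_ord0 powR0 ?gt_eqF// mul0r.
  rewrite big_ord_recr/=; have := incr_lo (ler0n R N); rewrite natr1 => h.
  have : N%:R `^ b <= (N.+1%:R `^ (b + 1) - N%:R `^ (b + 1)) / (b + 1) by rewrite ler_pdivlMr// mulrC.
  by rewrite mulrBl; lra.
have up : N%:R `^ (b + 1) / (b + 1) <= \sum_(r < N) (r.+1%:R : R) `^ b.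
  elim: N {lo} => [|N IH]; first by rewrite big_ord0 powR0 ?gt_eqF// mul0r.
  rewrite big_ord_recr/=; have := incr_up (ler0n R N); rewrite natr1 => h.
  have : (N.+1%:R `^ (b + 1) - N%:R `^ (b + 1)) / (b + 1) <= N.+1%:R `^ b by rewrite ler_pdivrMr// mulrC.
  by rewrite mulrBl; lra.
have shift : \sum_(r < N) (r.+1%:R : R) `^ b = \sum_(r < N) (r%:R : R) `^ b + N%:R `^ b.
  transitivity (\sum_(r < N.+1) (r%:R : R) `^ b); last by rewrite big_ord_recr.
  by rewrite big_ord_recl/= powR0 ?gt_eqF// add0r.
have m1 : \sum_(r < N) (r%:R : R) `^ b <= \sum_(r < N) (r%:R + 2^-1) `^ b by apply: ler_sum => r _; apply: mono => //; lra.
have m2 : \sum_(r < N) (r%:R + 2^-1) `^ b <= \sum_(r < N) (r.+1%:R : R) `^ b.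
  apply: ler_sum => r _; apply: mono; first by have := ler0n R r; lra.
  by rewrite -[r.+1%:R]natr1; lra.
by rewrite ler_norml; lra.
Qed.

Lemma riemann_power : (\sum_(r < N.+1) gtime R N.+1 r `^ b) / N.+1%:R @[N --> \oo] --> (b + 1)^-1.
Proof.
apply/cvgrPdist_le => e e0.
have ie0 : 0 <= e^-1 by rewrite invr_ge0 ltW.
have [M [_ M1 _]] := nat_above ie0.
near=> N; set K : R := N.+1%:R; have K0 : 0 < K by rewrite /K.
have tE r : gtime R N.+1 r `^ b = (r%:R + 2^-1) `^ b / K `^ b.
  have -> : gtime R N.+1 r = (r%:R + 2^-1) * K^-1 by rewrite /gtime -/K; move: K K0 => K K0; field; rewrite gt_eqF.
  have r0 : 0 <= r%:R + 2^-1 :> R by have := ler0n R r; lra.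
  rewrite powRM ?invr_ge0 ?(ltW K0)//; congr (_ * _).
  by rewrite -powR_inv1 ?(ltW K0)// -powRrM mulN1r powRN.
under eq_bigr do rewrite tE; rewrite -mulr_suml.
have Kb := powR_gt0 b K0.
have := sum_pow_half N.+1; rewrite -/K split_pow//.
move: (\sum_(r < N.+1) _) => S h.
have g0 : 0 < b + 1 by rewrite addr_gt0.
have -> : (b + 1)^-1 - S / K `^ b / K = - (S - K * K `^ b / (b + 1)) / (K * K `^ b) by field; rewrite !gt_eqF.
have KK : 0 < K * K `^ b by rewrite mulr_gt0.
rewrite mulNr normrN normrM normfV (gtr0_norm KK) ler_pdivrMr//; apply: le_trans h _.
have Ke : 1 <= e * K.
  rewrite -ler_pdivrMl// mulr1; apply: le_trans M1 _; rewrite /K ler_nat; apply: leqW.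
  by near: N; exact: nbhs_infty_ge.
by rewrite mulrA ler_peMl// ltW.
Unshelve. all: end_near. Qed.

Lemma powR_slope_cvg (c : R) (h : nat -> R) : (forall k, h k != 0) -> h k @[k --> \oo] --> 0 ->
  ((1 + h k) `^ c - 1) / h k @[k --> \oo] --> c.
Proof.
move=> h0 hc; apply/cvgrPdist_le => e e0; have [r r0 Hr] := powR_slope c e0.
near=> k; rewrite distrC; apply: ltW; apply: Hr; first exact: h0.
have : `|0 - h k| < r by near: k; move/cvgrPdist_lt : hc; exact.
by rewrite sub0r normrN.
Unshelve. all: end_near. Qed.

End RiemannPower.

(** * The Galton-Watson process: measurability, Markov property, expectations *)

Section Tree.
Variables (R : realType) (p : nat -> R) (a : R).
Hypothesis p_ge0 : forall k, 0 <= p k.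
Hypothesis p_sum : (\sum_(k <oo) (p k)%:E = 1)%E.
Hypothesis p_mean : (\sum_(k <oo) (k%:R * p k)%:E = 1)%E.
Hypothesis dd : decrement a (loss p).
Variables (d : measure_display) (T : measurableType d) (P : probability T R).
Variable (Z : nat -> T -> nat).
Hypothesis gw : is_GW P Z p.

Section Process.
Local Notation path w := (fun k => Z k w).

Definition cylinder (n : nat) (z : nat -> nat) : set T :=
  [set w | forall k, (k <= n)%N -> Z k w = z k].

Lemma measurable_cylinder n z : measurable (cylinder n z).
Proof.
have [mZ _] := gw.
elim: n => [|n IH].
  rewrite (_ : cylinder 0 z = [set w | Z 0 w = z 0%N])//.
  apply/seteqP; split=> w /=; first exact.
  by move=> h k; rewrite leqn0 => /eqP ->.
rewrite (_ : cylinder n.+1 z = cylinder n z `&` [set w | Z n.+1 w = z n.+1]); first exact: measurableI.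
apply/seteqP; split=> w /=.
  by move=> h; split; [move=> k kn; apply: h; exact: leqW|exact: h].
by move=> [h1 h2] k; rewrite leq_eqVlt => /predU1P[->//|]; rewrite ltnS; exact: h1.
Qed.

(** There are only countably many histories up to generation n, so every preimage is a countable
    union of cylinders. *)
Lemma measurable_adapt n (d' : measure_display) (U : measurableType d')
    (g : (nat -> nat) -> U) : adapt n g -> mfunT (fun w => g (path w)).
Proof.
move=> ga _ B mB; rewrite setTI.
pose F (s : seq nat) := if `[< B (g (nth 0%N s)) >] then cylinder n (nth 0%N s) else set0.
rewrite (_ : _ @^-1` _ = \bigcup_s F s).
  apply: countable_bigcupT_measurable => // s.
  by rewrite /F; case: ifP => // _; exact: measurable_cylinder.
apply/seteqP; split=> w /=.
  move=> Bw; exists [seq Z k w | k <- iota 0 n.+1] => //.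
  rewrite /F; set s := map _ _.
  have E k : (k <= n)%N -> Z k w = nth 0%N s k by move=> kn; rewrite (nth_map 0%N) ?size_iota ?ltnS// nth_iota ?ltnS.
  by rewrite -(ga _ _ E); case: asboolP.
move=> [s _]; rewrite /F; case: asboolP => // Bs h.
by rewrite /= (ga _ (nth 0%N s)).
Qed.

(** A countable partition into cylinders of depth n, enumerated by the codes of integer sequences; a
    code of the wrong length, or of no sequence, gives the empty set. *)
Let D n i : set T := if (pickle_inv i : option (seq nat)) is Some s then
  (if size s == n.+1 then cylinder n (nth 0%N s) else set0) else set0.

Let mD n i : measurable (D n i).
Proof.
rewrite /D; case: pickle_inv => [s|//]; case: ifP => // _; exact: measurable_cylinder.
Qed.
Let D_triv n : trivIset setT (D n).
Proof.
move=> i j _ _ [w]; rewrite /D.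
have := pickle_invK (T := seq nat) i; have := pickle_invK (T := seq nat) j.
case: (pickle_inv i) => [s|] => [|_ _ []//].
case: eqP => [ss|_ _ _ []//].
case: (pickle_inv j) => [s'|] => [|_ _ []//].
case: eqP => [ss'|_ _ _ []//] /= <- <- [h h'].
congr (pickle _); apply: (@eq_from_nth _ 0%N) => [|k]; first by rewrite ss ss'.
by rewrite ss ltnS => kn; rewrite -h// -h'.
Qed.
Let D_cover n : \bigcup_i D n i = setT.
Proof.
apply/seteqP; split=> w // _; exists (pickle [seq Z k w | k <- iota 0 n.+1]) => //.
rewrite /D pickleK_inv size_map size_iota eqxx => k kn.
by rewrite (nth_map 0%N) ?size_iota ?ltnS// nth_iota ?ltnS.
Qed.
Let DP n i : D n i = set0 \/ exists z, D n i = cylinder n z.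
Proof.
rewrite /D; case: pickle_inv => [s|]; last by left.
by case: ifP => _; [right; exists (nth 0%N s)|left].
Qed.

Local Open Scope ereal_scope.

Let integral_cylinder n (g : (nat -> nat) -> \bar R) (z : nat -> nat) (B : set T) :
  measurable B -> B `<=` cylinder n z -> adapt n g ->
  \int[P]_(w in B) g (path w) = g z * P B.
Proof.
move=> mB Bz ga; rewrite -(integral_cst P mB); apply: eq_integral => w.
by rewrite inE => /Bz h; exact: ga.
Qed.

Lemma cylinder_next n z b :
  P (cylinder n z `&` [set w | Z n.+1 w = b]) = (convpow p (z n) b)%:E * P (cylinder n z).
Proof.
have [_ gwE] := gw.
pose z' k := if (k <= n)%N then z k else b.
have -> : cylinder n z `&` [set w | Z n.+1 w = b] = cylinder n.+1 z'.
  apply/seteqP; split => w /=.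
    move=> [h1 h2] k; rewrite leq_eqVlt ltnS => /predU1P[->|kn].
      by rewrite /z' ltnn.
    by rewrite /z' kn; exact: h1.
  move=> h; split; last by have := h n.+1 (leqnn _); rewrite /z' ltnn.
  by move=> k kn; have := h k (leqW kn); rewrite /z' kn.
have z'E k : (k <= n)%N -> z' k = z k by rewrite /z' => ->.
have z'n1 : z' n.+1 = b by rewrite /z' ltnn.
rewrite /cylinder !gwE -EFinM big_ord_recr/= z'n1 (z'E n)// (z'E 0%N)//; congr (_%:E).
rewrite mulrA mulrC; congr (_ * (_ * _))%R.
by apply: eq_bigr => i _; rewrite !z'E// ltnW.
Qed.

(** Conditioning on the first n + 1 generations without sigma-algebras: on each cylinder of the
    partition both sides are sums over the next value. *)
Lemma markov_step n (G : (nat -> nat) -> nat -> R) :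
  (forall z b, 0 <= G z b)%R -> (forall b, adapt n (G ^~ b)) ->
  \int[P]_w (G (path w) (Z n.+1 w))%:E =
  \int[P]_w \sum_(b <oo) (G (path w) b * convpow p (Z n w) b)%:E.
Proof.
move=> G0 Ga; have [mZ _] := gw.
have G'0 z b k : 0 <= (G z b * convpow p k b)%:E by rewrite lee_fin mulr_ge0// convpow_ge0.
have Ga' : adapt n (fun z => \sum_(b <oo) (G z b * convpow p (z n) b)%:E).
  move=> z z' E; apply: eq_eseriesr => b _.
  by rewrite (Ga b _ _ E) (E n (leqnn n)).
have Ga2 : adapt n.+1 (fun z => G z (z n.+1)).
  move=> z z' E; rewrite (E n.+1 (leqnn _)); apply: (Ga) => k kn; exact/E/leqW.
have m1 : mfunT (EFin \o (fun w => G (path w) (Z n.+1 w))) by apply/measurable_EFinP; exact: (measurable_adapt Ga2).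
have m2 := @measurable_adapt n _ (\bar R) _ Ga'.
rewrite -{1 2}(D_cover n) !ge0_integral_bigcup ?D_cover//; last 2 first.
  by move=> w _; apply: nneseries_ge0 => k _ _; exact: G'0.
  by move=> w _; rewrite lee_fin.
apply: eq_eseriesr => i _.
have [->|[z Dz]] := DP n i; first by rewrite !integral_set0.
rewrite (@integral_cylinder n _ z _ (mD n i) _ Ga') ?Dz// muleC.
rewrite -(fineK (fin_num_measure P _ (measurable_cylinder n z))) -nneseriesZl//.
pose E b : set T := cylinder n z `&` [set w | Z n.+1 w = b].
have mE b : measurable (E b) by apply: measurableI => //; exact: measurable_cylinder.
have EU : cylinder n z = \bigcup_b E b by apply/seteqP; split=> w; [move=> h; exists (Z n.+1 w)|move=> [b _ []]].
rewrite {1}EU ge0_integral_bigcup//.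
- apply: eq_eseriesr => b _.
  transitivity (\int[P]_(w in E b) (fun z => (G z b)%:E) (path w)).
    by apply: eq_integral => w; rewrite inE => -[_ /= ->].
  rewrite (@integral_cylinder n (fun y => (G y b)%:E) z)//; last 2 first.
    by move=> w [].
    by move=> y y' e; rewrite (Ga b _ _ e).
  rewrite /E cylinder_next muleA -EFinM muleC.
  by rewrite fineK// fin_num_measure//; exact: measurable_cylinder.
- by apply: measurable_funTS.
- by move=> w _; rewrite lee_fin.
- by move=> b b' _ _ [w [[_ /= <-] [_ /= <-]]].
Qed.

Lemma Z0_ae : {ae P, forall w, Z 0 w = 1%N}.
Proof.
have [mZ gwE] := gw.
exists [set w | Z 0 w <> 1%N]; split => //=.
  rewrite [X in measurable X](_ : _ = ~` [set w | Z 0 w = 1%N])//.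
  exact: measurableC.
rewrite (_ : [set _ | _] = ~` [set w | Z 0 w = 1%N])// probability_setC//.
have := gwE 0%N (fun=> 1%N); rewrite big_ord0 mulr1/=.
rewrite (_ : [set w | _] = [set w | Z 0 w = 1%N]); last first.
  apply/seteqP; split=> w /=; first exact.
  by move=> h k; rewrite leqn0 => /eqP ->.
by move=> ->; rewrite subee.
Qed.

Lemma integral_Z n : \int[P]_w ((Z n w)%:R%:E) = 1.
Proof.
elim: n => [|n IH].
  rewrite -[RHS](probability_setT P) -[RHS]mul1e -(integral_cst P measurableT 1%E).
  apply: ae_eq_integral => //.
    apply/measurable_EFinP.
    by apply: (@measurable_adapt 0 _ _ (fun z => (z 0%N)%:R : R)) => z z' ->.
  by case: Z0_ae => A [mA PA AP]; exists A; split => // w /= h; apply: AP => /= h'; apply: h => _; rewrite h'.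
have := @markov_step n (fun _ b => b%:R)%R (fun _ b => ler0n _ b) (fun b _ _ _ => erefl) => ->.
rewrite -IH; apply: eq_integral => w _; exact: convpow_mean.
Qed.

Local Close Scope ereal_scope.

Definition Ex (g : (nat -> nat) -> R) : R := fine (\int[P]_w (g (path w))%:E)%E.

(** Functionals of finitely many generations with at most linear growth. Each generation has mean 1,
    so all of them are integrable. *)
Definition grow (g : (nat -> nat) -> R) := exists n (C : R), adapt n g /\
  forall z, `|g z| <= C * (1 + \sum_(k < n.+1) (z k)%:R).

Lemma integrable_growth g : grow g -> P.-integrable setT (fun w => (g (path w))%:E).
Proof.
move=> [n [C [ga gC]]].
have C0 : 0 <= C.
  have := gC (fun=> 0%N); rewrite big1// addr0 mulr1; exact: le_trans.
have mZ k : mfunT (fun w => (Z k w)%:R : R) by apply: (@measurable_adapt k _ _ (fun z => (z k)%:R : R)) => z z' ->.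
have iS : P.-integrable setT (fun w => (1 + \sum_(k < n.+1) (Z k w)%:R)%:E).
  rewrite (_ : (fun _ => _) = (fun w => 1%E + \sum_(k < n.+1) (Z k w)%:R%:E)%E); last first.
    by apply/funext => w; rewrite EFinD sumEFin.
  apply: integrableD => //.
    by apply: finite_measure_integrable_cst.
  apply: integrable_sum => // k _.
  apply/integrableP; split; first exact/measurable_EFinP.
  under eq_integral do rewrite gee0_abs ?lee_fin//.
  by rewrite integral_Z ltry.
have := @integrableZl _ _ _ P setT measurableT C _ iS.
apply: le_integrable => //.
  by apply/measurable_EFinP; exact: (measurable_adapt ga).
move=> w _; rewrite -EFinM lee_fin; apply: le_trans (gC _) _.
by rewrite ger0_norm// mulr_ge0// addr_ge0// sumr_ge0.
Qed.

Lemma ExE g : grow g -> (\int[P]_w (g (path w))%:E)%E = (Ex g)%:E.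
Proof. by move=> gg; rewrite /Ex fineK// integrable_fin_num//; exact: integrable_growth. Qed.

Lemma grow_adapt n C g : adapt n g -> (forall z, `|g z| <= C * (1 + \sum_(k < n.+1) (z k)%:R)) ->
  grow g.
Proof. by exists n, C. Qed.

Lemma grow_bounded n C g : adapt n g -> (forall z, `|g z| <= C) -> grow g.
Proof.
move=> ga gC; apply: (grow_adapt (C := C) ga) => z; apply: le_trans (gC z) _.
have C0 : 0 <= C by apply: le_trans (gC z).
by rewrite mulrDr mulr1 lerDl mulr_ge0// sumr_ge0.
Qed.

Lemma grow_cst c : grow (fun=> c).
Proof. by apply: (@grow_bounded 0 `|c|). Qed.

Lemma le_coord_sum (z : nat -> nat) n k : (k <= n)%N -> (z k)%:R <= \sum_(i < n.+1) (z i)%:R :> R.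
Proof.
move=> kn; have kn' : (k < n.+1)%N by [].
rewrite (bigD1 (Ordinal kn'))//= lerDl; exact: sumr_ge0.
Qed.

Lemma grow_coord k : grow (fun z => (z k)%:R).
Proof.
apply: (@grow_adapt k 1) => [z z' ->//|z].
by rewrite mul1r ger0_norm//; have := le_coord_sum z (leqnn k); lra.
Qed.

Lemma eq_growth g h : (forall z, g z = h z) -> grow h -> grow g.
Proof. by move=> /funext ->. Qed.

Lemma growZ c g : grow g -> grow (fun z => c * g z).
Proof.
move=> [n [C [ga gC]]]; exists n, (`|c| * C); split; first by move=> z z' /ga ->.
by move=> z; rewrite normrM -mulrA ler_wpM2l.
Qed.

Lemma sum_coord_le (z : nat -> nat) m n : (m <= n)%N ->
  \sum_(i < m) (z i)%:R <= \sum_(i < n) (z i)%:R :> R.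
Proof.
move=> mn; rewrite -!(big_mkord xpredT (fun i => (z i)%:R)) [leRHS](@big_cat_nat _ _ _ m)//=.
by rewrite lerDl sumr_ge0.
Qed.

Lemma growD g h : grow g -> grow h -> grow (fun z => g z + h z).
Proof.
move=> [n [C [ga gC]]] [m [E [ha hE]]]; exists (maxn n m), (`|C| + `|E|); split.
  move=> z z' e; rewrite (ga z z') ?(ha z z')// => k kn; apply: e.
    by rewrite (leq_trans kn)// leq_maxr.
  by rewrite (leq_trans kn)// leq_maxl.
move=> z; apply: le_trans (ler_normD _ _) _; rewrite mulrDl; apply: lerD.
  apply: le_trans (gC z) _; apply: ler_pM; rewrite ?ler_norm//.
  - have := gC (fun=> 0%N); rewrite big1// addr0 mulr1; exact: le_trans.
  - by rewrite addr_ge0// sumr_ge0.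
  - by rewrite lerD2l sum_coord_le// ltnS leq_maxl.
apply: le_trans (hE z) _; apply: ler_pM; rewrite ?ler_norm//.
- have := hE (fun=> 0%N); rewrite big1// addr0 mulr1; exact: le_trans.
- by rewrite addr_ge0// sumr_ge0.
- by rewrite lerD2l sum_coord_le// ltnS leq_maxr.
Qed.

Lemma growB g h : grow g -> grow h -> grow (fun z => g z - h z).
Proof.
move=> gg hh; have := growD gg (growZ (- 1) hh).
by rewrite (_ : (fun _ => _) = (fun z => g z - h z))//; apply/funext => z; rewrite mulN1r.
Qed.

Lemma grow_sum (I : Type) (r : seq I) (Q : pred I) (g : I -> (nat -> nat) -> R) :
  (forall i, Q i -> grow (g i)) -> grow (fun z => \sum_(i <- r | Q i) g i z).
Proof.
move=> gg; elim: r => [|i r IH].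
  under [X in grow X]eq_fun do rewrite big_nil; exact: grow_cst.
under [X in grow X]eq_fun do rewrite big_cons.
by case E : (Q i) => //; apply: growD => //; exact: gg.
Qed.

Lemma grow_le n g h : adapt n g -> grow h -> (forall z, `|g z| <= h z) -> grow g.
Proof.
move=> ga [m [C [ha hC]]] gh; exists (maxn n m), C; split.
  by move=> z z' e; apply: ga => k kn; apply: e; rewrite (leq_trans kn)// leq_maxl.
move=> z; apply: le_trans (gh z) _; apply: le_trans (ler_norm _) _; apply: le_trans (hC z) _.
apply: ler_wpM2l; last by rewrite lerD2l sum_coord_le// ltnS leq_maxr.
have := hC (fun=> 0%N); rewrite big1// addr0 mulr1; exact: le_trans.
Qed.

Lemma growM_bounded n C g h : adapt n g -> (forall z, `|g z| <= C) -> grow h ->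
  grow (fun z => g z * h z).
Proof.
move=> ga gC [m [E [ha hE]]]; exists (maxn n m), (C * E); split.
  move=> z z' e; rewrite (ga z z') ?(ha z z')// => k kn; apply: e.
    by rewrite (leq_trans kn)// leq_maxr.
  by rewrite (leq_trans kn)// leq_maxl.
move=> z; rewrite normrM -mulrA; apply: ler_pM => //.
apply: le_trans (hE z) _; apply: ler_wpM2l.
  have := hE (fun=> 0%N); rewrite big1// addr0 mulr1; exact: le_trans.
by rewrite lerD2l sum_coord_le// ltnS leq_maxr.
Qed.

Lemma Ex_ge0 g : (forall z, 0 <= g z) -> 0 <= Ex g.
Proof. by move=> g0; apply: fine_ge0; apply: integral_ge0 => w _; rewrite lee_fin. Qed.

Lemma eq_Ex g h : (forall z, g z = h z) -> Ex g = Ex h.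
Proof. by move=> gh; congr Ex; apply/funext. Qed.

Lemma ExD g h : grow g -> grow h -> Ex (fun z => g z + h z) = Ex g + Ex h.
Proof.
move=> gg hh; apply: EFin_inj; rewrite -ExE; last exact: growD.
rewrite EFinD -!ExE// -integralD//; exact: integrable_growth.
Qed.

Lemma ExZ c g : grow g -> Ex (fun z => c * g z) = c * Ex g.
Proof.
move=> gg; apply: EFin_inj; rewrite -ExE; last exact: growZ.
by rewrite EFinM -!ExE// -integralZl//; exact: integrable_growth.
Qed.

Lemma ExB g h : grow g -> grow h -> Ex (fun z => g z - h z) = Ex g - Ex h.
Proof.
move=> gg hh; rewrite -[in RHS]mulN1r -ExZ// -ExD//; last exact: growZ.
by congr Ex; apply/funext => z; rewrite mulN1r.
Qed.

Lemma Ex_le g h : grow g -> grow h -> (forall z, g z <= h z) -> Ex g <= Ex h.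
Proof.
move=> gg hh gh; rewrite -subr_ge0 -ExB//; apply: Ex_ge0 => z.
by rewrite subr_ge0.
Qed.

Lemma Ex_cst c : Ex (fun=> c) = c.
Proof. rewrite /Ex (@integral_cst _ _ _ P setT measurableT c%:E).
by rewrite -[RHS]/(fine c%:E) -[in RHS](mule1 c%:E); congr (fine (_ * _)%E); exact: probability_setT. Qed.

Lemma Ex_coord k : Ex (fun z => (z k)%:R) = 1.
Proof. by rewrite /Ex integral_Z. Qed.

Lemma Ex_sum (I : Type) (r : seq I) (Q : pred I) (g : I -> (nat -> nat) -> R) :
  (forall i, Q i -> grow (g i)) ->
  Ex (fun z => \sum_(i <- r | Q i) g i z) = \sum_(i <- r | Q i) Ex (g i).
Proof.
move=> gg; elim: r => [|i r IH].
  rewrite big_nil -[RHS](Ex_cst 0); congr Ex; apply/funext => z; exact: big_nil.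
rewrite big_cons -IH; case: ifP => Qi.
  rewrite -ExD; [|exact: gg|exact: grow_sum].
  by congr Ex; apply/funext => z; rewrite big_cons Qi.
by congr Ex; apply/funext => z; rewrite big_cons Qi.
Qed.

Lemma Ex_norm g : grow g -> `|Ex g| <= Ex (fun z => `|g z|).
Proof.
move=> gg; have gn : grow (fun z => `|g z|) by move: gg => [n [C [ga gC]]]; exists n, C; split=> [z z' /ga ->//|z]; rewrite normr_id.
rewrite ler_norml -mulN1r -ExZ//; apply/andP; split; apply: Ex_le => //.
- exact: growZ.
- by move=> z; rewrite mulN1r lerNl ler_normr lexx orbT.
- by move=> z; exact: ler_norm.
Qed.

Lemma Ex_start (h : nat -> R) : Ex (fun z => h (z 0%N)) = h 1%N.
Proof.
rewrite -[RHS]Ex_cst /Ex; congr fine; apply: ae_eq_integral => //.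
  by apply/measurable_EFinP; apply: (@measurable_adapt 0 _ _ (fun z => h (z 0%N))) => z z' ->.
by case: Z0_ae => A [mA PA AP]; exists A; split => // w /= h1; apply: AP => /= h'; apply: h1 => _; rewrite h'.
Qed.

(** The argument [s] may depend on the past; [lower_deviation] uses one that depends on the current
    population. *)
Lemma markov_gen n (g s : (nat -> nat) -> R) : (forall z, 0 <= g z) -> adapt n g ->
  (forall z, 0 <= s z <= 1) -> adapt n s ->
  Ex (fun z => g z * s z ^+ z n.+1) = Ex (fun z => g z * pgf p (s z) ^+ z n).
Proof.
move=> g0 ga s01 sa; rewrite /Ex; congr fine.
have := @markov_step n (fun z b => g z * s z ^+ b) => ->.
- apply: eq_integral => w _; rewrite EFinM -(convpow_gen p_ge0 p_sum _ (s01 _)) -nneseriesZl.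
    by apply: eq_eseriesr => b _; rewrite -EFinM mulrA.
  by move=> b _; rewrite lee_fin mulr_ge0 ?convpow_ge0// exprn_ge0//; case/andP: (s01 (path w)).
- by move=> z b; rewrite mulr_ge0// exprn_ge0//; case/andP: (s01 z).
- by move=> b z z' e; rewrite (ga z z' e) (sa z z' e).
Qed.

Lemma adaptW m n (U : Type) (g : (nat -> nat) -> U) : (m <= n)%N -> adapt m g -> adapt n g.
Proof. by move=> mn ga z z' e; apply: ga => k km; apply: e; exact: leq_trans km mn. Qed.

Lemma markov_gen_iter n k (g s : (nat -> nat) -> R) : (forall z, 0 <= g z) -> adapt n g ->
  (forall z, 0 <= s z <= 1) -> adapt n s ->
  Ex (fun z => g z * s z ^+ z (n + k)%N) = Ex (fun z => g z * iter k (pgf p) (s z) ^+ z n).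
Proof.
move=> g0 ga; elim: k s => [|k IH] s s01 sa; first by rewrite addn0.
rewrite addnS (markov_gen g0 (adaptW (leq_addr _ _) ga) s01 (adaptW (leq_addr _ _) sa)).
rewrite (IH (fun z => pgf p (s z))).
- by under eq_fun do rewrite -iterSr.
- by move=> z; exact: pgf_itv.
- by move=> z z' e; rewrite (sa z z' e).
Qed.

Lemma martingale n k (g : (nat -> nat) -> R) : (forall z, 0 <= g z) -> adapt n g ->
  Ex (fun z => g z * (z (n + k)%N)%:R) = Ex (fun z => g z * (z n)%:R).
Proof.
move=> g0 ga; elim: k => [|k IH]; first by rewrite addn0.
rewrite -IH addnS /Ex; congr fine.
have := @markov_step (n + k) (fun z b => g z * b%:R) => ->.
- apply: eq_integral => w _; rewrite EFinM -(convpow_mean p_ge0 p_sum p_mean) -nneseriesZl.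
    by apply: eq_eseriesr => b _; rewrite -EFinM mulrA.
  by move=> b _; rewrite lee_fin mulr_ge0 ?convpow_ge0.
- by move=> z b; rewrite mulr_ge0.
- by move=> b z z' e; rewrite (adaptW (leq_addr k n) ga e).
Qed.
End Process.

Local Notation E := Ex.
Local Notation q := (survp (loss p)).
Implicit Types z : nat -> nat.

Let cstg := grow_cst.
Let EB := ExB.
Let ED := ExD.
Let EZ := ExZ.
Let ES := Ex_sum.
Let Ecoord := Ex_coord.
Let Ele := Ex_le.

(** * Excess and increment estimates for one generation *)

Section Estimates.
Local Notation u := (rate (loss p)).
Local Notation phi := (surv_next (loss p)).

Lemma Ex_gen k s : 0 <= s <= 1 -> E (fun z => s ^+ z k) = iter k (pgf p) s.
Proof.
move=> s01; have := @markov_gen_iter 0 k (fun=> 1) (fun=> s).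
move=> /(_ (fun=> ler01) (fun _ _ _ => erefl) (fun=> s01) (fun _ _ _ => erefl)) H.
transitivity (E (fun z => 1 * s ^+ z (0 + k)%N)); first by apply: eq_Ex => z; rewrite mul1r.
by rewrite H (Ex_start (fun n => 1 * iter k (pgf p) s ^+ n)) expr1 mul1r.
Qed.

Lemma Ex_survive k : E (fun z => (0 < z k)%N%:R) = q k.
Proof.
rewrite /survp iter_next_pgf// subrr -Ex_gen ?lexx ?ler01//.
rewrite -[in RHS](@Ex_cst 1) -EB//; last first.
  by apply: (@grow_bounded k 1) => [z z' ->//|z]; rewrite expr0n; case: (z k) => *; rewrite ?normr1 ?normr0.
by congr Ex; apply/funext => z; rewrite expr0n lt0n; case: eqP => _; rewrite ?subrr ?subr0.
Qed.

(** Uses (n - 1/x)^+ <= n - (1 - (1-x)^n)/x. The right-hand side has mean 1 - phi^k(x)/x, at most k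
    u(x) by [iter_next_ge]. This is the source of all uniform integrability below. *)
Lemma excess_le k x : 0 < x <= 1 -> E (fun z => pos ((z k)%:R - x^-1)) <= k%:R * u x.
Proof.
move=> xx; have /andP[x0 x1] := xx.
have s01 : 0 <= 1 - x <= 1 by lra.
have gs : grow (fun z => (1 - x) ^+ z k).
  apply: (@grow_bounded k 1) => [z z' ->//|z]; have /andP[av b] := s01.
  by rewrite ger0_norm ?exprn_ge0// exprn_ile1.
have gh : grow (fun z => (z k)%:R - (x^-1 * (1 - (1 - x) ^+ z k))).
  apply: growB; first exact: grow_coord.
  by apply: growZ; apply: growB.
have pt z : pos ((z k)%:R - x^-1) <= (z k)%:R - (x^-1 * (1 - (1 - x) ^+ z k)).
  apply: pos_le.
    rewrite lerD2l lerN2 ger_pMr ?invr_gt0// gerBl exprn_ge0//.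
    by case/andP: s01.
  rewrite subr_ge0 mulrC ler_pdivrMr//.
  have := @bernoulli_le _ x (z k); rewrite (ltW x0) x1 => /(_ isT); lra.
have gp : grow (fun z => pos ((z k)%:R - x^-1)).
  apply: grow_le gh _ => [|z]; first by move=> z z' e; rewrite (e k).
  by rewrite ger0_norm ?pos_ge0.
apply: le_trans (Ele gp gh pt) _.
rewrite EB; [|exact: grow_coord|by apply: growZ; apply: growB].
rewrite Ecoord EZ; last exact: growB.
rewrite EB// Ex_cst Ex_gen// -iter_next_pgf//.
have := iter_next_ge dd k xx; set U := u x; set y := iter k phi x => h.
by rewrite lerBlDr -lerBlDl ler_pdivlMl.
Qed.

(** A large population rarely drops: [pos_le_exp] is applied to Z_(n+k)/Z_n. Replacing exp(-mu/Z_n)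
    by the larger 1/(1 + mu/Z_n) gives a generating function at a rational argument; started from
    Z_n individuals, it is at most exp(-(mu - 2)). *)
Lemma lower_deviation n k (mu : R) (g : (nat -> nat) -> R) : 1 <= mu ->
  (forall z, 0 <= g z) -> adapt n g -> grow g ->
  (forall z, g z != 0 -> mu ^+ 2 <= (z n)%:R /\ k%:R * u (mu / (z n)%:R) <= mu^-1) ->
  E (fun z => g z * pos (1 - (z (n + k)%N)%:R / (z n)%:R)) <= expR 2 / mu * E g.
Proof.
move=> m1 g0 ga gg gz.
have m0 : 0 < mu by lra.
pose av z : R := mu / (z n)%:R.
have a0 z : 0 <= av z by rewrite /av divr_ge0// ltW.
pose s z := (1 + av z)^-1.
have s01 z : 0 <= s z <= 1.
  have := a0 z => h.
  by rewrite /s invr_ge0 invf_le1 ?addr_ge0 ?lerDl// ltr_wpDr.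
have sa : adapt n s by move=> z z' e; rewrite /s /av e.
pose g' z := expR mu / mu * g z.
have g'0 z : 0 <= g' z by rewrite mulr_ge0// divr_ge0 ?expR_ge0// ltW.
have g'av : adapt n g' by move=> z z' e; rewrite /g' (ga z z').
have nn : (n <= n + k)%N by rewrite leq_addr.
have bd z r : `|s z ^+ r| <= 1 by have /andP[h1 h2] := s01 z; rewrite ger0_norm ?exprn_ge0// exprn_ile1.
have bi z r : `|iter k (pgf p) (s z) ^+ r| <= 1.
  have /andP[h1 h2] := iter_pgf_itv p_ge0 p_sum k (s01 z).
  by rewrite ger0_norm ?exprn_ge0// exprn_ile1.
have g1 : grow (fun z => g z * pos (1 - (z (n + k)%N)%:R / (z n)%:R)).
  apply: (eq_growth (fun z => mulrC _ _)).
  apply: (@growM_bounded (n + k) 1) => // [|z].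
    by move=> z z' e; rewrite (e (n + k)%N)// (e n).
  by rewrite ger0_norm ?pos_ge0// pos_le// gerBl divr_ge0.
have g2 : grow (fun z => g' z * s z ^+ z (n + k)%N).
  apply: (eq_growth (fun z => mulrC _ _)).
  apply: (@growM_bounded (n + k) 1) => //; last exact: growZ.
  move=> z z' e; rewrite (e (n + k)%N)// (sa z z')// => i hi; apply: e.
  exact: leq_trans hi nn.
apply: (@le_trans _ _ (E (fun z => g' z * s z ^+ z (n + k)%N))).
  apply: Ele => // z; rewrite /g' mulrAC -mulrA [leLHS]mulrC.
  have [gz0|gz0] := eqVneq (g z) 0; first by rewrite gz0 !mulr0.
  rewrite mulrA ler_wpM2r//.
  apply: le_trans (pos_le_exp _ m0) _.
  rewrite mulrBr mulr1 expRB -mulrA [leRHS]mulrAC -[leRHS]mulrA; apply: ler_wpM2l; first exact: expR_ge0.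
  rewrite ler_wpM2r ?invr_ge0 ?(ltW m0)//.
  rewrite (_ : mu * _ = (z (n + k)%N)%:R * av z); last by rewrite /av; ring.
  have sz0 : 0 <= s z by case/andP: (s01 z).
  rewrite expRM_natl -exprVn; apply: lerXn2r; [by rewrite nnegrE invr_ge0 expR_ge0|by rewrite nnegrE|].
  by rewrite /s lef_pV2 ?posrE ?expR_gt0 ?ltr_wpDr// expR_ge1Dx.
rewrite (@markov_gen_iter)//.
have g3 : grow (fun z => g' z * iter k (pgf p) (s z) ^+ z n).
  apply: (eq_growth (fun z => mulrC _ _)).
  apply: (@growM_bounded n 1) => //; last exact: growZ.
  by move=> z z' e; rewrite (e n)// (sa z z').
rewrite -EZ//; apply: Ele => //; first exact: growZ.
move=> z; rewrite /g' -mulrA (mulrC (g z)) mulrA.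
have [gz0|gz0] := eqVneq (g z) 0; first by rewrite gz0 !mulr0.
rewrite ler_wpM2r//.
have [zm kz] := gz z gz0.
have zn0 : 0 < (z n)%:R :> R by apply: lt_le_trans zm; rewrite exprn_gt0.
have az : 0 < av z by rewrite /av divr_gt0.
have aE : av z * mu <= 1 by rewrite /av mulrAC ler_pdivrMr// mul1r -expr2.
have a1 : av z <= 1 by nra.
pose x := 1 - s z.
have xE : x = av z / (1 + av z) by rewrite /x /s; field; rewrite gt_eqF// ltr_wpDl.
have x0 : 0 < x by rewrite xE divr_gt0// addr_gt0.
have xa : x <= av z by rewrite xE ler_pdivrMr ?addr_gt0// mulrDr mulr1 lerDl mulr_ge0.
have xx : 0 < x <= 1 by rewrite x0 (le_trans xa).
rewrite (_ : iter k (pgf p) (s z) = 1 - iter k phi x); last first.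
  by rewrite iter_next_pgf// /x !subKr.
have il := iter_next_ge dd k xx.
have ux : k%:R * u x <= mu^-1 by apply: le_trans kz; rewrite ler_wpM2l//; apply: (rate_le dd).
(* The exponent loses one unit because Z_n x >= mu - 1 and another because k u(x) <= 1/mu. *)
have ib : (1 - iter k phi x) ^+ z n <= expR (- (mu - 2)).
  apply: (@le_trans _ _ (expR (- iter k phi x) ^+ z n)).
    rewrite lerXn2r ?nnegrE ?expR_ge0 ?expR_ge1Dx//.
    by rewrite subr_ge0; have /andP[_ h] := iter_next_bounds dd k xx; apply: le_trans h _; case/andP: xx.
  rewrite -expRM_natl ler_expR mulrN lerN2.
  apply: le_trans (ler_wpM2l (ltW zn0) il).
  have zx : mu - 1 <= (z n)%:R * x.
    rewrite xE /av -[X in _ <= X](_ : mu / (1 + av z) = _); last first.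
      by rewrite /av; field; rewrite !gt_eqF// addr_gt0.
    rewrite ler_pdivlMr ?addr_gt0//; nra.
  have zx' : (z n)%:R * x <= mu by apply: le_trans (ler_wpM2l (ltW zn0) xa) _; rewrite /av mulrC divfK// gt_eqF.
  have m1' : mu * mu^-1 = 1 by rewrite divff// gt_eqF.
  rewrite mulrA mulrBr mulr1.
  have : (z n)%:R * x * (k%:R * u x) <= mu * mu^-1.
    apply: ler_pM => //; first by rewrite mulr_ge0// ltW.
    by rewrite mulr_ge0// ltW// (rate_gt0 dd).
  by lra.
rewrite mulrAC; apply: (@le_trans _ _ (expR mu * expR (- (mu - 2)) / mu)).
  by rewrite ler_wpM2r ?invr_ge0 ?(ltW m0)// ler_wpM2l ?expR_ge0.
by rewrite -expRD (_ : mu + - (mu - 2) = 2)//; ring.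
Qed.

(** When Z_n < y the increment is at most Z_n + Z_(n+k), with mean at most 2 y P(Z_n > 0). When Z_n
    >= y, with A = Z_(n+k) and B = Z_n, one has |A - B| = (A - B) + 2 (B - A)^+: the first part has
    mean 0 and the second is a lower deviation. *)
Lemma increment_le n k (mu y : R) : 1 <= mu -> mu ^+ 2 <= y -> k%:R * u (mu / y) <= mu^-1 ->
  E (fun z => `|(z (n + k)%N)%:R - (z n)%:R|) <= 2 * y * q n + 2 * (expR 2 / mu).
Proof.
move=> m1 my ky; have m0 : 0 < mu by lra.
have y0 : 0 < y by apply: lt_le_trans my; rewrite exprn_gt0.
have nn : (n <= n + k)%N by rewrite leq_addr.
pose lo z : R := ((z n)%:R < y)%R%:R.
pose hi z : R := (y <= (z n)%:R)%R%:R.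
have loa : adapt n lo by move=> z z' e; rewrite /lo e.
have hia : adapt n hi by move=> z z' e; rewrite /hi e.
have lo1 z : `|lo z| <= 1 by rewrite /lo; case: (_ < _); rewrite ?normr0 ?normr1.
have hi1 z : `|hi z| <= 1 by rewrite /hi; case: (y <= _); rewrite ?normr0 ?normr1.
have gc i : grow (fun z => (z i)%:R) by exact: grow_coord.
have gl i : grow (fun z => lo z * (z i)%:R) by apply: growM_bounded loa lo1 _.
have gh i : grow (fun z => hi z * (z i)%:R) by apply: growM_bounded hia hi1 _.
pose w z := hi z * (z n)%:R.
have w0 z : 0 <= w z by rewrite mulr_ge0.
have wa : adapt n w by move=> z z' e; rewrite /w (hia _ _ e) e.
have gw1 : grow (fun z => w z * pos (1 - (z (n + k)%N)%:R / (z n)%:R)).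
  apply: (eq_growth (fun z => mulrC _ _)).
  apply: (@growM_bounded (n + k) 1) => // [|z|]; last exact: gh.
    by move=> z z' e; rewrite (e (n + k)%N)// (e n).
  by rewrite ger0_norm ?pos_ge0// pos_le// gerBl divr_ge0.
have D : E (fun z => w z * pos (1 - (z (n + k)%N)%:R / (z n)%:R)) <= expR 2 / mu * E w.
  apply: (lower_deviation m1 w0 wa (gh n)) => z; rewrite /w /hi.
  have [yz _|] := leP y (z n)%:R; last by rewrite mul0r eqxx.
  split; first exact: le_trans yz.
  apply: le_trans ky; rewrite ler_wpM2l//; apply: (rate_le dd).
  - by rewrite divr_gt0// (lt_le_trans y0).
  - by rewrite ler_wpM2l ?(ltW m0)// lef_pV2 ?posrE// (lt_le_trans y0).
  - by rewrite ler_pdivrMr// mul1r (le_trans _ my)// expr2 ler_peMl// ltW.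
have pt z : `|(z (n + k)%N)%:R - (z n)%:R| <=
   lo z * (z (n + k)%N)%:R + lo z * (z n)%:R + (hi z * (z (n + k)%N)%:R - hi z * (z n)%:R
     + 2 * (w z * pos (1 - (z (n + k)%N)%:R / (z n)%:R))).
  rewrite /w /lo /hi; have [yz|zy] := leP y (z n)%:R.
    have zn0 : 0 < (z n)%:R :> R by apply: lt_le_trans yz.
    rewrite !mul0r !add0r !mul1r.
    set A := (z (n + k)%N)%:R; set B := (z n)%:R in zn0 *.
    have e1 : B * pos (1 - A / B) >= B - A.
      have := ler_wpM2l (ltW zn0) (pos_ge (1 - A / B)).
      by rewrite mulrBr mulr1 mulrCA divff ?gt_eqF// mulr1.
    have e2 : 0 <= B * pos (1 - A / B) by rewrite mulr_ge0 ?pos_ge0// ltW.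
    by rewrite ler_norml; lra.
  rewrite !mul0r !mul1r !subr0 mulr0 addr0 addr0.
  by rewrite (le_trans (ler_normB _ _))// !ger0_norm.
have nd : grow (fun z => `|(z (n + k)%N)%:R - (z n)%:R : R|).
  apply: (@grow_le (n + k) _ (fun z => (z (n + k)%N)%:R + (z n)%:R)) => [z z' e|//|z].
  - by rewrite (e (n + k)%N)// (e n).
  - exact: growD.
  - by rewrite normr_id (le_trans (ler_normB _ _))// !ger0_norm.
apply: le_trans (Ele nd _ pt) _.
  by apply: growD; apply: growD => //; [exact: growB|exact: growZ].
rewrite ED; [|exact: growD|by apply: growD; [exact: growB|exact: growZ]].
rewrite ED//.
rewrite ED; [|exact: growB|exact: growZ].
rewrite EB// EZ//.
rewrite !(@martingale)// subrr add0r.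
have L : E (fun z => lo z * (z n)%:R) <= y * q n.
  rewrite -Ex_survive -EZ; last first.
    by apply: (@grow_bounded n 1) => [z z' ->//|z]; case: (0 < z n)%N; rewrite ?normr0 ?normr1.
  apply: Ele => //.
    apply: growZ; apply: (@grow_bounded n 1) => [z z' ->//|z].
    by case: (0 < z n)%N; rewrite ?normr0 ?normr1.
  move=> z; rewrite /lo; case: (z n) => [|i]; first by rewrite !mulr0.
  by case: ltP => h; rewrite ?mul1r ?mul0r mulr1 ltW.
have W : E w <= 1.
  rewrite -(Ecoord n); apply: (Ele (gh n) (gc n)) => z.
  by rewrite /w /hi; case: (y <= _); rewrite ?mul1r ?mul0r.
have : expR 2 / mu * E w <= expR 2 / mu by rewrite ler_piMr// divr_ge0 ?expR_ge0// ltW.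
by lra.
Qed.
End Estimates.

Let a01 := dec_alpha dd.

(** * The tail of the maximal population *)

Section Tail.
Local Notation u := (rate (loss p)).
Local Notation f := (pgf p).

Definition below (y : R) n z : bool := [forall k : 'I_n, (z k)%:R < y].
(** First passage to [y] in generation n: these events are disjoint, and over n < m they make up the
    complement of [below y m]. *)
Local Notation fp y n z := (below y n z && ~~ below y n.+1 z).

Lemma belowS y n z : below y n.+1 z = below y n z && ((z n)%:R < y).
Proof.
apply/forallP/andP => [h|[/forallP h hn] k].
  split; last exact: (h ord_max).
  by apply/forallP => k; exact: (h (widen_ord (leqnSn n) k)).
have [kn|] := ltnP k n; first exact: (h (Ordinal kn)).
by move=> nk; have -> : k = n :> nat by apply/eqP; rewrite eqn_leq nk -ltnS ltn_ord.
Qed.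

Lemma below0 y z : below y 0 z.
Proof. by apply/forallP => -[]. Qed.

Lemma adapt_below y n (U : Type) (h : bool -> U) : adapt n (fun z => h (below y n.+1 z)).
Proof.
move=> z z' e; congr h; apply: eq_forallb => k; rewrite e//.
by rewrite -ltnS.
Qed.

Lemma adapt_below0 y n (U : Type) (h : bool -> U) : adapt n (fun z => h (below y n z)).
Proof.
move=> z z' e; congr h; apply: eq_forallb => k; rewrite e//.
exact: ltnW.
Qed.

Lemma grow_bool n (b : (nat -> nat) -> bool) : adapt n b -> grow (fun z => (b z)%:R).
Proof.
move=> ba; apply: (@grow_bounded n 1) => [z z' /ba->//|z].
by case: (b z); rewrite ?normr1 ?normr0.
Qed.
Let sub_itv (t : R) n : 0 <= t <= 1 -> 0 <= t ^+ n <= 1.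
Proof. by move=> /andP[t0 t1]; rewrite exprn_ge0//= exprn_ile1. Qed.
Let node01 (x : R) i : 0 < x < 1 -> 0 <= node x i <= 1.
Proof. by move=> /(node_itv i) /andP[h1 h2]; rewrite !ltW. Qed.

Lemma grow_tfun B x n : 0 < x < 1 -> grow (fun z => tfun p B x (z n)).
Proof.
move=> x01; apply: (@grow_bounded n (\sum_(i < size B) `|tcoef p B x i|)) => [z z' ->//|z].
apply: le_trans (ler_norm_sum _ _ _) _; apply: ler_sum => i _.
rewrite normrM ler_piMr//; have /andP[h1 h2] := sub_itv (z n) (node01 i x01).
by rewrite ger0_norm; lra.
Qed.

Lemma grow_tgain B x n : 0 < x < 1 -> grow (fun z => tgain p B x (z n)).
Proof.
move=> x01; apply: (@grow_bounded n (\sum_(i < size B) `|tcoef p B x i|)) => [z z' ->//|z].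
apply: le_trans (ler_norm_sum _ _ _) _; apply: ler_sum => i _.
rewrite normrM ler_piMr//; have /andP[h1 h2] := sub_itv (z n) (node01 i x01).
have /andP[h3 h4] := sub_itv (z n) (pgf_itv p_ge0 p_sum (node01 i x01)).
by rewrite ler_norml; lra.
Qed.
Let bg n (b : (nat -> nat) -> bool) g : adapt n b -> grow g -> grow (fun z => (b z)%:R * g z).
Proof.
move=> ba; apply: (@growM_bounded n 1) => [z z' /ba->//|z].
by case: (b z); rewrite ?normr1 ?normr0.
Qed.

Lemma test_step B x n (b : (nat -> nat) -> bool) : 0 < x < 1 -> adapt n b ->
  E (fun z => (b z)%:R * tfun p B x (z n.+1)) =
  E (fun z => (b z)%:R * tfun p B x (z n)) - E (fun z => (b z)%:R * tgain p B x (z n)).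
Proof.
move=> x01 ba; rewrite -EB; last 2 first.
- exact: bg ba (grow_tfun _ _ x01).
- exact: bg ba (grow_tgain _ _ x01).
have pg t k : 0 <= t <= 1 -> grow (fun z => t ^+ z k).
  move=> t01; apply: (@grow_bounded k 1) => [z z' ->//|z].
  by have /andP[h1 h2] := sub_itv (z k) t01; rewrite ger0_norm.
have gb := grow_bool ba.
transitivity (E (fun z => \sum_(i < size B) tcoef p B x i * ((b z)%:R - (b z)%:R * node x i ^+ z n.+1))).
  by apply: eq_Ex => z; rewrite /tfun mulr_sumr; apply: eq_bigr => i _; ring.
transitivity (E (fun z => \sum_(i < size B) tcoef p B x i * ((b z)%:R - (b z)%:R * f (node x i) ^+ z n))).
  have f01 i := pgf_itv p_ge0 p_sum (node01 i x01).
  rewrite !ES; last 2 first.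
  - by move=> i _; apply: growZ; apply: growB => //; apply: (bg ba); exact: pg.
  - by move=> i _; apply: growZ; apply: growB => //; apply: (bg ba); apply: pg; exact: node01.
  apply: eq_bigr => i _; rewrite !EZ; last 2 first.
  - by apply: growB => //; apply: (bg ba); exact: pg.
  - by apply: growB => //; apply: (bg ba); apply: pg; exact: node01.
  rewrite !EB//; last 2 first.
  - by apply: (bg ba); exact: pg.
  - by apply: (bg ba); apply: pg; exact: node01.
  congr (_ * (_ - _)).
  apply: (@markov_gen n (fun z => (b z)%:R) (fun=> node x i)) => //.
  - by move=> z z' /ba->.
  - by move=> z; exact: node01.
apply: eq_Ex => z; rewrite /tfun /tgain !mulr_sumr -sumrB; apply: eq_bigr => i _; ring.
Qed.

(** Optional stopping of the test function at the first passage, the accumulated gains being the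
    compensator. *)
Lemma test_stopped B x y m : 0 < x < 1 ->
  tfun p B x 1 = E (fun z => (below y m z)%:R * tfun p B x (z m)) +
   \sum_(n < m) E (fun z => (fp y n z)%:R * tfun p B x (z n)) +
   \sum_(n < m) E (fun z => (below y n.+1 z)%:R * tgain p B x (z n)).
Proof.
move=> x01; elim: m => [|m IH].
  rewrite !big_ord0 !addr0 -(Ex_start (fun k => tfun p B x k)).
  by apply: eq_Ex => z; rewrite below0 mul1r.
have ab : adapt m (below y m.+1) := @adapt_below y m _ id.
have ab0 : adapt m (below y m) := @adapt_below0 y m _ id.
rewrite IH !big_ord_recr/= test_step//.
have -> : E (fun z => (below y m z)%:R * tfun p B x (z m)) =
   E (fun z => (below y m.+1 z)%:R * tfun p B x (z m)) +
   E (fun z => (below y m z && ~~ below y m.+1 z)%:R * tfun p B x (z m)).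
  rewrite -ED; last 2 first.
  - exact: bg ab (grow_tfun _ _ x01).
  - apply: (@bg m) (grow_tfun _ _ x01) => z z' e.
    by rewrite (ab _ _ e) (ab0 _ _ e).
  apply: eq_Ex => z; rewrite belowS; case: (below y m z); case: ((z m)%:R < y); rewrite /=; ring.
ring.
Qed.

Lemma first_passage y m z :
  \sum_(n < m) ((fp y n z)%:R : R) = (~~ below y m z)%:R.
Proof.
elim: m => [|m IH]; first by rewrite big_ord0 below0.
rewrite big_ord_recr/= IH belowS; case: (below y m z); case: ((z m)%:R < y); rewrite /=; ring.
Qed.

Lemma fp_adapt (U : Type) y n (h : bool -> U) : adapt n (fun z => h (fp y n z)).
Proof. by move=> z z' e; rewrite (@adapt_below y n _ id _ _ e) (@adapt_below0 y n _ id _ _ e). Qed.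

Lemma grow_fp y n : grow (fun z => (fp y n z)%:R).
Proof. by apply: (@grow_bounded n 1) => [|z]; [exact: (@fp_adapt _ y n (fun b => b%:R))|case: (fp y n z); rewrite ?normr1 ?normr0]. Qed.
Let g_first := grow_fp.

Lemma Ex_fp y m : E (fun z => (~~ below y m z)%:R) = \sum_(n < m) E (fun z => (fp y n z)%:R).
Proof. by rewrite -ES//; apply: eq_Ex => z; rewrite first_passage. Qed.
(** At a first passage the state is at least [y], so bounds on [h] beyond [y] are enough. *)
Let E_first_le y m c (h : nat -> R) : (forall n, grow (fun z => h (z n))) ->
  (forall w, y <= w%:R -> h w <= c) ->
  \sum_(n < m) E (fun z => (fp y n z)%:R * h (z n)) <= c * E (fun z => (~~ below y m z)%:R).
Proof.
move=> hg hc; rewrite Ex_fp mulr_sumr; apply: ler_sum => n _.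
rewrite -EZ//; apply: Ele; last 2 first.
- exact: growZ.
- move=> z; rewrite belowS; case: (below y n z) => /=; last by rewrite mulr0 mul0r.
  by case: ltP => /= zy; rewrite ?mulr0 ?mul0r// mulr1 mul1r hc.
by apply: (@bg n (fun z => fp y n z)) => //; exact: (@fp_adapt _ y n id).
Qed.
Let E_first_ge y m c (h : nat -> R) : (forall n, grow (fun z => h (z n))) ->
  (forall w, y <= w%:R -> c <= h w) ->
  c * E (fun z => (~~ below y m z)%:R) <= \sum_(n < m) E (fun z => (fp y n z)%:R * h (z n)).
Proof.
move=> hg hc; rewrite -lerN2 -mulNr -sumrN.
have := @E_first_le y m (- c) (fun w => -1 * h w) (fun n => growZ (-1) (hg n)).
move=> /(_ (fun w yw => ltac:(by rewrite mulN1r lerN2; exact: hc))); apply: le_trans; apply: ler_sum => n _.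
suff -> : E (fun z => (fp y n z)%:R * (-1 * h (z n))) = - E (fun z => (fp y n z)%:R * h (z n)) by [].
rewrite -[RHS]mulN1r -EZ; first by apply: eq_Ex => z; ring.
by apply: (@bg n (fun z => fp y n z)) => //; exact: (@fp_adapt _ y n id).
Qed.

(** The bump lies just below the level (l < 1 and b = 1). Past the level the test function is at
    least about mu, at the start it is at most about a mu x / l, and the gains are nonnegative, so
    they may be dropped. The part not stopped by time m is bounded below through the mean of Z_m. *)
Lemma max_tail_le (e : R) : 0 < e -> \forall x \near (0:R)^'+, forall m,
  E (fun z => (~~ below x^-1 m z)%:R) <= (1 + e) * a * x.
Proof.
move=> e0; have /andP[a0 a1] := a01.
pose l := (1 + e / 3)^-1.
have e3 : 0 < 1 + e / 3 by apply: addr_gt0 => //; exact: divr_gt0.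
have l01 : 0 < l < 1 by rewrite /l invr_gt0 e3/= invf_lt1// ltrDl divr_gt0.
have [mu [mu0 Hmu]] := poly_bump a01 l01.
(* [c] is tuned so that c K = (2e/3) a mu, exactly the slack in the final comparison with 1/l = 1 +
   e/3. *)
pose K := 5 + (1 + e) * a.
have K0 : 0 < K by rewrite addr_gt0// mulr_gt0// addr_gt0.
pose c := 2 * e / 3 * a * mu / K.
have c0 : 0 < c by rewrite !(mulr_gt0, invr_gt0).
have cK : c * K = 2 * e / 3 * a * mu by rewrite divfK// gt_eqF.
clearbody c.
have cmu : c < mu.
  rewrite -(ltr_pM2r K0) cK mulrC ltr_pM2l// /K.
  have : 0 < e * a by exact: mulr_gt0.
  lra.
have [B [B1 B2 B3 B4 /andP[B5 B6]]] := Hmu c c0.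
have slope := @tfun1_cvg _ _ _ dd B.
have gain : \forall x \near (0:R)^'+, forall w, 0 <= tgain p B x w.
  exact: (@tgain_ge R p a dd B c c0 B1).
have coef := tcoef_near dd B c0.
near=> x => m.
have x01 : 0 < x < 1 by apply/andP; split; near: x; [exact: nbhs_right_gt|exact: nbhs_right_lt].
have /andP[x0 x1] := x01.
have g0 w : 0 <= tgain p B x w by move: w; near: x.
have S1 : \sum_(i < size B) `|tcoef p B x i - B`_i * i.+1%:R `^ (- (1 + a))| * i.+1%:R <= c by near: x.
have H1 : tfun p B x 1 <= (a * mu / l + 3 * c + c) * x.
  rewrite -ler_pdivrMr//; near: x; apply: cvgr_le slope _ _.
  by apply: le_lt_trans B6 _; rewrite ltrDl.
have Hge w : x^-1 <= w%:R -> mu - c <= tfun p B x w.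
  move=> xw; have v1 : 0 < (1 - x) ^+ w <= expR (- 1).
    rewrite exprn_gt0 ?subr_gt0//=; apply: le_trans (_ : expR (- x) ^+ w <= _).
      by apply: lerXn2r; rewrite ?nnegrE ?subr_ge0 ?(ltW x1) ?expR_ge0//; exact: expR_ge1Dx.
    rewrite -expRM_natl ler_expR mulrN lerN2.
    by have := ler_wpM2r (ltW x0) xw; rewrite mulVf// gt_eqF.
  have := B3 _ v1; have := @tfun_potl R p a B x w x01.
  by rewrite ler_norml => /andP[+ _]; lra.
have Hge0 w : - (c * x * w%:R) <= tfun p B x w.
  have pot v : 0 < v <= 1 -> 0 <= potl a B v by move=> /B4/andP[].
  apply: le_trans (@tfun_ge R p a B x w x01 pot).
  rewrite lerN2 (_ : c * x * w%:R = w%:R * x * c); last by ring.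
  by rewrite ler_wpM2l// mulr_ge0// ltW.
have := test_stopped B x^-1 m x01.
have A1 : - (c * x) <= E (fun z => (below x^-1 m z)%:R * tfun p B x (z m)).
  have -> : - (c * x) = E (fun z => - (c * x) * (z m)%:R) by rewrite EZ ?Ecoord ?mulr1//; exact: grow_coord.
  apply: Ele.
  - by apply: growZ; exact: grow_coord.
  - by apply: (@bg m) (grow_tfun _ _ x01); exact: (@adapt_below0 _ _ _ id).
  - move=> z; have := Hge0 (z m); have : 0 <= c * x * (z m)%:R by rewrite mulr_ge0// mulr_ge0 ?(ltW c0) ?(ltW x0).
    by case: (below _ _ _); rewrite /= ?mul1r ?mul0r mulNr; lra.
have A2 := @E_first_ge x^-1 m (mu - c) (tfun p B x) (fun n => grow_tfun B n x01) Hge.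
have A3 : 0 <= \sum_(n < m) E (fun z => (below x^-1 n.+1 z)%:R * tgain p B x (z n)).
  by apply: sumr_ge0 => n _; apply: Ex_ge0 => z; rewrite mulr_ge0.
move=> id0.
have mc : 0 < mu - c by lra.
rewrite -(ler_pM2l mc).
have : (a * mu / l + 5 * c) * x <= (mu - c) * ((1 + e) * a * x).
  rewrite (_ : (mu - c) * ((1 + e) * a * x) = (mu - c) * ((1 + e) * a) * x); last by ring.
  rewrite ler_wpM2r ?(ltW x0)// /l invrK; move: cK; rewrite /K; lra.
by lra.
Unshelve. all: end_near. Qed.

(** The bump now lies beyond the level (1 < l < b), so gains below the level are small. A population
    that has not passed contributes only if it is alive at time m, which produces the term [q m]. *)
Lemma max_tail_ge (e : R) : 0 < e -> \forall x \near (0:R)^'+, forall m,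
  (1 - e) * a * x - q m <= E (fun z => (~~ below x^-1 m z)%:R).
Proof.
move=> e0; have /andP[a0 a1] := a01.
have [e1|e1] := leP 1 e.
  near=> x => m; have x0 : 0 < x by near: x; exact: nbhs_right_gt.
  apply: (@le_trans _ _ 0); last exact: Ex_ge0.
  have /andP[q0 _] := survp_gt0 dd m; have : 0 <= (e - 1) * a * x by rewrite mulr_ge0 ?(ltW x0)// mulr_ge0 ?(ltW a0)// subr_ge0.
  by lra.
pose b := (1 - e / 3)^-1.
have b1 : 1 < b by rewrite invf_gt1//; lra.
pose l := (1 + b) / 2.
have l1 : 1 < l by rewrite /l; lra.
have lb : 0 < l < b by rewrite /l; lra.
have [mu [mu0 Hmu]] := poly_bump a01 lb.
pose c := 2 * e / 3 * a * mu / 9.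
have c0 : 0 < c by rewrite !(mulr_gt0, invr_gt0).
have cE : 9 * c = 2 * e / 3 * a * mu by rewrite /c; field.
clearbody c.
have [B [B1 B2 B3 B4 /andP[B5 B6]]] := Hmu c c0.
have slope := @tfun1_cvg _ _ _ dd B.
have c30 : 0 <= 3 * c by rewrite mulr_ge0// ltW.
have gain : \forall x \near (0:R)^'+, forall w, w%:R * x <= 1 ->
    tgain p B x w <= (3 * c + c) * (f (1 - x) ^+ w - (1 - x) ^+ w).
  exact: (@tgain_le R p a dd B c (3 * c) l c0 c30 l1 B2).
have coef := tcoef_near dd B c0.
near=> x => m.
have x01 : 0 < x < 1 by apply/andP; split; near: x; [exact: nbhs_right_gt|exact: nbhs_right_lt].
have /andP[x0 x1] := x01.
have gle w : w%:R * x <= 1 -> tgain p B x w <= (3 * c + c) * (f (1 - x) ^+ w - (1 - x) ^+ w) by move: w; near: x.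
have S1 : \sum_(i < size B) `|tcoef p B x i - B`_i * i.+1%:R `^ (- (1 + a))| * i.+1%:R <= c by near: x.
have H1 : (a * mu / b - c) * x <= tfun p B x 1.
  rewrite -ler_pdivlMr//; near: x; apply: cvgr_ge slope _ _.
  by apply: lt_le_trans B5; rewrite gtrBl.
have Hle w : tfun p B x w <= mu + 3 * c + c.
  have v1 : 0 < (1 - x) ^+ w <= 1 by rewrite exprn_gt0 ?subr_gt0//= exprn_ile1 ?subr_ge0 ?(ltW x1)// gerBl ltW.
  have /andP[_] := B4 _ v1; have := @tfun_potl R p a B x w x01.
  by rewrite ler_norml => /andP[_]; lra.
have x01' : 0 <= 1 - x <= 1 by lra.
have := test_stopped B x^-1 m x01.
have mc0 : 0 < mu + 3 * c + c by rewrite !addr_gt0// mulr_gt0.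
have A1 : E (fun z => (below x^-1 m z)%:R * tfun p B x (z m)) <= (mu + 3 * c + c) * q m.
  rewrite -(Ex_survive m) -EZ; last first.
    by apply: (@grow_bool m) => z z' ->.
  apply: Ele.
  - by apply: (@bg m) (grow_tfun _ _ x01); exact: (@adapt_below0 _ _ _ id).
  - by apply: growZ; apply: (@grow_bool m) => z z' ->.
  - move=> z; have := Hle (z m); case: (posnP (z m)) => [->|_].
      by rewrite tfun0 !mulr0.
    by case: (below _ _ _); rewrite /= ?mul1r ?mul0r ?mulr1// => _; exact: ltW.
have A2 := @E_first_le x^-1 m (mu + 3 * c + c) (tfun p B x) (fun n => grow_tfun B n x01)
  (fun w _ => Hle w).
have pg t k : 0 <= t <= 1 -> grow (fun z => t ^+ z k).
  move=> t01; apply: (@grow_bounded k 1) => [z z' ->//|z].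
  by have /andP[h1 h2] := sub_itv (z k) t01; rewrite ger0_norm.
have A3 : \sum_(n < m) E (fun z => (below x^-1 n.+1 z)%:R * tgain p B x (z n)) <= 4 * c * x.
  (* The gain is dominated by the telescoping function of [tgain_le]; over all generations these
     differences add up to at most 1 - (1 - x) = x. *)
  have step n : E (fun z => (below x^-1 n.+1 z)%:R * tgain p B x (z n)) <=
      4 * c * (E (fun z => (1 - x) ^+ z n.+1) - E (fun z => (1 - x) ^+ z n)).
    have f01 := pgf_itv p_ge0 p_sum x01'.
    have -> : E (fun z => (1 - x) ^+ z n.+1) = E (fun z => f (1 - x) ^+ z n).
      have := @markov_gen n (fun=> 1) (fun=> 1 - x)
        (fun=> ler01) (fun _ _ _ => erefl) (fun=> x01') (fun _ _ _ => erefl).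
      by under eq_Ex do rewrite mul1r; under [in RHS]eq_Ex do rewrite mul1r.
    rewrite -EB; [|exact: pg|exact: pg]; rewrite -EZ; last by apply: growB; exact: pg.
    apply: Ele.
    - by apply: (@bg n) (grow_tgain _ _ x01); exact: (@adapt_below _ _ _ id).
    - by apply: growZ; apply: growB; exact: pg.
    - move=> z; have [zx|zx] := boolP (below x^-1 n.+1 z); rewrite ?mul1r ?mul0r.
        have := gle (z n); rewrite (_ : 3 * c + c = 4 * c); last by ring.
        apply; move: zx; rewrite belowS => /andP[_ /ltW zx].
        by have := ler_wpM2r (ltW x0) zx; rewrite mulVf// gt_eqF.
      apply: mulr_ge0; first by rewrite mulr_ge0 ?(ltW c0).
      rewrite subr_ge0.
      have /andP[h0 h1] := x01'; apply: lerXn2r; rewrite ?nnegrE//; first by have /andP[] := f01.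
      have x01b : 0 < x <= 1 by rewrite x0 ltW.
      by have /andP[h _] := dec_bounds dd x01b; move: h; rewrite /loss subr_gt0 => /ltW.
  apply: le_trans (ler_sum _ (fun (n : 'I_m) _ => step n)) _.
  rewrite -mulr_sumr ler_wpM2l ?mulr_ge0 ?(ltW c0)//.
  rewrite -(big_mkord xpredT (fun n => E (fun z => (1 - x) ^+ z n.+1) - E (fun z => (1 - x) ^+ z n))).
  rewrite telescope_sumr//.
  rewrite (_ : E (fun z => (1 - x) ^+ z 0%N) = 1 - x); last first.
    by rewrite (Ex_start (fun k => (1 - x) ^+ k)) expr1.
  have : E (fun z => (1 - x) ^+ z m) <= 1.
    rewrite -[leRHS](@Ex_cst); apply: Ele => //; first exact: pg.
    by move=> z; have /andP[] := sub_itv (z m) x01'.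
  by lra.
move=> id0.
rewrite -(ler_pM2l mc0).
have : (mu + 3 * c + c) * ((1 - e) * a * x) <= (a * mu / b - 5 * c) * x.
  rewrite (_ : (mu + 3 * c + c) * ((1 - e) * a * x) = (mu + 4 * c) * ((1 - e) * a) * x); last by ring.
  rewrite ler_wpM2r ?(ltW x0)// /b invrK.
  have ca : c * (1 - e) * a <= c.
    rewrite -mulrA ler_piMr ?(ltW c0)// -[leRHS]mulr1 ler_pM ?subr_ge0 ?(ltW e1) ?(ltW a0)//.
    by rewrite gerBl ltW.
  by lra.
by lra.
Unshelve. all: end_near. Qed.

Lemma max_tail (e : R) : 0 < e -> exists2 Y : R, 0 < Y & forall y m, Y <= y ->
  (1 - e) * a / y - q m <= E (fun z => (~~ below y m z)%:R) <= (1 + e) * a / y.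
Proof.
move=> e0; have [r1 /= r10 H1] := max_tail_le e0; have [r2 /= r20 H2] := max_tail_ge e0.
pose r := Num.min r1 r2; have r0 : 0 < r by rewrite lt_min r10.
exists (2 / r); first by rewrite divr_gt0.
move=> y m yY; have y0 : 0 < y by apply: lt_le_trans yY; rewrite divr_gt0.
have y'0 : 0 < y^-1 by rewrite invr_gt0.
have yr : y^-1 < r.
  rewrite -[X in _ < X]invrK ltf_pV2 ?posrE ?invr_gt0//; apply: lt_le_trans yY.
  by rewrite ltr_pMl ?invr_gt0// ltr1n.
move: yr; rewrite lt_min => /andP[h1 h2].
have b1 : ball_ Num.norm 0 r1 y^-1 by rewrite /ball_/= sub0r normrN gtr0_norm.
have b2 : ball_ Num.norm 0 r2 y^-1 by rewrite /ball_/= sub0r normrN gtr0_norm.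
by have := H1 _ b1 y'0 m; have := H2 _ b2 y'0 m; rewrite invrK => -> ->.
Qed.
End Tail.

Let a0 : 0 < a. Proof. by have /andP[] := a01. Qed.

(** * Expected maximal block sums: the logarithmic law *)

Section PartA.
Local Notation fp y n z := (below y n z && ~~ below y n.+1 z).
Lemma below_peak i m z : ~~ below (i.+1%:R : R) m z = (i < peak m z)%N.
Proof.
rewrite ltnNge; congr (~~ _); apply/forallP/bigmax_leqP => h k.
  by move=> _; have := h k; rewrite ltr_nat ltnS.
by rewrite ltr_nat ltnS; exact: h.
Qed.

Local Notation u := (rate (loss p)).

Lemma grow_top m j : grow (fun z => (top m j z)%:R).
Proof.
apply: (@grow_adapt (m + j) 1); first exact: (@top_adapt m j _ (fun n => n%:R : R)).
move=> z; rewrite mul1r ger0_norm//.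
have h : (top m j z <= \sum_(l < (m + j).+1) z l)%N.
  apply: top_leP => k km; rewrite block_shift.
  have e : ((m + j).+1 = k + (j + ((m + j).+1 - j - k)))%N by lia.
  rewrite [in leqRHS]e big_split_ord/= -[leqLHS]add0n leq_add// big_split_ord/=.
  by rewrite -[leqLHS]addn0 leq_add.
have : (top m j z)%:R <= (\sum_(l < (m + j).+1) z l)%:R :> R by rewrite ler_nat.
by rewrite natr_sum; lra.
Qed.

Lemma grow_pos_coord k (c : R) : grow (fun z => pos ((z k)%:R - c)).
Proof.
apply: (@grow_le k _ (fun z => (z k)%:R + `|c|)) => [z z' ->//||z].
  by apply: growD => //; exact: grow_coord.
rewrite ger0_norm ?pos_ge0//; apply: pos_le; last by rewrite addr_ge0.
by rewrite lerD2l -normrN; exact: ler_norm.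
Qed.
Let adapt_peak m (U : Type) (h : nat -> U) : adapt m (fun z => h (peak m z)).
Proof. by move=> z z' e; congr h; apply: eq_bigr => k _; apply: e; exact: ltnW. Qed.

Lemma pos_peak_le m b z : pos ((peak m z)%:R - b%:R) <= \sum_(k < m) pos ((z k)%:R - b%:R) :> R.
Proof.
have s0 : 0 <= \sum_(k < m) pos ((z k)%:R - b%:R) :> R by apply: sumr_ge0 => k _; exact: pos_ge0.
apply: pos_le => //; case: (posnP m) => [m0|m0].
  by rewrite /peak m0 !big_ord0 sub0r oppr_le0.
have [k ->] : exists k : 'I_m, peak m z = z k.
  have c0 : (0 < #|'I_m|)%N by rewrite card_ord.
  by have [k e] := @bigop.eq_bigmax _ (fun k : 'I_m => z k) c0; exists k.
rewrite (bigD1 k)//=; apply: le_trans (pos_ge _) _; rewrite lerDl; apply: sumr_ge0 => i _; exact: pos_ge0.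
Qed.

Lemma grow_pos_peak m (b : nat) : grow (fun z => pos ((peak m z)%:R - b%:R)).
Proof.
apply: (@grow_le m _ (fun z => \sum_(k < m) pos ((z k)%:R - b%:R))).
- exact: (@adapt_peak m _ (fun n => pos (n%:R - b%:R))).
- by apply: grow_sum => k _; exact: grow_pos_coord.
- by move=> z; rewrite ger0_norm ?pos_ge0// pos_peak_le.
Qed.

Lemma grow_below (y : R) m : grow (fun z => (~~ below y m z)%:R).
Proof. by apply: (@grow_bool m (fun z => ~~ below y m z)); exact: (@adapt_below0 y m _ negb). Qed.

Lemma level_sum m A b : (A <= b)%N ->
  E (fun z => pos ((peak m z)%:R - A%:R)) =
  \sum_(A <= i < b) E (fun z => (~~ below (i.+1%:R : R) m z)%:R) + E (fun z => pos ((peak m z)%:R - b%:R)).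
Proof.
move=> Ab; rewrite -(@ES _ (index_iota A b)); last by move=> i _; exact: grow_below.
rewrite -ED; last 2 first.
- by apply: grow_sum => i _; exact: grow_below.
- exact: grow_pos_peak.
apply: eq_Ex => z; under eq_bigr do rewrite below_peak.
elim: b Ab => [|b IH]; first by rewrite leqn0 => /eqP->; rewrite big_geq// add0r.
rewrite leq_eqVlt ltnS => /orP[/eqP->|Ab]; first by rewrite big_geq// add0r.
rewrite IH// big_nat_recr//= -addrA; congr (_ + _); rewrite /pos.
case: ltnP => h; rewrite -natr1.
  have h' : b%:R + 1 <= (peak m z)%:R :> R by rewrite natr1 ler_nat.
  by rewrite !max_l /=; [ring|lra|lra].
have h' : (peak m z)%:R <= b%:R :> R by rewrite ler_nat.
by rewrite !max_r ?add0r//; lra.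
Qed.

(** A crude bound for fixed [m]; it only serves to cut the sum over levels at some finite [b]. *)
Lemma excess_cvg m (e : R) : 0 < e -> \forall b \near \oo, E (fun z => pos ((peak m z)%:R - b%:R)) <= e.
Proof.
move=> e0; have c0 : 0 < e * (1 + m%:R * m%:R)^-1 :> R by rewrite mulr_gt0// invr_gt0 ltr_wpDr// mulr_ge0.
have C : u (b%:R^-1) @[b --> \oo] --> (0 : R).
  have pos1 : \forall b \near \oo, 0 < (b%:R^-1 : R) by near=> b; rewrite invr_gt0 ltr0n; near: b; exact: nbhs_infty_gt.
  exact: (cvg_comp _ _ (cvg_at_right_near _ pos1 (@cvg_inv_natr R)) (rate_cvg0 dd)).
near=> b.
have b0 : (0 < b)%N by near: b; exact: nbhs_infty_gt.
have ub : u (b%:R^-1) <= e * (1 + m%:R * m%:R)^-1 by near: b; exact: cvgr_le C _ c0.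
apply: le_trans (_ : E (fun z => \sum_(k < m) pos ((z k)%:R - b%:R)) <= _).
  apply: Ele; first exact: grow_pos_peak.
    by apply: grow_sum => k _; exact: grow_pos_coord.
  by move=> z; exact: pos_peak_le.
rewrite ES; last by move=> k _; exact: grow_pos_coord.
have b1 : 0 < (b%:R^-1 : R) <= 1 by rewrite invr_gt0 ltr0n b0 invf_le1 ?ltr0n// ler1n.
apply: le_trans (_ : \sum_(k < m) m%:R * (e * (1 + m%:R * m%:R)^-1) <= _).
  apply: ler_sum => k _; have := excess_le k b1; rewrite invrK => h.
  apply: le_trans h _; apply: ler_pM => //; first exact: ltW (rate_gt0 dd b1).
  by rewrite ler_nat ltnW.
rewrite sumr_const card_ord.
have -> : m%:R * (e / (1 + m%:R * m%:R)) *+ m = e * (m%:R * m%:R / (1 + m%:R * m%:R)) :> R by rewrite -mulr_natl; ring.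
by rewrite ler_piMr ?(ltW e0)// ler_pdivrMr ?mul1r ?lerDr// ltr_wpDr// mulr_ge0.
Unshelve. all: end_near. Qed.
Let first_g := grow_fp.
Let first_ge (y : R) n z : below y n z && ~~ below y n.+1 z -> y <= (z n)%:R.
Proof. by rewrite belowS => /andP[->]/=; rewrite -leNgt. Qed.
(** [lower_deviation] started at the first passage, where Z_n >= y; monotonicity of the rate
    replaces Z_n by [y]. *)
Lemma first_deviation (y mu : R) n r k : 1 <= mu -> mu ^+ 2 <= y -> (r <= k)%N -> k%:R * u (mu / y) <= mu^-1 ->
  E (fun z => (fp y n z)%:R * pos (1 - (z (n + r)%N)%:R / (z n)%:R)) <=
  expR 2 / mu * E (fun z => (fp y n z)%:R).
Proof.
move=> m1 my rk ku.
have mu0 : 0 < mu by lra.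
have y0 : 0 < y by apply: lt_le_trans my; rewrite exprn_gt0.
apply: (lower_deviation m1) => //.
  exact: (@fp_adapt _ y n (fun b => b%:R)).
move=> z; case: (boolP (below y n z && _)) => [/first_ge yz _|]; last by rewrite eqxx.
have zn0 : 0 < (z n)%:R :> R by apply: lt_le_trans yz.
split; first exact: le_trans my yz.
apply: le_trans ku; apply: ler_pM => //.
- apply: ltW; apply: (rate_gt0 dd); rewrite divr_gt0//= ler_pdivrMr// mul1r.
  apply: le_trans yz; apply: le_trans my; rewrite expr2 ler_peMl//; lra.
- by rewrite ler_nat.
- apply: (rate_le dd); first by rewrite divr_gt0.
    by rewrite ler_pM2l// lef_pV2 ?posrE.
  rewrite ler_pdivrMr// mul1r; apply: le_trans my; rewrite expr2 ler_peMl//; lra.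
Qed.

(** A population that has reached [y] is still above y/2 at time m with substantial probability. The
    condition 4 exp 2 <= mu bounds the mean deviation by 1/4 of the passage probability, which is
    then absorbed on the left. *)
Lemma peak_tail (y mu : R) m : 1 <= mu -> 4 * expR 2 <= mu -> mu ^+ 2 <= y -> m%:R * u (mu / y) <= mu^-1 ->
  E (fun z => (~~ below y m z)%:R) <= 2 * E (fun z => (y / 2 <= (z m)%:R)%R%:R).
Proof.
move=> m1 m4 my mu_u.
have mu0 : 0 < mu by lra.
have y0 : 0 < y by apply: lt_le_trans my; rewrite exprn_gt0.
pose fb n z := below y n z && ~~ below y n.+1 z.
have gdev n : (n < m)%N -> grow (fun z => (fb n z)%:R * pos (1 - (z m)%:R / (z n)%:R)).
  move=> nm; apply: (@grow_bounded m 1).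
    move=> z z' e; rewrite (e m)// (e n) ?(ltnW nm)//; congr (_ * _).
    by apply: (@fp_adapt _ y n (fun b => b%:R)) => k kn; apply: e; lia.
  move=> z; rewrite ger0_norm ?mulr_ge0 ?pos_ge0//.
  have : pos (1 - (z m)%:R / (z n)%:R) <= 1 :> R by apply: pos_le => //; rewrite gerBl divr_ge0.
  by case: (fb n z); rewrite ?mul1r// mul0r.
have gy : grow (fun z => (y / 2 <= (z m)%:R)%R%:R) by apply: (@grow_bool m (fun z => y / 2 <= (z m)%:R)) => z z' ->.
have key : E (fun z => (~~ below y m z)%:R) <=
   E (fun z => (y / 2 <= (z m)%:R)%R%:R) + 2 * \sum_(n < m) E (fun z => (fb n z)%:R * pos (1 - (z m)%:R / (z n)%:R)).
  rewrite -ES; last by move=> n _; exact: gdev.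
  rewrite -EZ; last by apply: grow_sum => n _; exact: gdev.
  rewrite -ED//; last by apply: growZ; apply: grow_sum => n _; exact: gdev.
  apply: Ele; first exact: grow_below.
    by apply: growD => //; apply: growZ; apply: grow_sum => n _; exact: gdev.
  move=> z; rewrite -first_passage.
  have nn : 0 <= \sum_(n < m) (fb n z)%:R * pos (1 - (z m)%:R / (z n)%:R) :> R by apply: sumr_ge0 => n _; rewrite mulr_ge0 ?pos_ge0.
  have [zy|zy] := leP (y / 2) (z m)%:R.
    rewrite first_passage; case: (~~ _) => /=; lra.
  rewrite add0r mulr_sumr; apply: ler_sum => n _; rewrite -/(fb n z).
  case: (boolP (fb n z)) => [/first_ge yz|_]; last by rewrite mul0r mulr0.
  rewrite mul1r; apply: le_trans (_ : 2 * (1 - (z m)%:R / (z n)%:R) <= _); last by rewrite ler_pM2l// pos_ge.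
  have : (z m)%:R / (z n)%:R <= 2^-1 :> R by rewrite ler_pdivrMr//; lra.
  by rewrite /=; lra.
have dev : \sum_(n < m) E (fun z => (fb n z)%:R * pos (1 - (z m)%:R / (z n)%:R)) <=
   4^-1 * E (fun z => (~~ below y m z)%:R).
  rewrite Ex_fp mulr_sumr; apply: ler_sum => n _.
  have nm := ltn_ord n; have := @first_deviation y mu n (m - n) m m1 my (leq_subr _ _) mu_u.
  rewrite subnKC ?(ltnW nm)// => h; apply: le_trans h _.
  rewrite ler_wpM2r//; first by apply: Ex_ge0.
  by rewrite ler_pdivrMr//; lra.
by lra.
Qed.

(** Levels beyond K/q_m contribute little, uniformly in [m]: [peak_tail] replaces the maximum by the
    last generation, for which [excess_le] and [rate_survp_small] give a bound independent of m. *)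
Lemma peak_excess (e : R) : 0 < e -> exists2 K : R, 1 <= K &
  forall m b, K / q m <= b%:R -> E (fun z => pos ((peak m z)%:R - b%:R)) <= e.
Proof.
move=> e0; pose mu : R := 4 * expR 2.
have mu4 : 1 <= mu by rewrite /mu; have := @expR_ge1Dx R 2; lra.
have mu0 : 0 < mu by lra.
have imu : 0 < mu^-1 by rewrite invr_gt0.
pose e' := Num.min mu^-1 (e / 8).
have e'0 : 0 < e' by rewrite lt_min imu divr_gt0.
have e'mu : e' <= mu^-1 by rewrite ge_min lexx.
have e'e : e' <= e / 8 by rewrite ge_min lexx orbT.
have [kap [/andP[k0 k1] Hk]] := rate_survp_small dd e'0.
(* The first summand makes [peak_tail] applicable beyond K/q_m, the second brings 2/b below kap q_m
   for [excess_le]. *)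
pose K := mu ^+ 2 / kap + 2 / kap.
have K1 : mu ^+ 2 / kap <= K by rewrite lerDl divr_ge0// ltW.
have K2 : 2 / kap <= K by rewrite lerDr divr_ge0 ?exprn_ge0// ltW.
have mm : mu <= mu ^+ 2 by rewrite expr2 ler_peMl// ltW.
have m2k : mu ^+ 2 <= mu ^+ 2 / kap by rewrite ler_peMr ?exprn_ge0 ?(ltW mu0)// invf_ge1.
exists K; first by apply: le_trans K1; apply: le_trans m2k; lra.
move=> m b Kb.
have e40 : 0 < e / 2 by rewrite divr_gt0.
have [n _ Hn] := excess_cvg m e40.
pose b' := maxn b n.
have bb' : (b <= b')%N by exact: leq_maxl.
rewrite (level_sum m bb').
have rest : E (fun z => pos ((peak m z)%:R - b'%:R)) <= e / 2 by apply: Hn; exact: leq_maxr.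
have /andP[q0 q1] := survp_gt0 dd m.
have Kq : K <= K / q m by rewrite ler_peMr ?invf_ge1//; apply: le_trans K2; rewrite divr_ge0// ltW.
have b0 : 0 < b%:R :> R by apply: lt_le_trans Kb; rewrite divr_gt0//; apply: lt_le_trans K2; rewrite divr_gt0.
have rate_ok (c y : R) : 0 < c -> c / kap <= K -> b%:R <= y -> c / y <= kap * q m.
  move=> c0 cK yb; have y0 : 0 < y by apply: lt_le_trans yb.
  rewrite ler_pdivrMr//; apply: le_trans (_ : kap * q m * (K / q m) <= _); last first.
    by rewrite ler_wpM2l ?mulr_ge0 ?(ltW k0) ?(ltW q0)//; exact: le_trans yb.
  have -> : kap * q m * (K / q m) = kap * K by field; rewrite gt_eqF.
  by rewrite -ler_pdivrMl// mulrC.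
have kq1 : kap * q m <= 1 by rewrite mulr_ile1// ltW.
have tail i : (b <= i)%N -> E (fun z => (~~ below (i.+1%:R : R) m z)%:R) <=
    2 * E (fun z => (i.+1%:R / 2 <= (z m)%:R :> R)%R%:R).
  move=> bi; have bi' : b%:R <= i.+1%:R :> R by rewrite ler_nat ltnW.
  apply: (@peak_tail _ mu) => //.
    by apply: le_trans bi'; apply: le_trans Kb; apply: le_trans Kq; apply: le_trans K1.
  apply: le_trans e'mu; apply: le_trans (Hk m); rewrite ler_wpM2l//; apply: (rate_le dd) => //.
    by rewrite divr_gt0// ltr0n.
  by apply: rate_ok => //; apply: le_trans K1; rewrite ler_wpM2r ?invr_ge0// ltW.
have main : \sum_(b <= i < b') E (fun z => (~~ below (i.+1%:R : R) m z)%:R) <=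
    \sum_(b <= i < b') 2 * E (fun z => (i.+1%:R / 2 <= (z m)%:R :> R)%R%:R).
  by rewrite big_nat [leRHS]big_nat; apply: ler_sum => i /andP[/tail].
have gy i : grow (fun z => (i.+1%:R / 2 <= (z m)%:R :> R)%R%:R) by apply: (@grow_bool m (fun z => i.+1%:R / 2 <= (z m)%:R :> R)) => z z' ->.
have ESy := @ES _ (index_iota b b') predT _ (fun i _ => gy i).
rewrite -mulr_sumr -ESy in main.
have x0 : (0 < 2 / b%:R :> R) && (2 / b%:R <= 1 :> R).
  rewrite divr_gt0//= ler_pdivrMr// mul1r; apply: le_trans Kb; apply: le_trans Kq; apply: le_trans K2.
  by rewrite ler_peMr// invf_ge1.
have := excess_le m x0; rewrite invf_div => ex.
have exm : E (fun z => pos ((z m)%:R - b%:R / 2)) <= e'.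
  apply: le_trans ex _; apply: le_trans (Hk m); rewrite ler_wpM2l//; apply: (rate_le dd) => //.
    by rewrite divr_gt0.
  exact: rate_ok.
have : E (fun z => \sum_(b <= i < b') (i.+1%:R / 2 <= (z m)%:R :> R)%R%:R) <= 2 * E (fun z => pos ((z m)%:R - b%:R / 2)).
  rewrite -EZ; last exact: grow_pos_coord.
  apply: Ele; first by apply: grow_sum => i _; exact: gy.
    by apply: growZ; exact: grow_pos_coord.
  move=> z; rewrite -{1}(add0n b) big_addn.
  have h2 : (0:R) <= 2^-1 by rewrite invr_ge0.
  have := count_levels (b' - b) h2 (@pos_ge0 R ((z m)%:R - b%:R / 2)).
  rewrite -mulr_suml => h.
  have : \sum_(0 <= i < b' - b) (((i + b).+1%:R / 2 <= (z m)%:R :> R)%R%:R : R) <=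
      \sum_(0 <= i < b' - b) ((2^-1 * i.+1%:R <= pos ((z m)%:R - b%:R / 2) :> R)%R%:R : R).
    apply: ler_sum => i _; rewrite ler_nat; case: (leP ((i + b).+1%:R / 2) _) => //= h1.
    rewrite (_ : _ <= _ = true)//; apply: le_trans (pos_ge _).
    by move: h1; rewrite -addSn natrD; lra.
  by lra.
by lra.
Qed.

(** Permanence of extinction, obtained in mean from the martingale property. *)
Lemma Ex_extinct_tail j l : (j <= l)%N -> E (fun z => (z j == 0%N)%:R * (z l)%:R) = 0.
Proof.
move=> jl; rewrite -(subnKC jl) (@martingale j (l - j) (fun z => (z j == 0%N)%:R))//.
  by rewrite -[RHS](@Ex_cst 0); apply: eq_Ex => z; case: (z j) => [|n]; rewrite ?mulr0 ?mul0r.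
by move=> z z' ->.
Qed.

(** Split by survival at generation j. After extinction a block sum is at most the sum of the first
    j generations plus terms that vanish in mean; otherwise it is at most j times the peak, cut at a
    free threshold [A]. *)
Lemma top_le m j A z : (j <= m)%N -> (top m j z)%:R <=
  \sum_(l < j) (z l)%:R + (0 < z j)%N%:R * (j%:R * A%:R) + j%:R * pos ((peak m z)%:R - A%:R)
  + \sum_(i < m - j) (z j == 0%N)%:R * (z (j + i)%N)%:R :> R.
Proof.
move=> jm.
have h1 : 0 <= \sum_(l < j) (z l)%:R :> R by apply: sumr_ge0.
have h2 : 0 <= j%:R * pos ((peak m z)%:R - A%:R) :> R by rewrite mulr_ge0// pos_ge0.
case: (posnP (z j)) => [zj|zj].
  have : (top m j z)%:R <= (\sum_(l < m) z l)%:R :> R by rewrite ler_nat top_le_sum.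
  have e : (m = j + (m - j))%N by rewrite subnKC.
  have e' : (\sum_(l < m) z l = \sum_(l < j) z l + \sum_(i < m - j) z (j + i))%N by rewrite [in LHS]e big_split_ord.
  rewrite e' natrD !natr_sum /= mul0r.
  by under [X in _ -> _ <= _ + X]eq_bigr do rewrite mul1r; lra.
have : (top m j z)%:R <= (j * peak m z)%:R :> R by rewrite ler_nat top_le_peak.
rewrite natrM [X in _ -> _ <= _ + X]big1 ?addr0; last first.
  by move=> i _; rewrite /= mul0r.
have : j%:R * (peak m z)%:R <= j%:R * (A%:R + pos ((peak m z)%:R - A%:R)) :> R by rewrite ler_wpM2l//; have := pos_ge ((peak m z)%:R - A%:R : R); lra.
by rewrite mulrDr mul1r; lra.
Qed.

Lemma Ex_top_le m j A : (j <= m)%N ->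
  E (fun z => (top m j z)%:R) <= j%:R * (1 + q j * A%:R + E (fun z => pos ((peak m z)%:R - A%:R))).
Proof.
move=> jm.
have g1 : grow (fun z => \sum_(l < j) (z l)%:R) by apply: grow_sum => l _; exact: grow_coord.
have g2 : grow (fun z => (0 < z j)%N%:R) by apply: (@grow_bool j (fun z => (0 < z j)%N)) => z z' ->.
have g3 := grow_pos_peak m A.
have g4 i : grow (fun z => (z j == 0%N)%:R * (z (j + i)%N)%:R).
  apply: (@growM_bounded j 1) (grow_coord _) => [z z' ->//|z].
  by case: eqP; rewrite ?normr1 ?normr0.
have g4' : grow (fun z => \sum_(i < m - j) (z j == 0%N)%:R * (z (j + i)%N)%:R) by apply: grow_sum => i _.
have g2' : grow (fun z => (0 < z j)%N%:R * (j%:R * A%:R)).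
  by apply: (@eq_growth _ (fun z => (j%:R * A%:R) * (0 < z j)%N%:R)) (growZ _ g2) => z; rewrite mulrC.
apply: le_trans (Ele (grow_top m j) _ (fun z => @top_le m j A z jm)) _.
  by apply: growD => //; apply: growD; [exact: growD|exact: growZ].
rewrite ED//; last by apply: growD; [exact: growD|exact: growZ].
rewrite ED; [|exact: growD|exact: growZ].
rewrite ED// EZ// ES; last by move=> l _; exact: grow_coord.
rewrite ES// [X in _ + X <= _]big1 ?addr0; last by move=> i _; apply: Ex_extinct_tail; exact: leq_addr.
under eq_bigr do rewrite Ecoord.
rewrite sumr_const card_ord -mulr_natl mulr1.
have -> : E (fun z => (0 < z j)%N%:R * (j%:R * A%:R)) = j%:R * A%:R * q j by rewrite -(Ex_survive j) -EZ//; apply: eq_Ex => z; rewrite mulrC.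
by rewrite le_eqVlt; apply/orP; left; apply/eqP; ring.
Qed.

(** With A about 1/q_j the survival term q_j A stays bounded, and the levels from A to K/q_m
    contribute a (ln q_j - ln q_m), about ln(m/j). The bound is uniform in m and j, so it also
    serves when j/m has a positive limit. *)
Lemma top_upper (e : R) : 0 < e -> exists2 C : R, 0 <= C & forall m j, (0 < j <= m)%N ->
  E (fun z => (top m j z)%:R) <= j%:R * ((1 + e) * ln (m%:R / j%:R) + C).
Proof.
move=> e0; pose e' := Num.min (e / 3) 1.
have e'0 : 0 < e' by rewrite lt_min divr_gt0/=.
have e'1 : e' <= 1 by rewrite ge_min lexx orbT.
have e'e : e' <= e / 3 by rewrite ge_min lexx.
have [Y Y0 HY] := max_tail e'0.
have [K K1 HK] := peak_excess ltr01.
have [C2 [C20 HC2]] := survp_ln_bound dd e'0.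
exists (1 + (Y + 2) + (1 + e') * (a * ln (K + 1) + C2) + 1).
  have l0 : 0 <= ln (K + 1) by apply: ln_ge0; lra.
  have : 0 <= (1 + e') * (a * ln (K + 1) + C2) by rewrite mulr_ge0 ?addr_ge0 ?mulr_ge0 ?(ltW e'0) ?(ltW a0).
  by lra.
move=> m j /andP[j0 jm]; have m0 : (0 < m)%N by apply: leq_trans jm.
have /andP[qj0 qj1] := survp_gt0 dd j; have /andP[qm0 qm1] := survp_gt0 dd m.
have qmj : q m <= q j by exact: (survp_decr dd).
(* A is at least Y, where the tail estimate is valid, and at least 1/q_j, where the logarithm has to
   start. *)
have [A [A0 A1 A2]] : exists n : nat, [/\ (0 < n)%N, Y + (q j)^-1 <= n%:R & n%:R <= Y + (q j)^-1 + 1].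
  by apply: nat_above; rewrite addr_ge0 ?invr_ge0 ?(ltW Y0) ?(ltW qj0).
have [B [B0 B1 B2]] : exists n : nat, [/\ (0 < n)%N, K / q m <= n%:R & n%:R <= K / q m + 1] by apply: nat_above; rewrite divr_ge0 ?(ltW qm0)//; lra.
have iq0 : 0 < (q j)^-1 by rewrite invr_gt0.
apply: le_trans (Ex_top_le A jm) _; rewrite ler_wpM2l//.
have Ab : (A <= maxn A B)%N by exact: leq_maxl.
rewrite (level_sum m Ab).
have h1 : q j * A%:R <= Y + 2.
  apply: le_trans (ler_wpM2l (ltW qj0) A2) _; rewrite !mulrDr mulfV ?gt_eqF// mulr1.
  have : q j * Y <= 1 * Y by rewrite ler_wpM2r// ltW.
  by lra.
have h2 : E (fun z => pos ((peak m z)%:R - (maxn A B)%:R)) <= 1 by apply: HK => //; apply: le_trans B1 _; rewrite ler_nat leq_maxr.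
have h3 : \sum_(A <= i < maxn A B) E (fun z => (~~ below (i.+1%:R : R) m z)%:R) <=
    (1 + e') * a * (ln (maxn A B)%:R - ln A%:R).
  apply: le_trans (_ : \sum_(A <= i < maxn A B) (1 + e') * a * i.+1%:R^-1 <= _).
    rewrite big_nat [leRHS]big_nat; apply: ler_sum => i /andP[Ai _].
    have Yi : Y <= i.+1%:R.
      apply: le_trans (_ : A%:R <= _); last by rewrite ler_nat ltnW.
      by apply: le_trans A1; lra.
    by have /andP[] := HY _ m Yi.
  rewrite -mulr_sumr ler_wpM2l; last by apply: harmonic_le; rewrite A0.
    by [].
  by rewrite mulr_ge0 ?(ltW a0)//; lra.
have lA : - ln (q j) <= ln (A%:R : R) by rewrite -lnV ?posrE// ler_ln ?posrE ?ltr0n//; apply: le_trans A1; lra.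
have lB : ln (B%:R : R) <= ln (K + 1) - ln (q m).
  rewrite -ln_div ?posrE//; last by lra.
  rewrite ler_ln ?posrE ?ltr0n ?divr_gt0//; last by lra.
  apply: le_trans B2 _; rewrite mulrDl lerD2l mul1r invf_ge1//.
have lq : ln (q m) <= ln (q j) by rewrite ler_ln ?posrE.
have lK : 0 <= ln (K + 1) by apply: ln_ge0; lra.
have h4 : ln (maxn A B)%:R - ln A%:R <= ln (K + 1) + (ln (q j) - ln (q m)) :> R by case: (leqP A B) => AB; rewrite ?subrr; lra.
have h5 := HC2 j m j0 jm; rewrite ler_norml in h5; case/andP: h5 => _ h5.
have lmj : ln (m%:R / j%:R : R) = ln m%:R - ln j%:R by rewrite ln_div ?posrE ?ltr0n.
have lm0 : 0 <= ln (m%:R / j%:R : R) by rewrite lmj subr_ge0 ler_ln ?posrE ?ltr0n// ler_nat.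
rewrite -lmj in h5; set l := ln (m%:R / j%:R) in h5 lm0 *.
have h6 : a * (ln (maxn A B)%:R - ln A%:R) <= a * ln (K + 1) + (1 + e') * l + C2 by apply: le_trans (ler_wpM2l (ltW a0) h4) _; rewrite mulrDr; lra.
have h7 : (1 + e') * (a * (ln (maxn A B)%:R - ln A%:R)) <= (1 + e') * (a * ln (K + 1) + (1 + e') * l + C2) by rewrite ler_wpM2l//; lra.
have h8 : (1 + e') * (1 + e') * l <= (1 + e) * l.
  rewrite ler_wpM2r//; have : e' * e' <= e' * 1 by rewrite ler_wpM2l// ltW.
  by lra.
rewrite -mulrA in h3; by lra.
Qed.

(** After a first passage to [y] the next j generations stay near that height on average, so their
    sum reaches (1 - th) j y unless the averaged deviation exceeds [th]; Markov's inequality bounds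
    that event. Passages up to generation m - j leave room for a full block. *)
Lemma top_level (y mu th : R) m j : (0 < j <= m)%N -> 0 < th < 1 -> 1 <= mu -> mu ^+ 2 <= y ->
  j%:R * u (mu / y) <= mu^-1 ->
  (1 - expR 2 / mu / th) * E (fun z => (~~ below y (m - j).+1 z)%:R) <=
  E (fun z => ((1 - th) * j%:R * y <= (top m j z)%:R)%R%:R).
Proof.
move=> /andP[j0 jm] /andP[th0 th1] m1 my ju.
have mu0 : 0 < mu by lra.
have y0 : 0 < y by apply: lt_le_trans my; rewrite exprn_gt0.
have j0' : 0 < j%:R :> R by rewrite ltr0n.
pose fb n z := below y n z && ~~ below y n.+1 z.
pose D n z : R := j%:R^-1 * \sum_(r < j) ((fb n z)%:R * pos (1 - (z (n + r)%N)%:R / (z n)%:R)).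
have gdev n r : grow (fun z => (fb n z)%:R * pos (1 - (z (n + r)%N)%:R / (z n)%:R)).
  apply: (@grow_bounded (n + r) 1).
    move=> z z' e; rewrite (e (n + r)%N)// (e n) ?leq_addr//; congr (_ * _).
    by apply: (@fp_adapt _ y n (fun b => b%:R)) => k kn; apply: e; lia.
  move=> z; rewrite ger0_norm ?mulr_ge0 ?pos_ge0//.
  have : pos (1 - (z (n + r)%N)%:R / (z n)%:R) <= 1 :> R by apply: pos_le => //; rewrite gerBl divr_ge0.
  by case: (fb n z); rewrite ?mul1r// mul0r.
have gD n : grow (D n) by apply: growZ; apply: grow_sum => r _; exact: gdev.
have gt' : grow (fun z => ((1 - th) * j%:R * y <= (top m j z)%:R)%R%:R).
  apply: (@grow_bool (m + j) (fun z => (1 - th) * j%:R * y <= (top m j z)%:R)).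
  exact: (@top_adapt m j _ (fun n => (1 - th) * j%:R * y <= n%:R)).
have devD n : E (D n) <= expR 2 / mu * E (fun z => (fb n z)%:R).
  rewrite EZ; last by apply: grow_sum => r _; exact: gdev.
  rewrite ES; last by move=> r _; exact: gdev.
  rewrite ler_pdivrMl// -[j in leRHS]card_ord mulr_natl -sumr_const; apply: ler_sum => r _.
  by apply: (@first_deviation _ _ _ _ j) => //; rewrite ltnW.
have key : E (fun z => (~~ below y (m - j).+1 z)%:R) <=
    E (fun z => ((1 - th) * j%:R * y <= (top m j z)%:R)%R%:R) + th^-1 * \sum_(n < (m - j).+1) E (D n).
  rewrite -ES; last by move=> n _; exact: gD.
  rewrite -EZ; last by apply: grow_sum => n _; exact: gD.
  rewrite -ED//; last by apply: growZ; apply: grow_sum => n _; exact: gD.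
  apply: Ele; first exact: grow_below.
    by apply: growD => //; apply: growZ; apply: grow_sum => n _; exact: gD.
  move=> z.
  have D0 n : 0 <= D n z by rewrite mulr_ge0 ?invr_ge0//; apply: sumr_ge0 => r _; rewrite mulr_ge0 ?pos_ge0.
  have nn : 0 <= th^-1 * \sum_(n < (m - j).+1) D n z by rewrite mulr_ge0 ?invr_ge0 ?(ltW th0)//; apply: sumr_ge0 => n _; exact: D0.
  have [zt|zt] := leP ((1 - th) * j%:R * y) (top m j z)%:R.
    by case: (~~ _) => /=; lra.
  rewrite add0r -first_passage mulr_sumr; apply: ler_sum => n _; rewrite -/(fb n z).
  case: (boolP (fb n z)) => [fbz|_]; last by rewrite mulr_ge0 ?invr_ge0 ?(ltW th0)// D0.
  have yz := first_ge fbz; have zn0 : 0 < (z n)%:R :> R by apply: lt_le_trans yz.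
  rewrite ler_pdivlMl// mulr1 /D fbz ler_pdivlMl// mulrC.
  have h1 : \sum_(r < j) (1 - (z (n + r)%N)%:R / (z n)%:R) <=
      \sum_(r < j) 1%:R * pos (1 - (z (n + r)%N)%:R / (z n)%:R) :> R.
    by apply: ler_sum => r _; rewrite mul1r pos_ge.
  apply: le_trans h1; rewrite sumrB sumr_const card_ord -mulr_suml -natr_sum -block_shift.
  have bt : (block j n z)%:R <= (top m j z)%:R :> R by rewrite ler_nat; apply: block_le_top; rewrite -ltnS.
  have : (block j n z)%:R / (z n)%:R <= (1 - th) * j%:R :> R.
    rewrite ler_pdivrMr//; apply: le_trans bt _; apply: le_trans (ltW zt) _.
    by rewrite ler_wpM2l// mulr_ge0//; lra.
  by lra.
have : \sum_(n < (m - j).+1) E (D n) <= expR 2 / mu * E (fun z => (~~ below y (m - j).+1 z)%:R).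
  by rewrite Ex_fp mulr_sumr; apply: ler_sum => n _; exact: devD.
move=> h; have h' : th^-1 * \sum_(n < (m - j).+1) E (D n) <=
    th^-1 * (expR 2 / mu * E (fun z => (~~ below y (m - j).+1 z)%:R)).
  by rewrite ler_wpM2l// invr_ge0 ltW.
by lra.
Qed.

(** Levels are counted from K/q_j, beyond which [top_level] applies, up to 1/q at generation m - j +
    1: over that range the correction term of [max_tail] sums to at most 1. The hypothesis 2 j <= m
    makes m - j comparable with m. *)
Lemma top_lower (e : R) : 0 < e -> exists2 C : R, 0 <= C & forall m j, (0 < j)%N -> (2 * j <= m)%N ->
  j%:R * ((1 - e) * ln (m%:R / j%:R) - C) <= E (fun z => (top m j z)%:R).
Proof.
move=> e0; have [e1|e1] := leP 1 e.
  exists 0 => // m j j0 jm; apply: (@le_trans _ _ 0); last by apply: Ex_ge0 => z.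
  rewrite subr0 -oppr_ge0 -mulrN mulr_ge0// -mulNr mulr_ge0//; first by lra.
  by apply: ln_ge0; rewrite ler_pdivlMr ?ltr0n// mul1r ler_nat; have [_ /andP[]] := half_nat j0 jm.
(* Four factors 1 - th are lost: the height of the block, the deviation, the tail estimate and the
   comparison of logarithms; and (1 - th)^4 >= 1 - 4e/5. *)
pose th := e / 5; have th0 : 0 < th by rewrite divr_gt0.
have th01 : 0 < th < 1 by rewrite /th in th0 *; lra.
have [Y Y0 HY] := max_tail th0.
have [C2 [C20 HC2]] := survp_ln_bound dd th0.
(* Makes the cost exp 2 / (mu th) of [top_level] equal to [th]. *)
pose mu : R := expR 2 / (th * th).
have e2 : 1 <= expR 2 :> R by have := @expR_ge1Dx R 2; lra.
have tt0 : 0 < th * th by rewrite mulr_gt0.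
have mu1 : 1 <= mu.
  rewrite ler_pdivlMr// mul1r; apply: le_trans e2; rewrite mulr_ile1//; rewrite /th in th01 *; lra.
have mu0 : 0 < mu by lra.
have dev : expR 2 / mu / th = th by rewrite /mu; field; rewrite !gt_eqF ?expR_gt0.
have imu : 0 < mu^-1 by rewrite invr_gt0.
have [kap [/andP[k0 k1] Hk]] := rate_survp_small dd imu.
pose K := mu ^+ 2 / kap + Y.
have K0 : 0 < K by rewrite addr_gt0// divr_gt0// exprn_gt0.
have mm : mu <= mu ^+ 2 by rewrite expr2 ler_peMl// ltW.
have m2k : mu ^+ 2 <= mu ^+ 2 / kap by rewrite ler_peMr ?exprn_ge0 ?(ltW mu0)// invf_ge1.
exists (a * ln (K + 2) + C2 + ln 2 + 1).
  by rewrite !addr_ge0// ?mulr_ge0 ?(ltW a0)// ln_ge0//; lra.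
move=> m j j0 jm; have [jm' jm2 m0 mm2] := half_nat j0 jm.
have j0' : 0 < j%:R :> R by rewrite ltr0n.
set m' := (m - j)%N in jm' mm2 *.
have /andP[qj0 qj1] := survp_gt0 dd j; have /andP[qm0 qm1] := survp_gt0 dd m'.+1.
have iq1 : 1 <= (q j)^-1 by rewrite invf_ge1.
have iqm : 0 <= (q m'.+1)^-1 by rewrite invr_ge0 ltW.
have [A [A0 A1 A2]] : exists n : nat, [/\ (0 < n)%N, K / q j <= n%:R & n%:R <= K / q j + 1] by apply: nat_above; rewrite divr_ge0 ?ltW.
have /andP[b1 b2] := truncn_itv iqm; set b := Num.truncn (q m'.+1)^-1 in b1 b2.
have Kq : K <= K / q j by rewrite ler_peMr// ltW.
have lev i : (A <= i)%N -> (1 - th) * ((1 - th) * a / i.+1%:R - q m'.+1) <=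
    E (fun z => ((1 - th) * j%:R * i.+1%:R <= (top m j z)%:R)%R%:R).
  move=> Ai; have Ai' : K / q j <= i.+1%:R by apply: le_trans A1 _; rewrite ler_nat ltnW.
  have Yi : Y <= i.+1%:R by apply: le_trans Ai'; apply: le_trans Kq; rewrite /K lerDr divr_ge0 ?exprn_ge0// ltW.
  have mi : mu ^+ 2 <= i.+1%:R by apply: le_trans Ai'; apply: le_trans Kq; apply: le_trans m2k _; rewrite /K lerDl ltW.
  have ju : j%:R * u (mu / i.+1%:R) <= mu^-1.
    apply: le_trans (Hk j); rewrite ler_wpM2l//; apply: (rate_le dd).
    - by rewrite divr_gt0 ?ltr0n.
    - rewrite ler_pdivrMr ?ltr0n// -ler_pdivrMl ?mulr_gt0//; apply: le_trans Ai'.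
      apply: le_trans (_ : mu / kap / q j <= _).
        by rewrite le_eqVlt; apply/orP; left; apply/eqP; field; rewrite !gt_eqF.
      rewrite ler_wpM2r ?invr_ge0 ?(ltW qj0)// /K; apply: le_trans (_ : mu ^+ 2 / kap <= _).
        by rewrite ler_wpM2r ?invr_ge0// ltW.
      by rewrite lerDl ltW.
    - by rewrite mulr_ile1// ltW.
  have := top_level jm2 th01 mu1 mi ju; rewrite dev -/m'; apply: le_trans.
  have /andP[h _] := HY _ m'.+1 Yi.
  by rewrite ler_wpM2l//; rewrite /th in th01 *; lra.
pose c := (1 - th) * j%:R.
have c0 : 0 < c by rewrite mulr_gt0//; rewrite /th in th01 *; lra.
have gl i : grow (fun z => (c * i.+1%:R <= (top m j z)%:R)%R%:R).
  apply: (@grow_bool (m + j) (fun z => c * i.+1%:R <= (top m j z)%:R)).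
  exact: (@top_adapt m j _ (fun n => c * i.+1%:R <= n%:R)).
have cnt : c * \sum_(A <= i < b) E (fun z => (c * i.+1%:R <= (top m j z)%:R)%R%:R) <= E (fun z => (top m j z)%:R).
  rewrite -ES; last by move=> i _; exact: gl.
  rewrite -EZ; last by apply: grow_sum => i _; exact: gl.
  apply: Ele; [by apply: growZ; apply: grow_sum => i _; exact: gl|exact: grow_top|move=> z].
  apply: le_trans (count_levels b (ltW c0) (ler0n R (top m j z))).
  rewrite -mulr_suml mulrC ler_wpM2r ?(ltW c0)//.
  have [Ab|bA] := leqP A b; last by rewrite (big_geq (ltnW bA)); apply: sumr_ge0.
  by rewrite [leRHS](big_cat_nat (leq0n A) Ab)/= lerDr; apply: sumr_ge0.
apply: le_trans cnt.
have s1 : \sum_(A <= i < b) (1 - th) * ((1 - th) * a / i.+1%:R - q m'.+1) <=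
    \sum_(A <= i < b) E (fun z => (c * i.+1%:R <= (top m j z)%:R)%R%:R).
  by rewrite big_nat [leRHS]big_nat; apply: ler_sum => i /andP[/lev].
have s2 : \sum_(A <= i < b) q m'.+1 <= 1.
  rewrite sumr_const_nat -[q m'.+1 *+ _]mulr_natr; apply: le_trans (_ : q m'.+1 * b%:R <= _).
    by rewrite ler_wpM2l ?(ltW qm0)// ler_nat leq_subr.
  by apply: le_trans (ler_wpM2l (ltW qm0) b1) _; rewrite mulfV// gt_eqF.
have s3 := @harmonic_ge R A b.
have lb : - ln (q m'.+1) <= ln (b.+1%:R : R) by rewrite -lnV ?posrE// ler_ln ?posrE ?ltr0n ?invr_gt0// ltW.
have lA : ln (A.+1%:R : R) <= ln (K + 2) - ln (q j).
  have K2 : 0 < K + 2 by rewrite addr_gt0.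
  rewrite -ln_div ?posrE// ler_ln ?posrE ?ltr0n ?divr_gt0//.
  by rewrite -natr1 mulrDl; lra.
have h5 := HC2 j m'.+1 j0 (leqW jm'); rewrite ler_norml in h5; case/andP: h5 => h5 _.
have lm : ln m%:R - ln 2 <= ln m'.+1%:R :> R.
  rewrite -ln_div ?posrE ?ltr0n// ler_ln ?posrE ?ltr0n ?divr_gt0 ?ltr0n//.
  by rewrite ler_pdivrMr// -natrM ler_nat.
have lmj : ln (m%:R / j%:R : R) = ln m%:R - ln j%:R by rewrite ln_div ?posrE ?ltr0n.
have lm0 : 0 <= ln (m%:R / j%:R : R) by rewrite lmj subr_ge0 ler_ln ?posrE ?ltr0n// ler_nat; case/andP: jm2.
set l := ln (m%:R / j%:R) in lmj lm0 *.
have l2 : 0 <= ln 2 :> R by apply: ln_ge0; lra.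
set S := \sum_(A <= i < b) i.+1%:R^-1 in s3.
have s4 : \sum_(A <= i < b) (1 - th) * ((1 - th) * a / i.+1%:R - q m'.+1) =
   (1 - th) * ((1 - th) * a * S - \sum_(A <= i < b) q m'.+1).
  by rewrite -mulr_sumr sumrB -mulr_sumr.
have aS : (1 - th) * l - (a * ln (K + 2) + C2 + ln 2) <= a * S.
  have h6 : a * (ln (q j) - ln (q m'.+1) - ln (K + 2)) <= a * S by rewrite ler_wpM2l ?(ltW a0)//; lra.
  have h7 : (1 - th) * (l - ln 2) <= (1 - th) * (ln m'.+1%:R - ln j%:R) by rewrite ler_wpM2l//; rewrite /th in th01 *; lra.
  have h8 : th * ln 2 >= 0 by rewrite mulr_ge0// ltW.
  by lra.
set G := a * ln (K + 2) + C2 + ln 2 in aS *.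
have G0 : 0 <= G by rewrite !addr_ge0// ?mulr_ge0 ?(ltW a0)// ln_ge0//; lra.
have t1 : 0 <= 1 - th <= 1 by rewrite /th in th01 *; lra.
have c1 : c * \sum_(A <= i < b) (1 - th) * ((1 - th) * a / i.+1%:R - q m'.+1) <=
   c * \sum_(A <= i < b) E (fun z => (c * i.+1%:R <= (top m j z)%:R)%R%:R).
  by rewrite ler_wpM2l// ltW.
apply: le_trans c1; rewrite s4 /c [leRHS](_ : _ = j%:R * ((1 - th) ^+ 2 * ((1 - th) * (a * S) - \sum_(A <= i < b) q m'.+1))); last by ring.
rewrite ler_wpM2l//.
have /andP[t0 t1'] := t1.
have v1 : (1 - th) * ((1 - th) * l - G) - 1 <= (1 - th) * (a * S) - \sum_(A <= i < b) q m'.+1 by apply: lerB => //; rewrite ler_wpM2l.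
apply: le_trans (ler_wpM2l (exprn_ge0 2 t0) v1).
have sq1 : (1 - th) ^+ 2 <= 1 by rewrite exprn_ile1.
have sq3 : (1 - th) ^+ 3 <= 1 by rewrite exprn_ile1.
have sq4 : 1 - e <= (1 - th) ^+ 4.
  have := @bernoulli_le _ th 4; rewrite (ltW th0)/= => /(_ _); rewrite /th in th01 *.
  by move=> h; apply: le_trans (h _); lra.
have -> : (1 - th) ^+ 2 * ((1 - th) * ((1 - th) * l - G) - 1) = (1 - th) ^+ 4 * l - (1 - th) ^+ 3 * G - (1 - th) ^+ 2 by ring.
have w1 : (1 - e) * l <= (1 - th) ^+ 4 * l by rewrite ler_wpM2r.
have w2 : (1 - th) ^+ 3 * G <= 1 * G by rewrite ler_wpM2r.
by lra.
Qed.

Lemma top_ge m j : (j <= m)%N -> j%:R <= E (fun z => (top m j z)%:R).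
Proof.
move=> jm; apply: le_trans (_ : E (fun z => \sum_(l < j) (z l)%:R) <= _).
  rewrite ES; last by move=> l _; exact: grow_coord.
  by under eq_bigr do rewrite Ecoord; rewrite sumr_const card_ord.
apply: Ele; [by apply: grow_sum => l _; exact: grow_coord|exact: grow_top|move=> z].
rewrite -natr_sum ler_nat; have := @block_le_top m j 0 z (leq0n _); rewrite block_shift.
exact.
Qed.

(** As j/m tends to 0 the logarithm tends to infinity and swallows the constants of the two uniform
    bounds. *)
Lemma top_small (j : nat -> nat) :
  (forall m, (0 < m)%N -> (0 < j m <= m)%N) ->
  (j m)%:R / m%:R @[m --> \oo] --> (0 : R) ->
  E (fun z => (top m (j m) z)%:R) / ((j m)%:R * ln (m%:R / (j m)%:R)) @[m --> \oo] --> (1 : R).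
Proof.
move=> jm jc; apply/cvgrPdist_le => e e0.
have e2 : 0 < e / 2 by rewrite divr_gt0.
have [C1 C10 H1] := top_upper e2; have [C2 C20 H2] := top_lower e2.
(* Once ln(m/j) >= W, the sum of both constants is at most (e/2) ln(m/j). *)
pose W := (C1 + C2 + 1) / (e / 2).
have W0 : 0 < W by rewrite divr_gt0//; lra.
have s0 : 0 < expR (- W) by exact: expR_gt0.
have h2 : (0 : R) < 2^-1 by rewrite invr_gt0.
near=> m.
have m0 : (0 < m)%N by near: m; exact: nbhs_infty_gt.
have /andP[j0 jm'] := jm m m0.
have j0' : 0 < (j m)%:R :> R by rewrite ltr0n.
have m0' : 0 < m%:R :> R by rewrite ltr0n.
have r1 : (j m)%:R / m%:R <= expR (- W) by near: m; exact: cvgr_le jc _ s0.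
have r2 : (j m)%:R / m%:R <= 2^-1 :> R by near: m; exact: cvgr_le jc _ h2.
have jm2 : (2 * j m <= m)%N by move: r2; rewrite ler_pdivrMr// mulrC ler_pdivlMr// -natrM ler_nat mulnC.
set l := ln (m%:R / (j m)%:R).
have lW : W <= l.
  rewrite /l -(expRK W) ler_ln ?posrE ?expR_gt0 ?divr_gt0//.
  by rewrite -[leRHS]invf_div -(invrK (expR W)) -expRN lef_pV2 ?posrE ?divr_gt0.
have l0 : 0 < l by lra.
have Wl : C1 + C2 + 1 <= e / 2 * l by rewrite mulrC -ler_pdivrMr.
have := H1 m (j m) (jm m m0); have := H2 m (j m) j0 jm2; rewrite -/l => b2 b1.
have jl0 : 0 < (j m)%:R * l by rewrite mulr_gt0.
set ET := E _ in b1 b2 *.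
have u1 : ET / ((j m)%:R * l) <= 1 + e.
  rewrite ler_pdivrMr//; apply: le_trans b1 _.
  by rewrite (_ : (1 + e) * _ = (j m)%:R * ((1 + e) * l)); [rewrite ler_wpM2l//; lra|ring].
have u2 : 1 - e <= ET / ((j m)%:R * l).
  rewrite ler_pdivlMr//; apply: le_trans b2.
  by rewrite (_ : (1 - e) * _ = (j m)%:R * ((1 - e) * l)); [rewrite ler_wpM2l//; lra|ring].
by rewrite ler_norml; lra.
Unshelve. all: end_near. Qed.
End PartA.

(** * Replacing block sums by samples on a grid *)

Section GridError.
Local Notation u := (rate (loss p)).

Variable j : nat -> nat.
Hypothesis jinf : forall J, \forall m \near \oo, (J <= j m)%N.

Lemma grow_gap k l : grow (fun z => `|(z k)%:R - (z l)%:R|).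
Proof.
apply: (@grow_le (maxn k l) _ (fun z => (z k)%:R + (z l)%:R)).
- by move=> z z' e; rewrite !e ?leq_maxl ?leq_maxr.
- by apply: growD; exact: grow_coord.
- by move=> z; rewrite normr_id; apply: le_trans (ler_normB _ _) _; rewrite !ger0_norm.
Qed.

Lemma grow_spread s n : grow (fun z => spread R s n z).
Proof. by apply: grow_sum => r _; apply: grow_sum => l _; exact: grow_gap. Qed.

Lemma Ex_gap_le2 k l : E (fun z => `|(z k)%:R - (z l)%:R|) <= 2.
Proof.
apply: le_trans (_ : E (fun z => (z k)%:R + (z l)%:R) <= _).
  apply: Ele; [exact: grow_gap|by apply: growD; exact: grow_coord|].
  by move=> z; apply: le_trans (ler_normB _ _) _; rewrite !ger0_norm.
by rewrite ED ?Ecoord; [|exact: grow_coord|exact: grow_coord].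
Qed.

Lemma rate_survp_dilate (lam : R) : 0 < lam -> n%:R * u (lam * q n) @[n --> \oo] --> lam `^ a / a.
Proof.
move=> lam0.
have c1 := cvg_comp _ _ (survp_at_right dd) (rate_rv dd lam0).
have c2 : (n%:R * u (q n)) * (u (lam * q n) / u (q n)) @[n --> \oo] --> a^-1 * lam `^ a by apply: cvgM; [exact: (rate_survp dd)|exact: c1].
rewrite [X in _ --> X]mulrC; apply: near_cvg c2; apply: nearW => n.
have u0 : 0 < u (q n) by apply: (rate_gt0 dd); exact: (survp_gt0 dd).
by field; rewrite gt_eqF.
Qed.

(** The threshold [y] must be small against 1/q_n, to control populations below it, and large
    against mu^2, to make deviations from above it rare. *)
Lemma ordered_gap_le (b mu y qb : R) (k l n s : nat) : 1 <= mu -> mu ^+ 2 <= y -> 0 < b ->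
  s%:R * u (mu / y) <= mu^-1 -> 2 * (expR 2 / mu) <= b / 2 -> 2 * y * q n <= b / 2 ->
  mu <= y -> (n <= k)%N -> (k <= l)%N -> (l - k <= s)%N -> E (fun z => `|(z l)%:R - (z k)%:R|) <= b.
Proof.
move=> m1 my b0 su h1 h2 muy nk kl ks.
have mu0 : 0 < mu by lra.
have y0 : 0 < y by lra.
have up : 0 <= u (mu / y) by apply: ltW; apply: (rate_gt0 dd); rewrite divr_gt0//= ler_pdivrMr// mul1r.
have ksu : (l - k)%N%:R * u (mu / y) <= mu^-1 by apply: le_trans su; rewrite ler_wpM2r// ler_nat.
have := increment_le k m1 my ksu; rewrite subnKC// => h.
apply: le_trans h _; have qk : q k <= q n by exact: (survp_decr dd).
have : 2 * y * q k <= 2 * y * q n by rewrite ler_wpM2l// mulr_ge0// ltW.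
by lra.
Qed.
Let pos_in_cell r l s n : (l < s)%N -> (n <= r)%N ->
  [/\ (n * s <= r * s + l)%N, (n * s <= mid s r)%N, (r * s + l - mid s r <= s)%N & (mid s r - (r * s + l) <= s)%N].
Proof.
move=> ls nr; have h : (n * s <= r * s)%N by rewrite leq_mul2r nr orbT.
by rewrite /mid; split; lia.
Qed.

(** In the first R0 cells 1/q is too small for the increment estimate; there each term is bounded by
    2, the sum of two means. *)
Lemma Ex_spread_le (b : R) (s n R0 : nat) : 0 <= b ->
  (forall r l, (R0 <= r)%N -> (l < s)%N -> E (fun z => `|(z (r * s + l)%N)%:R - (z (mid s r))%:R|) <= b) ->
  E (fun z => spread R s n z) <= s%:R * (2 * R0%:R + n%:R * b).
Proof.
move=> b0 h; rewrite /spread ES; last by move=> r _; apply: grow_sum => l _; exact: grow_gap.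
have cell r : E (fun z => \sum_(l < s) `|(z (r * s + l)%N)%:R - (z (mid s r))%:R|) <=
    s%:R * (2 * (r < R0)%N%:R + b).
  rewrite ES; last by move=> l _; exact: grow_gap.
  rewrite -[X in X%:R * _]card_ord mulr_natl -sumr_const; apply: ler_sum => l _.
  case: ltnP => rR; last by rewrite mulr0 add0r h.
  by rewrite mulr1; have := Ex_gap_le2 (r * s + l)%N (mid s r); lra.
apply: le_trans (_ : \sum_(r < n) s%:R * (2 * (r < R0)%N%:R + b) <= _).
  by apply: ler_sum => r _; exact: cell.
have eb : \sum_(r < n) b = n%:R * b by rewrite sumr_const card_ord mulr_natl.
rewrite -mulr_sumr ler_wpM2l// big_split/= -mulr_sumr eb lerD2r ler_wpM2l//.
rewrite -natr_sum ler_nat; elim: (n) => [|k IH]; first by rewrite big_ord0.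
have : (\sum_(r < k) (r < R0) <= k)%N by rewrite -[leqRHS]card_ord -sum1_card; apply: leq_sum => r _; case: (_ < _)%N.
by rewrite big_ord_recr/=; case: (ltnP k R0) => kR; lia.
Qed.

(** A rescaled initial time of about [del] is sacrificed. After it q is at most 2 C q_j, so the
    single threshold kap/q_j works in every later cell, and a large N makes the cells short enough
    for the rate condition. *)
Lemma spread_small (e : R) (cT : nat) : 0 < e -> exists N0 : nat, forall N n, (N0 <= N)%N -> (n <= cT * N)%N ->
  \forall m \near \oo, E (fun z => spread R (j m %/ N) n z) <= e * (j m)%:R.
Proof.
move=> e0; pose c : R := cT%:R + 1; have c0 : 0 < c by rewrite ltr_wpDl.
pose b := e / (2 * c); have b0 : 0 < b by rewrite divr_gt0// mulr_gt0.
pose del := e / 8; have del0 : 0 < del by rewrite divr_gt0.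
pose C := del `^ (- a^-1); have C0 : 0 < C by rewrite powR_gt0.
have E2 : 1 <= expR 2 :> R by have := @expR_ge1Dx R 2; lra.
pose mu := 1 + 8 * expR 2 / b.
have h8 : 0 < 8 * expR 2 / b by rewrite divr_gt0//; lra.
have m1 : 1 <= mu by rewrite /mu; lra.
have mu0 : 0 < mu by lra.
have hmu : 2 * (expR 2 / mu) <= b / 2.
  rewrite mulrA ler_pdivrMr//.
  have : 8 * expR 2 = b * (8 * expR 2 / b) by field; rewrite gt_eqF.
  have : b * mu = b + b * (8 * expR 2 / b) by rewrite /mu mulrDr mulr1.
  by lra.
(* With y = kap/q_j this gives 2 y q <= 4 C kap = b/2 after the sacrificed cells. *)
pose kap := b / (8 * C); have kap0 : 0 < kap by rewrite divr_gt0// mulr_gt0.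
pose lam := mu / kap; have lam0 : 0 < lam by rewrite divr_gt0.
pose Q := lam `^ a / a + 1; have Q0 : 0 <= Q by rewrite addr_ge0// divr_ge0 ?powR_ge0// ltW.
have mQ0 : 0 <= mu * Q by rewrite mulr_ge0// ltW.
have e80 : 0 <= 8 / e by rewrite divr_ge0// ltW.
have hN : 0 <= 8 / e + mu * Q by rewrite addr_ge0.
have [N0 [N00 N01 _]] := nat_above hN.
exists N0 => N n NN nN.
have N0' : (0 < N)%N by exact: leq_trans NN.
have NR0 : 0 < N%:R :> R by rewrite ltr0n.
have NN' : N0%:R <= N%:R :> R by rewrite ler_nat.
have N8 : 8 / e <= N%:R by lra.
have NQ : mu * Q <= N%:R by lra.
have dN : 0 <= del * N%:R by rewrite mulr_ge0// ltW.
have [R0 [R00 R01 R02]] := nat_above dN.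
have tR0 : 0 < R0%:R / N%:R :> R by rewrite divr_gt0// ltr0n.
pose k m := (R0 * (j m %/ N))%N.
have kj : (k m)%:R / (j m)%:R @[m --> \oo] --> (R0%:R / N%:R : R).
  rewrite (_ : (fun m => _) = (fun m => R0%:R * ((j m %/ N)%N%:R / (j m)%:R) : R)); last first.
    by apply/funext => m; rewrite natrM mulrA.
  by apply: cvgM; [exact: cvg_cst|exact: cell_ratio].
have qk := survp_ratio dd tR0 jinf kj.
have qC : (R0%:R / N%:R) `^ (- a^-1) <= C.
  rewrite /C !powRN lef_pV2 ?posrE ?powR_gt0//.
  by apply: ge0_ler_powR; rewrite ?nnegrE ?invr_ge0 ?(ltW a0) ?(ltW del0) ?(ltW tR0)// ler_pdivlMr.
have qk2 : (R0%:R / N%:R) `^ (- a^-1) < 2 * C by lra.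
have uQ : lam `^ a / a < Q by rewrite /Q; lra.
have small : 0 < Num.min (kap / mu ^+ 2) lam^-1 by rewrite lt_min divr_gt0 ?exprn_gt0//= invr_gt0.
have qj0 : q (j m) @[m --> \oo] --> (0 : R) by exact: (cvg_infty_comp jinf (survp_cvg0 dd)).
near=> m.
have jm0 : (0 < j m)%N by near: m; exact: jinf.
have /andP[q0 q1] := survp_gt0 dd (j m).
have qs : q (j m) < Num.min (kap / mu ^+ 2) lam^-1 by near: m; exact: cvgr_lt qj0 _ small.
have ju : (j m)%:R * u (lam * q (j m)) < Q.
  by near: m; apply: (@near_infty_comp (fun n => n%:R * u (lam * q n) < Q) j jinf); exact: cvgr_lt (rate_survp_dilate lam0) _ uQ.
have qkm : q (k m) / q (j m) < 2 * C by near: m; exact: cvgr_lt qk _ qk2.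
pose y := kap / q (j m).
have y0 : 0 < y by rewrite divr_gt0.
have [qs1 qs2] : q (j m) < kap / mu ^+ 2 /\ q (j m) < lam^-1 by move: qs; rewrite lt_min => /andP[].
have my : mu ^+ 2 <= y by rewrite /y ler_pdivlMr// mulrC -ler_pdivlMr ?exprn_gt0//; exact: ltW.
have muy : mu <= y by apply: le_trans my; rewrite expr2 ler_peMl// ltW.
have myE : mu / y = lam * q (j m) by rewrite /y /lam; field; rewrite !gt_eqF.
set s := (j m %/ N)%N.
have sN : s%:R * N%:R <= (j m)%:R :> R by rewrite -natrM ler_nat leq_trunc_div.
have sj : s%:R <= (j m)%:R / N%:R :> R by rewrite ler_pdivlMr.
have u0 : 0 <= u (mu / y) by apply: ltW; apply: (rate_gt0 dd); rewrite divr_gt0//= ler_pdivrMr// mul1r.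
have su : s%:R * u (mu / y) <= mu^-1.
  apply: le_trans (_ : Q / N%:R <= _).
    apply: le_trans (ler_wpM2r u0 sj) _; rewrite myE mulrAC ler_pM2r ?invr_gt0//; exact: ltW.
  by rewrite ler_pdivrMr// ler_pdivlMl.
have yq : 2 * y * q (R0 * s)%N <= b / 2.
  have : q (R0 * s)%N <= 2 * C * q (j m) by rewrite -ler_pdivrMr//; exact: ltW.
  move=> h; apply: le_trans (_ : 2 * y * (2 * C * q (j m)) <= _).
    by rewrite ler_wpM2l// mulr_ge0// ltW.
  rewrite /y /kap le_eqVlt; apply/orP; left; apply/eqP; field; by rewrite !gt_eqF.
apply: le_trans (_ : s%:R * (2 * R0%:R + n%:R * b) <= _).
  apply: (@Ex_spread_le b s n R0 (ltW b0)) => r l rR ls.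
  have [p1 p2 p3 p4] := pos_in_cell ls rR.
  case: (leqP (mid s r) (r * s + l)) => c1.
    exact: (@ordered_gap_le b mu y 0 _ _ (R0 * s) s).
  have := @ordered_gap_le b mu y 0 (r * s + l) (mid s r) (R0 * s) s m1 my b0 su hmu yq muy p1 (ltnW c1) p4.
  by under eq_Ex do rewrite distrC.
have nc : n%:R * b <= e / 2 * N%:R.
  apply: le_trans (_ : c * N%:R * b <= _).
    rewrite ler_wpM2r ?(ltW b0)//; apply: le_trans (_ : (cT * N)%N%:R <= _); first by rewrite ler_nat.
    by rewrite natrM ler_wpM2r// /c; lra.
  by rewrite /b le_eqVlt; apply/orP; left; apply/eqP; field; rewrite gt_eqF.
have h2 : 2 <= e / 4 * N%:R by move: N8; rewrite ler_pdivrMr//; lra.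
have R2 : 2 * R0%:R + n%:R * b <= e * N%:R by move: R02; rewrite /del; lra.
apply: le_trans (_ : s%:R * (e * N%:R) <= _); first by rewrite ler_wpM2l.
by rewrite mulrCA ler_pM2l.
Unshelve. all: end_near. Qed.

(** For blocks of 4 cells and a horizon of n + 8 cells, [top_upper] gives 4 s (2 ln((n+8)/4) + C).
    Since s is at most j/N and n at most a multiple of N, the logarithm loses against N. *)
Lemma short_block_small (e : R) (cT : nat) : 0 < e -> exists N0 : nat, forall N n, (N0 <= N)%N -> (n <= cT * N)%N ->
  \forall m \near \oo, E (fun z => (top ((n + 8) * (j m %/ N)) (4 * (j m %/ N)) z)%:R) <= e * (j m)%:R.
Proof.
move=> e0; have [C C0 HC] := top_upper ltr01.
pose c : R := cT%:R + 8; have c0 : 0 < c by rewrite ltr_wpDl.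
pose K := 1 + 16 * c / e.
have hK : 0 < 16 * c / e by rewrite divr_gt0// mulr_gt0.
have K1 : 1 <= K by rewrite /K; lra.
have K0 : 0 < K by lra.
have cK : 8 * c / K <= e / 2.
  rewrite ler_pdivrMr//; have : e * K = e + 16 * c by rewrite /K mulrDr mulr1 mulrCA mulfV ?gt_eqF// mulr1.
  by lra.
have lK : 0 <= ln K by exact: ln_ge0.
have hN : 0 <= (16 * ln K + 8 * C) / e by rewrite divr_ge0 ?(ltW e0)// addr_ge0 ?mulr_ge0.
have [N0 [N00 N01 _]] := nat_above hN.
exists N0 => N n NN nN.
have N0' : (0 < N)%N by exact: leq_trans NN.
have NN' : N0%:R <= N%:R :> R by rewrite ler_nat.
have lN : 16 * ln K + 8 * C <= e * N%:R by rewrite (mulrC e) -ler_pdivrMr//; lra.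
have nc : n%:R + 8 <= c * N%:R :> R.
  have h1 : n%:R <= cT%:R * N%:R :> R by rewrite -natrM ler_nat.
  have h2 : 1 <= N%:R :> R by rewrite ler1n.
  by rewrite /c mulrDl; lra.
near=> m.
have s0 : (0 < j m %/ N)%N by near: m; exact: (cell_infty jinf N0').
set s := (j m %/ N)%N in s0 *.
have sR0 : 0 < s%:R :> R by rewrite ltr0n.
have sN : s%:R * N%:R <= (j m)%:R :> R by rewrite -natrM ler_nat leq_trunc_div.
have h4 := four_cells n s0.
apply: le_trans (HC _ _ h4) _.
have -> : ((n + 8) * s)%N%:R / (4 * s)%N%:R = (n%:R + 8) / 4 :> R by rewrite !natrM natrD; field; rewrite gt_eqF.
(* Dividing by [K] before applying the linear bound on ln yields a slope in N as small as
   required. *)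
have lnb : ln ((n%:R + 8) / 4 : R) <= c * N%:R / K + ln K.
  have n80 : 0 < (n%:R + 8) / 4 / K :> R by rewrite !divr_gt0// ltr_wpDl.
  have -> : (n%:R + 8) / 4 = ((n%:R + 8) / 4 / K) * K :> R by rewrite divfK// gt_eqF.
  rewrite lnM ?posrE// lerD2r; apply: le_trans (ltW (ln_sublinear n80)) _.
  rewrite ler_pM2r ?invr_gt0//; have : 0 <= n%:R :> R by [].
  by lra.
rewrite natrM; apply: le_trans (_ : 4 * s%:R * (2 * (c * N%:R / K + ln K) + C) <= _).
  by rewrite ler_wpM2l ?mulr_ge0// (_ : 1 + 1 = 2)// lerD2r ler_wpM2l.
apply: le_trans (_ : s%:R * (e * N%:R) <= _); last by rewrite mulrCA ler_pM2l.
have := ler_wpM2r (ler0n R N) cK => cKN.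
have -> : 4 * s%:R * (2 * (c * N%:R / K + ln K) + C) = s%:R * (8 * c / K * N%:R + (8 * ln K + 4 * C)) by ring.
by rewrite ler_wpM2l//; lra.
Unshelve. all: end_near. Qed.

Lemma grow_window s N I : grow (fun z => window N I (fun r => (z (mid s r))%:R)).
Proof.
apply: (@grow_le (mid s (I + N)) _ (fun z => \sum_(r < I + N) (z (mid s r))%:R)).
- move=> z z' e; apply: window_ext => r rI; rewrite e//.
  by rewrite /mid leq_add2r leq_mul2r (ltnW rI) orbT.
- by apply: grow_sum => r _; exact: grow_coord.
- by move=> z; rewrite ger0_norm; [exact: window_le_sum|exact: window_ge0].
Qed.

Lemma grow_alive n g : grow g -> grow (fun z => (0 < z n)%N%:R * g z).
Proof.
apply: (@growM_bounded n 1) => [z z' ->//|z].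
by case: (_ < _)%N; rewrite ?normr1 ?normr0.
Qed.

(** The number of cells in m - j tends to N (1/eta - 1), within one unit of the bounds on [I N], so
    the hypotheses of [window_close] hold eventually. *)
Lemma grid_close (I : nat -> nat) (eta e : R) : 0 < eta <= 1 -> 0 < e ->
  (forall m, (0 < m)%N -> (0 < j m <= m)%N) ->
  (j m)%:R / m%:R @[m --> \oo] --> eta ->
  (forall N, (I N)%:R <= N%:R * (eta^-1 - 1) < (I N)%:R + 1) ->
  exists N0 : nat, forall N, (N0 <= N)%N -> (0 < N)%N -> \forall m \near \oo,
    `|E (fun z => (0 < z (j m))%N%:R * (top m (j m) z)%:R) -
      (j m %/ N)%N%:R * E (fun z => (0 < z (j m))%N%:R * window N (I N) (fun r => (z (mid (j m %/ N) r))%:R))| <=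
    e * (j m)%:R.
Proof.
move=> /andP[eta0 eta1] e0 hj jm hI.
have ie0 : 0 <= eta^-1 by rewrite invr_ge0 ltW.
have [cT [_ cT1 _]] := nat_above ie0.
have e20 : 0 < e / 2 by rewrite divr_gt0.
have [N1 H1] := spread_small cT e20; have [N2 H2] := short_block_small cT e20.
exists (maxn N1 N2) => N NN N0.
have NR0 : 0 < N%:R :> R by rewrite ltr0n.
have /andP[I1 I2] := hI N.
have In : (I N + N <= cT * N)%N.
  rewrite -(ler_nat R) natrD natrM.
  have : eta^-1 * N%:R <= cT%:R * N%:R by rewrite ler_wpM2r.
  by lra.
have {H1} H1 := H1 _ _ (leq_trans (leq_maxl _ _) NN) In.
have {H2} H2 := H2 _ _ (leq_trans (leq_maxr _ _) NN) In.
have C1 : (m%:R / (j m)%:R - 1) / ((j m %/ N)%N%:R / (j m)%:R) @[m --> \oo] --> ((eta^-1 - 1) / N%:R^-1 : R).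
  apply: cvgM; last by apply: cvgV; [by rewrite invr_neq0// gt_eqF|exact: cell_ratio].
  apply: cvgB; last exact: cvg_cst.
  have C0 : ((j m)%:R / m%:R)^-1 @[m --> \oo] --> (eta^-1 : R) by apply: cvgV => //; exact: lt0r_neq0.
  apply: near_cvg C0; apply: nearW => m.
  by rewrite invf_div.
rewrite invrK mulrC in C1.
have L1 : N%:R * (eta^-1 - 1) < N%:R * (eta^-1 - 1) + 1 by lra.
have L2 : N%:R * (eta^-1 - 1) - 1 < N%:R * (eta^-1 - 1) by lra.
near=> m.
have Ns : (N <= j m %/ N)%N by near: m; exact: (cell_infty jinf N0).
have up0 : (m%:R / (j m)%:R - 1) / ((j m %/ N)%N%:R / (j m)%:R) < N%:R * (eta^-1 - 1) + 1 by near: m; exact: cvgr_lt C1 _ L1.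
have lo0 : N%:R * (eta^-1 - 1) - 1 < (m%:R / (j m)%:R - 1) / ((j m %/ N)%N%:R / (j m)%:R) by near: m; exact: cvgr_gt C1 _ L2.
have b1 : E (fun z => spread R (j m %/ N) (I N + N) z) <= e / 2 * (j m)%:R by near: m.
have b2 : E (fun z => (top ((I N + N + 8) * (j m %/ N)) (4 * (j m %/ N)) z)%:R) <= e / 2 * (j m)%:R by near: m.
set s := (j m %/ N)%N in Ns up0 lo0 b1 b2 *.
have m0 : (0 < m)%N by near: m; exact: nbhs_infty_gt.
have /andP[j0 jm'] := hj m m0.
have jR0 : 0 < (j m)%:R :> R by rewrite ltr0n.
have s0 : 0 < s%:R :> R by rewrite ltr0n; exact: leq_trans Ns.
have xE : (m%:R / (j m)%:R - 1) / (s%:R / (j m)%:R) = (m - j m)%N%:R / s%:R :> R by rewrite natrB//; field; rewrite !gt_eqF.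
have up : (m - j m)%N%:R / s%:R < N%:R * (eta^-1 - 1) + 1 by rewrite -xE.
have lo : N%:R * (eta^-1 - 1) - 1 < (m - j m)%N%:R / s%:R by rewrite -xE.
have k1 : (m - j m <= (I N + 2) * s)%N.
  move: up; rewrite ltr_pdivrMr// => up; rewrite -(ler_nat R) natrM natrD.
  have : (N%:R * (eta^-1 - 1) + 1) * s%:R <= ((I N)%:R + 2) * s%:R by rewrite ler_wpM2r//; lra.
  by lra.
have k2 : (I N * s <= (m - j m) + s)%N.
  move: lo; rewrite ltr_pdivlMr// => lo; rewrite -(ler_nat R) natrD natrM.
  have : (I N)%:R * s%:R <= (N%:R * (eta^-1 - 1)) * s%:R by rewrite ler_wpM2r.
  by lra.
have gt1 : grow (fun z => (0 < z (j m))%N%:R * (top m (j m) z)%:R) by apply: grow_alive; exact: (grow_top).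
have gw1 := grow_alive (j m) (grow_window s N (I N)).
rewrite -EZ// -EB//; last exact: growZ.
apply: le_trans (Ex_norm _) _; first by apply: growB => //; exact: growZ.
have gt' : grow (fun z => (top ((I N + N + 8) * s) (4 * s) z)%:R) by exact: (grow_top).
have gs := grow_spread s (I N + N).
apply: le_trans (_ : E (fun z => (top ((I N + N + 8) * s) (4 * s) z)%:R + spread R s (I N + N) z) <= _).
  apply: Ele; [|exact: growD|].
    have gt2 := grow_top m (j m).
    apply: (@grow_le (maxn (m + j m) (maxn (j m) (mid s (I N + N)))) _ (fun z => (top m (j m) z)%:R + s%:R * window N (I N) (fun r => (z (mid s r))%:R))).
    - move=> z z' ez; rewrite (ez (j m)) ?leq_max ?leqnn ?orbT//.
      rewrite (@top_adapt m (j m) _ id z z'); last by move=> k kn; apply: ez; rewrite leq_max kn.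
      rewrite (@window_ext _ N (I N) (fun r => (z (mid s r))%:R) (fun r => (z' (mid s r))%:R))// => r rI.
      rewrite ez// !leq_max; apply/orP; right; apply/orP; right.
      by rewrite /mid leq_add2r leq_mul2r (ltnW rI) orbT.
    - by apply: growD => //; apply: growZ; exact: grow_window.
    - move=> z; rewrite normr_id; apply: le_trans (ler_normB _ _) _.
      have w0 : 0 <= window N (I N) (fun r => (z (mid s r))%:R) :> R by exact: window_ge0.
      rewrite !ger0_norm ?mulr_ge0// lerD//; case: (0 < z (j m))%N; rewrite ?mul1r// mul0r// ?mulr0.
      by rewrite mulr_ge0.
  move=> z; rewrite mulrCA -mulrBr normrM ger0_norm//.
  apply: le_trans (_ : 1 * `|(top m (j m) z)%:R - s%:R * window N (I N) (fun r => (z (mid s r))%:R)| <= _).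
    by rewrite ler_wpM2r//; case: (_ < _)%N.
  by rewrite mul1r; exact: window_close.
rewrite ED//.
by lra.
Unshelve. all: end_near. Qed.
End GridError.

Variables (Q : R -> R -> probability R R) (chi : probability R R).
Hypothesis hQ : csbp_kernel a Q.
Hypothesis hchi : chi_law a chi.
Variables (d' : measure_display) (Om : measurableType d') (Pr : probability Om R) (X : R -> Om -> R).
Hypothesis hX : is_Xstar a Q chi Pr X.

(** * Convergence in law at the grid times, on survival *)

Section Limit.
Local Notation u := (rate (loss p)).
Local Notation phi := (surv_next (loss p)).
Local Notation psi := (csbp_exponent a).

Variable j : nat -> nat.
Hypothesis jinf : forall J, \forall m \near \oo, (J <= j m)%N.
Variable N : nat.
Hypothesis N0 : (0 < N)%N.

Definition gpos m r := mid (j m %/ N) r.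
Local Notation gt := (gtime R N).
Local Notation qj m := (q (j m)).

Let qj0 m : 0 < qj m. Proof. by have /andP[] := survp_gt0 dd (j m). Qed.
Let qj1 m : qj m <= 1. Proof. by have /andP[] := survp_gt0 dd (j m). Qed.
Let qj_cvg : qj m @[m --> \oo] --> (0 : R).
Proof. exact: (cvg_infty_comp jinf (survp_cvg0 dd)). Qed.

Lemma gpos_mono m r r' : (r <= r')%N -> (gpos m r <= gpos m r')%N.
Proof. by move=> h; rewrite /gpos /mid leq_add2r leq_mul2r h orbT. Qed.

Lemma gpos_cvg r : (gpos m r)%:R / (j m)%:R @[m --> \oo] --> gt r.
Proof. exact: mid_ratio. Qed.

Lemma gpos_le m r n : (r < n)%N -> (gpos m r <= n * j m)%N.
Proof.
move=> rn; rewrite /gpos /mid; set s := (j m %/ N)%N.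
have h : (s <= j m)%N by exact: leq_div.
have h2 : (s./2 <= s)%N by rewrite -{2}(odd_double_half s) -addnn addnA leq_addl.
apply: leq_trans (_ : r.+1 * s <= _)%N; first by rewrite mulSnr leq_add2l.
exact: leq_mul.
Qed.

Lemma gpos_lt : \forall m \near \oo, forall r, (gpos m r < j m)%N = (r < N)%N.
Proof.
near=> m => r; rewrite /gpos /mid.
have hs : (2 * N <= j m %/ N)%N by near: m; exact: (cell_infty jinf N0).
set s := (j m %/ N)%N in hs *.
have jE := divn_eq (j m) N; rewrite -/s in jE; have rN := ltn_pmod (j m) N0.
have h2 : (N <= s./2)%N by rewrite -(doubleK N) half_leq// -mul2n.
have h3 : (s./2 < s)%N by rewrite -{2}(odd_double_half s) -addnn; lia.
apply/idP/idP => h; last first.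
  rewrite jE; apply: leq_trans (_ : r.+1 * s <= _)%N; first by rewrite mulSnr ltn_add2l.
  by apply: leq_trans (leq_addr _ _); rewrite mulnC leq_mul2l h orbT.
rewrite ltnNge; apply/negP => Nr; move: h; rewrite ltnNge => /negP; apply.
rewrite [leqLHS]jE leq_add//; last by apply: leq_trans h2; exact: ltnW.
by rewrite mulnC leq_mul2r Nr orbT.
Unshelve. all: end_near. Qed.

Fixpoint prodz m (l : seq (nat * R)) z : R := match l with
  | [::] => 1
  | (r, c) :: l' => expR (- (c * qj m)) ^+ z (gpos m r) * prodz m l' z
  end.

(** The joint generating function at the grid times, computed backwards and kept as a defect from 1:
    the discrete form of [Psi]. *)
Fixpoint back m k (l : seq (nat * R)) : R := match l with
  | [::] => 0
  | (r, c) :: l' => iter (gpos m r - k) phi (1 - expR (- (c * qj m)) * (1 - back m (gpos m r) l'))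
  end.

(** The same on extinction by generation j, the discrete form of [PsiK]; cells with index at least N
    lie after generation j and drop out. *)
Fixpoint backK m k (l : seq (nat * R)) : R := match l with
  | [::] => q (j m - k)
  | (r, c) :: l' => if (r < N)%N
      then iter (gpos m r - k) phi (1 - expR (- (c * qj m)) * (1 - backK m (gpos m r) l'))
      else q (j m - k)
  end.

Definition pcoef (l : seq (nat * R)) := all (fun x => 0 < x.2) l.

Let fac m c : 0 < c -> 0 < expR (- (c * qj m)) < 1.
Proof. by move=> c0; rewrite expR_gt0 expR_lt1 oppr_lt0 mulr_gt0. Qed.
Let gap m c b : 0 < c -> 0 <= b <= 1 -> 0 < 1 - expR (- (c * qj m)) * (1 - b) <= 1.
Proof.
move=> c0 /andP[b0 b1]; have /andP[f0 f1] := fac m c0; set e := expR _ in f0 f1 *.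
have h0 : 0 <= e * (1 - b) by rewrite mulr_ge0 ?(ltW f0)//; lra.
have h1 : e * (1 - b) <= e * 1 by rewrite ler_wpM2l ?(ltW f0)//; lra.
by lra.
Qed.

Lemma back_itv m k l : pcoef l -> 0 <= back m k l <= 1.
Proof.
elim: l k => [|[r c] l IH] k /=; first by rewrite lexx ler01.
move=> /andP[c0 cl]; have g := gap m c0 (IH (gpos m r) cl).
have /andP[h1 h2] := iter_next_bounds dd (gpos m r - k) g; have /andP[_ g1] := g.
by rewrite (ltW h1) (le_trans h2).
Qed.

Lemma backK_itv m k l : pcoef l -> 0 < backK m k l <= 1.
Proof.
elim: l k => [|[r c] l IH] k /=; first by move=> _; exact: (survp_gt0 dd).
move=> /andP[c0 cl]; case: (r < N)%N; last exact: (survp_gt0 dd).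
have /andP[b0 b1] := IH (gpos m r) cl.
have b01 : 0 <= backK m (gpos m r) l <= 1 by rewrite (ltW b0).
have g := gap m c0 b01.
have /andP[h1 h2] := iter_next_bounds dd (gpos m r - k) g; have /andP[_ g1] := g.
by rewrite h1 (le_trans h2).
Qed.
Let iter_pgf_next n s : iter n (pgf p) s = 1 - iter n phi (1 - s).
Proof. by rewrite iter_next_pgf !subKr. Qed.
Let exmul m r c b (g : (nat -> nat) -> R) k : (forall z, 0 <= g z) -> adapt k g -> (k <= gpos m r)%N ->
  0 < c -> 0 <= b <= 1 ->
  E (fun z => g z * expR (- (c * qj m)) ^+ z (gpos m r) * (1 - b) ^+ z (gpos m r)) =
  E (fun z => g z * (1 - iter (gpos m r - k) phi (1 - expR (- (c * qj m)) * (1 - b))) ^+ z k).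
Proof.
move=> g0 ga kr c0 b01; have /andP[h1 h2] := gap m c0 b01.
set e := expR _ in h1 h2 *.
have := @markov_gen_iter k (gpos m r - k) g (fun=> e * (1 - b)) g0 ga.
rewrite subnKC// iter_pgf_next => H.
have -> : E (fun z => g z * e ^+ z (gpos m r) * (1 - b) ^+ z (gpos m r)) =
    E (fun z => g z * (e * (1 - b)) ^+ z (gpos m r)) by apply: eq_Ex => z; rewrite exprMn mulrA.
by apply: H => // z; lra.
Qed.

Fixpoint linked m k (l : seq (nat * R)) : Prop := match l with
  | [::] => True
  | (r, _) :: l' => (k <= gpos m r)%N /\ linked m (gpos m r) l'
  end.

Lemma linked_path m r0 l : path ltn r0 (map fst l) -> linked m (gpos m r0) l.
Proof.
elim: l r0 => [|[r c] l IH] r0 //= /andP[rr pl]; split; last exact: IH.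
by apply: gpos_mono; exact: ltnW.
Qed.

Lemma linked0 m l : sorted ltn (map fst l) -> linked m 0 l.
Proof. by case: l => [|[r c] l] //= pl; split => //; exact: linked_path. Qed.

Lemma Ex_prodz m k l g : (forall z, 0 <= g z) -> adapt k g -> pcoef l -> linked m k l ->
  E (fun z => g z * prodz m l z) = E (fun z => g z * (1 - back m k l) ^+ z k).
Proof.
elim: l k g => [|[r c] l IH] k g g0 ga /=; first by move=> _ _; apply: eq_Ex => z; rewrite subr0 expr1n.
move=> /andP[c0 cl] [kr lk].
rewrite -exmul//; last exact: back_itv.
rewrite -(IH (gpos m r) (fun z => g z * expR (- (c * qj m)) ^+ z (gpos m r)))//.
- by apply: eq_Ex => z; rewrite mulrA.
- by move=> z; rewrite mulr_ge0// exprn_ge0// expR_ge0.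
- move=> z z' e; rewrite e//; congr (_ * _); apply: ga => i ik; apply: e; exact: leq_trans kr.
Qed.

Lemma prodz_itv m l z : pcoef l -> 0 <= prodz m l z <= 1.
Proof.
elim: l => [|[r c] l IH] /=; first by rewrite ler01 lexx.
move=> /andP[c0 /IH/andP[h0 h1]]; have /andP[f0 f1] := fac m c0.
have e1 : expR (- (c * qj m)) ^+ z (gpos m r) <= 1 by rewrite exprn_ile1// ltW.
by rewrite mulr_ge0//= mulr_ile1.
Qed.

Lemma prodz_adapt m l n : (forall x, x \in map fst l -> (x <= n)%N) -> adapt (gpos m n) (prodz m l).
Proof.
elim: l => [|[r c] l IH] h z z' e //=; congr (_ * _).
  by rewrite e//; apply: gpos_mono; apply: h; rewrite inE eqxx.
by apply: IH => // x xl; apply: h; rewrite inE xl orbT.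
Qed.

Lemma grow_prodz m l : pcoef l -> grow (prodz m l).
Proof.
move=> cl; apply: (@grow_bounded (gpos m (\max_(x <- map fst l) x)%N) 1); last first.
  by move=> z; have /andP[h0 h1] := prodz_itv m z cl; rewrite ger0_norm.
by apply: prodz_adapt => x xl; exact: (@leq_bigmax_seq _ (map fst l) predT id).
Qed.

Fixpoint late m (l : seq (nat * R)) : Prop := match l with
  | [::] => True
  | (r, _) :: l' => (j m <= gpos m r)%N /\ late m l'
  end.

(** The loss caused by a late factor is at most the population at that time on the event Z_j = 0,
    which has mean 0. *)
Lemma dead_prodz m k l g : (forall z, 0 <= g z <= 1) -> adapt k g -> pcoef l -> late m l ->
  E (fun z => g z * prodz m l z * (z (j m) == 0%N)%:R) = E (fun z => g z * (z (j m) == 0%N)%:R).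
Proof.
elim: l k g => [|[r c] l IH] k g g01 ga /=; first by move=> _ _; apply: eq_Ex => z; rewrite mulr1.
move=> /andP[c0 cl] [jr la]; have /andP[f0 f1] := fac m c0.
set e := expR _ in f0 f1 *.
have e01 n : 0 <= e ^+ n <= 1 by rewrite exprn_ge0 ?exprn_ile1// ltW.
have := IH (maxn k (gpos m r)) (fun z => g z * e ^+ z (gpos m r)) _ _ cl la.
have ge01 z : 0 <= g z * e ^+ z (gpos m r) <= 1.
  have /andP[g0 g1] := g01 z; have /andP[h0 h1] := e01 (z (gpos m r)).
  by rewrite mulr_ge0//= mulr_ile1.
have gea : adapt (maxn k (gpos m r)) (fun z => g z * e ^+ z (gpos m r)).
  move=> z z' ez; rewrite ez ?leq_maxr//; congr (_ * _); apply: ga => i ik; apply: ez.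
  by apply: leq_trans (leq_maxl _ _).
move=> /(_ ge01 gea) H.
have -> : E (fun z => g z * (e ^+ z (gpos m r) * prodz m l z) * (z (j m) == 0%N)%:R) =
    E (fun z => g z * e ^+ z (gpos m r) * prodz m l z * (z (j m) == 0%N)%:R).
  by apply: eq_Ex => z; rewrite !mulrA.
have ga1 (f : (nat -> nat) -> R) n : (forall z, 0 <= f z <= 1) -> adapt n f -> grow (fun z => f z * (z (j m) == 0%N)%:R).
  move=> f01 fa; apply: (@grow_bounded (maxn n (j m)) 1).
    move=> z z' ez; rewrite (ez (j m)) ?leq_maxr//; congr (_ * _); apply: fa => i ik; apply: ez.
    by apply: leq_trans (leq_maxl _ _).
  move=> z; have /andP[h0 h1] := f01 z; rewrite ger0_norm ?mulr_ge0//.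
  by case: (_ == _); rewrite ?mulr1 ?mulr0.
rewrite H; apply/eqP; rewrite eq_le; apply/andP; split.
  apply: Ele; [exact: ga1 ge01 gea|exact: ga1 g01 ga|move=> z].
  have /andP[g0 g1] := g01 z; have /andP[h0 h1] := e01 (z (gpos m r)).
  by rewrite ler_wpM2r// ler_piMr.
rewrite -subr_le0 -EB; [|exact: ga1 g01 ga|exact: ga1 ge01 gea].
have gx : grow (fun z => (z (j m) == 0%N)%:R * (z (gpos m r))%:R).
  apply: (@growM_bounded (j m) 1) (grow_coord _) => [z z' ->//|z].
  by case: eqP; rewrite ?normr1 ?normr0.
have x0 := Ex_extinct_tail jr.
rewrite -[leRHS]x0; apply: Ele => //.
  by apply: growB; [exact: ga1 g01 ga|exact: ga1 ge01 gea].
move=> z; have /andP[g0 g1] := g01 z; have /andP[h0 h1] := e01 (z (gpos m r)).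
case: (_ == _); rewrite ?mulr1 ?mulr0 ?mul1r ?mul0r ?subrr//.
case: (posnP (z (gpos m r))) => [->|zp]; first by rewrite expr0 mulr1 subrr.
have z1 : 1 <= (z (gpos m r))%:R :> R by rewrite ler1n.
have : 0 <= g z * e ^+ z (gpos m r) by rewrite mulr_ge0.
by lra.
Qed.

Lemma Ex_prodz_dead m k l g : (forall z, 0 <= g z <= 1) -> adapt k g -> pcoef l -> linked m k l ->
  path ltn 0 (map (fun x => x.1.+1) l) ->
  (forall r, (gpos m r < j m)%N = (r < N)%N) -> (k <= j m)%N ->
  E (fun z => g z * prodz m l z * (z (j m) == 0%N)%:R) = E (fun z => g z * (1 - backK m k l) ^+ z k).
Proof.
move=> g01 ga cl lk pl hN; have g0 z : 0 <= g z by have /andP[] := g01 z.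
have base k1 (g1 : (nat -> nat) -> R) : (forall z, 0 <= g1 z <= 1) -> adapt k1 g1 -> (k1 <= j m)%N ->
    E (fun z => g1 z * (z (j m) == 0%N)%:R) = E (fun z => g1 z * (1 - q (j m - k1)) ^+ z k1).
  move=> h1 h2 h3; have g10 z : 0 <= g1 z by have /andP[] := h1 z.
  have := @markov_gen_iter k1 (j m - k1) g1 (fun=> 0) g10 h2.
  rewrite subnKC// iter_pgf_next subr0 => H.
  have z01 : forall z : nat -> nat, 0 <= (0 : R) <= 1 by move=> _; rewrite lexx ler01.
  rewrite -[RHS](H z01 (fun _ _ _ => erefl)).
  by apply: eq_Ex => z; rewrite expr0n.
elim: l k g g01 g0 ga cl lk pl => [|[r c] l IH] k g g01 g0 ga /=.
  move=> _ _ _ kj; rewrite -base//; by apply: eq_Ex => z; rewrite mulr1.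
move=> /andP[c0 cl] [kr lk] pl kj; have /andP[f0 f1] := fac m c0.
case: (ltnP r N) => rN; last first.
  rewrite -base//; rewrite -(@dead_prodz m k ((r, c) :: l) g)//=; first by rewrite c0.
  have jm' r' : (N <= r')%N -> (j m <= gpos m r')%N by move=> h; rewrite leqNgt hN -leqNgt.
  split; first exact: jm'.
  elim: (l) r rN pl {kr lk IH} => [|[r' c'] l' IHl] r rN //= /andP[rr pl].
  have rN' : (N <= r')%N by apply: leq_trans rN _; exact: ltnW.
  by split; [exact: jm'|exact: IHl rN' pl].
have /andP[b0 b1] := backK_itv m (gpos m r) cl.
have b01 : 0 <= backK m (gpos m r) l <= 1 by rewrite (ltW b0).
rewrite -exmul//.
have e01 n : 0 <= expR (- (c * qj m)) ^+ n <= 1 by rewrite exprn_ge0 ?exprn_ile1// ltW.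
rewrite -(IH (gpos m r) (fun z => g z * expR (- (c * qj m)) ^+ z (gpos m r)))//.
- by apply: eq_Ex => z; rewrite !mulrA.
- move=> z; have /andP[h0 h1] := g01 z; have /andP[h2 h3] := e01 (z (gpos m r)).
  by rewrite mulr_ge0//= mulr_ile1.
- by move=> z; have /andP[h2 h3] := e01 (z (gpos m r)); rewrite mulr_ge0.
- move=> z z' e; rewrite e//; congr (_ * _); apply: ga => i ik; apply: e; exact: leq_trans kr.
- by move: pl; case: (l) => //= x l'; case: x => x1 x2 /= /andP[_ ->].
- by apply: ltnW; rewrite hN.
Qed.

Definition ltime (l : seq (nat * R)) : seq (R * R) := map (fun x => (gt x.1, x.2)) l.

Lemma timed_path r0 l : path ltn r0 (map fst l) -> timed (gt r0) (ltime l).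
Proof.
elim: l r0 => [|[r c] l IH] r0 //= /andP[rr pl]; split; last exact: IH.
by rewrite /ok gtime_lt//= gtime_neq1.
Qed.

Lemma timed0 l : sorted ltn (map fst l) -> timed 0 (ltime l).
Proof.
case: l => [|[r c] l] //= pl; split; last exact: timed_path.
by rewrite /ok gtime_gt0//= gtime_neq1.
Qed.

Lemma pcoef_ltime l : pcoef l -> all (fun x => 0 < x.2) (ltime l).
Proof. by rewrite /pcoef all_map. Qed.
Let inner_cvg (c : R) (b : nat -> R) (lam : R) : 0 < c -> b m / qj m @[m --> \oo] --> lam ->
  (1 - expR (- (c * qj m)) * (1 - b m)) / qj m @[m --> \oo] --> c + lam.
Proof.
move=> c0 bl.
have e1 : expR (- (c * qj m)) @[m --> \oo] --> (1 : R).
  rewrite -expR0 -oppr0 -[X in - X](mulr0 c); apply: cvg_expR; apply: cvgN; apply: cvgM; [exact: cvg_cst|exact: qj_cvg].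
have c1 := expR_decay_cvg qj0 qj_cvg (ltW c0).
have c2 : (1 - expR (- (c * qj m))) / qj m + expR (- (c * qj m)) * (b m / qj m) @[m --> \oo] --> c + 1 * lam by apply: cvgD; [exact: c1|apply: cvgM].
rewrite mul1r in c2; apply: near_cvg c2; apply: nearW => m; field; by rewrite gt_eqF.
Qed.
Let diff_cvg r (k : nat -> nat) (s : R) : (forall m, (k m <= gpos m r)%N) -> (k m)%:R / (j m)%:R @[m --> \oo] --> s ->
  (gpos m r - k m)%N%:R / (j m)%:R @[m --> \oo] --> gt r - s.
Proof.
move=> kr ks; have C : (gpos m r)%:R / (j m)%:R - (k m)%:R / (j m)%:R @[m --> \oo] --> gt r - s by apply: cvgB => //; exact: gpos_cvg.
by apply: near_cvg C; apply: nearW => m; rewrite -mulrBl -natrB.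
Qed.

(** Each step of the recursion is an instance of [iter_next_scaling], the starting points being
    asymptotic to (c + Psi) q_j. *)
Lemma back_cvg (k : nat -> nat) (s : R) l : 0 <= s -> (k m)%:R / (j m)%:R @[m --> \oo] --> s -> pcoef l ->
  (forall m, linked m (k m) l) -> timed s (ltime l) ->
  back m (k m) l / qj m @[m --> \oo] --> Psi a s (ltime l).
Proof.
elim: l k s => [|[r c] l IH] k s s0 ks /=.
  by move=> _ _ _; under eq_fun do rewrite mul0r; exact: cvg_cst.
move=> /andP[c0 cl] lk [/andP[sr r1] tl].
have kr m : (k m <= gpos m r)%N by have [] := lk m.
have lk' m : linked m (gpos m r) l by have [] := lk m.
have P0 := Psi_ge0 a tl (pcoef_ltime cl).
apply: (iter_next_scaling dd (x := fun m => 1 - expR (- (c * qj m)) * (1 - back m (gpos m r) l)) (k := fun m => (gpos m r - k m)%N) (j := j)) => //.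
- by rewrite ltr_wpDr.
- by rewrite subr_ge0 ltW.
- by move=> m; apply: gap => //; exact: back_itv.
- apply: inner_cvg => //; apply: (IH (fun m => gpos m r)) => //; [apply: ltW; exact: gtime_gt0|exact: gpos_cvg].
- exact: diff_cvg.
Qed.

Lemma backK_cvg (k : nat -> nat) (s : R) l : 0 <= s < 1 -> (k m)%:R / (j m)%:R @[m --> \oo] --> s -> pcoef l ->
  (forall m, linked m (k m) l) -> timed s (ltime l) ->
  backK m (k m) l / qj m @[m --> \oo] --> PsiK a s (ltime l).
Proof.
have base (k1 : nat -> nat) (s1 : R) : s1 < 1 -> (k1 m)%:R / (j m)%:R @[m --> \oo] --> s1 ->
    q (j m - k1 m) / qj m @[m --> \oo] --> (1 - s1) `^ (- a^-1).
  move=> s11 ks; apply: (survp_ratio dd) => //; first by rewrite subr_gt0.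
  have C : 1 - (k1 m)%:R / (j m)%:R @[m --> \oo] --> 1 - s1 by apply: cvgB => //; exact: cvg_cst.
  apply: near_cvg C; near=> m.
  have j0 : 0 < (j m)%:R :> R by rewrite ltr0n; near: m; exact: jinf.
  have h : (k1 m)%:R / (j m)%:R < 1 :> R by near: m; exact: cvgr_lt ks _ s11.
  move: h; rewrite ltr_pdivrMr// mul1r ltr_nat => h.
  by rewrite natrB ?(ltnW h)// mulrBl mulfV// gt_eqF.
elim: l k s => [|[r c] l IH] k s /andP[s0 s1] ks /=; first by move=> _ _ _; exact: base.
move=> /andP[c0 cl] lk [/andP[sr r1] tl].
rewrite gtime_lt1//; case: ltnP => rN; last exact: base.
have g1 : gt r < 1 by rewrite gtime_lt1.
have g0 := gtime_gt0 R N0 r.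
have kr m : (k m <= gpos m r)%N by have [] := lk m.
have lk' m : linked m (gpos m r) l by have [] := lk m.
have P0 := PsiK_gt0 a g1 tl (pcoef_ltime cl).
apply: (iter_next_scaling dd (x := fun m => 1 - expR (- (c * qj m)) * (1 - backK m (gpos m r) l)) (k := fun m => (gpos m r - k m)%N) (j := j)) => //.
- by rewrite addr_gt0.
- by rewrite subr_ge0 ltW.
- move=> m; apply: gap => //; have /andP[b0 ->] := backK_itv m (gpos m r) cl; by rewrite ltW.
- by apply: inner_cvg => //; apply: (IH (fun m => gpos m r)) => //; [rewrite ltW|exact: gpos_cvg].
- exact: diff_cvg.
Unshelve. all: end_near. Qed.
Let Ex1 (c : R) : E (fun z => c ^+ z 0%N) = c.
Proof. by rewrite (Ex_start (fun n => c ^+ n)) expr1. Qed.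
Let alive_split n z : (0 < z n)%N%:R = 1 - (z n == 0%N)%:R :> R.
Proof. by case: (z n) => [|k]; rewrite ?subrr ?subr0. Qed.

(** The expectation on survival is the full transform minus the one on extinction. Both are 1 minus
    a defect of order q_j, so dividing by q_j leaves [PsiK] - [Psi], which is the transform of
    [X^*]. *)
Lemma laplace_cvg l : pcoef l -> sorted ltn (map fst l) ->
  E (fun z => (0 < z (j m))%N%:R * prodz m l z) / qj m @[m --> \oo] -->
  mean Pr (prodX X (lap (ltime l))).
Proof.
move=> cl sl; have tl := timed0 sl.
have k0 : (0%N)%:R / (j m)%:R @[m --> \oo] --> (0 : R) by under eq_fun do rewrite mul0r; exact: cvg_cst.
have C1 := @back_cvg (fun=> 0%N) 0 l (lexx _) k0 cl (fun m => linked0 m sl) tl.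
have s01 : 0 <= (0 : R) < 1 by rewrite lexx ltr01.
have C2 := @backK_cvg (fun=> 0%N) 0 l s01 k0 cl (fun m => linked0 m sl) tl.
have -> : mean Pr (prodX X (lap (ltime l))) = PsiK a 0 (ltime l) - Psi a 0 (ltime l).
  case: l cl sl tl {C1 C2} => [|[r c] l] cl sl tl; last exact: (laplace_Xstar a01 hQ hchi hX tl (pcoef_ltime cl)).
  by rewrite /= mean_cst !subr0 powR1.
have C3 : backK m 0 l / qj m - back m 0 l / qj m @[m --> \oo] --> PsiK a 0 (ltime l) - Psi a 0 (ltime l).
  exact: cvgB.
apply: near_cvg C3; near=> m; rewrite -mulrBl; congr (_ / _).
have hN : forall r, (gpos m r < j m)%N = (r < N)%N by near: m; exact: gpos_lt.
have gp := grow_prodz m cl.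
have gd : grow (fun z => prodz m l z * (z (j m) == 0%N)%:R).
  apply: (@eq_growth _ (fun z => (z (j m) == 0%N)%:R * prodz m l z)) => [z|]; first by rewrite mulrC.
  apply: (@growM_bounded (j m) 1) => // [z z' ->//|z].
  by case: eqP; rewrite ?normr1 ?normr0.
have -> : E (fun z => (0 < z (j m))%N%:R * prodz m l z) =
    E (prodz m l) - E (fun z => prodz m l z * (z (j m) == 0%N)%:R).
  by rewrite -EB//; apply: eq_Ex => z; rewrite alive_split mulrBl mul1r [in RHS]mulrC.
have one_ad k : adapt k (fun=> 1 : R) by [].
have one01 : forall z : nat -> nat, 0 <= (1 : R) <= 1 by rewrite ler01 lexx.
have e1 := @Ex_prodz m 0 l (fun=> 1) (fun=> ler01) (one_ad 0%N) cl (linked0 m sl).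
have pl : path ltn 0 (map (fun x : nat * R => x.1.+1) l).
  case: (l) sl => [|[r c] l'] //=; elim: l' r => [|[r' c'] l' IH] r //= /andP[rr pl].
  by rewrite ltnS rr; exact: IH.
have e2 := @Ex_prodz_dead m 0 l (fun=> 1) one01 (one_ad 0%N) cl (linked0 m sl) pl hN (leq0n _).
have -> : E (prodz m l) = 1 - back m 0 l.
  transitivity (E (fun z => 1 * prodz m l z)); first by apply: eq_Ex => z; rewrite mul1r.
  by rewrite e1 -[RHS]Ex1; apply: eq_Ex => z; rewrite mul1r.
have -> : E (fun z => prodz m l z * (z (j m) == 0%N)%:R) = 1 - backK m 0 l.
  transitivity (E (fun z => 1 * prodz m l z * (z (j m) == 0%N)%:R)); first by apply: eq_Ex => z; rewrite mul1r.
  by rewrite e2 -[RHS]Ex1; apply: eq_Ex => z; rewrite mul1r.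
by ring.
Unshelve. all: end_near. Qed.

Variable n : nat.

(** In the coordinates exp(-x) monomials are joint Laplace transforms; coordinates from [n] on are
    set to 1 so that the point stays in the cube. *)
Definition vz m z : nat -> R := fun r => if (r < n)%N then expR (- (qj m * (z (gpos m r))%:R)) else 1.
Definition vX (w : Om) : nat -> R := fun r => if (r < n)%N then expf 1 (X (gt r) w) else 1.
Definition Lz m (F : (nat -> R) -> R) : R := E (fun z => (0 < z (j m))%N%:R * F (vz m z)) / qj m.

Lemma vz_cube m z : in_cube (vz m z).
Proof.
move=> r; rewrite /vz; case: ifP => _; last by rewrite ler01 lexx.
by rewrite expR_ge0 expR_le1 oppr_le0 mulr_ge0// ltW.
Qed.

Lemma vX_cube w : in_cube (vX w).
Proof.
move=> r; rewrite /vX; case: ifP => _; last by rewrite ler01 lexx.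
exact: expf_itv.
Qed.
Let grow_F m F B : (forall x, in_cube x -> `|F x| <= B) ->
  grow (fun z => (0 < z (j m))%N%:R * F (vz m z)).
Proof.
move=> FB; apply: (@grow_bounded (maxn (j m) (gpos m n)) B).
  move=> z z' e; rewrite e ?leq_maxl//; congr (_ * F _); apply/funext => r; rewrite /vz.
  case: ifP => // rn; rewrite e//; apply: leq_trans (leq_maxr _ _); apply: gpos_mono; exact: ltnW.
move=> z; rewrite normrM ger0_norm//; have h := FB _ (vz_cube m z).
by case: (_ < _)%N; rewrite ?mul1r// mul0r; exact: le_trans h.
Qed.
Let alive_mean m : E (fun z => (0 < z (j m))%N%:R) = qj m.
Proof. exact: (Ex_survive). Qed.
Let Lz_close m F G B B' e : (forall x, in_cube x -> `|F x| <= B) -> (forall x, in_cube x -> `|G x| <= B') ->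
  (forall x, in_cube x -> `|F x - G x| <= e) -> `|Lz m F - Lz m G| <= e.
Proof.
move=> FB GB FG; have gF := grow_F m FB; have gG := grow_F m GB.
rewrite /Lz -mulrBl -EB// normrM normfV (gtr0_norm (qj0 m)) ler_pdivrMr//.
apply: le_trans (Ex_norm (growB gF gG)) _.
have ga : grow (fun z => (0 < z (j m))%N%:R) by apply: (@grow_bool (j m) (fun z => (0 < z (j m))%N)) => z z' ->.
rewrite -alive_mean -EZ//.
have gg : grow (fun z => (0 < z (j m))%N%:R * (F (vz m z) - G (vz m z))) by apply: (@grow_F m (fun x => F x - G x) e).
apply: Ele.
- apply: (@grow_le (maxn (j m) (gpos m n)) _ (fun z => e * (0 < z (j m))%N%:R)).
  + move=> z z' ez; rewrite ez ?leq_maxl//; congr (`|_ * F _ - _ * G _|); apply/funext => r; rewrite /vz.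
      case: ifP => // rn; rewrite ez//; apply: leq_trans (leq_maxr _ _); apply: gpos_mono; exact: ltnW.
    case: ifP => // rn; rewrite ez//; apply: leq_trans (leq_maxr _ _); apply: gpos_mono; exact: ltnW.
  + apply: growZ; apply: (@grow_bool (j m) (fun z => (0 < z (j m))%N)) => z z' ez; by rewrite ez.
  + move=> z; rewrite normr_id -mulrBr normrM ger0_norm// mulrC ler_wpM2r//; exact: FG (vz_cube m z).
- apply: growZ; apply: (@grow_bool (j m) (fun z => (0 < z (j m))%N)) => z z' ez; by rewrite ez.
- move=> z; rewrite -mulrBr normrM ger0_norm// mulrC ler_wpM2r//; exact: FG (vz_cube m z).
Qed.

(** The class fed to [weierstrass_cube]; boundedness and measurability belong to it so that they too
    are inherited from monomials. *)
Definition conv_law (F : (nat -> R) -> R) := [/\ exists B, forall x, in_cube x -> `|F x| <= B,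
  mfunT (fun w => F (vX w)) &
  Lz m F @[m --> \oo] --> mean Pr (fun w => F (vX w))].

Let conv_bmf F : conv_law F -> bmf (fun w => F (vX w)).
Proof. by move=> [[B FB] mF _]; split => //; exists B => w; apply: FB; exact: vX_cube. Qed.

Lemma conv_law_monomial n' (b : nat -> nat) : conv_law (fun x => \prod_(i < n') x i ^+ b i).
Proof.
pose l : seq (nat * R) := [seq (i, (b i)%:R) | i <- [seq i <- index_iota 0 n' | (i < n)%N && (0 < b i)%N]].
have cl : pcoef l by apply/allP => x /mapP[i]; rewrite mem_filter => /andP[/andP[_ bi] _] ->; rewrite /= ltr0n.
have sl : sorted ltn (map fst l).
  rewrite -map_comp map_id_in//; apply: sorted_filter; [exact: ltn_trans|exact: iota_ltn_sorted].
have Ez m z : \prod_(i < n') vz m z i ^+ b i = prodz m l z.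
  rewrite -(big_mkord xpredT (fun i => vz m z i ^+ b i)) /l; elim: (index_iota 0 n') => [|i s IH] /=; first by rewrite big_nil.
  rewrite big_cons IH /vz; case: (ltnP i n) => ri; rewrite /= ?expr1n ?mul1r//.
  case: (posnP (b i)) => [->|bi] /=; first by rewrite expr0 mul1r.
  congr (_ * _); rewrite -!expRM_natl; congr expR; ring.
have EX w : \prod_(i < n') vX w i ^+ b i = prodX X (lap (ltime l)) w.
  rewrite -(big_mkord xpredT (fun i => vX w i ^+ b i)) /l; elim: (index_iota 0 n') => [|i s IH] /=; first by rewrite big_nil.
  rewrite big_cons IH /vX; case: (ltnP i n) => ri; rewrite /= ?expr1n ?mul1r//.
  case: (posnP (b i)) => [->|bi] /=; first by rewrite expr0 mul1r.
  by congr (_ * _); rewrite /expf mul1r -expRM_natl mulrN.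
have [bm _] := prodX_bmf hX (lexx 0) ((timed_map (@expf R) 0 (ltime l)).2 (timed0 sl)) (lap_bmf (pcoef_ltime cl)).
split.
- exists 1 => x x01; have : 0 <= \prod_(i < n') x i ^+ b i <= 1.
    elim/big_ind: _ => [|y1 y2 /andP[h1 h2] /andP[h3 h4]|i _]; first by rewrite ler01 lexx.
      by rewrite mulr_ge0//= mulr_ile1.
    by have /andP[h1 h2] := x01 i; rewrite exprn_ge0//= exprn_ile1.
  by move=> /andP[h1 h2]; rewrite ger0_norm.
- by under eq_fun do rewrite EX.
under [X in mean Pr X]eq_fun do rewrite EX.
have C := laplace_cvg cl sl; apply: near_cvg C; apply: nearW => m.
by rewrite /Lz; congr (_ / _); apply: eq_Ex => z; rewrite Ez.
Qed.

Lemma conv_lawP (Lip : R) f : 0 <= Lip ->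
  (forall x y, (forall i, (i < n)%N -> x i = y i) -> f x = f y) ->
  (forall x k c, in_cube x -> 0 <= c <= 1 -> `|f (upd x k c) - f x| <= Lip * `|c - x k|) ->
  conv_law f.
Proof.
apply: (@weierstrass_cube R conv_law) => [n' b|c F G cF cG|F HF].
- exact: conv_law_monomial.
- have bF := conv_bmf cF; have bG := conv_bmf cG.
  case: cF cG => [[B FB] mF LF] [[B' GB] mG LG]; split.
  + exists (`|c| * B + B') => x x01; apply: le_trans (ler_normD _ _) _; rewrite lerD ?GB//.
    by rewrite normrM ler_wpM2l// FB.
  + by apply: measurable_funD => //; exact: measurable_funM.
  rewrite meanD ?meanZ//; last exact: bmfZ.
  have C : c * Lz m F + Lz m G @[m --> \oo] --> c * mean Pr (fun w => F (vX w)) + mean Pr (fun w => G (vX w)).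
    by apply: cvgD => //; apply: cvgM => //; exact: cvg_cst.
  apply: near_cvg C; apply: nearW => m; rewrite /Lz mulrA -mulrDl; congr (_ / _).
  rewrite -EZ; last exact: grow_F FB.
  rewrite -ED; [|by apply: growZ; exact: grow_F FB|exact: grow_F GB].
  by apply: eq_Ex => z; rewrite mulrDr mulrCA.
have [G1 [[B1 GB1] _ _] FG1] := HF 1 ltr01.
have FB x : in_cube x -> `|F x| <= B1 + 1.
  move=> x01; rewrite -[F x](subrK (G1 x)) addrC; apply: le_trans (ler_normD _ _) _.
  by rewrite lerD ?GB1 ?FG1.
have mF : mfunT (fun w => F (vX w)).
  have H' i : exists G, conv_law G /\ forall x, in_cube x -> `|F x - G x| <= i.+1%:R^-1.
    have i0 : 0 < i.+1%:R^-1 :> R by rewrite invr_gt0.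
    by have [G h1 h2] := HF _ i0; exists G.
  have [g Hg] := choice H'.
  apply: (measurable_fun_cvg (h := fun i w => g i (vX w))); first by move=> i; have [[]] := Hg i.
  move=> w _; apply/cvgrPdist_le => e e0.
  have e'0 : 0 <= e^-1 by rewrite invr_ge0 ltW.
  have [M [M0 M1 _]] := nat_above e'0.
  near=> i; have [_ gi] := Hg i; apply: le_trans (gi _ (vX_cube w)) _.
  rewrite -[leRHS]invrK lef_pV2 ?posrE ?invr_gt0//; apply: le_trans M1 _; rewrite ler_nat.
  by apply: leqW; near: i; exact: nbhs_infty_ge.
split => //; first by exists (B1 + 1).
apply: cvg_of_approx => e e0; have [G cG FG] := HF e e0.
have [[B' GB'] mG LG] := cG.
exists (fun m => Lz m G), (mean Pr (fun w => G (vX w))); split => //.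
  by apply: nearW => m; exact: Lz_close FB GB' FG.
apply: mean_close; [by split => //; exists (B1 + 1) => w; apply: FB; exact: vX_cube|exact: conv_bmf|].
by move=> w; apply: FG; exact: vX_cube.
Unshelve. all: end_near. Qed.

(** Lipschitz with constant 1 in each coordinate and null at 0, hence bounded by the sum of the
    coordinates; this is what allows truncation to be removed. *)
Definition nice (Phi : (nat -> R) -> R) := [/\
  forall x y, (forall i, (i < n)%N -> x i = y i) -> Phi x = Phi y,
  forall x k c, (forall i, 0 <= x i) -> 0 <= c -> `|Phi (upd x k c) - Phi x| <= `|c - x k| &
  Phi (fun=> 0) = 0].

(** The coordinates are exchanged one at a time through mixtures of x and y. *)
Lemma nice_diff Phi x y : nice Phi -> (forall i, 0 <= x i) -> (forall i, 0 <= y i) ->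
  `|Phi x - Phi y| <= \sum_(r < n) `|x r - y r|.
Proof.
move=> [P1 P2 _] x0 y0; pose mix k i := if (i < k)%N then x i else y i.
have mix0 k i : 0 <= mix k i by rewrite /mix; case: ifP.
have -> : Phi x = Phi (mix n) by apply: P1 => i ik; rewrite /mix ik.
have H k : `|Phi (mix k) - Phi y| <= \sum_(r < k) `|x r - y r|.
  elim: k => [|k IH]; first by rewrite big_ord0 (_ : mix 0%N = y) ?subrr ?normr0.
  rewrite big_ord_recr/= -(subrK (Phi (mix k)) (Phi _)) -addrA addrC.
  apply: le_trans (ler_normD _ _) _; apply: lerD => //.
  have e : mix k.+1 = upd (mix k) k (x k).
    by apply/funext => i; rewrite /upd /mix; case: eqP => [->|/eqP ne]; rewrite ?ltnSn// ltnS leq_eqVlt (negbTE ne).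
  have := P2 (mix k) k (x k) (mix0 k) (x0 k); rewrite -e => h; apply: le_trans h _.
  by rewrite /mix ltnn.
exact: H.
Qed.

Lemma nice_sum : nice (fun x => \sum_(r < n) x r).
Proof.
split=> [x y e|x k c x0 c0|]; first by apply: eq_bigr => r _; rewrite e.
  rewrite -sumrB; case: (ltnP k n) => kn.
    rewrite (bigD1 (Ordinal kn))//= big1 ?addr0; first by rewrite /upd eqxx.
    by move=> i /negP ne; rewrite /upd; case: eqP => e; rewrite ?subrr//; case: ne; apply/eqP/val_inj.
  rewrite big1 ?normr0// => i _; rewrite /upd; case: eqP => e; rewrite ?subrr//.
  by have := ltn_ord i; rewrite e ltnNge kn.
by rewrite big1.
Qed.

Definition xz m z : nat -> R := fun r => qj m * (z (gpos m r))%:R.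
Definition pX (w : Om) : nat -> R := fun r => pos (X (gt r) w).
Definition cap (K : R) (x : nat -> R) : nat -> R := fun r => Num.min (x r) K.
Definition Lx m (Phi : (nat -> R) -> R) : R := E (fun z => (0 < z (j m))%N%:R * Phi (xz m z)) / qj m.

Let xz0 m z i : 0 <= xz m z i.
Proof. by rewrite mulr_ge0// ltW. Qed.
Let pX0 w i : 0 <= pX w i. Proof. exact: pos_ge0. Qed.
Let cap0 K x : 0 <= K -> (forall i, 0 <= x i) -> forall i, 0 <= cap K x i.
Proof. by move=> K0 x0 i; rewrite le_min x0. Qed.
Let lncap (x K : R) : - ln (Num.max (expR (- x)) (expR (- K))) = Num.min x K.
Proof.
case: (leP x K) => h; first by rewrite max_l ?expRK ?opprK// ler_expR lerN2.
by rewrite max_r ?expRK ?opprK// ler_expR lerN2 ltW.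
Qed.

(** Capping at [K] keeps exp(-x) above exp(-K), where the logarithm has Lipschitz constant exp K;
    the capped functional is thus Lipschitz on the cube. *)
Lemma capped_law Phi K : nice Phi -> 0 <= K ->
  [/\ mfunT (fun w => Phi (cap K (pX w))),
      exists B, forall x, (forall i, 0 <= x i) -> `|Phi (cap K x)| <= B &
      Lx m (fun x => Phi (cap K x)) @[m --> \oo] --> mean Pr (fun w => Phi (cap K (pX w)))].
Proof.
move=> nP K0; have [P1 P2 P3] := nP.
pose h (v : R) : R := - ln (Num.max v (expR (- K))).
have eK := expR_gt0 (- K).
have mx0 v : 0 < Num.max v (expR (- K)) by rewrite lt_max eK orbT.
have h0 v : v <= 1 -> 0 <= h v by move=> v1; rewrite oppr_ge0 ln_le0// ge_max v1 expR_le1 oppr_le0.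
have hLip v1 v2 : `|h v1 - h v2| <= expR K * `|v1 - v2|.
  have half s t : 0 < s -> 0 < t -> expR (- K) <= s -> ln t - ln s <= expR K * `|t - s|.
    move=> s0 t0 Ks; rewrite -ln_div ?posrE//.
    have ts : 0 < t / s by rewrite divr_gt0.
    apply: le_trans (_ : (t - s) / s <= _).
      rewrite mulrBl mulfV ?gt_eqF//; have := @le_ln1Dx R (t / s - 1).
      by rewrite (addrC 1) subrK; apply; lra.
    apply: le_trans (_ : `|t - s| / s <= _); first by rewrite ler_wpM2r ?invr_ge0 ?(ltW s0)// ler_norm.
    by rewrite mulrC ler_wpM2r// -[leRHS]invrK lef_pV2 ?posrE ?invr_gt0 ?expR_gt0// -expRN.
  have mLip : `|Num.max v1 (expR (- K)) - Num.max v2 (expR (- K))| <= `|v1 - v2|.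
    have dv : `|v2 - v1| = `|v1 - v2| by exact: distrC.
    case: (leP v1 (expR (- K))) => c1; case: (leP v2 (expR (- K))) => c2; rewrite ?subrr ?normr0//.
    - by rewrite distrC -dv !ger0_norm; lra.
    - by rewrite !ger0_norm; lra.
  have eK0 := expR_gt0 K.
  apply: le_trans (_ : expR K * `|Num.max v1 (expR (- K)) - Num.max v2 (expR (- K))| <= _); last by rewrite ler_pM2l.
  rewrite /h opprK addrC ler_norml; apply/andP; split.
    by rewrite lerNl opprB; apply: half; rewrite ?mx0// le_max lexx orbT.
  by rewrite distrC; apply: half; rewrite ?mx0// le_max lexx orbT.
have [] := @conv_lawP (expR K) (fun v => Phi (fun r => h (if (r < n)%N then Num.min (v r) 1 else 1))).
- exact: expR_ge0.
- by move=> x y e; apply: P1 => i iN; rewrite iN e.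
- move=> x k c x01 /andP[c0 c1]; case: (ltnP k n) => kn; last first.
    rewrite (P1 _ (fun r => h (if (r < n)%N then Num.min (x r) 1 else 1))) ?subrr ?normr0 ?mulr_ge0 ?expR_ge0//.
    move=> i iN; rewrite iN /upd; case: eqP => // e; by move: iN; rewrite e ltnNge kn.
  have e : (fun r => h (if (r < n)%N then Num.min (upd x k c r) 1 else 1)) =
      upd (fun r => h (if (r < n)%N then Num.min (x r) 1 else 1)) k (h c).
    by apply/funext => r; rewrite /upd; case: eqP => // ->; rewrite kn min_l.
  rewrite e; apply: le_trans (P2 _ _ _ _ _) _.
  + by move=> i; apply: h0; case: ifP => // _; rewrite ge_min lexx orbT.
  + exact: h0.
  + by rewrite kn min_l ?hLip//; have /andP[] := x01 k.
move=> [B FB] mF LF.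
have eX w : Phi (fun r => h (if (r < n)%N then Num.min (vX w r) 1 else 1)) = Phi (cap K (pX w)).
  apply: P1 => i iN; rewrite iN /vX iN min_l; last by have /andP[] := expf_itv (X (gt i) w) (@ler01 R).
  by rewrite /h /expf mul1r lncap.
have eZ m z : Phi (fun r => h (if (r < n)%N then Num.min (vz m z r) 1 else 1)) = Phi (cap K (xz m z)).
  apply: P1 => i iN; rewrite iN min_l; last by have /andP[] := vz_cube m z i.
  by rewrite /h /vz iN lncap.
split.
- by under eq_fun do rewrite -eX.
- exists B => x x0.
  have cx : in_cube (fun i => expR (- x i)) by move=> i; rewrite expR_ge0 expR_le1 oppr_le0 x0.
  have := FB _ cx; rewrite (P1 _ (cap K x)); last first.
    by move=> i iN; rewrite iN min_l ?expR_le1 ?oppr_le0// /h lncap.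
  exact.
under [X in mean Pr X]eq_fun do rewrite -eX.
apply: near_cvg LF; apply: nearW => m; rewrite /Lz /Lx; congr (_ / _); apply: eq_Ex => z.
by rewrite eZ.
Qed.
Let xz_adapt m (F : (nat -> R) -> R) : (forall x y, (forall i, (i < n)%N -> x i = y i) -> F x = F y) ->
  adapt (gpos m n) (fun z => F (xz m z)).
Proof.
move=> P1 z z' e; apply: P1 => i iN; rewrite /xz e//; apply: gpos_mono; exact: ltnW.
Qed.
Let grow_sum_xz m : grow (fun z => \sum_(r < n) xz m z r).
Proof. by apply: grow_sum => r _; apply: growZ; exact: grow_coord. Qed.
Let nice_le Phi x : nice Phi -> (forall i, 0 <= x i) -> `|Phi x| <= \sum_(r < n) x r.
Proof.
move=> nP x0; have [_ _ P3] := nP; have := nice_diff nP x0 (fun=> lexx 0); rewrite P3 subr0 => h.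
by apply: le_trans h _; apply: ler_sum => r _; rewrite subr0 ger0_norm.
Qed.
Let grow_nice m Phi : nice Phi -> grow (fun z => (0 < z (j m))%N%:R * Phi (xz m z)).
Proof.
move=> nP; have [P1 _ _] := nP; apply: grow_alive.
apply: (@grow_le (gpos m n) _ (fun z => \sum_(r < n) xz m z r)) => // [|z].
  exact: (xz_adapt P1).
exact: nice_le.
Qed.
Let nice_cap Phi K : nice Phi -> 0 <= K -> nice (fun x => Phi (cap K x)).
Proof.
move=> [P1 P2 P3] K0; split=> [x y e|x k c x0 c0|].
- by apply: P1 => i iN; rewrite /cap e.
- have e : cap K (upd x k c) = upd (cap K x) k (Num.min c K) by apply/funext => r; rewrite /cap /upd; case: eqP.
  rewrite e; apply: le_trans (P2 _ _ _ _ _) _; [exact: cap0|by rewrite le_min c0|].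
  rewrite /cap; have dv : `|x k - c| = `|c - x k| by exact: distrC.
  case: (leP c K) => c1; case: (leP (x k) K) => c2; rewrite ?subrr ?normr0//.
  + by rewrite distrC -dv !ger0_norm; lra.
  + by rewrite !ger0_norm; lra.
- by rewrite -[RHS]P3; apply: P1 => i _; rewrite /cap min_l.
Qed.
Let cap_diff K x : (forall i : nat, 0 <= x i) -> forall r, `|x r - cap K x r| = pos (x r - K).
Proof.
move=> x0 r; rewrite /cap /pos; case: (leP (x r) K) => h; first by rewrite subrr normr0 max_r// subr_le0.
by rewrite max_l ?subr_ge0 ?(ltW h)// ger0_norm// subr_ge0 ltW.
Qed.

(** The excess of a coordinate over [K] is q_j (Z - K/q_j)^+, of mean at most q_j n j u(q_j/K);
    [rate_survp_small] makes j u(q_j/K) small for all m at once. *)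
Lemma cap_tail (e : R) : 0 < e -> exists K0 : R, 1 <= K0 /\ forall K, K0 <= K -> forall m Phi, nice Phi ->
  `|Lx m Phi - Lx m (fun x => Phi (cap K x))| <= e.
Proof.
move=> e0; have nn0 : 0 < (n * n)%:R + 1 :> R by rewrite ltr_wpDl.
have e'0 : 0 < e / ((n * n)%:R + 1) by rewrite divr_gt0.
have [kap [/andP[k0 k1] Hk]] := rate_survp_small dd e'0.
exists kap^-1; split; first by rewrite invf_ge1.
move=> K kK m Phi nP.
have K1 : 1 <= K by apply: le_trans kK; rewrite invf_ge1.
have K0 : 0 < K by lra.
have gP := grow_nice m nP; have gC := grow_nice m (nice_cap nP (ltW K0)).
have gpc r : grow (fun z => qj m * pos ((z (gpos m r))%:R - (qj m / K)^-1)) by apply: growZ; exact: grow_pos_coord.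
have gtail : grow (fun z => \sum_(r < n) qj m * pos ((z (gpos m r))%:R - (qj m / K)^-1)) by apply: grow_sum => r _.
have qK : 0 < qj m / K <= 1 by rewrite divr_gt0//= ler_pdivrMr// mul1r; apply: le_trans (qj1 m) _.
have tailE z r : pos (xz m z r - K) = qj m * pos ((z (gpos m r))%:R - (qj m / K)^-1).
  have q0 := qj0 m; rewrite /xz /pos maxr_pMr ?mulr0 ?(ltW q0)//; congr (Num.max _ 0).
  by rewrite mulrBr invf_div mulrCA mulfV ?gt_eqF// mulr1.
rewrite /Lx -mulrBl -EB// normrM normfV (gtr0_norm (qj0 m)) ler_pdivrMr//.
apply: le_trans (Ex_norm (growB gP gC)) _.
apply: le_trans (_ : E (fun z => \sum_(r < n) qj m * pos ((z (gpos m r))%:R - (qj m / K)^-1)) <= _).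
  have pw z : `|(0 < z (j m))%N%:R * Phi (xz m z) - (0 < z (j m))%N%:R * Phi (cap K (xz m z))| <=
      \sum_(r < n) qj m * pos ((z (gpos m r))%:R - (qj m / K)^-1).
    rewrite -mulrBr normrM ger0_norm//.
    apply: le_trans (_ : 1 * `|Phi (xz m z) - Phi (cap K (xz m z))| <= _).
      by rewrite ler_wpM2r//; case: (_ < _)%N.
    rewrite mul1r; apply: le_trans (nice_diff nP _ _) _; [exact: xz0|exact: cap0 (ltW K0) (xz0 m z)|].
    by apply: ler_sum => r _; rewrite cap_diff// tailE.
  apply: Ele => //.
  apply: (@grow_le (maxn (j m) (gpos m n)) _ _ _ gtail) => [z z' ez|z]; last by rewrite normr_id; exact: pw.
  have [P1 _ _] := nP; have [P1' _ _] := nice_cap nP (ltW K0).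
  have ez' k : (k <= gpos m n)%N -> z k = z' k by move=> kn; apply: ez; exact: leq_trans (leq_maxr _ _).
  by rewrite ez ?leq_maxl// (xz_adapt P1 ez') (xz_adapt P1' ez').
rewrite ES; last by move=> r _; exact: gpc.
have u0 : 0 <= u (qj m / K) by apply: ltW; exact: (rate_gt0 dd).
apply: le_trans (_ : \sum_(r < n) qj m * (n%:R * ((j m)%:R * u (qj m / K))) <= _).
  apply: ler_sum => r _; rewrite EZ; last exact: grow_pos_coord.
  rewrite ler_pM2l//; apply: le_trans (excess_le _ qK) _.
  by rewrite mulrA ler_wpM2r// -natrM ler_nat gpos_le.
have ju : (j m)%:R * u (qj m / K) <= e / ((n * n)%:R + 1).
  apply: le_trans (Hk (j m)); rewrite ler_wpM2l//; have /andP[h1 h2] := qK.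
  apply: (rate_le dd) => //; last by rewrite mulr_ile1// ?(ltW k0) ?(ltW (qj0 m)).
  by rewrite mulrC ler_pM2r// -[leRHS]invrK lef_pV2 ?posrE ?invr_gt0.
have -> : \sum_(r < n) qj m * (n%:R * ((j m)%:R * u (qj m / K))) = qj m * ((n * n)%:R * ((j m)%:R * u (qj m / K))).
  by rewrite sumr_const card_ord -[LHS]mulr_natl natrM; ring.
rewrite mulrC ler_pM2r//; apply: le_trans (_ : (n * n)%:R * (e / ((n * n)%:R + 1)) <= _).
  by rewrite ler_wpM2l.
by rewrite mulrCA ler_piMr ?(ltW e0)// ler_pdivrMr// mul1r lerDl.
Qed.
Let cap_eventually (x : nat -> R) : \forall K \near \oo, forall r, (r < n)%N -> cap K%:R x r = x r.
Proof.
have h0 : 0 <= \sum_(r < n) `|x r| by apply: sumr_ge0.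
have [M [_ M1 _]] := nat_above h0; near=> K => r rn; rewrite /cap min_l//.
apply: le_trans (ler_norm _) _; apply: le_trans (_ : \sum_(r < n) `|x r| <= _).
  by rewrite (bigD1 (Ordinal rn))//= lerDl sumr_ge0.
by apply: le_trans M1 _; rewrite ler_nat; near: K; exact: nbhs_infty_ge.
Unshelve. all: end_near. Qed.
Let nice_measurable Phi : nice Phi -> mfunT (fun w => Phi (pX w)).
Proof.
move=> nP; have [P1 _ _] := nP.
apply: (measurable_fun_cvg (h := fun (K : nat) w => Phi (cap K%:R (pX w)))).
  by move=> K; have [] := capped_law nP (ler0n R K).
move=> w _; apply: (@near_cvg R _ _ _ (fun=> Phi (pX w))); last exact: cvg_cst.
near=> K; apply: P1 => i iN; apply/esym; move: i iN; near: K; exact: cap_eventually.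
Unshelve. all: end_near. Qed.
Let Lx_sum_le m K : 0 <= K -> Lx m (fun x => \sum_(r < n) cap K x r) <= n%:R.
Proof.
move=> K0; rewrite ler_pdivrMr//.
apply: le_trans (_ : E (fun z => \sum_(r < n) xz m z r) <= _).
  apply: Ele => //; first exact: grow_nice (nice_cap nice_sum K0).
  move=> z; apply: le_trans (_ : 1 * \sum_(r < n) cap K (xz m z) r <= _).
    rewrite ler_wpM2r//; last by case: (_ < _)%N.
    by apply: sumr_ge0 => r _; exact: cap0.
  by rewrite mul1r; apply: ler_sum => r _; rewrite ge_min lexx.
rewrite ES => [|r _]; last by apply: growZ; exact: grow_coord.
have -> : \sum_(r < n) E (fun z => xz m z r) = \sum_(r < n) qj m by apply: eq_bigr => r _; rewrite /xz EZ ?Ecoord ?mulr1//; exact: grow_coord.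
by rewrite sumr_const card_ord mulr_natl.
Qed.

(** Capped sums have means at most [n], inherited from the tree where every generation has mean 1;
    they increase to the full sum. *)
Lemma sum_integrable : Pr.-integrable setT (fun w => (\sum_(r < n) pX w r)%:E).
Proof.
have mS := nice_measurable nice_sum.
apply/integrableP; split; first exact/measurable_EFinP.
pose S (K : nat) w : R := \sum_(r < n) cap K%:R (pX w) r.
have mK K : mfunT (S K) by have [] := capped_law nice_sum (ler0n R K).
have S0 K w : 0 <= S K w by apply: sumr_ge0 => r _; exact: cap0.
have bS K : bmf (S K).
  split => //; have [_ [B HB] _] := capped_law nice_sum (ler0n R K).
  by exists B => w; apply: HB => i; exact: pX0.
have Sn K : mean Pr (S K) <= n%:R.
  have [_ _ C] := capped_law nice_sum (ler0n R K).
  by apply: (cvgr_to_le C); apply: nearW => m; exact: Lx_sum_le.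
have H : (\int[Pr]_w (S K w)%:E)%E @[K --> \oo] --> (\int[Pr]_w (\sum_(r < n) pX w r)%:E)%E.
  have -> : (fun w => (\sum_(r < n) pX w r)%:E) = (fun w => limn (fun K => (S K w)%:E)).
    apply/funext => w; apply/esym/cvg_lim => //.
    apply: (@cvg_trans _ ((fun _ : nat => (\sum_(r < n) pX w r)%:E) @ \oo)); last exact: cvg_cst.
    apply: near_eq_cvg; near=> K; congr (_%:E); apply: eq_bigr => r _; apply/esym.
    have hr := ltn_ord r; move: (nat_of_ord r) hr; near: K; exact: cap_eventually.
  apply: cvg_monotone_convergence => //.
  - by move=> K; exact/measurable_EFinP.
  - by move=> K w _; rewrite lee_fin.
  - move=> w _ K K' KK; rewrite lee_fin; apply: ler_sum => r _; rewrite /cap le_min ge_min lexx/=.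
    by rewrite ge_min ler_nat KK orbT.
have E1 : (\int[Pr]_w `|(\sum_(r < n) pX w r)%:E| = \int[Pr]_w (\sum_(r < n) pX w r)%:E)%E.
  by apply: eq_integral => w _; rewrite gee0_abs// lee_fin sumr_ge0.
rewrite E1; apply: le_lt_trans (_ : n%:R%:E < +oo)%E; last exact: ltry.
rewrite -(cvg_lim _ H)//; apply: lime_le; first by apply/cvg_ex; eexists; exact: H.
by apply: nearW => K; rewrite meanE// lee_fin.
Unshelve. all: end_near. Qed.

(** The truncation is removed uniformly in m on the tree by [cap_tail], and by domination for the
    limit process. *)
Theorem functional_cvg Phi : nice Phi ->
  Pr.-integrable setT (fun w => (Phi (pX w))%:E) /\
  Lx m Phi @[m --> \oo] --> mean Pr (fun w => Phi (pX w)).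
Proof.
move=> nP; have [P1 _ _] := nP; have mP := nice_measurable nP.
have iP : Pr.-integrable setT (fun w => (Phi (pX w))%:E).
  apply: le_integrable sum_integrable => //; first exact/measurable_EFinP.
  move=> w _; rewrite /= lee_fin; apply: le_trans (nice_le nP (pX0 w)) _; exact: ler_norm.
split => //.
have H : (\int[Pr]_w (Phi (cap (K : nat)%:R (pX w)))%:E)%E @[K --> \oo] --> (\int[Pr]_w (Phi (pX w))%:E)%E.
  apply: (@dominated_cvg _ _ _ Pr setT measurableT (fun K w => (Phi (cap K%:R (pX w)))%:E) (fun w => (Phi (pX w))%:E)
     (fun w => (\sum_(r < n) pX w r)%:E)) => //.
  - by move=> K; apply/measurable_EFinP; have [] := capped_law nP (ler0n R K).
  - move=> w _; apply/fine_cvgP; split; first exact: nearW.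
    apply: (@near_cvg R _ _ _ (fun=> Phi (pX w))); last exact: cvg_cst.
    near=> K; apply: P1 => i iN; apply/esym; move: i iN; near: K; exact: cap_eventually.
  - exact: sum_integrable.
  - move=> K w _; rewrite /= lee_fin; apply: le_trans (nice_le nP (cap0 (ler0n R K) (pX0 w))) _.
    by apply: ler_sum => r _; rewrite ge_min lexx.
have bC K : bmf (fun w => Phi (cap (K : nat)%:R (pX w))).
  have [mC [B HB] _] := capped_law nP (ler0n R K); split => //.
  by exists B => w; apply: HB => i; exact: pX0.
have HR : mean Pr (fun w => Phi (cap (K : nat)%:R (pX w))) @[K --> \oo] --> mean Pr (fun w => Phi (pX w)).
  have fin := integrable_fin_num measurableT iP.
  by move: H; rewrite -(fineK fin) => /fine_cvgP[].
apply: cvg_of_approx => e e0.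
have [K0 [_ HK]] := cap_tail e0.
have K00 : 0 <= Num.max K0 0 by rewrite le_max lexx orbT.
have [M [_ M1 _]] := nat_above K00.
have : \forall K \near \oo, (M <= K)%N /\ `|mean Pr (fun w => Phi (pX w)) - mean Pr (fun w => Phi (cap (K : nat)%:R (pX w)))| <= e.
  near=> K; split; first by near: K; exact: nbhs_infty_ge.
  by near: K; move/cvgrPdist_le : HR; exact.
move=> /filter_ex[K [MK Ke]].
have [_ _ C] := capped_law nP (ler0n R K).
exists (fun m => Lx m (fun x => Phi (cap K%:R x))), (mean Pr (fun w => Phi (cap K%:R (pX w)))); split => //.
apply: nearW => m; apply: HK => //; apply: le_trans (_ : M%:R <= _); last by rewrite ler_nat.
by apply: le_trans M1; rewrite le_max lexx.
Unshelve. all: end_near. Qed.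
End Limit.

(** * The window maximum as a Lipschitz functional *)

Section NiceWindow.
(** A window contains an index at most once, and taking maxima does not increase distances. *)
Lemma window_upd N I (x : nat -> R) k c : `|window N I (upd x k c) - window N I x| <= `|c - x k|.
Proof.
have sum_upd i : `|\sum_(r < N) upd x k c (i + r)%N - \sum_(r < N) x (i + r)%N| <= `|c - x k|.
  rewrite -sumrB; case: (leqP i k) => ik; last first.
    rewrite big1 ?normr0// => r _; rewrite /upd; case: eqP => e; rewrite ?subrr//.
    by move: ik; rewrite -e ltnNge leq_addr.
  case: (ltnP (k - i) N) => kN; last first.
    rewrite big1 ?normr0// => r _; rewrite /upd; case: eqP => e; rewrite ?subrr//.
    by have := ltn_ord r; move: kN; rewrite -e addKn ltnNge => ->.
  rewrite (bigD1 (Ordinal kN))//= big1 ?addr0; first by rewrite /upd subnKC// eqxx.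
  move=> r /negP ne; rewrite /upd; case: eqP => e; rewrite ?subrr//.
  by case: ne; apply/eqP/val_inj; rewrite /= -e addKn.
have max_lip (s t s' t' D : R) : `|s - s'| <= D -> `|t - t'| <= D -> `|Num.max s t - Num.max s' t'| <= D.
  rewrite !ler_norml => /andP[h1 h2] /andP[h3 h4].
  by case: (leP s t) => c1; case: (leP s' t') => c2; lra.
elim: I => [|I IH] /=; first exact: (sum_upd 0%N).
by apply: max_lip => //; exact: sum_upd.
Qed.

Lemma window_zero N I : window N I (fun=> 0 : R) = 0.
Proof.
by elim: I => [|I IH] /=; rewrite ?IH big1// maxxx.
Qed.

Lemma nice_window N I : (0 < N)%N -> nice (I + N) (fun x : nat -> R => window N I x / N%:R).
Proof.
move=> N0; have NR : 1 <= N%:R :> R by rewrite ler1n.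
have N0' : 0 < N%:R :> R by lra.
split => [x y e|x k c x0 c0|]; first by rewrite (window_ext e).
  rewrite -mulrBl normrM (ger0_norm (x := N%:R^-1)) ?invr_ge0 ?(ltW N0')//.
  by rewrite ler_pdivrMr//; apply: le_trans (window_upd N I x k c) _; rewrite ler_peMr.
by rewrite window_zero mul0r.
Qed.

(** Excesses over [K] stay in the class, so [functional_cvg] also carries tail bounds from the tree
    to the limit. *)
Lemma nice_excess n (Phi : (nat -> R) -> R) K : 0 <= K -> nice n Phi -> nice n (fun x => pos (Phi x - K)).
Proof.
move=> K0 [P1 P2 P3]; split => [x y e|x k c x0 c0|]; first by rewrite (P1 _ _ e).
  apply: le_trans (P2 x k c x0 c0); set s := Phi _; set t := Phi x.
  have dv : `|t - s| = `|s - t| by exact: distrC.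
  rewrite /pos; case: (leP (s - K) 0) => c1; case: (leP (t - K) 0) => c2; rewrite ?subrr ?normr0//.
  - by rewrite sub0r normrN ger0_norm ?(ltW c2)// -dv ger0_norm; lra.
  - by rewrite subr0 ger0_norm ?(ltW c1)// ger0_norm; lra.
  - by rewrite (_ : s - K - (t - K) = s - t)//; ring.
by rewrite P3 /pos max_r// sub0r oppr_le0.
Qed.
End NiceWindow.

(** * From the grid to [V^*] *)

Section Survive.
Variables (eta : R) (j : nat -> nat).
Hypothesis eta01 : 0 < eta <= 1.
Hypothesis hj : forall m, (0 < m)%N -> (0 < j m <= m)%N.
Hypothesis jm : (j m)%:R / m%:R @[m --> \oo] --> eta.

Let eta0 : 0 < eta. Proof. by case/andP: eta01. Qed.
Let jinf : forall J, \forall m \near \oo, (J <= j m)%N.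
Proof. by apply: (ratio_infty eta0 _ jm) => J; exact: nbhs_infty_ge. Qed.
Let Tm := eta^-1.
Let Tm1 : 1 <= Tm. Proof. by case/andP: eta01 => h1 h2; rewrite /Tm invf_ge1. Qed.

(** The last window start in cells: the windows of [Vstar] start in [0, 1/eta - 1]. *)
Definition lastw N := Num.truncn (N%:R * (eta^-1 - 1)).
Local Notation I N := (lastw N).

Lemma lastwP N : (I N)%:R <= N%:R * (Tm - 1) < (I N)%:R + 1.
Proof. by rewrite natr1; apply: truncn_itv; rewrite mulr_ge0// subr_ge0. Qed.

Definition G N (x : nat -> R) : R := window N (I N) x / N%:R.
Definition Y N w : R := G N (pX N w).

Let nG N : nice (I N.+1 + N.+1) (G N.+1).
Proof. exact: nice_window. Qed.
Let YP N := functional_cvg jinf (ltn0Sn N) (nG N).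
Let iY N : Pr.-integrable setT (fun w => (Y N.+1 w)%:E). Proof. by have [] := YP N. Qed.
Let Y_ge0 N w : 0 <= Y N w.
Proof. by rewrite divr_ge0// window_ge0// => r; exact: pos_ge0. Qed.
Let alive_top m := E (fun z => (0 < z (j m))%N%:R * (top m (j m) z)%:R) / (j m)%:R.

Let grid_approx (e : R) : 0 < e -> exists N0, forall N, (N0 <= N)%N ->
  \forall m \near \oo, `|alive_top m - mean Pr (Y N.+1)| <= e.
Proof.
move=> e0; have e2 : 0 < e / 2 by rewrite divr_gt0.
have [N0 H] := grid_close jinf eta01 e2 hj jm lastwP.
exists N0 => N NN; have HN := H N.+1 (leqW NN) (ltn0Sn N).
have [_ L] := YP N.
have C : ((j m %/ N.+1)%N%:R / (j m)%:R * N.+1%:R) * Lx j N.+1 m (G N.+1) @[m --> \oo] --> (N.+1%:R^-1 * N.+1%:R) * mean Pr (Y N.+1).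
  apply: cvgM => //; apply: cvgM; last exact: cvg_cst.
  exact: (cell_ratio jinf (ltn0Sn N)).
rewrite mulVf ?pnatr_eq0// mul1r in C.
near=> m.
have j0 : (0 < j m)%N by near: m; exact: jinf.
have jR : 0 < (j m)%:R :> R by rewrite ltr0n.
have h1 : `|mean Pr (Y N.+1) - ((j m %/ N.+1)%N%:R / (j m)%:R * N.+1%:R) * Lx j N.+1 m (G N.+1)| <= e / 2 by near: m; move/cvgrPdist_le : C; exact.
have h2 : `|E (fun z => (0 < z (j m))%N%:R * (top m (j m) z)%:R) - (j m %/ N.+1)%N%:R *
   E (fun z => (0 < z (j m))%N%:R * window N.+1 (I N.+1) (fun r => (z (mid (j m %/ N.+1) r))%:R))| <= e / 2 * (j m)%:R.
  by near: m.
have /andP[q0 _] := survp_gt0 dd (j m).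
have LE : Lx j N.+1 m (G N.+1) =
   E (fun z => (0 < z (j m))%N%:R * window N.+1 (I N.+1) (fun r => (z (mid (j m %/ N.+1) r))%:R)) / N.+1%:R.
  rewrite /Lx /G /xz.
  have -> : E (fun z => (0 < z (j m))%N%:R * (window N.+1 (I N.+1) (fun r => q (j m) * (z (gpos j N.+1 m r))%:R) / N.+1%:R)) =
     E (fun z => q (j m) / N.+1%:R * ((0 < z (j m))%N%:R * window N.+1 (I N.+1) (fun r => (z (mid (j m %/ N.+1) r))%:R))).
    by apply: eq_Ex => z; rewrite windowZ ?(ltW q0)//; ring.
  rewrite EZ; last by apply: grow_alive; exact: grow_window.
  move: (E _) (q (j m)) q0 (N.+1%:R^-1 : R) => W qq qq0 iN; field; by rewrite gt_eqF.
move: h1 h2; rewrite LE.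
set W := E _; set A := E _; set s := (j m %/ N.+1)%N%:R.
have -> : s / (j m)%:R * N.+1%:R * (W / N.+1%:R) = s * W / (j m)%:R by rewrite mulrACA mulfV ?pnatr_eq0// mulr1 mulrAC.
move=> h1 h2; have h3 : `|alive_top m - s * W / (j m)%:R| <= e / 2 by rewrite /alive_top -mulrBl normrM normfV (gtr0_norm jR) ler_pdivrMr.
rewrite -(subrK (s * W / (j m)%:R) (alive_top m)) -addrA; apply: le_trans (ler_normD _ _) _.
by rewrite [leRHS](splitr e) lerD// distrC.
Unshelve. all: end_near. Qed.
(** Uniform in the mesh, because it is carried over from the tree: there the window average is at
    most q_j times the peak before generation cT j, where q is comparable with q_j, and
    [peak_excess] applies. *)
Let tail_small (e : R) : 0 < e -> exists2 K0 : R, 0 <= K0 & forall K, K0 <= K -> forall N,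
  mean Pr (fun w => pos (Y N.+1 w - K)) <= e.
Proof.
move=> e0; have [K1 K11 HK] := peak_excess e0.
have Tm0 : 0 <= Tm by exact: le_trans ler01 Tm1.
have [cT [cT0 cT1 _]] := nat_above Tm0.
have cTR : 0 < cT%:R :> R by rewrite ltr0n.
have kj : ((cT * j m)%N)%:R / (j m)%:R @[m --> \oo] --> (cT%:R : R).
  apply: (@near_cvg R _ _ _ (fun=> cT%:R)); last exact: cvg_cst.
  near=> m; rewrite natrM mulfK// gt_eqF// ltr0n; near: m; exact: jinf.
have qr := survp_ratio dd cTR jinf kj.
set kap := cT%:R `^ (- a^-1) in qr; have kap0 : 0 < kap by rewrite powR_gt0.
have kap1 : kap / 2 < kap by lra.
exists (4 * K1 / kap + 2); first by rewrite addr_ge0// divr_ge0 ?(ltW kap0)// mulr_ge0//; lra.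
move=> K KK N.
have hK1 : 0 < 4 * K1 / kap by rewrite divr_gt0// mulr_gt0//; lra.
have K0 : 0 <= K by lra.
have [_ L] := functional_cvg jinf (ltn0Sn N) (nice_excess K0 (nG N)).
apply: (cvgr_to_le L); near=> m.
have s0 : (0 < j m %/ N.+1)%N by near: m; exact: (cell_infty jinf (ltn0Sn N)).
have qk : kap / 2 < q (cT * j m)%N / q (j m) by near: m; exact: cvgr_gt qr _ kap1.
have /andP[q0 q1] := survp_gt0 dd (j m); have /andP[qM0 _] := survp_gt0 dd (cT * j m).
set M := (cT * j m)%N in qk qM0 *.
pose b := Num.truncn (K / q (j m)).
have Kq0 : 0 <= K / q (j m) by rewrite divr_ge0// ltW.
have /andP[b1 b2] := truncn_itv Kq0; rewrite -/b -natr1 in b1 b2.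
have KKq : K <= K / q (j m) by rewrite ler_peMr// invf_ge1.
have b3 : K / q (j m) / 2 <= b%:R by lra.
have b4 : K1 / q M <= b%:R.
  apply: le_trans b3; rewrite ler_pdivrMr//.
  have : kap / 2 * q (j m) <= q M by rewrite -ler_pdivlMr// ltW.
  have h4 : K1 = (4 * K1 / kap) * (kap / 4) by field; rewrite gt_eqF.
  have h5 : 4 * K1 / kap * (kap / 4) <= K * (kap / 4) by rewrite ler_wpM2r ?divr_ge0 ?(ltW kap0)//; lra.
  have h6 : K / q (j m) / 2 * (kap / 2 * q (j m)) = K * (kap / 4) by field; rewrite gt_eqF.
  move=> h7; have h8 : K / q (j m) / 2 * (kap / 2 * q (j m)) <= K / q (j m) / 2 * q M by rewrite ler_wpM2l// divr_ge0.
  by lra.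
have /andP[I1 _] := lastwP N.+1.
have In : (I N.+1 + N.+1 <= cT * N.+1)%N.
  rewrite -(ler_nat R) natrD natrM.
  have : Tm * N.+1%:R <= cT%:R * N.+1%:R by rewrite ler_wpM2r.
  by move: I1; rewrite mulrBr mulr1 mulrC; lra.
have gM r : (r < I N.+1 + N.+1)%N -> (gpos j N.+1 m r < M)%N.
  move=> rI; rewrite /gpos /mid.
  have sh : ((j m %/ N.+1)./2 < j m %/ N.+1)%N by rewrite ltn_half_double -addnn -[X in (X < _)%N]addn0 ltn_add2l.
  apply: leq_trans (_ : r.+1 * (j m %/ N.+1) <= _)%N; first by rewrite mulSnr ltn_add2l.
  apply: leq_trans (_ : cT * N.+1 * (j m %/ N.+1) <= _)%N.
    by rewrite leq_mul2r (leq_trans rI In) orbT.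
  by rewrite /M -mulnA leq_mul2l mulnC leq_trunc_div orbT.
have pk z : G N.+1 (xz j N.+1 m z) <= q (j m) * (peak M z)%:R.
  rewrite /G ler_pdivrMr// mulrC; apply: window_le_max.
    by rewrite mulr_ge0// ltW.
  by move=> r rI; rewrite ler_wpM2l ?(ltW q0)// ler_nat; apply: peak_ge; exact: gM.
rewrite /Lx ler_pdivrMr// mulrC; apply: le_trans (_ : q (j m) * E (fun z => pos ((peak M z)%:R - b%:R)) <= _); last first.
  by rewrite ler_pM2l//; exact: HK.
have gpk := grow_pos_peak M b.
rewrite -EZ//; apply: Ele; last first.
- move=> z; apply: le_trans (_ : 1 * pos (G N.+1 (xz j N.+1 m z) - K) <= _).
    by rewrite ler_wpM2r ?pos_ge0//; case: (_ < _)%N.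
  rewrite mul1r; apply: pos_le; last by rewrite mulr_ge0 ?pos_ge0// ltW.
  apply: le_trans (_ : q (j m) * ((peak M z)%:R - b%:R) <= _); last by rewrite ler_pM2l// pos_ge.
  rewrite mulrBr lerB//; last by rewrite mulrC -ler_pdivlMr.
- exact: growZ.
have [E1 E2 E3] := nice_excess K0 (nG N).
apply: grow_alive; apply: (@grow_le M _ (fun z => q (j m) * (peak M z)%:R)).
- by move=> z z' ez; apply: E1 => r rI; rewrite /xz ez// ltnW// gM.
- apply: growZ; have := growD (grow_pos_peak M 0) (grow_cst 0).
  apply: eq_growth => z; rewrite subr0 addr0 /pos max_l//.
- move=> z; rewrite ger0_norm ?pos_ge0//; apply: pos_le; last by rewrite mulr_ge0// ltW.
  by apply: le_trans (pk z); rewrite lerBlDr lerDl.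
Unshelve. all: end_near. Qed.
Let V w := fine (Vstar X Tm w).

Let paths w : (forall t, 0 <= t -> (fun u => X u w) @ t^'+ --> X t w) /\
    (forall t, 0 < t -> cvg ((fun u => X u w) @ t^'-)).
Proof. by have [_ _ hc _] := hX; exact: hc. Qed.
Let VP w : Vstar X Tm w \is a fin_num /\
  window N.+1 (I N.+1) (fun r => X (gtime R N.+1 r) w) / N.+1%:R @[N --> \oo] --> V w.
Proof. have [h1 h2] := paths w; exact: (window_cvg h1 h2 Tm1 lastwP). Qed.
(** Off this null set all grid values are nonnegative, for every mesh, and [pos] may be dropped. *)
Let Nul : set Om := \bigcup_N \bigcup_r [set w | X (gtime R N.+1 r) w < 0].

Let mneg t : 0 <= t -> measurable [set w | X t w < 0].
Proof.
move=> t0; have [_ mX _ _] := hX.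
rewrite (_ : [set w | _] = setT `&` X t @^-1` `]-oo, 0[); first exact: mX.
by apply/seteqP; split => w /=; rewrite in_itv/=; [|case].
Qed.
Let mNul : measurable Nul.
Proof. by apply: bigcupT_measurable => N; apply: bigcupT_measurable => r; apply: mneg; apply: ltW; exact: gtime_gt0. Qed.
Let Nul0 : Pr Nul = 0%E.
Proof.
have : Pr.-negligible Nul.
  apply: negligible_bigcup => N; apply: negligible_bigcup => r.
  exists [set w | X (gtime R N.+1 r) w < 0]; split => //.
    by apply: mneg; apply: ltW; exact: gtime_gt0.
  by apply: (Xstar_ge0 hQ hchi hX); exact: gtime_gt0.
by move=> [B [mB B0 NB]]; apply/eqP; rewrite eq_le measure_ge0 andbT -B0 le_measure// inE.
Qed.
(** Here the positive part is taken of the window average instead of the samples: [window_cvg] then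
    applies on every path, and [U] agrees with [Y] off [Nul]. *)
Let U N w : R := pos (window N.+1 (I N.+1) (fun r => X (gtime R N.+1 r) w) / N.+1%:R).

Let UY N w : ~ Nul w -> U N w = Y N.+1 w.
Proof.
move=> nw; rewrite /U /Y /G; have e r : X (gtime R N.+1 r) w = pX N.+1 w r.
  rewrite /pX posE// leNgt; apply/negP => h; apply: nw; exists N => //; exists r => //.
rewrite (@window_ext _ N.+1 (I N.+1) _ (pX N.+1 w)) => [|r _]; last exact: e.
exact: (posE (Y_ge0 N.+1 w)).
Qed.
Let measurable_window (N I : nat) (F : nat -> Om -> R) : (forall r, mfunT (F r)) ->
  mfunT (fun w => window N I (fun r => F r w)).
Proof.
move=> mF; elim: I => [|I' IH] /=; first by apply: measurable_sum => r.
by apply: measurable_maxr => //; apply: measurable_sum => r.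
Qed.
Let mU N : mfunT (U N).
Proof.
have [_ mX _ _] := hX.
apply: (measurableT_comp (@measurable_pos R)); apply: measurable_funM => //.
by apply: measurable_window => r; apply: mX; apply: ltW; exact: gtime_gt0.
Qed.
Let mVp : mfunT (fun w => pos (V w)).
Proof.
apply: (measurableT_comp (@measurable_pos R)).
apply: (measurable_fun_cvg (h := fun N w => window N.+1 (I N.+1) (fun r => X (gtime R N.+1 r) w) / N.+1%:R)).
  have [_ mX _ _] := hX.
  by move=> N; apply: measurable_funM => //; apply: measurable_window => r; apply: mX; apply: ltW; exact: gtime_gt0.
by move=> w _; have [] := VP w.
Qed.
Let pos_cvg (x : nat -> R) (l : R) : x n @[n --> \oo] --> l -> pos (x n) @[n --> \oo] --> pos l.
Proof.
move=> xl; apply/cvgrPdist_le => e e0; move/cvgrPdist_le : xl => /(_ _ e0) xl.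
near=> n; have h : `|l - x n| <= e by near: n.
apply: le_trans h; rewrite /pos.
have dv : `|x n - l| = `|l - x n| by exact: distrC.
case: (leP l 0) => c1; case: (leP (x n) 0) => c2; rewrite ?subrr ?normr0//.
- by rewrite sub0r normrN ger0_norm ?(ltW c2)// -dv ger0_norm; lra.
- by rewrite subr0 ger0_norm ?(ltW c1)// ger0_norm; lra.
Unshelve. all: end_near. Qed.
Let vK (K : R) := mean Pr (fun w => Num.min (pos (V w)) K).

Let bmin (h : Om -> R) (K : R) : 0 <= K -> mfunT h -> (forall w, 0 <= h w) ->
  bmf (fun w => Num.min (h w) K).
Proof.
move=> K0 mh h0; split; first by apply: measurable_minr.
by exists K => w; rewrite ger0_norm ?le_min ?h0// ge_min lexx orbT.
Qed.
Let mY N : mfunT (Y N.+1).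
Proof. by apply/measurable_EFinP; exact: (measurable_int Pr (iY N)). Qed.
Let vK_cvg (K : R) : 0 <= K -> mean Pr (fun w => Num.min (Y N.+1 w) K) @[N --> \oo] --> vK K.
Proof.
move=> K0.
have C : mean Pr (fun w => Num.min (U N w) K) @[N --> \oo] --> vK K.
  apply: (@mean_cvg _ _ _ _ _ _ K).
  - by move=> N; apply: measurable_minr.
  - by move=> N w; rewrite ger0_norm ?le_min ?pos_ge0// ge_min lexx orbT.
  - move=> w; have [_ h] := VP w; have h2 := pos_cvg h.
    have Emin (x : R) : Num.min x K = x - pos (x - K).
      rewrite /pos; case: (leP x K) => h3; first by rewrite max_r ?subr0// subr_le0.
      by rewrite max_l ?subr_ge0 ?(ltW h3)// subKr.
    under eq_fun do rewrite Emin; rewrite Emin.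
    apply: cvgB => //; apply: pos_cvg; apply: cvgB => //; exact: cvg_cst.
apply: near_cvg C; apply: nearW => N; apply: (mean_ae mNul Nul0).
- by apply: bmin => // w; exact: pos_ge0.
- by apply: bmin.
- by move=> w nw; rewrite UY.
Qed.
Let split_tail (K : R) N : 0 <= K ->
  mean Pr (Y N.+1) = mean Pr (fun w => Num.min (Y N.+1 w) K) + mean Pr (fun w => pos (Y N.+1 w - K)).
Proof.
move=> K0; have [i1 _] := functional_cvg jinf (ltn0Sn N) (nice_excess K0 (nG N)).
have i2 := bmf_integrable Pr (bmin K0 (mY N) (Y_ge0 N.+1)).
rewrite /mean -fineD; [|exact: integrable_fin_num|exact: integrable_fin_num].
rewrite -integralD//; congr fine; apply: eq_integral => w _; rewrite -EFinD; congr (_%:E).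
rewrite /pos; case: (leP (Y N.+1 w) K) => h; first by rewrite max_r ?addr0// subr_le0.
by rewrite max_l ?subr_ge0 ?(ltW h)// addrC subrK.
Qed.
(** Monotone convergence in the truncation level; the truncated means are bounded by the tail
    estimate that is uniform in the mesh. *)
Let Vp_int : [/\ (\int[Pr]_w (pos (V w))%:E)%E \is a fin_num &
  vK (K : nat)%:R @[K --> \oo] --> mean Pr (fun w => pos (V w))].
Proof.
have [K0 K00 HK] := tail_small ltr01.
have bound (K : nat) : vK K%:R <= K0 + 1.
  have C := vK_cvg (ler0n R K); apply: (cvgr_to_le C); apply: nearW => N.
  have hY : mean Pr (fun w => Num.min (Y N.+1 w) K%:R) <= mean Pr (Y N.+1).
    rewrite (split_tail N (ler0n R K)) lerDl; apply: mean_ge0 => w; exact: pos_ge0.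
  apply: le_trans hY _; rewrite (split_tail N K00) lerD ?HK//.
  rewrite -[leRHS](mean_cst Pr); apply: mean_le; [exact: bmin|exact: bmf_cst|].
  by move=> w; rewrite ge_min lexx orbT.
pose S (K : nat) w : R := Num.min (pos (V w)) K%:R.
have bS K : bmf (S K) by apply: bmin => // w; exact: pos_ge0.
have H : (\int[Pr]_w (S K w)%:E)%E @[K --> \oo] --> (\int[Pr]_w (pos (V w))%:E)%E.
  have -> : (fun w => (pos (V w))%:E) = (fun w => limn (fun K => (S K w)%:E)).
    apply/funext => w; apply/esym/cvg_lim => //.
    apply: (@cvg_trans _ ((fun _ : nat => (pos (V w))%:E) @ \oo)); last exact: cvg_cst.
    have [M [_ M1 _]] := nat_above (pos_ge0 (V w)).
    apply: near_eq_cvg; near=> K; rewrite /S min_l//; apply: le_trans M1 _.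
    by rewrite ler_nat; near: K; exact: nbhs_infty_ge.
  apply: cvg_monotone_convergence => //.
  - by move=> K; apply/measurable_EFinP; have [] := bS K.
  - by move=> K w _; rewrite lee_fin le_min pos_ge0 ler0n.
  - move=> w _ K K' KK; rewrite lee_fin /S le_min ge_min lexx/=.
    by rewrite ge_min ler_nat KK orbT.
have fin : (\int[Pr]_w (pos (V w))%:E)%E \is a fin_num.
  rewrite ge0_fin_numE; last by apply: integral_ge0 => w _; rewrite lee_fin pos_ge0.
  apply: le_lt_trans (_ : (K0 + 1)%:E < +oo)%E; last exact: ltry.
  rewrite -(cvg_lim _ H)//; apply: lime_le; first by apply/cvg_ex; eexists; exact: H.
  by apply: nearW => K; rewrite meanE// lee_fin; exact: bound.
split => //; rewrite /mean -/(vK _); move: H; rewrite -{1}(fineK fin) => /fine_cvgP[_].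
exact.
Unshelve. all: end_near. Qed.
Let EV_eq : EVstar Pr X Tm = (\int[Pr]_w (pos (V w))%:E)%E.
Proof.
rewrite /EVstar; have mV : mfunT (fun w => Vstar X Tm w).
  rewrite (_ : (fun w => _) = EFin \o V); last first.
    by apply/funext => w /=; rewrite /V fineK//; have [] := VP w.
  apply/measurable_EFinP.
  apply: (measurable_fun_cvg (h := fun N w => window N.+1 (I N.+1) (fun r => X (gtime R N.+1 r) w) / N.+1%:R)).
    have [_ mX _ _] := hX.
    by move=> N; apply: measurable_funM => //; apply: measurable_window => r; apply: mX; apply: ltW; exact: gtime_gt0.
  by move=> w _; have [] := VP w.
apply: ae_eq_integral => //; first exact/measurable_EFinP.
exists Nul; split => // w /= hw; apply: contrapT => nw; apply: hw => _.
have [fw cw] := VP w; rewrite -[LHS](fineK fw) -/(V w); congr (_%:E); rewrite posE//.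
apply: (cvgr_to_ge cw); apply: nearW => N.
rewrite divr_ge0//; apply: window_ge0 => r; rewrite leNgt; apply/negP => h; apply: nw.
by exists N => //; exists r.
Qed.

(** Truncation errors are uniform in N, so the limits in N and in the truncation level may be
    exchanged. *)
Theorem survive_grid : EVstar Pr X eta^-1 \is a fin_num /\
  mean Pr (Y N.+1) @[N --> \oo] --> fine (EVstar Pr X eta^-1).
Proof.
have [fin C] := Vp_int; rewrite -/Tm EV_eq; split => //.
apply: cvg_of_approx => e e0; have [K0 K00 HK] := tail_small e0.
have [M [_ M1 _]] := nat_above K00.
have : \forall K \near \oo, (M <= K)%N /\ `|mean Pr (fun w => pos (V w)) - vK (K : nat)%:R| <= e.
  near=> K; split; first by near: K; exact: nbhs_infty_ge.
  by near: K; move/cvgrPdist_le : C; exact.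
move=> /filter_ex[K [MK Ke]].
exists (fun N => mean Pr (fun w => Num.min (Y N.+1 w) K%:R)), (vK K%:R); split => //.
  exact: vK_cvg.
apply: nearW => N; rewrite (split_tail N (ler0n R K)) addrC addKr ger0_norm.
  by apply: HK; apply: le_trans M1 _; rewrite ler_nat.
by apply: mean_ge0 => w; exact: pos_ge0.
Unshelve. all: end_near. Qed.

Theorem survive_cvg :
  E (fun z => (0 < z (j m))%N%:R * (top m (j m) z)%:R) / (j m)%:R @[m --> \oo] --> fine (EVstar Pr X eta^-1).
Proof.
have [_ C] := survive_grid; apply: cvg_of_approx => e e0.
have [N0 H] := grid_approx e0.
have : \forall N \near \oo, (N0 <= N)%N /\ `|fine (EVstar Pr X eta^-1) - mean Pr (Y N.+1)| <= e.
  near=> N; split; first by near: N; exact: nbhs_infty_ge.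
  by near: N; move/cvgrPdist_le : C; exact.
move=> /filter_ex[N [NN Ne]].
exists (fun=> mean Pr (Y N.+1)), (mean Pr (Y N.+1)); split => //; first exact: cvg_cst.
exact: H.
Unshelve. all: end_near. Qed.
End Survive.

(** * The constant alpha/(2 alpha + 1) and the conclusions *)

Section Final.
Local Notation psi := (csbp_exponent a).

Let ia0 : 0 < a^-1. Proof. by rewrite invr_gt0. Qed.
Let c (k : nat) : R := k.+1%:R^-1.
Let c0 k : 0 < c k. Proof. by rewrite invr_gt0. Qed.
Let succ_infty J : \forall k \near \oo, (J <= k.+1)%N.
Proof. by near=> k; apply: leqW; near: k; exact: nbhs_infty_ge.
Unshelve. all: end_near. Qed.
Let c_cvg : c k @[k --> \oo] --> (0 : R).
Proof. exact: (cvg_infty_comp succ_infty (@cvg_inv_natr R)). Qed.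
Let powRV (x r : R) : 0 <= x -> (x^-1) `^ r = x `^ (- r).
Proof. by move=> x0; rewrite -powR_inv1// -powRrM mulN1r. Qed.
(** From psi_t(c)/c = (1 + t c^a)^(-1/a); it expresses that the unconditioned process has constant
    mean. *)
Let psi_slope0 (t : R) : 0 <= t -> psi t (c k) / c k @[k --> \oo] --> (1 : R).
Proof.
move=> t0.
have ca : c k `^ a @[k --> \oo] --> (0 : R).
  apply: near_cvg (cvg_infty_comp succ_infty (powR_inv_cvg0 a01)); apply: nearW => k.
  by rewrite /c powRV.
have C : t * c k `^ a + 1 @[k --> \oo] --> (1 : R).
  rewrite -[X in _ --> X]add0r -[X in _ --> X + _](mulr0 t); apply: cvgD; last exact: cvg_cst.
  by apply: cvgM => //; exact: cvg_cst.
have C2 : (t * c k `^ a + 1) `^ (- a^-1) @[k --> \oo] --> (1 : R).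
  suff : (t * c k `^ a + 1) `^ (- a^-1) @[k --> \oo] --> 1 `^ (- a^-1) by rewrite powR1.
  by apply: cvg_powR.
apply: near_cvg C2; apply: nearW => k.
have ck := c0 k; have cka := powR_gt0 a ck; have h : 0 <= t * c k `^ a + 1 by rewrite addr_ge0// mulr_ge0// ltW.
have -> : psi t (c k) = (c k `^ (- a) * (t * c k `^ a + 1)) `^ (- a^-1).
  rewrite /csbp_exponent; congr (_ `^ _); rewrite mulrDr mulr1 mulrCA powRN mulVf ?gt_eqF// mulr1//.
rewrite powRM ?powR_ge0// -powRrM mulrNN mulfV ?gt_eqF// powRr1 ?(ltW ck)//.
by rewrite mulrAC mulfV ?gt_eqF// mul1r.
Qed.
(** The derivative of psi_t at mu = (1-t)^(-1/a), where psi_t(mu) = 1, as a product of two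
    difference quotients of powers near 1. *)
Let psi_slope (t : R) : 0 < t < 1 ->
  (psi t (c k + (1 - t) `^ (- a^-1)) - 1) / c k @[k --> \oo] --> (1 - t) `^ (1 + a^-1).
Proof.
move=> /andP[t0 t1]; have t1' : 0 < 1 - t by lra.
set mu := (1 - t) `^ (- a^-1); have mu0 : 0 < mu by rewrite powR_gt0.
have mua : mu `^ (- a) = 1 - t by rewrite /mu -powRrM mulrNN mulVf ?gt_eqF// powRr1// ltW.
pose h k := c k / mu.
have h0 k : 0 < h k by rewrite divr_gt0.
have hc : h k @[k --> \oo] --> (0 : R) by rewrite -[X in _ --> X](mul0r mu^-1); apply: cvgM => //; exact: cvg_cst.
pose dl k := (1 + h k) `^ (- a) - 1.
have dl0 k : dl k < 0.
  rewrite subr_lt0 -powRV ?powR_lt1 ?invr_ge0//.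
  - by have := h0 k; lra.
  - by rewrite invf_lt1; have := h0 k; lra.
  - by have := h0 k; lra.
have hn0 k : h k != 0 by rewrite gt_eqF.
have S1 := powR_slope_cvg (c := - a) hn0 hc.
have dc : dl k @[k --> \oo] --> (0 : R).
  have C : ((1 + h k) `^ (- a) - 1) / h k * h k @[k --> \oo] --> (- a * 0 : R) by apply: cvgM.
  by rewrite mulr0 in C; apply: near_cvg C; apply: nearW => k; rewrite divfK.
pose dl2 k := (1 - t) * dl k.
have dn0 k : dl2 k != 0 by rewrite mulf_neq0 //; [rewrite gt_eqF|rewrite lt_eqF].
have d2c : dl2 k @[k --> \oo] --> (0 : R) by rewrite -[X in _ --> X](mulr0 (1 - t)); apply: cvgM => //; exact: cvg_cst.
have S2 := powR_slope_cvg (c := - a^-1) dn0 d2c.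
have C : ((1 + dl2 k) `^ (- a^-1) - 1) / dl2 k * (1 - t) * (((1 + h k) `^ (- a) - 1) / h k) / mu @[k --> \oo] -->
    - a^-1 * (1 - t) * - a / mu.
  apply: cvgM; last exact: cvg_cst.
  by apply: cvgM => //; apply: cvgM => //; exact: cvg_cst.
have -> : (1 - t) `^ (1 + a^-1) = - a^-1 * (1 - t) * - a / mu.
  rewrite powRD; last by rewrite (gt_eqF t1') implybT.
  rewrite powRr1 ?(ltW t1')// /mu powRN invrK.
  by field; rewrite gt_eqF.
apply: near_cvg C; apply: nearW => k.
have -> : psi t (c k + mu) = (1 + dl2 k) `^ (- a^-1).
  rewrite /csbp_exponent; congr (_ `^ _).
  have -> : c k + mu = mu * (1 + h k) by rewrite /h mulrDr mulr1 mulrCA mulfV ?gt_eqF// mulr1 addrC.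
  rewrite powRM ?(ltW mu0) ?mua//; last by have := h0 k; lra.
  by rewrite /dl2 /dl; ring.
have ck := c0 k; have dlk := dl0 k.
rewrite -/(dl k) /dl2 /h; move: (c k) ck (dl k) dlk => ck ck0 dk dk0.
by field; rewrite (lt_eqF dk0) (gt_eqF t1') (gt_eqF mu0) (gt_eqF ck0).
Qed.

(** Differentiation of [laplace_Xstar] at c = 0: [Psi] contributes 1 and [PsiK] contributes (1-t)^(1
    + 1/a). *)
Lemma mean_Xstar (t : R) : 0 < t < 1 -> Pr.-integrable setT (fun w => (pos (X t w))%:E) ->
  mean Pr (fun w => pos (X t w)) = 1 - (1 - t) `^ (1 + a^-1).
Proof.
move=> t01 ip; have /andP[t0 t1] := t01; have [_ mX _ _] := hX.
have mXt : mfunT (X t) by apply: mX; exact: ltW.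
pose f k w : R := (1 - expf (c k) (X t w)) / c k.
have fb k w : 0 <= f k w <= pos (X t w).
  have ck := c0 k; have /andP[e0 e1] := expf_itv (X t w) (ltW ck).
  rewrite divr_ge0 ?(ltW ck) ?subr_ge0//= ler_pdivrMr//.
  by have := @expR_ge1Dx R (- (c k * pos (X t w))); rewrite /expf; lra.
have be k : bmf (fun w => expf (c k) (X t w)).
  split; first by apply: (measurableT_comp (measurable_expf (c k)) mXt).
  by exists 1 => w; have /andP[e0 e1] := expf_itv (X t w) (ltW (c0 k)); rewrite ger0_norm.
have bf k : bmf (f k).
  have H := bmfZ (c k)^-1 (bmfB (@bmf_cst _ _ Om 1) (be k)).
  by move: H; congr bmf; apply/funext => w; rewrite /f mulrC.
have H : (\int[Pr]_w (f k w)%:E)%E @[k --> \oo] --> (\int[Pr]_w (pos (X t w))%:E)%E.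
  apply: (@dominated_cvg _ _ _ Pr setT measurableT (fun k w => (f k w)%:E) (fun w => (pos (X t w))%:E) (fun w => (pos (X t w))%:E)) => //.
  - by move=> k; apply/measurable_EFinP; have [] := bf k.
  - move=> w _; apply/fine_cvgP; split; first exact: nearW.
    have := expR_decay_cvg c0 c_cvg (pos_ge0 (X t w)); apply: near_cvg; apply: nearW => k.
    by rewrite /= /f /expf (mulrC (c k)).
  - by move=> k w _; have /andP[f0 f1] := fb k w; rewrite /= lee_fin ger0_norm.
have C1 : mean Pr (f k) @[k --> \oo] --> mean Pr (fun w => pos (X t w)).
  have fin := integrable_fin_num measurableT ip.
  by move: H; rewrite -(fineK fin) => /fine_cvgP[].
have fE k : mean Pr (f k) = psi t (c k) / c k - (psi t (c k + (1 - t) `^ (- a^-1)) - 1) / c k.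
  have -> : mean Pr (f k) = (c k)^-1 * (1 - mean Pr (fun w => expf (c k) (X t w))).
    rewrite -[X in X - _](mean_cst Pr) -meanB//; last exact: bmf_cst.
    rewrite -meanZ; last by apply: bmfB => //; exact: bmf_cst.
    by congr mean; apply/funext => w; rewrite /f mulrC.
  have tl : timed 0 [:: (t, c k)] by rewrite /= /ok t0 lt_eqF.
  have cl : all (fun x : R * R => 0 < x.2) [:: (t, c k)] by rewrite /= c0.
  have := laplace_Xstar a01 hQ hchi hX tl cl; rewrite /= t1 !subr0 addr0.
  have -> : (fun w => expf (c k) (X t w) * 1) = (fun w => expf (c k) (X t w)) by apply/funext => w; rewrite mulr1.
  move=> ->; move: (psi _ _) (psi _ _) ((c k)^-1) => x y z; ring.
have C2 : psi t (c k) / c k - (psi t (c k + (1 - t) `^ (- a^-1)) - 1) / c k @[k --> \oo] --> 1 - (1 - t) `^ (1 + a^-1).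
  by apply: cvgB; [exact: psi_slope0 (ltW t0)|exact: psi_slope].
by apply: (cvg_unique _ C1) => //; apply: near_cvg C2; apply: nearW => k; rewrite fE.
Qed.
Let id_infty J : \forall m \near \oo, (J <= id m)%N. Proof. exact: nbhs_infty_ge. Qed.
Let ipX N r : Pr.-integrable setT (fun w => (pX N.+1 w r)%:E).
Proof.
have iS := sum_integrable id_infty (ltn0Sn N) r.+1.
have [_ mX _ _] := hX.
apply: le_integrable iS => //.
  apply/measurable_EFinP; apply: (measurableT_comp (@measurable_pos R)); apply: mX; apply: ltW; exact: gtime_gt0.
move=> w _; rewrite /= lee_fin ger0_norm ?pos_ge0// ger0_norm; last by apply: sumr_ge0 => i _; exact: pos_ge0.
by rewrite big_ord_recr/= lerDr sumr_ge0// => i _; exact: pos_ge0.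
Qed.
Let mean_sum N n : mean Pr (fun w => \sum_(r < n) pX N.+1 w r) = \sum_(r < n) mean Pr (fun w => pX N.+1 w r).
Proof.
elim: n => [|n IH].
  by rewrite big_ord0 -[RHS](mean_cst Pr); congr mean; apply/funext => w; rewrite big_ord0.
have i1 := sum_integrable id_infty (ltn0Sn N) n; have i2 := ipX N n.
rewrite big_ord_recr/= -IH /mean -fineD ?integrable_fin_num// -integralD//.
by congr fine; apply: eq_integral => w _; rewrite -EFinD big_ord_recr.
Qed.
Let ratio_id : (id m)%:R / m%:R @[m --> \oo] --> (1 : R).
Proof.
apply: (@near_cvg R _ _ _ (fun=> 1)); last exact: cvg_cst.
near=> m; rewrite mulfV// pnatr_eq0 -lt0n; near: m; exact: nbhs_infty_gt.
Unshelve. all: end_near. Qed.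
Let one01 : 0 < (1 : R) <= 1. Proof. by rewrite ltr01 lexx. Qed.

(** For eta = 1 there is a single window. Reversing the grid, which is symmetric about 1/2, turns
    the sum of means into a Riemann sum of t^(1 + 1/a). *)
Lemma EVstar1 : fine (EVstar Pr X (1^-1)) = 1 - a / (2 * a + 1).
Proof.
have [_ C] := survive_grid one01 ratio_id.
have b0 : 0 < 1 + a^-1 by rewrite addr_gt0.
have C2 : 1 - (\sum_(r < N.+1) gtime R N.+1 r `^ (1 + a^-1)) / N.+1%:R @[N --> \oo] --> 1 - (1 + a^-1 + 1)^-1.
  by apply: cvgB; [exact: cvg_cst|exact: riemann_power].
have -> : a / (2 * a + 1) = (1 + a^-1 + 1)^-1.
  have : 0 < 2 * a + 1 by rewrite addr_gt0// mulr_gt0.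
  by move=> h; have h2 : 1 + a^-1 + 1 = (2 * a + 1) / a; [field; rewrite gt_eqF|rewrite h2 invf_div].
apply: (cvg_unique _ C) => //; apply: near_cvg C2; apply: nearW => N.
have l0 : lastw (1 : R) N.+1 = 0%N by rewrite /lastw invr1 subrr mulr0; apply/eqP; rewrite Num.Theory.truncn_eq// lexx ltr01.
have K0 : 0 < N.+1%:R :> R by [].
have -> : mean Pr (Y 1 N.+1) = (\sum_(r < N.+1) mean Pr (fun w => pX N.+1 w r)) / N.+1%:R.
  rewrite -mean_sum /mean -[in RHS](fineK (integrable_fin_num measurableT (sum_integrable id_infty (ltn0Sn N) N.+1))).
  rewrite mulrC -[RHS]/(fine (_%:E)) EFinM fineK; last first.
    by apply: integrable_fin_num => //; exact: (sum_integrable id_infty (ltn0Sn N) N.+1).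
  rewrite -integralZl//; last exact: (sum_integrable id_infty (ltn0Sn N) N.+1).
  by congr fine; apply: eq_integral => w _; rewrite -EFinM /Y /G l0 /= mulrC.
have tr (r : 'I_N.+1) : gtime R N.+1 r < 1 by rewrite gtime_lt1.
have -> : \sum_(r < N.+1) mean Pr (fun w => pX N.+1 w r) = \sum_(r < N.+1) (1 - (1 - gtime R N.+1 r) `^ (1 + a^-1)).
  apply: eq_bigr => r _; apply: mean_Xstar; last exact: ipX.
  by rewrite gtime_gt0//= tr.
rewrite sumrB sumr_const card_ord mulrBl mulfV ?gt_eqF//; congr (1 - _ / _).
rewrite (reindex_inj rev_ord_inj)/=; apply: eq_bigr => r _; congr (_ `^ _).
rewrite /gtime natrB; last exact: ltn_ord.
move: (N.+1%:R : R) K0 => K K0; rewrite -natr1; field; by rewrite gt_eqF.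
Qed.

Lemma block0_top n z : top n n z = block n 0 z.
Proof. by rewrite /top subnn big_nat1. Qed.

(** On extinction by generation j the maximal block sum is at least S_0(j) and at most the sum over
    all generations before m, which exceeds S_0(j) only by terms of mean 0. The part S_0(j) has
    total mean j. *)
Lemma top_split m j : (j <= m)%N -> E (fun z => (top m j z)%:R) =
  E (fun z => (0 < z j)%N%:R * (top m j z)%:R) + j%:R - E (fun z => (0 < z j)%N%:R * (top j j z)%:R).
Proof.
move=> jm; have gt := grow_top m j; have gb := grow_top j j.
have ga := grow_alive j gt; have gab := grow_alive j gb.
have gtail : grow (fun z => \sum_(i < m - j) (z j == 0%N)%:R * (z (j + i)%N)%:R).
  apply: grow_sum => i _; apply: (@growM_bounded j 1) (grow_coord _) => [z z' ->//|z].
  by case: eqP; rewrite ?normr1 ?normr0.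
have gx : grow (fun z => (top m j z)%:R - (0 < z j)%N%:R * (top m j z)%:R) by exact: growB.
have gy : grow (fun z => (top j j z)%:R - (0 < z j)%N%:R * (top j j z)%:R) by exact: growB.
have Ej : E (fun z => (top j j z)%:R) = j%:R.
  rewrite (@eq_Ex _ (fun z => \sum_(l < j) (z l)%:R)) => [|z]; last first.
    by rewrite block0_top block_shift natr_sum.
  rewrite ES => [|l _]; last exact: grow_coord.
  by under eq_bigr do rewrite Ecoord; rewrite sumr_const card_ord.
suff key : E (fun z => (top m j z)%:R - (0 < z j)%N%:R * (top m j z)%:R) =
    E (fun z => (top j j z)%:R - (0 < z j)%N%:R * (top j j z)%:R).
  by move: key; rewrite !EB// Ej; lra.
apply/eqP; rewrite eq_le; apply/andP; split; last first.
  apply: Ele => // z; case: (posnP (z j)) => zj; last by rewrite !mul1r !subrr.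
  by rewrite !mul0r !subr0 ler_nat block0_top; exact: block_le_top.
apply: le_trans (_ : E (fun z => ((top j j z)%:R - (0 < z j)%N%:R * (top j j z)%:R) + \sum_(i < m - j) (z j == 0%N)%:R * (z (j + i)%N)%:R) <= _).
  apply: Ele => //; first exact: growD.
  move=> z; case: (posnP (z j)) => zj.
    rewrite !mul0r !subr0; under [X in _ <= _ + X]eq_bigr do rewrite mul1r.
    have e : (j + (m - j) = m)%N by rewrite subnKC.
    have : (top m j z)%:R <= (\sum_(l < m) z l)%:R :> R by rewrite ler_nat top_le_sum.
    rewrite block0_top block_shift -natr_sum -natrD !ler_nat.
    have bs n : (\sum_(l < j + n) z l = \sum_(r < j) z (0 + r)%N + \sum_(i < n) z (j + i)%N)%N by rewrite big_split_ord.
    by rewrite -bs e.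
  by rewrite !mul1r !subrr add0r sumr_ge0// => i _; rewrite mulr_ge0.
rewrite ED// ES => [|i _]; last first.
  apply: (@growM_bounded j 1) (grow_coord _) => [z z' ->//|z].
  by case: eqP; rewrite ?normr1 ?normr0.
rewrite [X in _ + X <= _]big1 ?addr0// => i _.
by apply: (Ex_extinct_tail); exact: leq_addr.
Qed.

Section Ratio.
Variables (eta : R) (j : nat -> nat).
Hypothesis eta01 : 0 < eta <= 1.
Hypothesis hj : forall m, (0 < m)%N -> (0 < j m <= m)%N.
Hypothesis jm : (j m)%:R / m%:R @[m --> \oo] --> eta.

Lemma phiV_fin : phiV a Pr X eta \is a fin_num.
Proof.
have [fin _] := survive_grid eta01 jm.
by rewrite /phiV fin_numD fin.
Qed.

Lemma top_cvg : E (fun z => (top m (j m) z)%:R) / (j m)%:R @[m --> \oo] --> fine (phiV a Pr X eta).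
Proof.
have [fin _] := survive_grid eta01 jm.
have eta0 : 0 < eta by case/andP: eta01.
have jinf : forall J, \forall m \near \oo, (J <= j m)%N by apply: (ratio_infty eta0 _ jm) => J; exact: nbhs_infty_ge.
have C1 := survive_cvg eta01 hj jm.
have hid m : (0 < m)%N -> (0 < id m <= m)%N by move=> m0; rewrite m0/=.
(* The case eta = 1, where block and horizon coincide, read along the sequence j. *)
have C2 := cvg_infty_comp jinf (survive_cvg one01 hid ratio_id).
have -> : fine (phiV a Pr X eta) = fine (EVstar Pr X eta^-1) + 1 - fine (EVstar Pr X (1^-1)) by rewrite /phiV fineD// EVstar1 /=; ring.
have C3 : E (fun z => (0 < z (j m))%N%:R * (top m (j m) z)%:R) / (j m)%:R + 1 -
    E (fun z => (0 < z (j m))%N%:R * (top (j m) (j m) z)%:R) / (j m)%:R @[m --> \oo] -->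
    fine (EVstar Pr X eta^-1) + 1 - fine (EVstar Pr X (1^-1)).
  by apply: cvgB; [apply: cvgD => //; exact: cvg_cst|exact: C2].
apply: near_cvg C3; near=> m.
have m0 : (0 < m)%N by near: m; exact: nbhs_infty_gt.
have /andP[j0 jm'] := hj m0; have jR : 0 < (j m)%:R :> R by rewrite ltr0n.
by rewrite (top_split jm') !mulrDl mulfV ?gt_eqF// mulNr.
Unshelve. all: end_near. Qed.

(** Positivity of the limit is what permits the division in [top_ratio]. *)
Lemma phiV_ge1 : 1 <= fine (phiV a Pr X eta).
Proof.
apply: (cvgr_to_ge top_cvg); near=> m.
have m0 : (0 < m)%N by near: m; exact: nbhs_infty_gt.
have /andP[j0 jm'] := hj m0; rewrite ler_pdivlMr ?ltr0n// mul1r.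
exact: (top_ge).
Unshelve. all: end_near. Qed.

Lemma top_ratio : E (fun z => (top m (j m) z)%:R) / ((j m)%:R * fine (phiV a Pr X eta)) @[m --> \oo] --> (1 : R).
Proof.
have f1 := phiV_ge1; have fn0 : fine (phiV a Pr X eta) != 0 by rewrite gt_eqF//; lra.
rewrite -[X in _ --> X](mulfV fn0).
have C : E (fun z => (top m (j m) z)%:R) / (j m)%:R * (fine (phiV a Pr X eta))^-1 @[m --> \oo] -->
    fine (phiV a Pr X eta) * (fine (phiV a Pr X eta))^-1 by apply: cvgM; [exact: top_cvg|exact: cvg_cst].
by apply: near_cvg C; apply: nearW => m; rewrite invfM mulrA.
Qed.

End Ratio.

(** Block lengths realising a given eta; the maximum with 1 keeps them positive for small m. *)
Let fl (eta : R) m := maxn 1 (Num.truncn (eta * m%:R)).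

Let fl_ok (eta : R) : 0 < eta <= 1 -> forall m, (0 < m)%N -> (0 < fl eta m <= m)%N.
Proof.
move=> /andP[e0 e1] m m0; rewrite /fl leq_max/= geq_max m0/= -(ler_nat R).
have h : 0 <= eta * m%:R by rewrite mulr_ge0// ltW.
by have /andP[h1 _] := truncn_itv h; apply: le_trans h1 _; rewrite ler_piMl.
Qed.
Let fl_cvg (eta : R) : 0 < eta <= 1 -> (fl eta m)%:R / m%:R @[m --> \oo] --> eta.
Proof.
move=> /andP[e0 e1].
have c1 : eta - m%:R^-1 @[m --> \oo] --> eta by rewrite -[X in _ --> X]subr0; apply: cvgB; [exact: cvg_cst|exact: cvg_inv_natr].
have c2 : eta + m%:R^-1 @[m --> \oo] --> eta by rewrite -[X in _ --> X]addr0; apply: cvgD; [exact: cvg_cst|exact: cvg_inv_natr].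
apply: (squeeze_cvgr _ c1 c2); near=> m.
have m0 : 0 < m%:R :> R by rewrite ltr0n; near: m; exact: nbhs_infty_gt.
have h : 0 <= eta * m%:R by rewrite mulr_ge0// ltW.
have /andP[h1 h2] := truncn_itv h; rewrite -natr1 in h2.
have u : (fl eta m)%:R <= eta * m%:R + 1 by rewrite /fl /maxn; case: ifP => _; lra.
have l : eta * m%:R - 1 <= (fl eta m)%:R.
  apply: le_trans (_ : (Num.truncn (eta * m%:R))%:R <= _); first by lra.
  by rewrite ler_nat /fl leq_maxr.
rewrite ler_pdivlMr// ler_pdivrMr// mulrBl mulrDl mulVf ?gt_eqF//.
by rewrite l u.
Unshelve. all: end_near. Qed.

(** [top_upper] and [top_lower] are uniform in m and j, so they pass to the limit along [fl eta];
    eta < 1/2 provides 2 j <= m eventually. *)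
Lemma phiV_log (e : R) : 0 < e -> exists2 C : R, 0 <= C & forall eta, 0 < eta < 2^-1 ->
  (1 - e) * ln (1 / eta) - C <= fine (phiV a Pr X eta) <= (1 + e) * ln (1 / eta) + C.
Proof.
move=> e0; have [C1 C10 H1] := top_upper e0.
have [C2 C20 H2] := top_lower e0.
exists (C1 + C2); first exact: addr_ge0.
move=> eta /andP[eta0 etah]; have eta01 : 0 < eta <= 1 by rewrite eta0/=; lra.
have jm := fl_cvg eta01; have hj := fl_ok eta01.
have TC := top_cvg eta01 hj jm.
have i0 : 0 < 1 / eta by rewrite divr_gt0.
have lc : ln (m%:R / (fl eta m)%:R) @[m --> \oo] --> ln (1 / eta).
  have C : m%:R / (fl eta m)%:R @[m --> \oo] --> 1 / eta.
    rewrite div1r; have C0 : ((fl eta m)%:R / m%:R)^-1 @[m --> \oo] --> eta^-1 by apply: cvgV => //; rewrite gt_eqF.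
    by apply: near_cvg C0; apply: nearW => m; rewrite invf_div.
  by apply: (continuous_cvg _ _ C); exact: continuous_ln.
have small : \forall m \near \oo, (2 * fl eta m <= m)%N.
  near=> m; have m0 : 0 < m%:R :> R by rewrite ltr0n; near: m; exact: nbhs_infty_gt.
  have : (fl eta m)%:R / m%:R < 2^-1 :> R by near: m; exact: cvgr_lt jm _ etah.
  by rewrite ltr_pdivrMr// -(ler_nat R) natrM; lra.
apply/andP; split.
  have L : (1 - e) * ln (m%:R / (fl eta m)%:R) - (C1 + C2) @[m --> \oo] --> (1 - e) * ln (1 / eta) - (C1 + C2).
    by apply: cvgB; [apply: cvgM => //; exact: cvg_cst|exact: cvg_cst].
  apply: (ler_cvg_to L TC); near=> m.
  have m0 : (0 < m)%N by near: m; exact: nbhs_infty_gt.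
  have /andP[j0 jm'] := hj m m0; have jR : 0 < (fl eta m)%:R :> R by rewrite ltr0n.
  rewrite ler_pdivlMr// mulrC; apply: le_trans (H2 m (fl eta m) j0 _); last by near: m.
  by rewrite ler_pM2l//; lra.
have L : (1 + e) * ln (m%:R / (fl eta m)%:R) + (C1 + C2) @[m --> \oo] --> (1 + e) * ln (1 / eta) + (C1 + C2).
  by apply: cvgD; [apply: cvgM => //; exact: cvg_cst|exact: cvg_cst].
apply: (ler_cvg_to TC L); near=> m.
have m0 : (0 < m)%N by near: m; exact: nbhs_infty_gt.
have jj := hj m m0; have /andP[j0 jm'] := jj; have jR : 0 < (fl eta m)%:R :> R by rewrite ltr0n.
rewrite ler_pdivrMr// mulrC; apply: le_trans (H1 m (fl eta m) jj) _.
by rewrite ler_pM2l//; lra.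
Unshelve. all: end_near. Qed.

Lemma phiV_equiv : fine (phiV a Pr X eta) / ln (1 / eta) @[eta --> (0:R)^'+] --> (1 : R).
Proof.
apply/cvgrPdist_le => e e0; have e2 : 0 < e / 2 by rewrite divr_gt0.
have [C C0 HC] := phiV_log e2.
pose r := Num.min 2^-1 (expR (- (2 * C / e + 1))).
have r0 : 0 < r by rewrite lt_min invr_gt0 expR_gt0 ltr0n.
apply: (right_near r0) => eta /andP[eta0 etar].
have [r1 r2] : eta < 2^-1 /\ eta < expR (- (2 * C / e + 1)) by move: etar; rewrite lt_min => /andP[].
have hC : 0 <= 2 * C / e by rewrite divr_ge0 ?(ltW e0)// mulr_ge0.
have L : 2 * C / e + 1 <= ln (1 / eta).
  rewrite div1r lnV ?posrE// lerNr -[leRHS]expRK ler_ln ?posrE ?expR_gt0//; exact: ltW.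
have L0 : 0 < ln (1 / eta) by lra.
have eta01 : 0 < eta < 2^-1 by rewrite eta0 r1.
have /andP[h1 h2] := HC eta eta01.
have CL : C <= e / 2 * ln (1 / eta).
  have : e / 2 * (2 * C / e) <= e / 2 * ln (1 / eta) by rewrite ler_pM2l//; lra.
  have -> : e / 2 * (2 * C / e) = C by field; rewrite gt_eqF.
  by [].
move: (ln (1 / eta)) L0 h1 h2 CL {L} => l l0 h1 h2 CL.
rewrite distrC ler_norml; apply/andP; split.
  rewrite lerBrDr ler_pdivlMr//; lra.
rewrite lerBlDr ler_pdivrMr//; lra.
Qed.
End Final.

End Tree.

Theorem theorem1 (R : realType) (alpha : R) (p : nat -> R) (L : R -> R)
    (d : measure_display) (T : measurableType d) (P : probability T R)
    (Z : nat -> T -> nat)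
    (d' : measure_display) (Om : measurableType d') (Pr : probability Om R)
    (X : R -> Om -> R) (Q : R -> R -> probability R R) (chi : probability R R) :
  0 < alpha <= 1 ->
  offspring_hyp alpha p L ->
  is_GW P Z p ->
  csbp_kernel alpha Q ->
  chi_law alpha chi ->
  is_Xstar alpha Q chi Pr X ->
  [/\
   (* (a) eta = 0 *)
   (forall j : nat -> nat,
      (forall m, (0 < m)%N -> (0 < j m <= m)%N) ->
      (fun m : nat => (j m)%:R / m%:R : R) @ \oo --> (0 : R) ->
      (fun m : nat => fine (EMmax P Z m (j m))
                      / ((j m)%:R * ln (m%:R / (j m)%:R))) @ \oo --> (1 : R)),
   (* (b) 0 < eta <= 1 *)
   (forall (eta : R) (j : nat -> nat),
      0 < eta <= 1 ->
      (forall m, (0 < m)%N -> (0 < j m <= m)%N) ->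
      (fun m : nat => (j m)%:R / m%:R : R) @ \oo --> eta ->
      phiV alpha Pr X eta \is a fin_num /\
      (fun m : nat => fine (EMmax P Z m (j m))
                      / ((j m)%:R * fine (phiV alpha Pr X eta))) @ \oo --> (1 : R))
   &
   (* phiV(eta) ~ log(1/eta) as eta -> 0+ *)
   (fun eta : R => fine (phiV alpha Pr X eta) / ln (1 / eta)) @ (0:R)^'+ --> (1 : R)].
Proof.
move=> alpha01 hyp gw hQ hchi hX; have dd := decrement_loss alpha01 hyp.
have [p_ge0 p_sum p_mean _ _] := hyp.
split=> [j hj jm|eta j eta01 hj jm|].
(* By conversion, [fine] of [EMmax] is the expectation [Ex] of the path functional [top]. *)
- exact: (top_small p_ge0 p_sum p_mean dd gw hj jm).
- split; first exact: (phiV_fin p_ge0 p_sum p_mean dd gw hQ hchi hX eta01 jm).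
  exact: (top_ratio p_ge0 p_sum p_mean dd gw hQ hchi hX eta01 hj jm).
- exact: (phiV_equiv p_ge0 p_sum p_mean dd gw hQ hchi hX).
Qed.
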